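(* Let $m\ge 0$ and $n\ge 1$ be integers, and let $\mathcal{F}(u_0,\dots,u_m;v_0,\dots,v_n)$ be a function of $m+n+2$ complex variables belonging to the family $\mathscr{F}$ (defined in the context). Suppose that $$\mathcal{F}\big(\zeta(z),\zeta'(z),\dots,\zeta^{(m)}(z);\Gamma(z),\Gamma'(z),\dots,\Gamma^{(n)}(z)\big)=0$$ for all $z\in\mathbf{C}$ (at which $\zeta$ and $\Gamma$ are defined, i.e. away from their poles). Then $\mathcal{F}$ vanishes identically, i.e. $F_\lambda\equiv 0$ on $\mathbf{C}^{m+1}$ for every $\lambda\in\Lambda$.
   Context: $\zeta$ denotes the Riemann zeta-function and $\Gamma$ the Euler gamma-function. Let $\Lambda$ be a finite set of tuples $\lambda=(\lambda_0,\lambda_1,\dots,\lambda_n)$ of nonnegative integers. For $\lambda\in\Lambda$ put $|\lambda|:=\lambda_0+\lambda_1+\cdots+\lambda_n$ and $|\lambda|^\star:=\lambda_1+n\lambda_n$, and set $\Lambda_p:=\{\lambda\in\Lambda:|\lambda|=p\}$, $\Lambda^\star_q:=\{\lambda\in\Lambda:|\lambda|^\star=q\}$. The family $\mathscr{F}$ consists of all functions of the form $$\mathcal{F}(u_0,\dots,u_m;v_0,\dots,v_n)=\sum_{\lambda\in\Lambda}F_\lambda(u_0,\dots,u_m)\,v_0^{\lambda_0}v_1^{\lambda_1}\cdots v_n^{\lambda_n},$$ where $\Lambda$ is such a finite index set, each $F_\lambda:\mathbf{C}^{m+1}\to\mathbf{C}$ is continuous, and the following conditions hold: (i) for each fixed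 $p$, the entries $\lambda_2,\dots,\lambda_{n-1}$ of $\lambda\in\Lambda_p$ depend only on $|\lambda|^\star$ (i.e. if $\lambda,\mu\in\Lambda_p$ and $|\lambda|^\star=|\mu|^\star$ then $\lambda_j=\mu_j$ for $2\le j\le n-1$; $\lambda_1$ and $\lambda_n$ may vary); (ii) for each fixed $p$, the quantity $\chi(|\lambda|^\star):=2\lambda_2+3\lambda_3+\cdots+(n-1)\lambda_{n-1}$, regarded (by (i)) as a function of $q=|\lambda|^\star$ for $\lambda\in\Lambda_p$, is nondecreasing in $q$. *)

(* Defs.v *)
From Stdlib Require Import Reals List ClassicalEpsilon Factorial Binomial.
From Coquelicot Require Import Coquelicot.
Open Scope R_scope.

Definition Cexp (z : C) : C :=
  (exp (Re z) * cos (Im z), exp (Re z) * sin (Im z))%R.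

Definition Rcpow (a : R) (z : C) : C := Cexp (Cmult z (RtoC (ln a))).

Definition Clim (u : nat -> C) : C :=
  epsilon (inhabits (RtoC 0)) (fun l => filterlim u eventually (locally l)).

Definition Cseries (a : nat -> C) : C :=
  epsilon (inhabits (RtoC 0)) (fun l => @is_series C_AbsRing C_NormedModule a l).

(* Euler Gamma function via Gauss' product formula, valid for z not in {0,-1,-2,...}:
   Gamma z = lim_N  N! N^z / (z (z+1) ... (z+N)) *)
Fixpoint rising (z : C) (k : nat) : C :=
  match k with
  | O => z
  | S k' => Cmult (rising z k') (Cplus z (RtoC (INR k)))
  end.
Definition Gamma (z : C) : C :=
  Clim (fun N => Cdiv (Cmult (RtoC (INR (fact N))) (Rcpow (INR N) z)) (rising z N)).

(* Riemann zeta function via Hasse's globally convergent series, valid for s <> 1: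
   zeta s = 1/(s-1) * sum_{n>=0} 1/(n+1) sum_{k=0}^n (-1)^k C(n,k) (k+1)^(1-s) *)
Fixpoint Csum (f : nat -> C) (n : nat) : C :=
  match n with
  | O => f O
  | S n' => Cplus (Csum f n') (f n)
  end.
Definition hasse_term (s : C) (n : nat) : C :=
  Cmult (RtoC (/ INR (S n)))
    (Csum (fun k => Cmult (RtoC ((-1) ^ k * Binomial.C n k))
                          (Rcpow (INR (S k)) (Cminus (RtoC 1) s))) n).
Definition zeta (s : C) : C :=
  Cmult (Cinv (Cminus s (RtoC 1))) (Cseries (hasse_term s)).

Definition Cderive (f : C -> C) (z : C) : C :=
  epsilon (inhabits (RtoC 0)) (fun l => @is_derive C_AbsRing C_NormedModule f z l).
Fixpoint Cderive_n (k : nat) (f : C -> C) : C -> C :=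
  match k with
  | O => f
  | S k' => Cderive (Cderive_n k' f)
  end.

Definition zeta_pole (z : C) : Prop := z = RtoC 1.
Definition Gamma_pole (z : C) : Prop := exists k : nat, z = RtoC (- INR k).

(* A tuple lambda = (lambda_0,...,lambda_n) is a list nat of length n+1;
   entry j is nth j lam 0%nat. *)
Definition lam_abs (lam : list nat) : nat := fold_right Nat.add 0%nat lam.
Definition lam_star (n : nat) (lam : list nat) : nat :=
  (nth 1 lam 0%nat + n * nth n lam 0%nat)%nat.
Definition lam_chi (n : nat) (lam : list nat) : nat :=
  fold_right Nat.add 0%nat (map (fun j => j * nth j lam 0%nat)%nat (seq 2 (n - 2))).

(* F_lam : C^{m+1} -> C, represented on u : nat -> C and depending only on u_0..u_m,
   continuous for the (max) product topology on C^{m+1}. *)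
Definition depends_only_on (m : nat) (G : (nat -> C) -> C) : Prop :=
  forall u v : nat -> C, (forall i, (i <= m)%nat -> u i = v i) -> G u = G v.
Definition continuous_Cm (m : nat) (G : (nat -> C) -> C) : Prop :=
  forall (u : nat -> C) (eps : R), 0 < eps -> exists delta, 0 < delta /\
    forall v : nat -> C, (forall i, (i <= m)%nat -> Cmod (Cminus (v i) (u i)) < delta) ->
      Cmod (Cminus (G v) (G u)) < eps.

Definition monomial (n : nat) (lam : list nat) (v : nat -> C) : C :=
  fold_right Cmult (RtoC 1) (map (fun j => Cpow (v j) (nth j lam 0%nat)) (seq 0 (S n))).
Definition calF (n : nat) (Lam : list (list nat)) (F : list nat -> (nat -> C) -> C)
  (u v : nat -> C) : C :=
  fold_right Cplus (RtoC 0) (map (fun lam => Cmult (F lam u) (monomial n lam v)) Lam).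

Definition in_family (m n : nat) (Lam : list (list nat)) (F : list nat -> (nat -> C) -> C)
  : Prop :=
  NoDup Lam /\
  (forall lam, In lam Lam -> length lam = S n) /\
  (forall lam, In lam Lam -> depends_only_on m (F lam) /\ continuous_Cm m (F lam)) /\
  (forall lam mu, In lam Lam -> In mu Lam -> lam_abs lam = lam_abs mu ->
     lam_star n lam = lam_star n mu ->
     forall j, (2 <= j <= n - 1)%nat -> nth j lam 0%nat = nth j mu 0%nat) /\
  (forall lam mu, In lam Lam -> In mu Lam -> lam_abs lam = lam_abs mu ->
     (lam_star n lam <= lam_star n mu)%nat -> (lam_chi n lam <= lam_chi n mu)%nat).

(* Main.v *)
(* Only the half-plane Re s > 1 is used.  There (log zeta)^(k) is a series over primes up to a bounded
   error.  Since the sum of 1/p diverges, unimodular phases on successive blocks of large primes can be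
   chosen so that, for Re s near 1, the series for k = 0, ..., m come close to any prescribed values: the
   block adjusting the k-th series lies so far out that it does not disturb the lower ones, and the
   remaining primes get alternating signs.  Kronecker's theorem realises these phases as p^(-it) with t
   large, so any point of C^(m+1) with nonzero first coordinate is a limit of (zeta, ..., zeta^(m)) along
   a sequence with 1 < Re s < 2 and Im s -> oo.

   Along such a sequence psi = Gamma'/Gamma grows like log s, Gamma decays faster than any power of s, and
   eps = Gamma^(n) / (Gamma psi^n) - 1 ~ n(n-1)/2 psi'/psi^2 lies between: smaller than any power of
   1/psi, larger than 1/s^2 in modulus.  Expanding (1 + eps)^(lambda_n) turns the monomials into combinations of
   Gamma^p psi^(q + chi(q)) eps^k, which are strictly ordered by size in (p, k, q); so their coefficients,
   continuous functions of the zeta vector, vanish one after another.  For fixed p and q these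
   coefficients are sums of binom(lambda_n, k) F_lambda, a triangular system with the unknowns F_lambda.

   To identify Hasse's series with the Dirichlet series for Re s > 1, write k^(1-s) as the limit for
   h -> 0 of ((1 - exp(-kh)) / h)^(1-s).  Its binomial expansion replaces the alternating sums over k by
   powers (1 - exp(-jh))^n, the sum over n becomes a logarithm, and what remains is a Riemann-sum form of
   (s - 1) times the sum of m^(-s). *)
Require Import Defs.
From Stdlib Require Import Reals List Lra Lia Classical ClassicalEpsilon.
From Stdlib Require Import FinFun Factorial FunctionalExtensionality.
From mathcomp Require ssreflect ssrbool ssrfun eqtype ssrnat div prime.
From Coquelicot Require Import Coquelicot.
Open Scope R_scope.
Set Bullet Behavior "Strict Subproofs".

(** To leading order Gamma^(n) is Gamma psi^n, so monomials that differ only in how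
    [lambda_1 + n lambda_n] is split between [lambda_1] and [lambda_n] look alike; eps is the only
    quantity that separates them. Condition (i) makes monomials with equal (p, q) share their middle
    factors, so one coefficient per (p, k, q) collects them. Condition (ii) makes q + chi(q)
    strictly increasing, so different q carry different powers of psi. A continuous coefficient that
    is nonzero somewhere is also nonzero at a point with nonzero first coordinate, where density is
    available.

    No contour integral and no Stirling formula occurs. Limits are differentiated by means of
    uniform bounds on second derivatives. The identity zeta = exp(log zeta) comes from a
    differential equation and the limit for large real shifts. The decay of Gamma comes from
    iterating Gamma(z + 1) = z Gamma(z). Limits, sums and derivatives in the definitions are choices
    by [epsilon], informative only where existence is proved; hence every derivative is matched with
    an explicit family on Re s > 1. *)

Definition clim (u : nat -> C) (l : C) : Prop :=
  is_lim_seq (fun n => Cmod (Cminus (u n) l)) 0.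

(** The form with [<=] needs neither a quotient nor an exception at [h = 0]. [cder_is_derive] leads
    from it to the derivative behind [Cderive], as [clim_filterlim] leads from [clim] to the limit
    behind [Clim]. *)
Definition cder (f : C -> C) (z l : C) : Prop :=
  forall eps, 0 < eps -> exists delta, 0 < delta /\
    forall h, Cmod h < delta ->
      Cmod (f (z + h)%C - f z - h * l)%C <= eps * Cmod h.

(** * Moduli, real and imaginary parts *)

Lemma Cmod_minus_sym (x y : C) : Cmod (x - y)%C = Cmod (y - x)%C.
Proof. rewrite <- Cmod_opp. f_equal. ring. Qed.

Lemma Cmod_minus_le (x y : C) : Cmod (x - y)%C <= Cmod x + Cmod y.
Proof. rewrite <- (Cmod_opp y). apply Cmod_triangle. Qed.

Lemma Cmod_rev (x y : C) : Cmod x - Cmod y <= Cmod (x - y)%C.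
Proof.
  assert (H := Cmod_triangle (x - y)%C y).
  replace (x - y + y)%C with x in H by ring. lra.
Qed.

Lemma Cmod_tri3 (x y z : C) : Cmod (x - z)%C <= Cmod (x - y)%C + Cmod (y - z)%C.
Proof. replace (x - z)%C with ((x - y) + (y - z))%C by ring. apply Cmod_triangle. Qed.

Lemma RtoC_neq0 (x : R) : x <> 0 -> RtoC x <> RtoC 0.
Proof. intros H E. apply H. injection E. auto. Qed.

Lemma Cmod_minus_0 (x : C) : Cmod (x - 0)%C = Cmod x.
Proof. f_equal. ring. Qed.

Lemma Cmod_RtoC_pos (x : R) : 0 <= x -> Cmod (RtoC x) = x.
Proof. intros H; rewrite Cmod_R; apply Rabs_pos_eq, H. Qed.

Lemma im_le_Cmod (z : C) : Rabs (Im z) <= Cmod z.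
Proof. eapply Rle_trans; [apply Rmax_r | apply (Rmax_Cmod z)]. Qed.

Lemma Cmod_pos (z : C) : z <> RtoC 0 -> 0 < Cmod z.
Proof. apply Cmod_gt_0. Qed.

Lemma Cmod_pos_neq (z : C) : 0 < Cmod z -> z <> RtoC 0.
Proof. apply Cmod_gt_0. Qed.

Lemma Cmod_le_ReIm (z : C) : Cmod z <= Rabs (Re z) + Rabs (Im z).
Proof.
  replace z with (RtoC (Re z) + Ci * RtoC (Im z))%C at 1.
  - eapply Rle_trans; [apply Cmod_triangle|].
    rewrite Cmod_mult, Cmod_Ci, !Cmod_R. lra.
  - destruct z as [a b]; unfold Ci, RtoC, Cplus, Cmult, Re, Im; simpl; f_equal; ring.
Qed.

Lemma C_eq_ReIm (z w : C) : Re z = Re w -> Im z = Im w -> z = w.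
Proof. destruct z, w; unfold Re, Im; simpl; intros; subst; reflexivity. Qed.

Lemma Re_plus z w : Re (z + w)%C = Re z + Re w. Proof. reflexivity. Qed.
Lemma Im_plus z w : Im (z + w)%C = Im z + Im w. Proof. reflexivity. Qed.
Lemma Re_opp z : Re (- z)%C = - Re z. Proof. reflexivity. Qed.
Lemma Im_opp z : Im (- z)%C = - Im z. Proof. reflexivity. Qed.
Lemma Re_minus z w : Re (z - w)%C = Re z - Re w. Proof. reflexivity. Qed.
Lemma Im_minus z w : Im (z - w)%C = Im z - Im w. Proof. reflexivity. Qed.
Lemma Re_mult z w : Re (z * w)%C = Re z * Re w - Im z * Im w. Proof. reflexivity. Qed.
Lemma Im_mult z w : Im (z * w)%C = Re z * Im w + Im z * Re w. Proof. reflexivity. Qed.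
Lemma Re_RtoC x : Re (RtoC x) = x. Proof. reflexivity. Qed.
Lemma Im_RtoC x : Im (RtoC x) = 0. Proof. reflexivity. Qed.
Global Hint Rewrite Re_plus Im_plus Re_opp Im_opp Re_minus Im_minus Re_mult Im_mult
  Re_RtoC Im_RtoC : cri.

(** * Limits *)

Lemma clim_eps (u : nat -> C) (l : C) :
  clim u l <-> forall eps, 0 < eps -> exists N, forall n, (N <= n)%nat ->
    Cmod (u n - l)%C < eps.
Proof.
  unfold clim. split.
  - intros H eps He. apply is_lim_seq_spec in H.
    destruct (H (mkposreal eps He)) as [N HN]. exists N. intros n Hn.
    specialize (HN n Hn). simpl in HN. rewrite Rminus_0_r in HN.
    eapply Rle_lt_trans; [apply Rle_abs | exact HN].
  - intros H. apply is_lim_seq_spec. intros [eps He].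
    destruct (H eps He) as [N HN]. exists N. intros n Hn. simpl.
    rewrite Rminus_0_r, Rabs_pos_eq by apply Cmod_ge_0. apply HN, Hn.
Qed.

Lemma is_lim_seq_eps (u : nat -> R) (l : R) :
  is_lim_seq u l <-> forall eps, 0 < eps -> exists N, forall n, (N <= n)%nat ->
    Rabs (u n - l) < eps.
Proof.
  split.
  - intros H eps He. apply is_lim_seq_spec in H. exact (H (mkposreal eps He)).
  - intros H. apply is_lim_seq_spec. intros [eps He]. exact (H eps He).
Qed.

Lemma clim_squeeze (u : nat -> C) (l : C) (b : nat -> R) :
  (exists N, forall n, (N <= n)%nat -> Cmod (u n - l)%C <= b n) -> is_lim_seq b 0 -> clim u l.
Proof.
  intros [N HN] Hb. unfold clim.
  apply is_lim_seq_le_le_loc with (u := fun _ => 0) (w := b); auto.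
  - exists N. intros n Hn. split; [apply Cmod_ge_0 | apply HN, Hn].
  - apply is_lim_seq_const.
Qed.

Lemma is_lim_seq_inv_INR : is_lim_seq (fun n => / INR (S n)) 0.
Proof.
  apply (is_lim_seq_incr_1 (fun n => / INR n)). apply is_lim_seq_eps. intros eps He.
  destruct (archimed_cor1 eps He) as [N [HN PN]]. exists N. intros n Hn.
  rewrite Rminus_0_r, Rabs_pos_eq by (apply Rlt_le, Rinv_0_lt_compat, lt_0_INR; lia).
  eapply Rle_lt_trans; [|exact HN]. apply Rinv_le_contravar; [apply lt_0_INR; lia | now apply le_INR].
Qed.

Lemma clim_unique u l l' : clim u l -> clim u l' -> l = l'.
Proof.
  intros H H'. rewrite clim_eps in H, H'.
  destruct (Req_dec (Cmod (l - l')%C) 0) as [E|E].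
  - apply Cmod_eq_0 in E. replace l with (l - l' + l')%C by ring. rewrite E. ring.
  - assert (P : 0 < Cmod (l - l')%C / 2) by (assert (P := Cmod_ge_0 (l - l')%C); lra).
    destruct (H _ P) as [N HN]. destruct (H' _ P) as [N' HN'].
    specialize (HN (max N N') (Nat.le_max_l _ _)). specialize (HN' (max N N') (Nat.le_max_r _ _)).
    assert (T := Cmod_tri3 l (u (max N N')) l'). rewrite (Cmod_minus_sym l (u _)) in T. lra.
Qed.

Lemma clim_const c : clim (fun _ => c) c.
Proof.
  unfold clim. apply is_lim_seq_ext with (fun _ => 0); [|apply is_lim_seq_const].
  intros _. replace (c - c)%C with (RtoC 0) by ring. now rewrite Cmod_0.
Qed.

Lemma clim_ext_loc u v l :
  (exists N, forall n, (N <= n)%nat -> u n = v n) -> clim u l -> clim v l.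
Proof.
  intros [N HN] H. unfold clim in *.
  apply is_lim_seq_ext_loc with (2 := H). exists N. intros n Hn. now rewrite HN.
Qed.

Lemma clim_ext u v l : (forall n, u n = v n) -> clim u l -> clim v l.
Proof. intros H. apply clim_ext_loc. exists 0%nat. auto. Qed.

Lemma clim_plus u v a b : clim u a -> clim v b -> clim (fun n => u n + v n)%C (a + b)%C.
Proof.
  intros Hu Hv. apply clim_squeeze with (fun n => Cmod (u n - a)%C + Cmod (v n - b)%C).
  - exists 0%nat. intros n _.
    replace (u n + v n - (a + b))%C with ((u n - a) + (v n - b))%C by ring.
    apply Cmod_triangle.
  - replace (Finite 0) with (Finite (0 + 0)) by (f_equal; ring). now apply is_lim_seq_plus'.
Qed.

Lemma clim_Cmod u a : clim u a -> is_lim_seq (fun n => Cmod (u n)) (Cmod a).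
Proof.
  rewrite clim_eps, is_lim_seq_eps. intros H eps He. destruct (H eps He) as [N HN].
  exists N. intros n Hn. specialize (HN n Hn).
  assert (A := Cmod_rev (u n) a). assert (B := Cmod_rev a (u n)).
  rewrite (Cmod_minus_sym a (u n)) in B.
  apply Rabs_def1; lra.
Qed.

Lemma clim_mult u v a b : clim u a -> clim v b -> clim (fun n => u n * v n)%C (a * b)%C.
Proof.
  intros Hu Hv.
  apply clim_squeeze with (fun n => Cmod (u n - a)%C * Cmod (v n) + Cmod a * Cmod (v n - b)%C).
  - exists 0%nat. intros n _.
    replace (u n * v n - (a * b))%C with ((u n - a) * v n + a * (v n - b))%C by ring.
    eapply Rle_trans; [apply Cmod_triangle|]. rewrite !Cmod_mult. lra.
  - replace (Finite 0) with (Finite (0 * Cmod b + Cmod a * 0)) by (f_equal; ring).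
    apply is_lim_seq_plus'; apply is_lim_seq_mult'; auto.
    + now apply clim_Cmod.
    + apply is_lim_seq_const.
Qed.

Lemma clim_scal c u a : clim u a -> clim (fun n => c * u n)%C (c * a)%C.
Proof. intros H. apply clim_mult; auto. apply clim_const. Qed.

Lemma clim_opp u a : clim u a -> clim (fun n => - u n)%C (- a)%C.
Proof.
  intros H. apply clim_ext with (fun n => (- (1)) * u n)%C; [intros; ring|].
  replace (- a)%C with ((-(1)) * a)%C by ring. now apply clim_scal.
Qed.

Lemma clim_minus u v a b : clim u a -> clim v b -> clim (fun n => u n - v n)%C (a - b)%C.
Proof. intros. apply clim_plus; auto. now apply clim_opp. Qed.

Lemma clim_inv (u : nat -> C) (a : C) : a <> RtoC 0 -> clim u a -> clim (fun n => / u n)%C (/ a)%C.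
Proof.
  intros Ha H.
  assert (Hp : 0 < Cmod a) by now apply Cmod_pos.
  assert (HM := clim_Cmod _ _ H).
  assert (HN : exists N, forall n, (N <= n)%nat -> Cmod a / 2 < Cmod (u n)).
  { rewrite is_lim_seq_eps in HM. destruct (HM (Cmod a / 2)) as [N HN]; [lra|].
    exists N. intros n Hn. specialize (HN n Hn). apply Rabs_def2 in HN. lra. }
  destruct HN as [N HN].
  apply clim_squeeze with (fun n => (2 / (Cmod a * Cmod a)) * Cmod (u n - a)%C).
  - exists N. intros n Hn. specialize (HN n Hn).
    assert (Hu : u n <> RtoC 0) by (apply Cmod_pos_neq; lra).
    replace (/ u n - / a)%C with ((a - u n) / (u n * a))%C by (field; split; auto).
    rewrite Cmod_div by (apply Cmult_neq_0; auto).
    rewrite Cmod_mult, Cmod_minus_sym.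
    unfold Rdiv. rewrite Rmult_comm. apply Rmult_le_compat_r; [apply Cmod_ge_0|].
    apply Rle_trans with (/ (Cmod a / 2 * Cmod a)).
    + apply Rinv_le_contravar; nra.
    + right. field. lra.
  - replace (Finite 0) with (Finite (2 / (Cmod a * Cmod a) * 0)) by (f_equal; ring).
    apply is_lim_seq_mult'; auto. apply is_lim_seq_const.
Qed.

Lemma clim_RtoC u l : is_lim_seq u (Finite l) -> clim (fun n => RtoC (u n)) (RtoC l).
Proof.
  rewrite clim_eps, is_lim_seq_eps. intros H eps He. destruct (H eps He) as [N HN].
  exists N. intros n Hn. rewrite <- RtoC_minus, Cmod_R. auto.
Qed.

Lemma clim_Re u l : clim u l -> is_lim_seq (fun n => Re (u n)) (Re l).
Proof.
  rewrite clim_eps, is_lim_seq_eps. intros H eps He. destruct (H eps He) as [N HN].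
  exists N. intros n Hn. eapply Rle_lt_trans; [|apply (HN n Hn)].
  rewrite <- Re_minus. apply re_le_Cmod.
Qed.

Lemma clim_ReIm u l : is_lim_seq (fun n => Re (u n)) (Re l) ->
  is_lim_seq (fun n => Im (u n)) (Im l) -> clim u l.
Proof.
  intros H1 H2. apply clim_ext with (fun n => RtoC (Re (u n)) + Ci * RtoC (Im (u n)))%C.
  - intros n. apply C_eq_ReIm; autorewrite with cri; unfold Ci, Re, Im; simpl; ring.
  - replace l with (RtoC (Re l) + Ci * RtoC (Im l))%C.
    + apply clim_plus; [|apply clim_scal]; now apply clim_RtoC.
    + apply C_eq_ReIm; autorewrite with cri; unfold Ci, Re, Im; simpl; ring.
Qed.

Lemma clim_le u l B : clim u l -> (exists N, forall n, (N <= n)%nat -> Cmod (u n) <= B) ->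
  Cmod l <= B.
Proof.
  intros H [N HN]. apply clim_Cmod in H.
  assert (X := is_lim_seq_le_loc (fun n => Cmod (u n)) (fun _ => B) (Cmod l) B).
  simpl in X. apply X; auto.
  - exists N. auto.
  - apply is_lim_seq_const.
Qed.

Lemma clim_incr_1 u l : clim u l <-> clim (fun n => u (S n)) l.
Proof. unfold clim. split; intros H; [apply (is_lim_seq_incr_1 (fun n => Cmod (u n - l)%C)) in H|apply is_lim_seq_incr_1]; auto. Qed.

Lemma clim_incr_n u l N : clim u l <-> clim (fun n => u (n + N)%nat) l.
Proof. unfold clim. split; intros H; [apply (is_lim_seq_incr_n (fun n => Cmod (u n - l)%C) N) in H|apply (is_lim_seq_incr_n _ N)]; auto. Qed.

Lemma clim_filterlim u l : clim u l <-> filterlim u eventually (locally l).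
Proof.
  rewrite clim_eps. split.
  - intros H P [eps HP]. destruct (H eps (cond_pos eps)) as [N HN].
    exists N. intros n Hn. apply HP. apply C_NormedModule_mixin_compat1. apply HN, Hn.
  - intros H eps He.
    (* The balls of the uniform structure on C are squares; a square of half-side r lies in the disc
       of radius [sqrt 2] times r. *)
    assert (P : 0 < eps / sqrt 2) by (apply Rdiv_lt_0_compat; [auto | apply sqrt_lt_R0; lra]).
    destruct (H (fun y => ball l (eps / sqrt 2) y)) as [N HN].
    { exists (mkposreal _ P). auto. }
    exists N. intros n Hn. specialize (HN n Hn).
    apply (C_NormedModule_mixin_compat2 l (u n) (mkposreal _ P)) in HN. simpl in HN.
    replace (sqrt 2 * (eps / sqrt 2)) with eps in HN; [exact HN|].
    field. apply Rgt_not_eq, sqrt_lt_R0; lra.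
Qed.

Lemma Clim_eq u l : clim u l -> Clim u = l.
Proof.
  intros H. unfold Clim. apply clim_unique with u; auto.
  apply clim_filterlim. apply epsilon_spec. exists l. now apply clim_filterlim.
Qed.

Definition ccauchy (u : nat -> C) := forall eps, 0 < eps -> exists N, forall n m,
  (N <= n)%nat -> (N <= m)%nat -> Cmod (u n - u m)%C < eps.

Lemma ccauchy_clim u : ccauchy u -> exists l, clim u l.
Proof.
  intros H.
  assert (H1 : ex_finite_lim_seq (fun n => Re (u n))).
  { apply ex_lim_seq_cauchy_corr. intros eps. destruct (H eps (cond_pos eps)) as [N HN].
    exists N. intros n m Hn Hm. rewrite <- Re_minus. eapply Rle_lt_trans; [apply re_le_Cmod | auto]. }
  assert (H2 : ex_finite_lim_seq (fun n => Im (u n))).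
  { apply ex_lim_seq_cauchy_corr. intros eps. destruct (H eps (cond_pos eps)) as [N HN].
    exists N. intros n m Hn Hm. rewrite <- Im_minus. eapply Rle_lt_trans; [apply im_le_Cmod | auto]. }
  destruct H1 as [a Ha], H2 as [b Hb]. exists (a, b). apply clim_ReIm; auto.
Qed.

(** * Derivatives *)

Lemma cder_const c z : cder (fun _ => c) z 0.
Proof.
  intros eps He. exists 1. split; [lra|]. intros h _.
  replace (c - c - h * 0)%C with (RtoC 0) by ring. rewrite Cmod_0.
  apply Rmult_le_pos; [lra | apply Cmod_ge_0].
Qed.

Lemma cder_id z : cder (fun w => w) z 1.
Proof.
  intros eps He. exists 1. split; [lra|]. intros h _.
  replace (z + h - z - h * 1)%C with (RtoC 0) by ring. rewrite Cmod_0.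
  apply Rmult_le_pos; [lra | apply Cmod_ge_0].
Qed.

Lemma cder_plus f g z a b : cder f z a -> cder g z b -> cder (fun w => f w + g w)%C z (a + b)%C.
Proof.
  intros Hf Hg eps He. destruct (Hf (eps / 2)) as [d1 [P1 H1]]; [lra|].
  destruct (Hg (eps / 2)) as [d2 [P2 H2]]; [lra|].
  exists (Rmin d1 d2). split; [now apply Rmin_pos|]. intros h Hh.
  specialize (H1 h). specialize (H2 h).
  assert (M1 := Rmin_l d1 d2). assert (M2 := Rmin_r d1 d2).
  replace (f (z + h)%C + g (z + h)%C - (f z + g z) - h * (a + b))%C with
    ((f (z + h)%C - f z - h * a) + (g (z + h)%C - g z - h * b))%C by ring.
  eapply Rle_trans; [apply Cmod_triangle|].
  specialize (H1 ltac:(lra)). specialize (H2 ltac:(lra)). lra.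
Qed.

Lemma cder_scal c f z a : cder f z a -> cder (fun w => c * f w)%C z (c * a)%C.
Proof.
  intros Hf eps He.
  assert (Hc := Cmod_ge_0 c).
  destruct (Hf (eps / (Cmod c + 1))) as [d [P H]].
  { apply Rdiv_lt_0_compat; lra. }
  exists d. split; auto. intros h Hh. specialize (H h Hh).
  replace (c * f (z + h)%C - c * f z - h * (c * a))%C with
    (c * (f (z + h)%C - f z - h * a))%C by ring.
  rewrite Cmod_mult.
  apply Rle_trans with (Cmod c * (eps / (Cmod c + 1) * Cmod h)).
  - now apply Rmult_le_compat_l.
  - replace (Cmod c * (eps / (Cmod c + 1) * Cmod h)) with
      ((Cmod c / (Cmod c + 1)) * (eps * Cmod h)) by (field; lra).
    rewrite <- (Rmult_1_l (eps * Cmod h)) at 2.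
    apply Rmult_le_compat_r.
    + apply Rmult_le_pos; [lra | apply Cmod_ge_0].
    + apply Rmult_le_reg_r with (Cmod c + 1); [lra|]. field_simplify; lra.
Qed.

Lemma cder_ext_loc f g z l : (exists r, 0 < r /\ forall h, Cmod h < r -> f (z + h)%C = g (z + h)%C) ->
  cder f z l -> cder g z l.
Proof.
  intros [r [Pr Hr]] Hf eps He. destruct (Hf eps He) as [d [P H]].
  exists (Rmin d r). split; [now apply Rmin_pos|]. intros h Hh.
  assert (M1 := Rmin_l d r). assert (M2 := Rmin_r d r).
  rewrite <- Hr by lra.
  replace (g z) with (f z). { apply H; lra. }
  replace z with (z + 0)%C by ring. apply Hr. rewrite Cmod_0. exact Pr.
Qed.

Lemma cder_ext f g z l : (forall w, f w = g w) -> cder f z l -> cder g z l.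
Proof. intros H. apply cder_ext_loc. exists 1. split; [lra | auto]. Qed.

Lemma cder_opp f z a : cder f z a -> cder (fun w => - f w)%C z (- a)%C.
Proof.
  intros H. apply cder_ext with (fun w => (-(1)) * f w)%C; [intros; ring|].
  replace (- a)%C with ((-(1)) * a)%C by ring. now apply cder_scal.
Qed.

Lemma cder_minus f g z a b : cder f z a -> cder g z b -> cder (fun w => f w - g w)%C z (a - b)%C.
Proof. intros. apply cder_plus; auto. now apply cder_opp. Qed.

Lemma cder_lip f z l : cder f z l -> exists r, 0 < r /\ forall h, Cmod h < r ->
  Cmod (f (z + h)%C - f z)%C <= (Cmod l + 1) * Cmod h.
Proof.
  intros H. destruct (H 1 ltac:(lra)) as [d [P Hd]]. exists d. split; auto.
  intros h Hh. specialize (Hd h Hh).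
  assert (T := Cmod_triangle (f (z + h)%C - f z - h * l)%C (h * l)%C).
  replace (f (z + h)%C - f z - h * l + h * l)%C with (f (z + h)%C - f z)%C in T by ring.
  rewrite Cmod_mult in T. lra.
Qed.

(** The increment k of f is at most (|a| + 1)|h|. The error is that of g at k plus b times that of f
    at h, and each receives half of [eps]. *)
Lemma cder_comp f g z a b : cder f z a -> cder g (f z) b -> cder (fun w => g (f w)) z (a * b)%C.
Proof.
  intros Hf Hg eps He.
  assert (Ha := Cmod_ge_0 a). assert (Hb := Cmod_ge_0 b).
  destruct (cder_lip _ _ _ Hf) as [r [Pr Hr]].
  destruct (Hg (eps / (2 * (Cmod a + 1)))) as [d2 [P2 H2]].
  { apply Rdiv_lt_0_compat; lra. }
  destruct (Hf (eps / (2 * (Cmod b + 1)))) as [d1 [P1 H1]].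
  { apply Rdiv_lt_0_compat; lra. }
  assert (P3 : 0 < d2 / (Cmod a + 1)) by (apply Rdiv_lt_0_compat; lra).
  exists (Rmin (Rmin r d1) (d2 / (Cmod a + 1))). split.
  { repeat apply Rmin_pos; auto. }
  intros h Hh.
  assert (M1 := Rmin_l (Rmin r d1) (d2 / (Cmod a + 1))).
  assert (M2 := Rmin_r (Rmin r d1) (d2 / (Cmod a + 1))).
  assert (M3 := Rmin_l r d1). assert (M4 := Rmin_r r d1).
  specialize (Hr h ltac:(lra)). specialize (H1 h ltac:(lra)).
  set (k := (f (z + h)%C - f z)%C) in *.
  assert (Hk : Cmod k < d2).
  { eapply Rle_lt_trans; [exact Hr|].
    apply Rlt_le_trans with ((Cmod a + 1) * (d2 / (Cmod a + 1))).
    - apply Rmult_lt_compat_l; lra.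
    - right. field. lra. }
  specialize (H2 k Hk).
  replace (f (z + h)%C) with (f z + k)%C by (unfold k; ring).
  replace (g (f z + k)%C - g (f z) - h * (a * b))%C with
    ((g (f z + k)%C - g (f z) - k * b) + (k - h * a) * b)%C by ring.
  eapply Rle_trans; [apply Cmod_triangle|]. rewrite Cmod_mult.
  assert (B1 : eps / (2 * (Cmod a + 1)) * Cmod k <= eps / 2 * Cmod h).
  { apply Rle_trans with (eps / (2 * (Cmod a + 1)) * ((Cmod a + 1) * Cmod h)).
    - apply Rmult_le_compat_l; auto. apply Rlt_le, Rdiv_lt_0_compat; lra.
    - right. field. lra. }
  assert (B2 : Cmod (k - h * a)%C * Cmod b <= eps / 2 * Cmod h).
  { apply Rle_trans with (eps / (2 * (Cmod b + 1)) * Cmod h * Cmod b).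
    - apply Rmult_le_compat_r; auto.
    - replace (eps / (2 * (Cmod b + 1)) * Cmod h * Cmod b) with
        ((Cmod b / (Cmod b + 1)) * (eps / 2 * Cmod h)) by (field; lra).
      rewrite <- (Rmult_1_l (eps / 2 * Cmod h)) at 2.
      apply Rmult_le_compat_r.
      + apply Rmult_le_pos; [lra | apply Cmod_ge_0].
      + apply Rmult_le_reg_r with (Cmod b + 1); [lra|]. field_simplify; lra. }
  lra.
Qed.

Lemma cder_sqr z : cder (fun w => w * w)%C z (2 * z)%C.
Proof.
  intros eps He. exists eps. split; auto. intros h Hh.
  replace ((z + h) * (z + h) - z * z - h * (2 * z))%C with (h * h)%C by ring.
  rewrite Cmod_mult. apply Rmult_le_compat_r; [apply Cmod_ge_0 | lra].
Qed.

Lemma cder_eq f z a b : a = b -> cder f z a -> cder f z b.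
Proof. intros ->; auto. Qed.

(* Polarization [4 f g = (f + g)^2 - (f - g)^2] reduces the product rule to the chain rule. *)
Lemma cder_mult f g z a b : cder f z a -> cder g z b ->
  cder (fun w => f w * g w)%C z (a * g z + f z * b)%C.
Proof.
  intros Hf Hg.
  assert (H1 := cder_comp _ _ _ _ _ (cder_plus _ _ _ _ _ Hf Hg) (cder_sqr _)).
  assert (H2 := cder_comp _ _ _ _ _ (cder_minus _ _ _ _ _ Hf Hg) (cder_sqr _)).
  assert (H := cder_scal (/ 4)%C _ _ _ (cder_minus _ _ _ _ _ H1 H2)). simpl in H.
  assert (N4 : RtoC 4 <> 0) by (intros E; injection E; lra).
  eapply cder_ext; [|eapply cder_eq; [|exact H]].
  - intros w. simpl. field; auto.
  - field; auto.
Qed.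

Lemma cder_inv (z : C) : z <> RtoC 0 -> cder (fun w => / w)%C z (- / (z * z))%C.
Proof.
  intros Hz eps He.
  assert (Pz : 0 < Cmod z) by now apply Cmod_pos.
  assert (P3 : 0 < Cmod z * Cmod z * Cmod z) by (repeat apply Rmult_lt_0_compat; auto).
  exists (Rmin (Cmod z / 2) (eps * (Cmod z * Cmod z * Cmod z) / 2)). split.
  { apply Rmin_pos; [lra|]. apply Rdiv_lt_0_compat; [apply Rmult_lt_0_compat; auto|lra]. }
  intros h Hh.
  assert (M1 := Rmin_l (Cmod z / 2) (eps * (Cmod z * Cmod z * Cmod z) / 2)).
  assert (M2 := Rmin_r (Cmod z / 2) (eps * (Cmod z * Cmod z * Cmod z) / 2)).
  assert (L : Cmod z / 2 < Cmod (z + h)%C).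
  { assert (T := Cmod_rev z (- h)%C). rewrite Cmod_opp in T.
    replace (z - - h)%C with (z + h)%C in T by ring. lra. }
  assert (Hzh : (z + h)%C <> RtoC 0) by (apply Cmod_pos_neq; lra).
  replace (/ (z + h) - / z - h * - / (z * z))%C with (h * (h / (z * z * (z + h))))%C
    by (field; auto).
  rewrite Cmod_mult, Rmult_comm. apply Rmult_le_compat_r; [apply Cmod_ge_0|].
  rewrite Cmod_div by (repeat apply Cmult_neq_0; auto). rewrite !Cmod_mult.
  apply Rle_trans with (eps * (Cmod z * Cmod z * Cmod z) / 2 / (Cmod z * Cmod z * (Cmod z / 2))).
  - apply Rmult_le_compat; try apply Cmod_ge_0.
    + apply Rlt_le, Rinv_0_lt_compat. repeat apply Rmult_lt_0_compat; lra.
    + lra.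
    + apply Rinv_le_contravar; [repeat apply Rmult_lt_0_compat; lra|].
      apply Rmult_le_compat_l; nra.
  - right. field. lra.
Qed.

(** At [k = 0] the truncated [pred 0] is harmless because the factor [INR 0] vanishes. *)
Lemma cder_pow f z a k : cder f z a ->
  cder (fun w => f w ^ k)%C z (RtoC (INR k) * f z ^ (pred k) * a)%C.
Proof.
  intros H. induction k as [|k IH].
  - simpl. apply cder_eq with (RtoC 0); [ring|]. apply cder_const.
  - apply cder_ext with (fun w => f w * f w ^ k)%C; [intros; reflexivity|].
    eapply cder_eq; [|apply (cder_mult _ _ _ _ _ H IH)].
    rewrite S_INR, RtoC_plus. simpl pred.
    destruct k as [|k]; [simpl; ring|]. simpl pred. rewrite (Cpow_S (f z) k). ring.
Qed.

Lemma cder_cont f z l u : cder f z l -> clim u z -> clim (fun n => f (u n)) (f z).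
Proof.
  intros H Hu. destruct (cder_lip _ _ _ H) as [r [Pr Hr]].
  apply clim_squeeze with (fun n => (Cmod l + 1) * Cmod (u n - z)%C).
  - rewrite clim_eps in Hu. destruct (Hu r Pr) as [N HN]. exists N. intros n Hn.
    specialize (Hr (u n - z)%C (HN n Hn)).
    replace (z + (u n - z))%C with (u n) in Hr by ring. exact Hr.
  - replace (Finite 0) with (Finite ((Cmod l + 1) * 0)) by (f_equal; ring).
    apply is_lim_seq_mult'; [apply is_lim_seq_const | exact Hu].
Qed.

Lemma cder_is_derive f z l : cder f z l -> @is_derive C_AbsRing C_NormedModule f z l.
Proof.
  intros H. split.
  - apply is_linear_scal_l.
  - intros x Hx. apply (@is_filter_lim_locally_unique C_AbsRing (AbsRing_NormedModule C_AbsRing)) in Hx. subst x.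
    intros [eps He]. destruct (H eps He) as [d [P Hd]].
    exists (mkposreal d P). intros y Hy.
    change C in y.
    change (Cmod (f y - f z - (y - z) * l)%C <= eps * Cmod (y - z)%C).
    specialize (Hd (y - z)%C).
    assert (E : forall a b : C, (a + (b - a))%C = b) by (intros; ring).
    rewrite E in Hd. apply Hd. exact Hy.
Qed.

(** The only way to evaluate [Cderive]: the chosen value means something once a derivative is known
    to exist, and uniqueness then determines it. *)
Lemma Cderive_eq f z l : cder f z l -> Cderive f z = l.
Proof.
  intros H. apply cder_is_derive in H. unfold Cderive.
  assert (E : @is_derive C_AbsRing C_NormedModule f z
    (epsilon (inhabits (RtoC 0)) (fun l => @is_derive C_AbsRing C_NormedModule f z l))).
  { apply epsilon_spec. exists l; auto. }
  apply is_C_derive_unique in E. apply is_C_derive_unique in H. congruence.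
Qed.

Lemma cder_unique f z a b : cder f z a -> cder f z b -> a = b.
Proof. intros H1 H2. rewrite <- (Cderive_eq _ _ _ H1). now apply Cderive_eq. Qed.

(** * Sums and series *)

Fixpoint rsum (u : nat -> R) (N : nat) : R :=
  match N with O => 0 | S n => rsum u n + u n end.
Fixpoint csum (u : nat -> C) (N : nat) : C :=
  match N with O => RtoC 0 | S n => (csum u n + u n)%C end.

Lemma rsum_ext u v N : (forall n, (n < N)%nat -> u n = v n) -> rsum u N = rsum v N.
Proof. induction N; intros H; simpl; auto. rewrite IHN, H; auto. Qed.

Lemma rsum_le u v N : (forall n, (n < N)%nat -> u n <= v n) -> rsum u N <= rsum v N.
Proof. induction N; intros H; simpl; [lra|]. apply Rplus_le_compat; auto. Qed.

Lemma rsum_nonneg u N : (forall n, (n < N)%nat -> 0 <= u n) -> 0 <= rsum u N.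
Proof. induction N; intros H; simpl; [lra|]. apply Rplus_le_le_0_compat; auto. Qed.

Lemma rsum_plus u v N : rsum (fun n => u n + v n) N = rsum u N + rsum v N.
Proof. induction N; simpl; lra. Qed.

Lemma rsum_scal c u N : rsum (fun n => c * u n) N = c * rsum u N.
Proof. induction N; simpl; [ring | rewrite IHN; ring]. Qed.

Lemma rsum_split u N M : rsum u (N + M) = rsum u N + rsum (fun k => u (N + k)%nat) M.
Proof.
  induction M; simpl; [rewrite Nat.add_0_r; ring|].
  rewrite Nat.add_succ_r. simpl. rewrite IHM. ring.
Qed.

Lemma rsum_mono u N M : (forall n, 0 <= u n) -> (N <= M)%nat -> rsum u N <= rsum u M.
Proof.
  intros H L. replace M with (N + (M - N))%nat by lia. rewrite rsum_split.
  assert (X := rsum_nonneg (fun k => u (N + k)%nat) (M - N) (fun n _ => H _)). lra.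
Qed.

Lemma rsum_term u N n : (forall n, 0 <= u n) -> (n < N)%nat -> u n <= rsum u N.
Proof.
  intros H L. apply Rle_trans with (rsum u (S n)).
  - simpl. assert (X := rsum_nonneg u n (fun k _ => H k)). lra.
  - apply rsum_mono; auto.
Qed.

Lemma csum_ext u v N : (forall n, (n < N)%nat -> u n = v n) -> csum u N = csum v N.
Proof. induction N; intros H; simpl; auto. rewrite IHN, H; auto. Qed.

Lemma csum_plus u v N : csum (fun n => u n + v n)%C N = (csum u N + csum v N)%C.
Proof. induction N; simpl; [ring | rewrite IHN; ring]. Qed.

Lemma csum_minus u v N : csum (fun n => u n - v n)%C N = (csum u N - csum v N)%C.
Proof. induction N; simpl; [ring | rewrite IHN; ring]. Qed.

Lemma csum_scal c u N : csum (fun n => c * u n)%C N = (c * csum u N)%C.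
Proof. induction N; simpl; [ring | rewrite IHN; ring]. Qed.

Lemma csum_split u N M : csum u (N + M) = (csum u N + csum (fun k => u (N + k)%nat) M)%C.
Proof.
  induction M; simpl; [rewrite Nat.add_0_r; ring|].
  rewrite Nat.add_succ_r. simpl. rewrite IHM. ring.
Qed.

Lemma csum_0 N : csum (fun _ => RtoC 0) N = 0.
Proof. induction N; simpl; [auto | rewrite IHN; ring]. Qed.

Lemma Cmod_csum u N : Cmod (csum u N) <= rsum (fun n => Cmod (u n)) N.
Proof.
  induction N; simpl; [rewrite Cmod_0; lra|].
  eapply Rle_trans; [apply Cmod_triangle | lra].
Qed.

Lemma RtoC_rsum u N : RtoC (rsum u N) = csum (fun n => RtoC (u n)) N.
Proof. induction N; simpl; [auto | now rewrite RtoC_plus, IHN]. Qed.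

Definition summable (b : nat -> R) : Prop := exists B, forall N, rsum b N <= B.
Definition Cser (u : nat -> C) : C := Clim (csum u).

Lemma rsum_cv b : (forall n, 0 <= b n) -> summable b ->
  exists l, is_lim_seq (rsum b) (Finite l) /\ forall N, rsum b N <= l.
Proof.
  intros Hb [B HB].
  assert (E : ex_finite_lim_seq (rsum b)).
  { apply ex_finite_lim_seq_incr with B; auto. intros n. simpl. specialize (Hb n). lra. }
  destruct E as [l Hl]. exists l. split; auto.
  intros N. apply (is_lim_seq_incr_compare (rsum b) l Hl).
  intros n. simpl. specialize (Hb n). lra.
Qed.

Lemma summable_tail b : (forall n, 0 <= b n) -> summable b ->
  forall eps, 0 < eps -> exists N, forall N' M, (N <= N')%nat ->
    rsum (fun k => b (N' + k)%nat) M <= eps.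
Proof.
  intros Hb H eps He. destruct (rsum_cv b Hb H) as [l [Hl Hle]].
  rewrite is_lim_seq_eps in Hl. destruct (Hl eps He) as [N HN].
  exists N. intros N' M Hn. specialize (HN N' Hn). apply Rabs_def2 in HN.
  specialize (Hle (N' + M)%nat). rewrite rsum_split in Hle. lra.
Qed.

Lemma summable_le b c : (forall n, b n <= c n) -> summable c -> summable b.
Proof.
  intros H [B HB]. exists B. intros N. eapply Rle_trans; [apply rsum_le; intros; apply H | apply HB].
Qed.

Lemma summable_scal k b : 0 <= k -> summable b -> summable (fun n => k * b n).
Proof.
  intros Hk [B HB]. exists (k * B). intros N. rewrite rsum_scal. now apply Rmult_le_compat_l.
Qed.

Lemma Cser_eq u l : clim (csum u) l -> Cser u = l.
Proof. apply Clim_eq. Qed.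

Lemma Cser_cv u b : (forall n, Cmod (u n) <= b n) -> summable b -> clim (csum u) (Cser u).
Proof.
  intros Hu Hs.
  assert (Hb : forall n, 0 <= b n) by (intros n; eapply Rle_trans; [apply Cmod_ge_0 | apply Hu]).
  destruct (ccauchy_clim (csum u)) as [l Hl].
  - intros eps He. destruct (summable_tail b Hb Hs (eps / 4)) as [N HN]; [lra|].
    assert (K : forall n, (N <= n)%nat -> Cmod (csum u n - csum u N)%C <= eps / 4).
    { intros n Hn. replace n with (N + (n - N))%nat by lia. rewrite csum_split.
      replace (csum u N + csum (fun k => u (N + k)%nat) (n - N) - csum u N)%C with
        (csum (fun k => u (N + k)%nat) (n - N)) by ring.
      eapply Rle_trans; [apply Cmod_csum|].
      eapply Rle_trans; [|apply (HN N (n - N)%nat (Nat.le_refl _))].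
      apply rsum_le. intros; apply Hu. }
    exists N. intros n m Hn Hm.
    assert (T := Cmod_tri3 (csum u n) (csum u N) (csum u m)).
    rewrite (Cmod_minus_sym (csum u N)) in T.
    assert (K1 := K n Hn). assert (K2 := K m Hm). lra.
  - now rewrite (Cser_eq u l Hl).
Qed.

Lemma Cser_tail u b N T : (forall n, Cmod (u n) <= b n) -> summable b ->
  (forall M, rsum (fun k => b (N + k)%nat) M <= T) -> Cmod (Cser u - csum u N)%C <= T.
Proof.
  intros Hu Hs HT. assert (H := Cser_cv u b Hu Hs).
  apply clim_le with (fun n => csum u n - csum u N)%C.
  - apply clim_minus; auto. apply clim_const.
  - exists N. intros n Hn. replace n with (N + (n - N))%nat by lia. rewrite csum_split.
    replace (csum u N + csum (fun k => u (N + k)%nat) (n - N) - csum u N)%C with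
      (csum (fun k => u (N + k)%nat) (n - N)) by ring.
    eapply Rle_trans; [apply Cmod_csum|]. eapply Rle_trans; [|apply HT].
    apply rsum_le; intros; apply Hu.
Qed.

Lemma Cser_le u b B : (forall n, Cmod (u n) <= b n) -> (forall N, rsum b N <= B) ->
  Cmod (Cser u) <= B.
Proof.
  intros Hu HB. replace (Cser u) with (Cser u - csum u 0)%C by (simpl; ring).
  apply Cser_tail with b; auto. exists B; auto.
Qed.

Lemma Cser_ext u v : (forall n, u n = v n) -> Cser u = Cser v.
Proof.
  intros H. replace v with u; auto. apply FunctionalExtensionality.functional_extensionality, H.
Qed.

Lemma Cser_scal c u b : (forall n, Cmod (u n) <= b n) -> summable b ->
  Cser (fun n => c * u n)%C = (c * Cser u)%C.
Proof.
  intros Hu Hs. apply Cser_eq.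
  apply clim_ext with (fun N => c * csum u N)%C; [intros; now rewrite csum_scal|].
  apply clim_scal. now apply Cser_cv with b.
Qed.

(* Tannery's theorem: dominated convergence for series. *)
Lemma Cser_dominated (u : nat -> nat -> C) (v : nat -> C) (b : nat -> R) :
  (forall N j, Cmod (u N j) <= b j) -> summable b ->
  (forall j, clim (fun N => u N j) (v j)) -> clim (fun N => Cser (u N)) (Cser v).
Proof.
  intros Hu Hs Hv.
  assert (Hb : forall n, 0 <= b n) by (intros n; eapply Rle_trans; [apply Cmod_ge_0 | apply (Hu 0%nat)]).
  assert (Hvb : forall j, Cmod (v j) <= b j).
  { intros j. apply clim_le with (1 := Hv j). exists 0%nat. auto. }
  apply clim_eps. intros eps He.
  destruct (summable_tail b Hb Hs (eps / 4)) as [J HJ]; [lra|].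
  specialize (HJ J).
  assert (F : clim (fun N => csum (u N) J) (csum v J)).
  { clear HJ. induction J; simpl; [apply clim_const|]. now apply clim_plus. }
  rewrite clim_eps in F. destruct (F (eps / 4)) as [N HN]; [lra|].
  exists N. intros n Hn. specialize (HN n Hn).
  assert (T1 := Cser_tail (u n) b J (eps / 4) (Hu n) Hs (fun M => HJ M (Nat.le_refl _))).
  assert (T2 := Cser_tail v b J (eps / 4) Hvb Hs (fun M => HJ M (Nat.le_refl _))).
  assert (A := Cmod_tri3 (Cser (u n)) (csum (u n) J) (Cser v)).
  assert (B := Cmod_tri3 (csum (u n) J) (csum v J) (Cser v)).
  rewrite (Cmod_minus_sym (csum v J)) in B. lra.
Qed.

(** * The exponential *)

Lemma Cexp_plus z w : Cexp (z + w)%C = (Cexp z * Cexp w)%C.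
Proof.
  unfold Cexp. apply C_eq_ReIm; autorewrite with cri; unfold Re, Im; simpl;
  rewrite exp_plus, ?cos_plus, ?sin_plus; ring.
Qed.

Lemma Cexp_0 : Cexp 0 = 1.
Proof. unfold Cexp, RtoC, Re, Im; simpl. rewrite exp_0, cos_0, sin_0. f_equal; ring. Qed.

Lemma Cexp_R x : Cexp (RtoC x) = RtoC (exp x).
Proof. unfold Cexp, RtoC, Re, Im; simpl. rewrite cos_0, sin_0. f_equal; ring. Qed.

Lemma Cmod_Cexp z : Cmod (Cexp z) = exp (Re z).
Proof.
  unfold Cexp, Cmod; simpl.
  replace (exp (Re z) * cos (Im z) * (exp (Re z) * cos (Im z) * 1) +
    exp (Re z) * sin (Im z) * (exp (Re z) * sin (Im z) * 1)) with
    (exp (Re z) * exp (Re z) * (Rsqr (sin (Im z)) + Rsqr (cos (Im z)))) by (unfold Rsqr; ring).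
  rewrite sin2_cos2, Rmult_1_r. apply sqrt_square, Rlt_le, exp_pos.
Qed.

Lemma Cexp_neq0 z : Cexp z <> RtoC 0.
Proof. apply Cmod_pos_neq. rewrite Cmod_Cexp. apply exp_pos. Qed.

Lemma Cexp_opp z : Cexp (- z)%C = (/ Cexp z)%C.
Proof.
  assert (H := Cexp_neq0 z).
  assert (E : (Cexp z * Cexp (- z))%C = 1).
  { rewrite <- Cexp_plus. replace (z + - z)%C with (RtoC 0) by ring. apply Cexp_0. }
  replace (Cexp (- z)%C) with (/ Cexp z * (Cexp z * Cexp (- z)))%C by (field; auto).
  rewrite E. ring.
Qed.

(** By the addition formula the point 0 suffices. There the error in exp x cos y and exp x sin y
    reduces to the real derivatives of exp, cos and sin at 0. *)
Lemma cder_Cexp z : cder Cexp z (Cexp z).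
Proof.
  assert (H0 : cder Cexp 0 1).
  { intros eps He.
    destruct (derivable_pt_lim_exp 0 (eps / 8)) as [d1 H1]; [lra|].
    destruct (derivable_pt_lim_cos 0 (eps / 8)) as [d2 H2]; [lra|].
    destruct (derivable_pt_lim_sin 0 (eps / 8)) as [d3 H3]; [lra|].
    rewrite exp_0, cos_0, sin_0 in *.
    assert (P1 := cond_pos d1). assert (P2 := cond_pos d2). assert (P3 := cond_pos d3).
    exists (Rmin (Rmin d1 d2) (Rmin d3 (Rmin (eps / 8) 1))).
    split; [repeat apply Rmin_pos; lra|].
    intros [x y] Hh.
    assert (Mx := re_le_Cmod (x, y)). assert (My := im_le_Cmod (x, y)).
    unfold Re, Im in Mx, My; simpl in Mx, My.
    set (m := Cmod (x, y)) in *.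
    assert (Hm := Cmod_ge_0 (x, y)). fold m in Hm.
    assert (L : m < d1 /\ m < d2 /\ m < d3 /\ m < eps / 8 /\ m < 1).
    { apply Rmin_Rgt_l in Hh. destruct Hh as [A Hh]. apply Rmin_Rgt_l in A.
      apply Rmin_Rgt_l in Hh. destruct Hh as [B Hh]. apply Rmin_Rgt_l in Hh. lra. }
    destruct L as (L1 & L2 & L3 & L4 & L5).
    assert (E1 : Rabs (exp x - 1 - x) <= eps / 8 * m).
    { destruct (Req_dec x 0) as [->|Nx].
      - rewrite exp_0. replace (1 - 1 - 0) with 0 by ring. rewrite Rabs_R0. nra.
      - specialize (H1 x Nx ltac:(lra)). rewrite Rplus_0_l in H1.
        replace (exp x - 1 - x) with (((exp x - 1) / x - 1) * x) by (field; auto).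
        rewrite Rabs_mult. apply Rmult_le_compat; try apply Rabs_pos; lra. }
    assert (E2 : Rabs (cos y - 1) <= eps / 8 * m).
    { destruct (Req_dec y 0) as [->|Nx].
      - rewrite cos_0. replace (1 - 1) with 0 by ring. rewrite Rabs_R0. nra.
      - specialize (H2 y Nx ltac:(lra)). rewrite Rplus_0_l in H2.
        replace (cos y - 1) with (((cos y - 1) / y - - 0) * y) by (field; auto).
        rewrite Rabs_mult. apply Rmult_le_compat; try apply Rabs_pos; lra. }
    assert (E3 : Rabs (sin y - y) <= eps / 8 * m).
    { destruct (Req_dec y 0) as [->|Nx].
      - rewrite sin_0. replace (0 - 0) with 0 by ring. rewrite Rabs_R0. nra.
      - specialize (H3 y Nx ltac:(lra)). rewrite Rplus_0_l in H3.
        replace (sin y - y) with (((sin y - 0) / y - 1) * y) by (field; auto).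
        rewrite Rabs_mult. apply Rmult_le_compat; try apply Rabs_pos; lra. }
    assert (E4 : Rabs (exp x - 1) <= eps / 8 * m + m).
    { replace (exp x - 1) with ((exp x - 1 - x) + x) by ring.
      eapply Rle_trans; [apply Rabs_triang | lra]. }
    rewrite Cexp_0. eapply Rle_trans; [apply Cmod_le_ReIm|].
    autorewrite with cri.
    replace (Re (Cexp (0 + (x, y))%C)) with (exp x * cos y)
      by (unfold Cexp, Re, Im; simpl; now rewrite !Rplus_0_l).
    replace (Im (Cexp (0 + (x, y))%C)) with (exp x * sin y)
      by (unfold Cexp, Re, Im; simpl; now rewrite !Rplus_0_l).
    change (Re (x, y)) with x. change (Im (x, y)) with y.
    assert (Ly : Rabs (sin y) <= eps / 8 * m + m).
    { replace (sin y) with ((sin y - y) + y) by ring.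
      eapply Rle_trans; [apply Rabs_triang | lra]. }
    assert (F1 : Rabs (exp x * cos y - 1 - (x * 1 - y * 0)) <=
       Rabs (exp x - 1 - x) + Rabs (exp x - 1) * Rabs (cos y - 1) + Rabs (cos y - 1)).
    { replace (exp x * cos y - 1 - (x * 1 - y * 0)) with
        ((exp x - 1 - x) + (exp x - 1) * (cos y - 1) + (cos y - 1)) by ring.
      rewrite <- Rabs_mult.
      eapply Rle_trans; [apply Rabs_triang|]. apply Rplus_le_compat_r, Rabs_triang. }
    assert (F2 : Rabs (exp x * sin y - 0 - (x * 0 + y * 1)) <=
       Rabs (exp x - 1) * Rabs (sin y) + Rabs (sin y - y)).
    { replace (exp x * sin y - 0 - (x * 0 + y * 1)) with
        ((exp x - 1) * sin y + (sin y - y)) by ring.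
      rewrite <- Rabs_mult. apply Rabs_triang. }
    assert (C1 : Rabs (cos y - 1) <= 2).
    { apply Rabs_le. assert (X := COS_bound y). lra. }
    assert (S1 : Rabs (sin y) <= 1).
    { apply Rabs_le. assert (X := SIN_bound y). lra. }
    assert (X1 := Rabs_pos (exp x - 1)). assert (X2 := Rabs_pos (cos y - 1)).
    assert (X3 := Rabs_pos (sin y)).
    assert (Em : 0 <= eps / 8 * m) by nra.
    assert (G1 : Rabs (exp x - 1) * Rabs (cos y - 1) <= 2 * (eps / 8 * m) + m * (eps / 8 * m)).
    { replace (Rabs (exp x - 1)) with ((Rabs (exp x - 1) - m) + m) by ring.
      rewrite Rmult_plus_distr_r. apply Rplus_le_compat.
      - destruct (Rle_dec 0 (Rabs (exp x - 1) - m)); nra.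
      - apply Rmult_le_compat_l; auto. }
    assert (G2 : Rabs (exp x - 1) * Rabs (sin y) <= eps / 8 * m + m * (eps / 8 * m + m)).
    { replace (Rabs (exp x - 1)) with ((Rabs (exp x - 1) - m) + m) by ring.
      rewrite Rmult_plus_distr_r. apply Rplus_le_compat.
      - destruct (Rle_dec 0 (Rabs (exp x - 1) - m)); nra.
      - apply Rmult_le_compat_l; auto. }
    assert (Q1 : m * (eps / 8 * m) <= eps / 8 * m) by nra.
    assert (Q2 : m * m <= eps / 8 * m) by nra.
    fold m. nra. }
  intros eps He.
  assert (Pz : 0 < Cmod (Cexp z)) by (rewrite Cmod_Cexp; apply exp_pos).
  destruct (H0 (eps / Cmod (Cexp z))) as [d [Pd Hd]]; [now apply Rdiv_lt_0_compat|].
  exists d. split; auto. intros h Hh. specialize (Hd h Hh).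
  rewrite Cexp_plus.
  replace (Cexp z * Cexp h - Cexp z - h * Cexp z)%C with
    (Cexp z * (Cexp (0 + h) - Cexp 0 - h * 1))%C
    by (rewrite Cexp_0; replace (0 + h)%C with h by ring; ring).
  rewrite Cmod_mult.
  replace (eps * Cmod h) with (Cmod (Cexp z) * (eps / Cmod (Cexp z) * Cmod h)) by (field; lra).
  apply Rmult_le_compat_l; lra.
Qed.

(** * Mean value estimates and derivatives of limits *)

(** The factor [c] is a rotation left free; the mean value inequality takes for it the conjugate of
    the whole increment. *)
Lemma cder_segment f z h l c (x : R) : cder f (z + x * h)%C l ->
  derivable_pt_lim (fun x : R => Re (c * f (z + x * h))%C) x (Re (c * (h * l))%C).
Proof.
  intros H eps He.
  assert (Hc := Cmod_ge_0 c). assert (Hh := Cmod_ge_0 h).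
  assert (Pq : 0 < eps / (2 * (Cmod c + 1) * (Cmod h + 1))) by (apply Rdiv_lt_0_compat; nra).
  destruct (H _ Pq) as [d [Pd Hd]].
  assert (Pd2 : 0 < d / (Cmod h + 1)) by (apply Rdiv_lt_0_compat; lra).
  exists (mkposreal _ Pd2). intros y Ny Hy. simpl in Hy.
  specialize (Hd (y * h)%C).
  replace (z + x * h + y * h)%C with (z + (x + y)%R * h)%C in Hd by (rewrite RtoC_plus; ring).
  rewrite Cmod_mult, Cmod_R in Hd.
  assert (Py := Rabs_pos_lt y Ny).
  assert (Hs : Rabs y * Cmod h < d).
  { apply Rle_lt_trans with (Rabs y * (Cmod h + 1)); [nra|].
    apply Rlt_le_trans with (d / (Cmod h + 1) * (Cmod h + 1)); [|right; field; lra].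
    apply Rmult_lt_compat_r; lra. }
  specialize (Hd Hs).
  set (A := (f (z + (x + y)%R * h) - f (z + x * h) - y * h * l)%C) in *.
  replace ((Re (c * f (z + (x + y)%R * h))%C - Re (c * f (z + x * h))%C) / y - Re (c * (h * l))%C)
    with (Re (c * A)%C / y).
  2:{ unfold A. autorewrite with cri. field. auto. }
  unfold Rdiv. rewrite Rabs_mult, Rabs_inv.
  assert (B : Rabs (Re (c * A)%C) <= Cmod c * (eps / (2 * (Cmod c + 1) * (Cmod h + 1)) * (Rabs y * Cmod h))).
  { eapply Rle_trans; [apply re_le_Cmod|]. rewrite Cmod_mult. apply Rmult_le_compat_l; auto. }
  apply Rle_lt_trans with (Cmod c * (eps / (2 * (Cmod c + 1) * (Cmod h + 1)) * (Rabs y * Cmod h)) * / Rabs y).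
  { apply Rmult_le_compat_r; auto. apply Rlt_le, Rinv_0_lt_compat; auto. }
  replace (Cmod c * (eps / (2 * (Cmod c + 1) * (Cmod h + 1)) * (Rabs y * Cmod h)) * / Rabs y) with
    ((eps / 2) * ((Cmod c / (Cmod c + 1)) * (Cmod h / (Cmod h + 1)))) by (field; lra).
  assert (Q : forall t, 0 <= t -> 0 <= t / (t + 1) <= 1).
  { intros t Ht. split; [apply Rmult_le_pos; [auto|apply Rlt_le, Rinv_0_lt_compat; lra]|].
    apply Rmult_le_reg_r with (t + 1); [lra|].
    replace (t / (t + 1) * (t + 1)) with t by (field; lra). lra. }
  assert (Q1 := Q _ Hc). assert (Q2 := Q _ Hh).
  assert (Q3 : Cmod c / (Cmod c + 1) * (Cmod h / (Cmod h + 1)) <= 1 * 1) by (apply Rmult_le_compat; lra).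
  nra.
Qed.

(** With D the increment of f, the real function Re(conj(D) f) grows by |D|^2 along the segment. The
    real mean value theorem bounds this by |D| M |h|, so no constant is lost in passing to complex
    values. *)
Lemma cder_mvt f g z h M :
  (forall x : R, 0 <= x <= 1 -> cder f (z + x * h)%C (g (z + x * h)%C) /\ Cmod (g (z + x * h)%C) <= M) ->
  Cmod (f (z + h)%C - f z)%C <= M * Cmod h.
Proof.
  intros H. set (D := (f (z + h) - f z)%C).
  destruct (MVT_cor2 (fun x : R => Re (Cconj D * f (z + x * h))%C)
    (fun x : R => Re (Cconj D * (h * g (z + x * h)))%C) 0 1) as [x [E Hx]]; [lra| |].
  { intros x Hx. apply cder_segment. now apply H. }
  cbv beta in E.
  replace (z + 1 * h)%C with (z + h)%C in E by ring.
  replace (z + 0 * h)%C with z in E by ring.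
  assert (E2 : Cmod D * Cmod D <= Cmod D * (M * Cmod h)).
  { assert (X : Cmod D * Cmod D = Re (Cconj D * f (z + h))%C - Re (Cconj D * f z)%C).
    { transitivity (Re (D * Cconj D)%C).
      - rewrite <- Cmod2_conj, Re_RtoC. ring.
      - transitivity (Re (Cconj D * f (z + h) - Cconj D * f z)%C); [|reflexivity].
        f_equal. unfold D. ring. }
    rewrite X, E. replace (1 - 0) with 1 by ring. rewrite Rmult_1_r.
    eapply Rle_trans; [apply Rle_abs|]. eapply Rle_trans; [apply re_le_Cmod|].
    rewrite !Cmod_mult, Cmod_conj, (Rmult_comm M). apply Rmult_le_compat_l; [apply Cmod_ge_0|].
    apply Rmult_le_compat_l; [apply Cmod_ge_0|]. apply H. lra. }
  destruct (Req_dec (Cmod D) 0) as [Z|Z].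
  - rewrite Z. apply Rmult_le_pos; [|apply Cmod_ge_0].
    destruct (H 0 ltac:(lra)) as [_ B]. eapply Rle_trans; [apply Cmod_ge_0 | apply B].
  - assert (P := Cmod_ge_0 D). apply Rmult_le_reg_l with (Cmod D); [lra | exact E2].
Qed.

(** The mean value inequality is applied to f(w) - w g(z), whose derivative g(w) - g(z) is itself
    small by the mean value inequality. *)
Lemma cder_taylor f g k z r M h :
  (forall w, Cmod (w - z)%C < r -> cder f w (g w) /\ cder g w (k w) /\ Cmod (k w) <= M) ->
  Cmod h < r -> Cmod (f (z + h)%C - f z - h * g z)%C <= M * Cmod h * Cmod h.
Proof.
  intros H Hh.
  assert (Hseg : forall x : R, 0 <= x <= 1 -> Cmod (x * h)%C <= Cmod h).
  { intros x Hx. rewrite Cmod_mult, Cmod_RtoC_pos by lra.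
    assert (P := Cmod_ge_0 h). nra. }
  assert (Hb : forall h', Cmod h' < r -> Cmod (z + h' - z)%C < r).
  { intros h' L. now replace (z + h' - z)%C with h' by ring. }
  assert (HM : 0 <= M).
  { destruct (H z) as (_ & _ & B).
    - replace (z - z)%C with (RtoC 0) by ring. rewrite Cmod_0.
      eapply Rle_lt_trans; [apply Cmod_ge_0 | exact Hh].
    - eapply Rle_trans; [apply Cmod_ge_0 | exact B]. }
  assert (K : forall h', Cmod h' <= Cmod h -> Cmod (g (z + h')%C - g z)%C <= M * Cmod h').
  { intros h' L. apply cder_mvt with k. intros x Hx.
    assert (B : Cmod (z + x * h' - z)%C < r).
    { apply Hb. rewrite Cmod_mult, Cmod_RtoC_pos by lra. assert (P := Cmod_ge_0 h'). nra. }
    destruct (H _ B) as (_ & X & Y). auto. }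
  assert (E := cder_mvt (fun w => f w - w * g z)%C (fun w => g w - g z)%C z h (M * Cmod h)).
  cbv beta in E.
  replace ((f (z + h) - (z + h) * g z - (f z - z * g z)))%C with (f (z + h) - f z - h * g z)%C in E by ring.
  apply E. intros x Hx. assert (S := Hseg x Hx). split.
  - destruct (H (z + x * h)%C) as (X & _ & _); [apply Hb; lra|].
    apply cder_minus; auto.
    apply cder_eq with (1 * g z + (z + x * h) * 0)%C; [ring|].
    apply (cder_mult (fun w => w) (fun _ => g z)); [apply cder_id | apply cder_const].
  - eapply Rle_trans; [apply K; lra|]. apply Rmult_le_compat_l; auto.
Qed.

(** Plays the part of Weierstrass's theorem. A bound on the second derivatives uniform in N makes
    the quadratic Taylor remainder uniform too, so it survives pointwise limits of [f N] near z and
    of [g N] at z alone. *)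
Lemma cder_lim (f g k : nat -> C -> C) (F : C -> C) (z G : C) (r M : R) :
  0 < r ->
  (forall N w, Cmod (w - z)%C < r ->
     cder (f N) w (g N w) /\ cder (g N) w (k N w) /\ Cmod (k N w) <= M) ->
  (forall w, Cmod (w - z)%C < r -> clim (fun N => f N w) (F w)) ->
  clim (fun N => g N z) G -> cder F z G.
Proof.
  intros Hr H HF HG.
  assert (B : forall h, Cmod h < r -> Cmod (F (z + h)%C - F z - h * G)%C <= M * Cmod h * Cmod h).
  { intros h Hh. apply clim_le with (fun N => f N (z + h) - f N z - h * g N z)%C.
    - apply clim_minus; [apply clim_minus|]; [apply HF|apply HF|now apply clim_scal].
      + now replace (z + h - z)%C with h by ring.
      + replace (z - z)%C with (RtoC 0) by ring. now rewrite Cmod_0.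
    - exists 0%nat. intros N _. apply (cder_taylor (f N) (g N) (k N) z r M h); auto. }
  intros eps He. assert (PM := Rabs_pos M).
  exists (Rmin r (eps / (Rabs M + 1))). split.
  { apply Rmin_pos; auto. apply Rdiv_lt_0_compat; lra. }
  intros h Hh. assert (M1 := Rmin_l r (eps / (Rabs M + 1))).
  assert (M2 := Rmin_r r (eps / (Rabs M + 1))).
  eapply Rle_trans; [apply B; lra|]. assert (P := Cmod_ge_0 h).
  apply Rmult_le_compat_r; auto.
  apply Rle_trans with ((Rabs M + 1) * (eps / (Rabs M + 1))); [|right; field; lra].
  assert (X := Rle_abs M).
  apply Rle_trans with ((Rabs M + 1) * Cmod h); [apply Rmult_le_compat_r; lra|].
  apply Rmult_le_compat_l; lra.
Qed.

(** * The von Mangoldt function and prime powers *)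

Module Arith.
Import ssreflect ssrbool ssrfun eqtype ssrnat div prime.

Definition is_prime (n : nat) : bool := prime n.
Definition divides (d n : nat) : bool := dvdn d n.
(** A number is compared with the full power of its least prime divisor, so [mangoldt] can name the
    prime directly; 0 and 1 are excluded. *)
Definition prime_power (n : nat) : bool :=
  (leq 2 n) && (n == expn (pdiv n) (logn (pdiv n) n)).
Definition proper_power (n : nat) : bool := prime_power n && leq 2 (logn (pdiv n) n).
Definition mangoldt (n : nat) : R := if prime_power n then ln (INR (pdiv n)) else 0.

Lemma is_prime_ge2 n : is_prime n -> le 2 n.
Proof. move=> /prime_gt1 H. exact/leP. Qed.

Lemma mangoldt_0 : mangoldt 0 = 0. Proof. by []. Qed.
Lemma mangoldt_1 : mangoldt 1 = 0. Proof. by []. Qed.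

Lemma prime_power_pfactor p r : prime p -> leq 1 r -> prime_power (expn p r) /\ pdiv (expn p r) = p.
Proof.
move=> pp; case: r => // r _; have E : pdiv (expn p r.+1) = p by apply: pdiv_pfactor.
split => //; rewrite /prime_power E pfactorK // eqxx andbT.
apply: (leq_trans (prime_gt1 pp)); by rewrite -[X in leq X _]expn1 leq_pexp2l // prime_gt0.
Qed.

Lemma prime_powerP n : prime_power n -> exists p r, [/\ prime p, leq 1 r, n = expn p r & pdiv n = p].
Proof.
move=> /andP [n1 /eqP e]; exists (pdiv n), (logn (pdiv n) n); split => //.
- exact: pdiv_prime.
- by rewrite logn_gt0 mem_primes pdiv_prime //= pdiv_dvd andbT (ltn_trans _ n1).
Qed.

Lemma mangoldt_prime n : is_prime n -> mangoldt n = ln (INR n).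
Proof.
move=> pn; rewrite /mangoldt; have [] := prime_power_pfactor n 1 pn isT; rewrite expn1 => -> -> //.
Qed.

Lemma mangoldt_case n : mangoldt n <> 0 -> is_prime n \/ proper_power n.
Proof.
rewrite /mangoldt; case h: (prime_power n) => // _.
have [p [r [pp r0 e epd]]] := prime_powerP _ h.
case: r r0 e => [//|[|r]] _ e.
- left; by rewrite e expn1.
- right; by rewrite /proper_power h epd e pfactorK.
Qed.

Lemma mangoldt_bound n : 0 <= mangoldt n <= ln (INR n) \/ (n = 0)%nat.
Proof.
case: n => [|n]; first by right.
left; rewrite /mangoldt.
have L0 : 0 <= ln (INR n.+1).
{ rewrite -ln_1; apply: ln_le; first lra. rewrite S_INR; have := pos_INR n; lra. }
case h: (prime_power _); last by lra.
have [p [r [pp r0 e epd]]] := prime_powerP _ h; rewrite epd.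
have p1 := prime_gt1 pp.
have i1 : 1 <= INR p.
{ apply: (le_INR 1); apply/leP; exact: ltnW. }
split; first by rewrite -ln_1; apply: ln_le; lra.
apply: ln_le; first lra.
apply: le_INR; apply/leP; rewrite e -[X in leq X _]expn1 leq_pexp2l // prime_gt0 //.
Qed.

Lemma rsum_zero N : rsum (fun=> 0) N = 0.
Proof. elim: N => //= N ->; ring. Qed.

Lemma rsum_delta a v N : (lt a N) -> rsum (fun d => if d == a then v else 0) N = v.
Proof.
elim: N => [|N IH] H; first by lia.
rewrite /=; case: eqP => [E|E].
- rewrite E; have -> : rsum (fun d => if d == a then v else 0) a = 0; last by ring.
  rewrite (rsum_ext _ (fun=> 0)); first by exact: rsum_zero.
  move=> n Hn; case: eqP => // e; lia.
- rewrite IH; [ring | lia].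
Qed.

(** Induction on n, dividing by its least prime p. Passing from n/p to n creates exactly one new
    prime power divisor, p raised to the valuation of n, and it contributes ln p. The cutoff [N] may
    be any bound above n. *)
Lemma mangoldt_sum N n : (lt 0 n) -> (lt n N) -> rsum (fun d => if divides d n then mangoldt d else 0) N = ln (INR n).
Proof.
elim/ltn_ind: n => n IH n0 nN.
have [n1|n1] := leqP 2 n; last first.
{ have -> : n = 1%nat by move/leP: n1 => n1; lia.
  rewrite ln_1 (rsum_ext _ (fun=> 0)); first by exact: rsum_zero.
  move=> d _; rewrite /divides dvdn1; case: eqP => [->|//]; exact: mangoldt_1. }
have pp := pdiv_prime n1; set p := pdiv n in pp *.
have [m e] : exists m, n = muln p m.
{ exists (divn n p); by rewrite mulnC divnK // pdiv_dvd. }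
have p1 := prime_gt1 pp.
have m0 : leq 1 m by move/leP: n0; rewrite e; case: (m) => [|//]; rewrite muln0.
have mn : leq m.+1 n by rewrite e -[X in leq X.+1 _]mul1n ltn_pmul2r.
have lp : leq 1 (logn p n).
{ by rewrite logn_gt0 mem_primes pp //= pdiv_dvd andbT (ltn_trans _ n1). }
have -> : rsum (fun d => if divides d n then mangoldt d else 0) N =
  rsum (fun d => (if divides d m then mangoldt d else 0) + (if d == expn p (logn p n) then ln (INR p) else 0)) N.
{ apply: rsum_ext => d _; rewrite /divides.
  case h: (prime_power d); last first.
  { rewrite /mangoldt h; case: eqP => [E|_]; last by case: dvdn; case: dvdn; ring.
    have [h' _] := prime_power_pfactor p (logn p n) pp lp; by rewrite E h' in h. }
  have [q [r [pq r0 E epd]]] := prime_powerP _ h.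
  have n0' : leq 1 n by apply/leP.
  rewrite {1 3}E !pfactor_dvdn //.
  have lnq : logn q n = addn (q == p) (logn q m).
  { rewrite {1}e lognM ?(prime_gt0 pp) // logn_prime //. }
  have [eqp|nqp] := eqVneq q p.
  - rewrite eqp in E epd lnq *; rewrite {}lnq eqxx /= [X in X == _]E eqn_exp2l //.
    rewrite add1n.
    have [h1|h1] := leqP r (logn p m).
    + rewrite ifT ?ifF; [ring| |by rewrite (leq_trans h1) // leq_addl].
      apply/negP => /eqP e1; move: h1; rewrite e1 ltnn //.
    + rewrite eqn_leq; case h2: (leq r (logn p m).+1) => /=; last by ring.
      rewrite h1 /mangoldt h epd; ring.
  - rewrite lnq (negbTE nqp) add0n.
    have -> : (d == expn p (logn p n)) = false; last by ring.
    apply/negP => /eqP E2; have [_ h2] := prime_power_pfactor p (logn p n) pp lp.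
    by move: nqp; rewrite -epd E2 h2 eqxx. }
rewrite rsum_plus rsum_delta; last first.
{ apply: Nat.le_lt_trans nN; apply/leP; apply: dvdn_leq; first exact/leP.
  by rewrite pfactor_dvdn //; apply/leP. }
rewrite IH //; [|exact/leP|apply: Nat.lt_trans nN; exact/leP].
rewrite e (_ : INR (muln p m) = INR p * INR m); last exact: mult_INR.
rewrite ln_mult; [ring| |]; apply: (lt_INR 0); apply/leP => //; exact: ltnW.
Qed.

Lemma divides_mod d m r : (lt 0 d) -> (lt r d) -> divides d (Nat.add (Nat.mul d m) r) = Nat.eqb r 0.
Proof.
move=> d0 rd; rewrite /divides; change (dvdn d (addn (muln d m) r) = Nat.eqb r 0).
rewrite dvdn_addr ?dvdn_mulr //; case: r rd => [|r] rd; first by rewrite dvdn0.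
rewrite gtnNdvd //; exact/leP.
Qed.

(** For n = p^r take m = p^(r/2), with the exponent rounded down: n is m^2 or m^2 p according to the
    parity of r, and p is [pdiv m]. Sums over proper powers are thereby reduced to sums over
    squares. *)
Lemma proper_power_half n : proper_power n -> exists m, (le m n) /\
  (n = Nat.mul m m \/ n = Nat.mul (Nat.mul m m) (pdiv m)) /\ le 2 m.
Proof.
move=> /andP [h l2]; have [p [r [pp r0 e epd]]] := prime_powerP _ h.
rewrite epd e pfactorK // in l2.
have k0 : leq 1 r./2 by move: l2; rewrite -(odd_double_half r); case: (r./2); case: odd.
have p1 := prime_gt1 pp.
exists (expn p r./2); split.
- apply/leP; rewrite e leq_exp2l //. by rewrite -{2}(odd_double_half r) -addnn addnA leq_addl.
- split.
  + have [h2 h3] := prime_power_pfactor p (r./2) pp k0.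
    have en : n = muln (muln (expn p r./2) (expn p r./2)) (expn p (odd r)).
    { by rewrite -!expnD addnn addnC odd_double_half. }
    rewrite h3 en; case: (odd r); [right|left]; first by rewrite expn1.
    by rewrite expn0 muln1.
  + apply/leP; apply: (leq_trans p1); by rewrite -[X in leq X _]expn1 leq_exp2l.
Qed.

Lemma pdiv_pos m : le 1 (pdiv m).
Proof. apply/leP; exact: pdiv_gt0. Qed.

(** Unique factorisation in the form that keeps integer frequencies distinct when one more prime is
    multiplied in; the exponents are read off as valuations. *)
Lemma coprime_pow_inj p n n' l l' : is_prime p -> divides p n = false -> divides p n' = false ->
  lt 0 n -> lt 0 n' ->
  Nat.mul n (Nat.pow p l) = Nat.mul n' (Nat.pow p l') -> n = n' /\ l = l'.
Proof.
have E : forall a b, Nat.pow a b = expn a b by move=> a; elim=> //= b ->; rewrite expnS.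
rewrite !E => pp h h' n0 n0' e0.
have e : muln n (expn p l) = muln n' (expn p l') by exact: e0.
move/leP: n0 => n0; move/leP: n0' => n0'.
have {}pp : prime p := pp; have p0 : leq 1 p := prime_gt0 pp.
have L : forall k j, leq 1 k -> divides p k = false -> logn p (muln k (expn p j)) = j.
{ move=> k j k0 hk; rewrite lognM ?expn_gt0 ?p0 // pfactorK //.
  have -> : logn p k = 0%nat; last by rewrite add0n.
  apply/eqP; rewrite -leqn0 leqNgt logn_gt0 mem_primes pp k0 /=; exact/negP/negP/negbT. }
have el : l = l' by rewrite -(L n l) // e L.
split => //; move: e; rewrite el => /eqP; rewrite eqn_pmul2r ?expn_gt0 ?p0 //; by move/eqP.
Qed.

Lemma divides_prime_mul_pow q p n l : is_prime p -> is_prime q -> p <> q -> divides q n = false ->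
  divides q (Nat.mul n (Nat.pow p l)) = false.
Proof.
have E : forall a b, Nat.pow a b = expn a b by move=> a; elim=> //= b ->; rewrite expnS.
move=> pp pq ne h; rewrite E; change (dvdn q (muln n (expn p l)) = false).
rewrite Euclid_dvdM //; apply/norP; split; first by rewrite /divides in h; rewrite h.
rewrite Euclid_dvdX // dvdn_prime2 // negb_and; apply/orP; left; apply/eqP => e; exact: ne.
Qed.

Lemma divides_prime_1 q : is_prime q -> divides q 1 = false.
Proof. move=> pq; rewrite /divides dvdn1; apply/negP => /eqP e; by rewrite e in pq. Qed.

Lemma prime_power_pow n : prime_power n -> exists p r, is_prime p /\ le 1 r /\ n = Nat.pow p r /\ le p n.
Proof.
have E : forall a b, Nat.pow a b = expn a b by move=> a; elim=> //= b ->; rewrite expnS.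
move=> /prime_powerP [p [r [pp r0 e _]]]; exists p, r; rewrite E; split=> //; split; first exact/leP.
split=> //; apply/leP; rewrite e -[X in leq X _]expn1 leq_pexp2l // prime_gt0 //.
Qed.
End Arith.

Import Arith.

(** * Logarithms of integers and convergence of the sum of n^(-sg) *)

Definition lnN (n : nat) : R := ln (INR n).

(** [ln] is 0 at 0 by convention, so [exp (- sg * lnN 0)] is 1: sums that start at index 0 contain
    one extra bounded term unless the coefficient there vanishes. *)
Lemma lnN_0 : lnN 0 = 0.
Proof. unfold lnN; simpl. unfold ln. destruct (Rlt_dec 0 0) as [H|H]; [destruct (Rlt_irrefl _ H) | reflexivity]. Qed.

Lemma lnN_1 : lnN 1 = 0.
Proof. apply ln_1. Qed.

Lemma INR_ge1 n : (1 <= n)%nat -> 1 <= INR n.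
Proof. intros H. apply (le_INR 1), H. Qed.

Lemma lnN_ge0 n : 0 <= lnN n.
Proof.
  destruct n; [rewrite lnN_0; lra|]. unfold lnN. rewrite <- ln_1.
  apply ln_le; [lra|]. apply INR_ge1. lia.
Qed.

Lemma lnN_pos n : (2 <= n)%nat -> 0 < lnN n.
Proof.
  intros H. unfold lnN. rewrite <- ln_1. apply ln_increasing; [lra|].
  apply (lt_INR 1). lia.
Qed.

Lemma lnN_le n m : (n <= m)%nat -> lnN n <= lnN m.
Proof.
  intros H. destruct n; [rewrite lnN_0; apply lnN_ge0|].
  apply ln_le; [|now apply le_INR]. apply lt_0_INR. lia.
Qed.

Lemma exp_ge_1p x : 1 + x <= exp x.
Proof. destruct (Req_dec x 0) as [->|]; [rewrite exp_0; lra|]. left. now apply exp_ineq1. Qed.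

Lemma exp_le x y : x <= y -> exp x <= exp y.
Proof. intros [H| ->]; [left; now apply exp_increasing | lra]. Qed.

Lemma exp_pow_INR x j : exp x ^ j = exp (INR j * x).
Proof.
  induction j; [simpl; rewrite Rmult_0_l, exp_0; auto|].
  simpl pow. rewrite IHj, <- exp_plus, S_INR. f_equal. ring.
Qed.

Lemma summable_telescope b (t : nat -> R) : (forall n, 0 <= b n) -> (forall n, 0 <= t n) ->
  (forall n, (1 <= n)%nat -> b (S n) <= t n - t (S n)) -> summable b.
Proof.
  intros Hb Ht H. exists (b 0%nat + b 1%nat + t 1%nat).
  assert (K : forall N, rsum b (S (S N)) <= b 0%nat + b 1%nat + t 1%nat - t (S N)).
  { induction N; [simpl; lra|]. change (rsum b (S (S (S N)))) with (rsum b (S (S N)) + b (S (S N))).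
    specialize (H (S N) ltac:(lia)). lra. }
  intros N. apply Rle_trans with (rsum b (S (S N))).
  - apply rsum_mono; auto.
  - specialize (K N). specialize (Ht (S N)). lra.
Qed.

(** A discrete integral test: n^(-sg) is dominated by the decrease of n^(-(sg - 1)) / (sg - 1), via
    exp x >= 1 + x and ln(n + 1) - ln n >= 1/(n + 1). *)
Lemma p_series sg : 1 < sg -> summable (fun n => exp (- sg * lnN n)).
Proof.
  intros Hs. apply summable_telescope with (fun n => / (sg - 1) * exp (- (sg - 1) * lnN n)).
  - intros; apply Rlt_le, exp_pos.
  - intros n. apply Rmult_le_pos; [apply Rlt_le, Rinv_0_lt_compat; lra | apply Rlt_le, exp_pos].
  - intros n Hn. rewrite <- Rmult_minus_distr_l.
    assert (P1 : 1 <= INR n) by now apply INR_ge1.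
    assert (P2 : INR (S n) = INR n + 1) by apply S_INR.
    assert (Dl : / INR (S n) <= lnN (S n) - lnN n).
    { unfold lnN. assert (E : ln (INR n / INR (S n)) = ln (INR n) - ln (INR (S n)))
        by (apply ln_div; lra).
      assert (F := exp_ge_1p (ln (INR n / INR (S n)))).
      rewrite exp_ln in F by (apply Rdiv_lt_0_compat; lra).
      assert (Q : INR n / INR (S n) = 1 - / INR (S n)) by (rewrite P2; field; lra).
      lra. }
    assert (E : exp (- (sg - 1) * lnN n) =
      exp (- (sg - 1) * lnN (S n)) * exp ((sg - 1) * (lnN (S n) - lnN n))).
    { rewrite <- exp_plus. f_equal. ring. }
    assert (E2 : exp (- sg * lnN (S n)) = exp (- (sg - 1) * lnN (S n)) * / INR (S n)).
    { replace (- sg * lnN (S n)) with (- (sg - 1) * lnN (S n) + - lnN (S n)) by ring.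
      rewrite exp_plus, exp_Ropp. unfold lnN at 2. rewrite exp_ln; [auto | lra]. }
    rewrite E2, E. set (X := exp (- (sg - 1) * lnN (S n))).
    assert (PX : 0 < X) by apply exp_pos.
    assert (F := exp_ge_1p ((sg - 1) * (lnN (S n) - lnN n))).
    assert (PI : 0 < / INR (S n)) by (apply Rinv_0_lt_compat; lra).
    apply Rmult_le_reg_l with (sg - 1); [lra|].
    set (Y := exp ((sg - 1) * (lnN (S n) - lnN n))) in *.
    replace ((sg - 1) * (/ (sg - 1) * (X * Y - X))) with (X * (Y - 1)) by (field; lra).
    replace ((sg - 1) * (X * / INR (S n))) with (X * ((sg - 1) * / INR (S n))) by ring.
    apply Rmult_le_compat_l; [lra|].
    assert (W : (sg - 1) * / INR (S n) <= (sg - 1) * (lnN (S n) - lnN n)) by (apply Rmult_le_compat_l; lra).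
    lra.
Qed.

(** * Dirichlet series *)

(* Coefficients of subpolynomial growth; index [0] carries no term. *)
Definition subpoly (a : nat -> R) : Prop := a 0%nat = 0 /\
  forall eps, 0 < eps -> exists B, 0 <= B /\ forall n, Rabs (a n) <= B * exp (eps * lnN n).

Lemma subpoly_bounded a B : a 0%nat = 0 -> (forall n, Rabs (a n) <= B) -> subpoly a.
Proof.
  intros H0 HB. split; auto. intros eps He. exists B.
  assert (PB : 0 <= B) by (eapply Rle_trans; [apply Rabs_pos | apply (HB 0%nat)]).
  split; auto. intros n.
  assert (1 <= exp (eps * lnN n)).
  { rewrite <- exp_0. apply exp_le. apply Rmult_le_pos; [lra | apply lnN_ge0]. }
  specialize (HB n). nra.
Qed.

Lemma subpoly_ln a : subpoly a -> subpoly (fun n => - lnN n * a n).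
Proof.
  intros [H0 H]. split; [rewrite H0; ring|]. intros eps He.
  destruct (H (eps / 2)) as [B [PB HB]]; [lra|].
  exists (2 / eps * B). split.
  { apply Rmult_le_pos; auto. apply Rlt_le, Rdiv_lt_0_compat; lra. }
  intros n. rewrite Rabs_mult, Rabs_Ropp, (Rabs_pos_eq (lnN n)) by apply lnN_ge0.
  replace (eps * lnN n) with (eps / 2 * lnN n + eps / 2 * lnN n) by field.
  rewrite exp_plus.
  replace (2 / eps * B * (exp (eps / 2 * lnN n) * exp (eps / 2 * lnN n))) with
    ((2 / eps * exp (eps / 2 * lnN n)) * (B * exp (eps / 2 * lnN n))) by ring.
  apply Rmult_le_compat; auto; [apply lnN_ge0 | apply Rabs_pos|].
  assert (F := exp_ge_1p (eps / 2 * lnN n)).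
  apply Rle_trans with (2 / eps * (eps / 2 * lnN n)); [right; field; lra|].
  apply Rmult_le_compat_l; [apply Rlt_le, Rdiv_lt_0_compat; lra | lra].
Qed.

(** Each derivative of n^(-s) brings down one factor - ln n, so these are the coefficients of the
    k-th derivative. *)
Definition dcoef (a : nat -> R) (k n : nat) : R := (- lnN n) ^ k * a n.

Lemma dcoef_S a k n : dcoef a (S k) n = - lnN n * dcoef a k n.
Proof. unfold dcoef. simpl. ring. Qed.

Lemma subpoly_ext a b : (forall n, a n = b n) -> subpoly a -> subpoly b.
Proof.
  intros E [H0 H]. split; [rewrite <- E; auto|]. intros eps He.
  destruct (H eps He) as [B [PB HB]]. exists B. split; auto. intros n. rewrite <- E. auto.
Qed.

Lemma subpoly_dcoef a k : subpoly a -> subpoly (dcoef a k).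
Proof.
  intros H. induction k.
  - apply subpoly_ext with (2 := H). intros n. unfold dcoef. simpl. ring.
  - apply subpoly_ext with (2 := subpoly_ln _ IHk). intros n. now rewrite dcoef_S.
Qed.

Lemma subpoly_summable a sg : subpoly a -> 1 < sg ->
  summable (fun n => Rabs (a n) * exp (- sg * lnN n)).
Proof.
  intros [_ H] Hs. destruct (H ((sg - 1) / 2)) as [B [PB HB]]; [lra|].
  apply summable_le with (fun n => B * exp (- ((sg + 1) / 2) * lnN n)).
  - intros n. replace (exp (- ((sg + 1) / 2) * lnN n)) with
      (exp ((sg - 1) / 2 * lnN n) * exp (- sg * lnN n)).
    + rewrite <- Rmult_assoc. apply Rmult_le_compat_r; [apply Rlt_le, exp_pos | auto].
    + rewrite <- exp_plus. f_equal. field.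
  - apply summable_scal; auto. apply p_series. lra.
Qed.

Definition npow (n : nat) (s : C) : C := Cexp (- s * RtoC (lnN n))%C.

Lemma Cmod_npow n s : Cmod (npow n s) = exp (- Re s * lnN n).
Proof. unfold npow. rewrite Cmod_Cexp. autorewrite with cri. f_equal. ring. Qed.

Lemma npow_mult n m s : (1 <= n)%nat -> (1 <= m)%nat ->
  npow (n * m) s = (npow n s * npow m s)%C.
Proof.
  intros Hn Hm. unfold npow. rewrite <- Cexp_plus. f_equal. unfold lnN.
  rewrite mult_INR, ln_mult by (apply lt_0_INR; lia). rewrite RtoC_plus. ring.
Qed.

Lemma npow_1 s : npow 1 s = 1.
Proof. unfold npow. rewrite lnN_1, Cmult_0_r. apply Cexp_0. Qed.

Lemma cder_npow n s : cder (npow n) s (RtoC (- lnN n) * npow n s)%C.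
Proof.
  unfold npow.
  apply cder_comp with (g := Cexp) (f := fun w => (- w * RtoC (lnN n))%C); [|apply cder_Cexp].
  apply cder_ext with (fun w => RtoC (- lnN n) * w)%C.
  - intros w. rewrite RtoC_opp. ring.
  - apply cder_eq with (RtoC (- lnN n) * 1)%C; [ring|]. apply cder_scal, cder_id.
Qed.

Definition dirichlet_term (a : nat -> R) (s : C) (n : nat) : C := (RtoC (a n) * npow n s)%C.
Definition dirichlet (a : nat -> R) (s : C) : C := Cser (dirichlet_term a s).

Lemma Cmod_dirichlet_term a s n : Cmod (dirichlet_term a s n) = Rabs (a n) * exp (- Re s * lnN n).
Proof. unfold dirichlet_term. now rewrite Cmod_mult, Cmod_R, Cmod_npow. Qed.

Lemma Cmod_dirichlet_term_le a s sg n : sg <= Re s -> Cmod (dirichlet_term a s n) <= Rabs (a n) * exp (- sg * lnN n).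
Proof.
  intros H. rewrite Cmod_dirichlet_term. apply Rmult_le_compat_l; [apply Rabs_pos|].
  apply exp_le. assert (X := lnN_ge0 n). nra.
Qed.

Lemma dirichlet_cv a s : subpoly a -> 1 < Re s -> clim (csum (dirichlet_term a s)) (dirichlet a s).
Proof.
  intros Ha Hs. apply Cser_cv with (fun n => Rabs (a n) * exp (- Re s * lnN n)).
  - intros n. rewrite Cmod_dirichlet_term. lra.
  - now apply subpoly_summable.
Qed.

Lemma dirichlet_ext a b s : (forall n, a n = b n) -> dirichlet a s = dirichlet b s.
Proof. intros H. apply Cser_ext. intros n. unfold dirichlet_term. now rewrite H. Qed.

Lemma cder_csum (f g : nat -> C -> C) z N : (forall n, cder (f n) z (g n z)) ->
  cder (fun w => csum (fun n => f n w) N) z (csum (fun n => g n z) N).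
Proof.
  intros H. induction N; simpl.
  - apply cder_const.
  - now apply cder_plus.
Qed.

Lemma cder_dirichlet_term a w n : cder (fun w => dirichlet_term a w n) w (dirichlet_term (fun n => - lnN n * a n) w n).
Proof.
  unfold dirichlet_term. apply cder_eq with (RtoC (a n) * (RtoC (- lnN n) * npow n w))%C.
  - rewrite RtoC_mult. ring.
  - apply cder_scal, cder_npow.
Qed.

Lemma cder_dirichlet a s : subpoly a -> 1 < Re s -> cder (dirichlet a) s (dirichlet (fun n => - lnN n * a n) s).
Proof.
  intros Ha Hs.
  set (a1 := fun n => - lnN n * a n). set (a2 := fun n => - lnN n * a1 n).
  assert (Ha1 : subpoly a1) by now apply subpoly_ln.
  assert (Ha2 : subpoly a2) by now apply subpoly_ln.
  (* Half the distance to the line Re s = 1, so that one exponent [sg > 1] serves the whole disc and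
     bounds all second derivatives. *)
  set (r := (Re s - 1) / 2). set (sg := Re s - r).
  assert (Hsg : 1 < sg) by (unfold sg, r; lra).
  destruct (subpoly_summable a2 sg Ha2 Hsg) as [M HM].
  assert (Hball : forall w, Cmod (w - s)%C < r -> sg <= Re w).
  { intros w Hw. assert (X := re_le_Cmod (w - s)%C). rewrite Re_minus in X.
    assert (Y := Rle_abs (- (Re w - Re s))). rewrite Rabs_Ropp in Y. unfold sg. lra. }
  apply (cder_lim (fun N w => csum (dirichlet_term a w) N) (fun N w => csum (dirichlet_term a1 w) N)
    (fun N w => csum (dirichlet_term a2 w) N)) with (r := r) (M := M).
  - unfold r. lra.
  - intros N w Hw. split; [|split].
    + apply (cder_csum (fun n w => dirichlet_term a w n) (fun n w => dirichlet_term a1 w n)). intros; apply cder_dirichlet_term.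
    + apply (cder_csum (fun n w => dirichlet_term a1 w n) (fun n w => dirichlet_term a2 w n)). intros; apply cder_dirichlet_term.
    + eapply Rle_trans; [apply Cmod_csum|]. eapply Rle_trans; [|apply (HM N)].
      apply rsum_le. intros n _. apply Cmod_dirichlet_term_le. auto.
  - intros w Hw. apply dirichlet_cv; auto. specialize (Hball w Hw). lra.
  - now apply dirichlet_cv.
Qed.

Lemma cder_dirichlet_dcoef a k s : subpoly a -> 1 < Re s -> cder (dirichlet (dcoef a k)) s (dirichlet (dcoef a (S k)) s).
Proof.
  intros Ha Hs. apply cder_eq with (2 := cder_dirichlet (dcoef a k) s (subpoly_dcoef a k Ha) Hs).
  apply dirichlet_ext. intros n. now rewrite dcoef_S.
Qed.

Lemma is_lim_exp_mINR y : 0 < y -> is_lim_seq (fun N => exp (- INR N * y)) 0.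
Proof.
  intros Hy. apply is_lim_seq_ext with (fun N => (exp (- y)) ^ N).
  - intros N. induction N; simpl pow; [simpl; rewrite Ropp_0, Rmult_0_l, exp_0; auto|].
    rewrite IHN, <- exp_plus. f_equal. rewrite S_INR. ring.
  - apply is_lim_seq_geom. rewrite Rabs_pos_eq by apply Rlt_le, exp_pos.
    rewrite <- exp_0. apply exp_increasing. lra.
Qed.

(** Far to the right only n = 1 survives. This supplies the constant of integration when zeta is
    compared with exp(log zeta). *)
Lemma dirichlet_at_infinity a s : subpoly a -> 1 < Re s ->
  clim (fun N => dirichlet a (s + INR N)%C) (RtoC (a 1%nat)).
Proof.
  intros Ha Hs.
  assert (E : RtoC (a 1%nat) = Cser (fun n => if Nat.eqb n 1 then RtoC (a 1%nat) else 0)).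
  { symmetry. apply Cser_eq.
    apply clim_ext_loc with (fun _ => RtoC (a 1%nat)); [|apply clim_const].
    exists 2%nat. intros n Hn. destruct n as [|[|n]]; try lia. clear Hn.
    induction n; [simpl; ring|].
    change (csum (fun n => if Nat.eqb n 1 then RtoC (a 1%nat) else 0) (S (S (S n)))) with
      (csum (fun n => if Nat.eqb n 1 then RtoC (a 1%nat) else 0) (S (S n)) + 0)%C.
    rewrite <- IHn. ring. }
  rewrite E. unfold dirichlet. apply Cser_dominated with (fun n => Rabs (a n) * exp (- Re s * lnN n)).
  - intros N n. apply Cmod_dirichlet_term_le. autorewrite with cri. assert (X := pos_INR N). lra.
  - now apply subpoly_summable.
  - intros n. destruct n as [|[|n]].
    + simpl. apply clim_ext with (fun _ => RtoC 0); [|apply clim_const].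
      intros N. unfold dirichlet_term. destruct Ha as [-> _]. ring.
    + simpl. apply clim_ext with (fun _ => RtoC (a 1%nat)); [|apply clim_const].
      intros N. unfold dirichlet_term. rewrite npow_1. ring.
    + simpl Nat.eqb. cbv iota.
      apply clim_squeeze with (fun N => (Rabs (a (S (S n))) * exp (- Re s * lnN (S (S n)))) * exp (- INR N * lnN (S (S n)))).
      * exists 0%nat. intros N _.
        replace (dirichlet_term a (s + INR N) (S (S n)) - 0)%C with (dirichlet_term a (s + INR N) (S (S n))) by ring.
        rewrite Cmod_dirichlet_term. autorewrite with cri. rewrite Rmult_assoc, <- exp_plus.
        right. f_equal. f_equal. ring.
      * replace (Finite 0) with (Finite ((Rabs (a (S (S n))) * exp (- Re s * lnN (S (S n)))) * 0)) by (f_equal; ring).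
        apply is_lim_seq_mult'; [apply is_lim_seq_const|].
        apply is_lim_exp_mINR, lnN_pos. lia.
Qed.

(** * The logarithm of zeta *)

Definition ones (n : nat) : R := if Nat.eqb n 0 then 0 else 1.
(** The coefficients of log zeta: 1/r at a prime power p^r and 0 elsewhere. At 0 and 1 the
    denominator is 0, but the numerator vanishes as well. *)
Definition lzcoef (n : nat) : R := mangoldt n / lnN n.

Lemma subpoly_ones : subpoly ones.
Proof.
  apply subpoly_bounded with 1; auto. intros [|n]; unfold ones; simpl.
  - rewrite Rabs_R0; lra.
  - rewrite Rabs_R1; lra.
Qed.

Lemma lzcoef_bound n : 0 <= lzcoef n <= 1.
Proof.
  unfold lzcoef. destruct n as [|[|n]].
  - rewrite mangoldt_0. unfold Rdiv. rewrite Rmult_0_l. lra.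
  - rewrite mangoldt_1. unfold Rdiv. rewrite Rmult_0_l. lra.
  - assert (P := lnN_pos (S (S n)) ltac:(lia)).
    destruct (mangoldt_bound (S (S n))) as [[H1 H2]|]; [|discriminate].
    split.
    + apply Rmult_le_pos; auto. apply Rlt_le, Rinv_0_lt_compat; auto.
    + apply Rmult_le_reg_r with (lnN (S (S n))); auto. unfold Rdiv.
      rewrite Rmult_assoc, Rinv_l, Rmult_1_r, Rmult_1_l by lra. exact H2.
Qed.

Lemma subpoly_lzcoef : subpoly lzcoef.
Proof.
  apply subpoly_bounded with 1.
  - unfold lzcoef. rewrite mangoldt_0. unfold Rdiv. ring.
  - intros n. assert (X := lzcoef_bound n). rewrite Rabs_pos_eq; lra.
Qed.

Lemma dcoef_lzcoef_1 n : dcoef lzcoef 1 n = - mangoldt n.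
Proof.
  unfold dcoef, lzcoef. destruct n as [|[|n]].
  - rewrite mangoldt_0. unfold Rdiv. ring.
  - rewrite mangoldt_1. unfold Rdiv. ring.
  - assert (P := lnN_pos (S (S n)) ltac:(lia)). field. lra.
Qed.

Definition zeta_d (k : nat) (s : C) : C := dirichlet (dcoef ones k) s.
Definition logzeta_d (k : nat) (s : C) : C := dirichlet (dcoef lzcoef k) s.

Lemma cder_zeta_d k s : 1 < Re s -> cder (zeta_d k) s (zeta_d (S k) s).
Proof. intros; apply cder_dirichlet_dcoef; auto. apply subpoly_ones. Qed.
Lemma cder_logzeta_d k s : 1 < Re s -> cder (logzeta_d k) s (logzeta_d (S k) s).
Proof. intros; apply cder_dirichlet_dcoef; auto. apply subpoly_lzcoef. Qed.

Lemma csum_multiples (f : nat -> C) d M : (1 <= d)%nat ->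
  csum (fun n => if divides d n then f n else 0) (d * M) = csum (fun m => f (d * m)%nat) M.
Proof.
  intros Hd. induction M.
  - now rewrite Nat.mul_0_r.
  - replace (d * S M)%nat with (d * M + d)%nat by lia. rewrite csum_split, IHM.
    change (csum ?u (S M)) with (csum u M + u M)%C. f_equal. destruct d as [|d]; [lia|]. clear IHM.
    assert (K : forall r, (r <= d)%nat ->
      csum (fun k => if divides (S d) (S d * M + k) then f (S d * M + k)%nat else 0) (S r) = f (S d * M)%nat).
    { induction r; intros Hr.
      - change (csum ?u 1) with (0 + u 0%nat)%C. cbv beta. rewrite divides_mod by lia. simpl Nat.eqb. cbv iota. rewrite Nat.add_0_r. ring.
      - change (csum ?u (S (S r))) with (csum u (S r) + u (S r))%C. rewrite IHr by lia.
        cbv beta. rewrite divides_mod by lia. simpl Nat.eqb. cbv iota. ring. }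
    apply K; lia.
Qed.

(** Along the partial sums of length d M the multiples of d are exactly d m with m < M; this
    subsequence already determines the limit. *)
Lemma dirichlet_multiples d s : (1 <= d)%nat -> 1 < Re s ->
  Cser (fun n => if divides d n then dirichlet_term ones s n else 0) = (npow d s * dirichlet ones s)%C.
Proof.
  intros Hd Hs.
  assert (H : clim (csum (fun n => if divides d n then dirichlet_term ones s n else 0))
    (Cser (fun n => if divides d n then dirichlet_term ones s n else 0))).
  { apply Cser_cv with (fun n => Rabs (ones n) * exp (- Re s * lnN n)).
    - intros n. destruct (divides d n); [rewrite Cmod_dirichlet_term; lra|]. rewrite Cmod_0.
      apply Rmult_le_pos; [apply Rabs_pos | apply Rlt_le, exp_pos].
    - now apply (subpoly_summable ones); [apply subpoly_ones|]. }
  apply clim_unique with (fun M => csum (fun n => if divides d n then dirichlet_term ones s n else 0) (d * M)).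
  - rewrite clim_eps in H |- *. intros eps He. destruct (H eps He) as [N HN]. exists N.
    intros n Hn. apply HN. nia.
  - apply clim_ext with (fun M => npow d s * csum (dirichlet_term ones s) M)%C.
    + intros M. rewrite csum_multiples by auto. rewrite <- csum_scal. apply csum_ext. intros m _.
      unfold dirichlet_term. destruct m as [|m].
      * rewrite Nat.mul_0_r. unfold ones. simpl. ring.
      * rewrite npow_mult by lia. unfold ones. destruct d as [|d]; [lia|]. simpl. ring.
    + apply clim_scal, dirichlet_cv; auto. apply subpoly_ones.
Qed.

(** The identity zeta' = - (sum of Lambda(d) d^(-s)) zeta. For a partial sum over d < N the product
    with zeta is a series over n carrying the divisors of n below N; then N grows under the sign of
    the series. *)
Lemma zeta_d_ode s : 1 < Re s -> zeta_d 1 s = (logzeta_d 1 s * zeta_d 0 s)%C.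
Proof.
  intros Hs.
  assert (Z0 : zeta_d 0 s = dirichlet ones s) by (apply dirichlet_ext; intros; unfold dcoef; simpl; ring).
  assert (G1 : clim (fun N => csum (dirichlet_term (dcoef lzcoef 1) s) N * zeta_d 0 s)%C (logzeta_d 1 s * zeta_d 0 s)%C).
  { apply clim_mult; [|apply clim_const]. apply dirichlet_cv; auto. apply subpoly_dcoef, subpoly_lzcoef. }
  apply clim_unique with (2 := G1).
  apply clim_ext with (fun N => Cser (fun n =>
    csum (fun d => RtoC (dcoef lzcoef 1 d) * (if divides d n then dirichlet_term ones s n else 0))%C N)).
  - intros N. rewrite Z0. induction N; simpl.
    + rewrite Cmult_0_l. apply Cser_eq. apply clim_ext with (fun _ => RtoC 0); [|apply clim_const].
      intros n. now rewrite csum_0.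
    + assert (Hd : forall d n, Cmod (RtoC (dcoef lzcoef 1 d) * (if divides d n then dirichlet_term ones s n else 0))%C <=
        mangoldt d * (Rabs (ones n) * exp (- Re s * lnN n))).
      { intros d n. rewrite dcoef_lzcoef_1, Cmod_mult, Cmod_R, Rabs_Ropp.
        assert (V : 0 <= mangoldt d).
        { destruct (mangoldt_bound d) as [V|V]; [lra | rewrite V, mangoldt_0; lra]. }
        rewrite Rabs_pos_eq by auto. apply Rmult_le_compat_l; auto.
        destruct (divides d n); [rewrite Cmod_dirichlet_term; lra|]. rewrite Cmod_0.
        apply Rmult_le_pos; [apply Rabs_pos | apply Rlt_le, exp_pos]. }
      assert (Sm : forall c, 0 <= c -> summable (fun n => c * (Rabs (ones n) * exp (- Re s * lnN n)))).
      { intros c Hc. apply summable_scal; auto. apply subpoly_summable; auto. apply subpoly_ones. }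
      assert (V : forall d, 0 <= mangoldt d).
      { intros d. destruct (mangoldt_bound d) as [V|V]; [lra | rewrite V, mangoldt_0; lra]. }
      rewrite Cmult_plus_distr_r, <- IHN.
      assert (L2 : Cser (fun n => RtoC (dcoef lzcoef 1 N) * (if divides N n then dirichlet_term ones s n else 0))%C =
        (dirichlet_term (dcoef lzcoef 1) s N * dirichlet ones s)%C).
      { destruct N as [|N].
        - unfold dirichlet_term at 2. rewrite dcoef_lzcoef_1, mangoldt_0, Ropp_0, !Cmult_0_l.
          apply Cser_eq. apply clim_ext with (fun _ => RtoC 0); [|apply clim_const].
          intros n. rewrite (csum_ext _ (fun _ => RtoC 0)); [now rewrite csum_0|]. intros; ring.
        - rewrite (Cser_scal _ _ (fun n => Rabs (ones n) * exp (- Re s * lnN n))).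
          + rewrite dirichlet_multiples by (auto; lia). unfold dirichlet_term. ring.
          + intros n. destruct (divides (S N) n); [rewrite Cmod_dirichlet_term; lra|]. rewrite Cmod_0.
            apply Rmult_le_pos; [apply Rabs_pos | apply Rlt_le, exp_pos].
          + apply subpoly_summable; auto. apply subpoly_ones. }
      rewrite <- L2. apply Cser_eq.
      assert (S1 : 0 <= rsum mangoldt N) by (apply rsum_nonneg; intros; apply V).
      eapply clim_ext; [intros M; symmetry; apply csum_plus|].
      apply clim_plus.
      * apply Cser_cv with (fun n => rsum mangoldt N * (Rabs (ones n) * exp (- Re s * lnN n))); [|now apply Sm].
        intros n. eapply Rle_trans; [apply Cmod_csum|]. rewrite (Rmult_comm (rsum mangoldt N)), <- rsum_scal.
        apply rsum_le. intros d _. rewrite Rmult_comm. apply Hd.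
      * apply Cser_cv with (fun n => mangoldt N * (Rabs (ones n) * exp (- Re s * lnN n))); [|now apply Sm].
        intros n. apply Hd.
  (* The divisor sums of Lambda increase to ln n, so ln n times n^(- Re s) dominates for every N,
     and for N > n the n-th term already has its final value. *)
  - unfold zeta_d, dirichlet. apply Cser_dominated with (fun n => Rabs (dcoef ones 1 n) * exp (- Re s * lnN n)).
    + intros N n.
      destruct n as [|n].
      * rewrite (csum_ext _ (fun _ => RtoC 0)).
        { rewrite csum_0, Cmod_0. apply Rmult_le_pos; [apply Rabs_pos | apply Rlt_le, exp_pos]. }
        intros d _. unfold dirichlet_term, ones. simpl. destruct (divides d 0); ring.
      * rewrite (csum_ext _ (fun d => dirichlet_term ones s (S n) * RtoC (- (if divides d (S n) then mangoldt d else 0)))%C).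
        2:{ intros d _. rewrite dcoef_lzcoef_1. destruct (divides d (S n)); rewrite ?Ropp_0; ring. }
        rewrite csum_scal, Cmod_mult, Cmod_dirichlet_term.
        rewrite Rmult_assoc, (Rmult_comm (exp _)), <- Rmult_assoc.
        apply Rmult_le_compat_r; [apply Rlt_le, exp_pos|].
        unfold dcoef. simpl pow. rewrite Rmult_1_r, Rabs_mult, Rabs_Ropp, Rmult_comm.
        apply Rmult_le_compat_r; [apply Rabs_pos|].
        rewrite (Rabs_pos_eq (lnN _)) by apply lnN_ge0.
        eapply Rle_trans; [apply Cmod_csum|].
        rewrite (rsum_ext _ (fun d => if divides d (S n) then mangoldt d else 0)).
        2:{ intros d _. rewrite Cmod_R, Rabs_Ropp. apply Rabs_pos_eq.
            destruct (divides d (S n)); [|lra].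
            destruct (mangoldt_bound d) as [V|V]; [lra | rewrite V, mangoldt_0; lra]. }
        unfold lnN. rewrite <- (mangoldt_sum (N + S (S n)) (S n)) by lia.
        apply rsum_mono; [|lia]. intros d. destruct (divides d (S n)); [|lra].
        destruct (mangoldt_bound d) as [V|V]; [lra | rewrite V, mangoldt_0; lra].
    + apply subpoly_summable; auto. apply subpoly_dcoef, subpoly_ones.
    + intros n. apply clim_ext_loc with (fun _ => dirichlet_term (dcoef ones 1) s n); [|apply clim_const].
      exists (S n). intros N HN. destruct n as [|n].
      * rewrite (csum_ext _ (fun _ => RtoC 0)).
        { rewrite csum_0. unfold dirichlet_term, dcoef, ones. simpl. rewrite Rmult_0_r. ring. }
        intros d _. unfold dirichlet_term, ones. simpl. destruct (divides d 0); ring.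
      * rewrite (csum_ext _ (fun d => dirichlet_term ones s (S n) * RtoC (- (if divides d (S n) then mangoldt d else 0)))%C).
        2:{ intros d _. rewrite dcoef_lzcoef_1. destruct (divides d (S n)); rewrite ?Ropp_0; ring. }
        rewrite csum_scal.
        assert (X : csum (fun d => RtoC (- (if divides d (S n) then mangoldt d else 0))) N = RtoC (- lnN (S n))).
        { rewrite <- (RtoC_rsum (fun d => - (if divides d (S n) then mangoldt d else 0))). f_equal.
          rewrite (rsum_ext _ (fun d => (-1) * (if divides d (S n) then mangoldt d else 0))) by (intros; ring).
          rewrite rsum_scal. unfold lnN. rewrite (mangoldt_sum N (S n)) by lia. ring. }
        rewrite X. unfold dirichlet_term, dcoef. simpl pow. rewrite Rmult_1_r, RtoC_mult. unfold ones; simpl Nat.eqb; cbv iota. ring.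
Qed.

(** The quotient q of zeta by exp(log zeta) has derivative 0, hence is constant along s, s + 1, s +
    2, ..., where it tends to 1. No Euler product is formed. *)
Lemma zeta_d_exp s : 1 < Re s -> zeta_d 0 s = Cexp (logzeta_d 0 s).
Proof.
  intros Hs.
  set (q := fun w => (zeta_d 0 w * Cexp (- logzeta_d 0 w))%C).
  assert (Hq : forall w, 1 < Re w -> cder q w 0).
  { intros w Hw. unfold q.
    eapply cder_eq; [|apply (cder_mult (zeta_d 0) (fun w => Cexp (- logzeta_d 0 w)%C)); [now apply cder_zeta_d|]].
    2:{ apply (cder_comp (fun w => - logzeta_d 0 w)%C Cexp); [|apply cder_Cexp]. now apply cder_opp, cder_logzeta_d. }
    rewrite (zeta_d_ode w Hw). ring. }
  assert (Hc : forall N, q (s + INR N)%C = q s).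
  { intros N. assert (X := cder_mvt q (fun _ => RtoC 0) s (RtoC (INR N)) 0).
    assert (Y : Cmod (q (s + INR N)%C - q s)%C <= 0 * Cmod (INR N)).
    { apply X. intros x Hx. split.
      - apply Hq. autorewrite with cri. assert (P := pos_INR N). nra.
      - rewrite Cmod_0; lra. }
    rewrite Rmult_0_l in Y. assert (W := Cmod_ge_0 (q (s + INR N) - q s)%C).
    assert (E : (q (s + INR N) - q s)%C = 0) by (apply Cmod_eq_0; lra).
    replace (q (s + INR N)%C) with (q (s + INR N) - q s + q s)%C by ring. rewrite E. ring. }
  assert (L : clim (fun N => q (s + INR N)%C) 1).
  { replace (RtoC 1) with (1 * Cexp (- 0))%C.
    - apply clim_mult.
      + apply clim_ext with (fun N => dirichlet ones (s + INR N)%C).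
        * intros N. apply dirichlet_ext. intros n. unfold dcoef. simpl. ring.
        * apply (dirichlet_at_infinity ones s subpoly_ones Hs).
      + apply (cder_cont Cexp (- 0)%C) with (1 := cder_Cexp _).
        apply clim_opp.
        apply clim_ext with (fun N => dirichlet lzcoef (s + INR N)%C).
        * intros N. apply dirichlet_ext. intros n. unfold dcoef. simpl. ring.
        * assert (X := dirichlet_at_infinity lzcoef s subpoly_lzcoef Hs).
          replace (RtoC (lzcoef 1)) with (RtoC 0) in X; auto.
          unfold lzcoef. rewrite mangoldt_1. unfold Rdiv. now rewrite Rmult_0_l.
    - replace (- 0)%C with (RtoC 0) by ring. rewrite Cexp_0. ring. }
  assert (Q1 : q s = 1).
  { apply clim_unique with (2 := L). apply clim_ext with (2 := clim_const (q s)). auto. }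
  unfold q in Q1. rewrite Cexp_opp in Q1.
  assert (NZ := Cexp_neq0 (logzeta_d 0 s)).
  replace (zeta_d 0 s) with (zeta_d 0 s * / Cexp (logzeta_d 0 s) * Cexp (logzeta_d 0 s))%C by (field; auto).
  rewrite Q1. ring.
Qed.

(** * Kronecker's theorem for logarithms of primes *)

Definition rmean (u : nat -> R) (l : R) : Prop :=
  is_lim_seq (fun N => rsum u (S N) / INR (S N)) l.
Definition cmean (u : nat -> C) (l : C) : Prop :=
  clim (fun N => csum u (S N) / RtoC (INR (S N)))%C l.

Lemma rmean_le u v a b : (forall n, u n <= v n) -> rmean u a -> rmean v b -> a <= b.
Proof.
  intros H Hu Hv. apply (is_lim_seq_le _ _ a b) with (2 := Hu) (3 := Hv).
  intros n. apply Rmult_le_compat_r.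
  - apply Rlt_le, Rinv_0_lt_compat, lt_0_INR. lia.
  - apply rsum_le. auto.
Qed.

Lemma rmean_plus u v a b : rmean u a -> rmean v b -> rmean (fun n => u n + v n) (a + b).
Proof.
  intros Hu Hv. apply is_lim_seq_ext with (fun N => rsum u (S N) / INR (S N) + rsum v (S N) / INR (S N)).
  - intros N. rewrite rsum_plus. unfold Rdiv. ring.
  - now apply is_lim_seq_plus'.
Qed.

Lemma rmean_scal c u a : rmean u a -> rmean (fun n => c * u n) (c * a).
Proof.
  intros Hu. apply is_lim_seq_ext with (fun N => c * (rsum u (S N) / INR (S N))).
  - intros N. rewrite rsum_scal. unfold Rdiv. ring.
  - apply is_lim_seq_mult'; auto. apply is_lim_seq_const.
Qed.

Lemma rmean_const c : rmean (fun _ => c) c.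
Proof.
  apply is_lim_seq_ext with (fun _ => c); [|apply is_lim_seq_const].
  intros N. assert (E : rsum (fun _ => c) (S N) = INR (S N) * c).
  { generalize (S N) as n. induction n; [simpl; ring|]. rewrite S_INR. simpl rsum. rewrite IHn. ring. }
  rewrite E. field. apply Rgt_not_eq, lt_0_INR. lia.
Qed.

Lemma rmean_ext u v a : (forall n, u n = v n) -> rmean u a -> rmean v a.
Proof.
  intros H. apply is_lim_seq_ext. intros N. f_equal. apply rsum_ext. auto.
Qed.

Lemma cmean_Re u : cmean u 0 -> rmean (fun n => Re (u n)) 0.
Proof.
  intros H. apply clim_Re in H. apply is_lim_seq_ext with (2 := H).
  intros N. assert (E : forall n, Re (csum u n) = rsum (fun n => Re (u n)) n).
  { induction n; [reflexivity|]. simpl csum. rewrite Re_plus, IHn. reflexivity. }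
  rewrite <- E. unfold Cdiv. rewrite <- RtoC_inv by (apply Rgt_not_eq, lt_0_INR; lia).
  rewrite Re_mult, Re_RtoC, Im_RtoC. unfold Rdiv. ring.
Qed.

Lemma cmean_plus u v a b : cmean u a -> cmean v b -> cmean (fun n => u n + v n)%C (a + b)%C.
Proof.
  intros Hu Hv. apply clim_ext with (fun N => csum u (S N) / RtoC (INR (S N)) + csum v (S N) / RtoC (INR (S N)))%C.
  - intros N. rewrite csum_plus. unfold Cdiv. ring.
  - now apply clim_plus.
Qed.

Lemma cmean_geom c w : Cmod w = 1 -> w <> RtoC 1 -> cmean (fun k => c * w ^ k)%C 0.
Proof.
  intros H1 Hw.
  assert (N1 : (w - 1)%C <> RtoC 0).
  { intros E. apply Hw. replace w with (w - 1 + 1)%C by ring. rewrite E. ring. }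
  assert (P := Cmod_pos _ N1).
  apply clim_squeeze with (fun N => (Cmod c * (2 / Cmod (w - 1)%C)) * / INR (S N)).
  - exists 0%nat. intros N _.
    assert (PN : 0 < INR (S N)) by (apply lt_0_INR; lia).
    assert (E : forall n, csum (fun k => c * w ^ k)%C n = (c * ((w ^ n - 1) / (w - 1)))%C).
    { induction n; [simpl; field; auto|]. simpl csum. rewrite IHn. simpl Cpow. field; auto. }
    rewrite E.
    rewrite Cmod_minus_0.
    rewrite Cmod_div by (apply RtoC_neq0; lra).
    rewrite Cmod_RtoC_pos by lra. apply Rmult_le_compat_r; [apply Rlt_le, Rinv_0_lt_compat; auto|].
    rewrite Cmod_mult, Cmod_div by auto. apply Rmult_le_compat_l; [apply Cmod_ge_0|].
    apply Rmult_le_compat_r; [apply Rlt_le, Rinv_0_lt_compat; auto|].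
    eapply Rle_trans; [apply Cmod_minus_le|]. rewrite Cmod_pow, H1, pow1, Cmod_1. lra.
  - replace (Finite 0) with (Finite (Cmod c * (2 / Cmod (w - 1)%C) * 0)) by (f_equal; ring).
    apply is_lim_seq_mult'; [apply is_lim_seq_const|].
    apply (is_lim_seq_incr_1 (fun n => / INR n)).
    apply is_lim_seq_eps. intros eps He.
    destruct (archimed_cor1 eps He) as [N [HN PN]]. exists N. intros n Hn.
    rewrite Rminus_0_r, Rabs_pos_eq by (apply Rlt_le, Rinv_0_lt_compat, lt_0_INR; lia).
    eapply Rle_lt_trans; [|exact HN]. apply Rinv_le_contravar; [apply lt_0_INR; lia | now apply le_INR].
Qed.

(** The unimodular number n^(-it). *)
Definition phase (n : nat) (t : R) : C := npow n (Ci * RtoC t)%C.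

Lemma phase_eq n t : phase n t = Cexp (- Ci * RtoC (t * lnN n))%C.
Proof. unfold phase, npow. f_equal. rewrite RtoC_mult. ring. Qed.

Lemma Cmod_phase n t : Cmod (phase n t) = 1.
Proof.
  unfold phase. rewrite Cmod_npow. replace (Re (Ci * RtoC t)%C) with 0.
  - rewrite Ropp_0, Rmult_0_l, exp_0. auto.
  - unfold Ci, Re; simpl. ring.
Qed.

Lemma phase_mult n m t : (1 <= n)%nat -> (1 <= m)%nat -> phase (n * m) t = (phase n t * phase m t)%C.
Proof. apply npow_mult. Qed.

Lemma phase_pow p l t : (1 <= p)%nat -> phase (p ^ l) t = (phase p t ^ l)%C.
Proof.
  intros Hp. induction l; simpl.
  - apply npow_1.
  - unfold phase in *. rewrite npow_mult, IHl; auto.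
    assert (X := Nat.pow_nonzero p l). lia.
Qed.

Lemma Cconj_Cexp_im x : Cconj (Cexp (- Ci * RtoC x)%C) = Cexp (- Ci * RtoC (- x))%C.
Proof.
  unfold Cexp, Cconj, Ci; simpl. apply C_eq_ReIm; unfold Re, Im; simpl.
  - f_equal; [f_equal; ring|].
    replace (-0 * 0 + - (1) * - x) with (- (- 0 * 0 + - (1) * x)) by ring. now rewrite cos_neg.
  - rewrite Ropp_mult_distr_r. f_equal; [f_equal; ring|].
    replace (-0 * 0 + - (1) * - x) with (- (- 0 * 0 + - (1) * x)) by ring. now rewrite sin_neg.
Qed.

Lemma Cexp_im_neq1 d : 0 < Rabs d < 1 -> Cexp (- Ci * RtoC d)%C <> RtoC 1.
Proof.
  intros Hd E. assert (F : Im (Cexp (- Ci * RtoC d)%C) = 0) by (rewrite E; reflexivity).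
  assert (F2 : Im (Cexp (- Ci * RtoC d)%C) = - sin d).
  { unfold Cexp, Ci, Im, Re; simpl.
    replace (-0 * d - - (1) * 0) with 0 by ring. rewrite exp_0.
    replace (-0 * 0 + - (1) * d) with (- d) by ring. rewrite sin_neg. ring. }
  assert (PI1 : 1 < PI) by (assert (X := PI_RGT_0); assert (Y := PI2_1); lra).
  unfold Rabs in Hd. destruct (Rcase_abs d).
  - assert (X := sin_gt_0 (- d)). rewrite sin_neg in X. lra.
  - assert (X := sin_gt_0 d). lra.
Qed.

Definition phase_sum (S : list (C * nat)) (t : R) : C :=
  fold_right (fun x acc => fst x * phase (snd x) t + acc)%C (RtoC 0) S.

Lemma Cconj_plus a b : Cconj (a + b)%C = (Cconj a + Cconj b)%C.
Proof. unfold Cconj, Cplus; simpl. f_equal. ring. Qed.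
Lemma Cconj_mult a b : Cconj (a * b)%C = (Cconj a * Cconj b)%C.
Proof. unfold Cconj, Cmult; simpl. f_equal; ring. Qed.

(** Orthogonality of distinct frequencies. Time is sampled with spacing [h], so the mean is that of
    a geometric sequence; the smallness of [h] keeps its angle nonzero and below 1, so that sampling
    cannot confuse two frequencies. *)
Lemma mean_cross T h n n' c : 0 < h -> (1 <= n)%nat -> (1 <= n')%nat -> n <> n' ->
  h * lnN n < 1 -> h * lnN n' < 1 ->
  cmean (fun k => c * (phase n (T + INR k * h) * Cconj (phase n' (T + INR k * h))))%C 0.
Proof.
  intros Hh Hn Hn' Hne L L'.
  set (d := h * (lnN n - lnN n')).
  assert (Hd : 0 < Rabs d < 1).
  { assert (A := lnN_ge0 n). assert (A' := lnN_ge0 n'). split.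
    - apply Rabs_pos_lt. unfold d. apply Rmult_integral_contrapositive. split; [lra|].
      intros E. apply Hne. apply INR_eq. apply ln_inv; try (apply lt_0_INR; lia).
      unfold lnN in E. lra.
    - apply Rabs_def1; unfold d; nra. }
  set (c' := (c * Cexp (- Ci * RtoC (T * (lnN n - lnN n'))))%C).
  set (w := Cexp (- Ci * RtoC d)%C).
  assert (E : forall k, (c * (phase n (T + INR k * h) * Cconj (phase n' (T + INR k * h))))%C = (c' * w ^ k)%C).
  { intros k. rewrite !phase_eq, Cconj_Cexp_im, <- Cexp_plus.
    assert (W : (w ^ k)%C = Cexp (- Ci * RtoC (INR k * d))%C).
    { induction k.
      - simpl. rewrite Rmult_0_l, Cmult_0_r, Cexp_0. auto.
      - rewrite Cpow_S, IHk, S_INR. unfold w. rewrite <- Cexp_plus. f_equal.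
        rewrite !RtoC_mult, RtoC_plus. ring. }
    rewrite W. unfold c'. rewrite <- Cmult_assoc, <- Cexp_plus. f_equal. f_equal.
    unfold d. autorewrite with cri. rewrite !RtoC_mult, ?RtoC_opp, ?RtoC_mult, ?RtoC_plus, ?RtoC_minus, ?RtoC_mult. ring. }
  unfold cmean. apply clim_ext with (fun N => csum (fun k => c' * w ^ k)%C (S N) / RtoC (INR (S N)))%C.
  - intros N. f_equal. apply csum_ext. intros k _. now rewrite E.
  - apply cmean_geom; [|now apply Cexp_im_neq1].
    unfold w. rewrite Cmod_Cexp. replace (Re (- Ci * RtoC d)%C) with 0.
    + apply exp_0.
    + unfold Ci, Re; simpl; ring.
Qed.

(** Parseval's identity for a trigonometric sum with unimodular coefficients and distinct
    frequencies: the cross terms have mean 0. *)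
Lemma mean_square T h S : 0 < h -> NoDup (map snd S) ->
  (forall x, In x S -> Cmod (fst x) = 1 /\ (1 <= snd x)%nat /\ h * lnN (snd x) < 1) ->
  rmean (fun k => Cmod (phase_sum S (T + INR k * h)) ^ 2) (INR (length S)).
Proof.
  intros Hh. induction S as [|[a n] S IH]; intros HN HS.
  - simpl phase_sum. simpl length. apply rmean_ext with (fun _ => 0); [|apply rmean_const].
    intros k. rewrite Cmod_0. ring.
  - inversion HN as [|? ? Hnin HN']; subst.
    assert (HS' : forall x, In x S -> Cmod (fst x) = 1 /\ (1 <= snd x)%nat /\ h * lnN (snd x) < 1)
      by (intros; apply HS; now right).
    specialize (IH HN' HS').
    destruct (HS (a, n)) as (Ha & Hn1 & Hn2); [now left|]. simpl in Ha, Hn1, Hn2, Hnin.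
    assert (X : cmean (fun k => a * phase n (T + INR k * h) * Cconj (phase_sum S (T + INR k * h)))%C 0).
    { clear IH HN HN' HS. induction S as [|[b m] S IH]; simpl phase_sum.
      - apply clim_ext with (fun _ => RtoC 0); [|apply clim_const].
        intros N. rewrite (csum_ext _ (fun _ => RtoC 0)).
        + rewrite csum_0. unfold Cdiv. ring.
        + intros k _. replace (Cconj 0) with (RtoC 0) by (unfold Cconj, RtoC; simpl; f_equal; ring). ring.
      - replace (RtoC 0) with (0 + 0)%C by ring.
        destruct (HS' (b, m)) as (Hb & Hm1 & Hm2); [now left|]. simpl in Hb, Hm1, Hm2, Hnin.
        assert (Y := cmean_plus _ _ _ _
          (mean_cross T h n m (a * Cconj b)%C Hh Hn1 Hm1 (fun e => Hnin (or_introl (eq_sym e))) Hn2 Hm2)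
          (IH (fun i => Hnin (or_intror i)) (fun x i => HS' x (or_intror i)))).
        unfold cmean in *. apply clim_ext with (2 := Y).
        intros N. f_equal. apply csum_ext. intros k _. cbn [fst snd].
        rewrite Cconj_plus, Cconj_mult. ring. }
    apply cmean_Re in X.
    replace (INR (length ((a, n) :: S))) with (1 + INR (length S) + 2 * 0) by (simpl length; rewrite S_INR; ring).
    apply rmean_ext with (fun k => 1 + Cmod (phase_sum S (T + INR k * h)) ^ 2 +
      2 * Re (a * phase n (T + INR k * h) * Cconj (phase_sum S (T + INR k * h)))%C).
    + intros k. simpl phase_sum. set (B := phase_sum S (T + INR k * h)). set (A := (a * phase n (T + INR k * h))%C).
      assert (HA : Cmod A ^ 2 = 1) by (unfold A; rewrite Cmod_mult, Ha, Cmod_phase; ring).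
      rewrite Cmod2_alt in HA. rewrite !Cmod2_alt, <- HA.
      unfold Cconj, Re, Im, Cmult, Cplus; simpl. ring.
    + apply rmean_plus; [apply rmean_plus; [apply rmean_const | exact IH]|]. now apply rmean_scal.
Qed.

(** Multiplies out the factors [kron_factor]: each entry holds a unimodular coefficient and an
    integer frequency, a product of powers of the primes with exponents below [r]. *)
Definition kron_step (th : nat -> C) (r : nat) (p : nat) (S : list (C * nat)) : list (C * nat) :=
  flat_map (fun x => map (fun l => ((fst x * Cconj (th p) ^ l)%C, (snd x * p ^ l)%nat)) (seq 0 r)) S.
Definition kron_list (th : nat -> C) (r : nat) (ps : list nat) : list (C * nat) :=
  fold_right (kron_step th r) ((RtoC 1, 1%nat) :: nil) ps.
(** A geometric sum of ratio conj(th p) p^(-it): equal to r when the phase hits its target, but at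
    most 2/eps when it stays eps away. *)
Definition kron_factor (th : nat -> C) (r : nat) (p : nat) (t : R) : C := csum (fun l => (Cconj (th p) * phase p t) ^ l)%C r.

Lemma phase_sum_app S S' t : phase_sum (S ++ S') t = (phase_sum S t + phase_sum S' t)%C.
Proof. induction S; simpl; [ring | rewrite IHS; ring]. Qed.

(** Distinct exponent vectors give distinct integers by unique factorisation, so the mean square of
    the product equals its number of terms. The clause on primes outside [ps] is the invariant that
    lets the next prime be added. *)
Lemma kron_list_spec th r ps : (forall p, Cmod (th p) = 1) -> NoDup ps -> (forall p, In p ps -> is_prime p = true) ->
  NoDup (map snd (kron_list th r ps)) /\ length (kron_list th r ps) = (r ^ length ps)%nat /\
  (forall x, In x (kron_list th r ps) -> Cmod (fst x) = 1 /\ (1 <= snd x)%nat /\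
     forall q, is_prime q = true -> ~ In q ps -> divides q (snd x) = false).
Proof.
  intros Hth. induction ps as [|p ps IH]; intros HN HP.
  - split; [|split].
    + apply NoDup_cons; [intros []|apply NoDup_nil].
    + reflexivity.
    + intros y [<-|[]]. cbn [fst snd]. rewrite Cmod_1. split; [auto|split; [lia|]].
      intros q Hq _. now apply divides_prime_1.
  - inversion HN as [|? ? Hnin HN']; subst.
    destruct IH as (I1 & I2 & I3); auto. { intros; apply HP; now right. }
    assert (Pp : is_prime p = true) by (apply HP; now left).
    assert (P2 := is_prime_ge2 p Pp).
    simpl kron_list. fold (kron_list th r ps). set (S := kron_list th r ps) in *. clearbody S.
    split; [|split].
    + clear I2. induction S as [|[a n] S IHS]; [constructor|].
      simpl in I1. inversion I1 as [|? ? Hn I1']; subst.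
      unfold kron_step. simpl. rewrite map_app. apply NoDup_app.
      * rewrite map_map. apply Injective_map_NoDup; [|apply seq_NoDup].
        intros l l' E. simpl in E.
        destruct (coprime_pow_inj p n n l l') as [_ K]; auto;
          try (apply (I3 (a, n)); [now left | auto | auto]);
          destruct (I3 (a, n)) as (_ & Q & _); [now left | simpl in Q; lia | now left | simpl in Q; lia].
      * apply IHS; auto. intros x Hx. apply I3. now right.
      * intros m Hm Hm'. rewrite map_map in Hm. apply in_map_iff in Hm.
        destruct Hm as [l [<- _]]. simpl in Hm'.
        apply in_map_iff in Hm'. destruct Hm' as [[b k] [E Hk]]. simpl in E.
        apply in_flat_map in Hk. destruct Hk as [[a' n'] [Hin Hk]].
        apply in_map_iff in Hk. destruct Hk as [l' [E' _]]. injection E' as _ E'. simpl in E'.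
        destruct (I3 (a, n)) as (_ & Q & R1); [now left|].
        destruct (I3 (a', n')) as (_ & Q' & R1'); [now right|]. simpl in *.
        destruct (coprime_pow_inj p n' n l' l) as [K _]; auto; try lia.
        subst n'. apply Hn. apply in_map_iff. exists (a', n). auto.
    + unfold kron_step. simpl. rewrite <- I2. clear. induction S; simpl; [lia|].
      rewrite length_app, length_map, length_seq, IHS. lia.
    + intros [b k] Hx. unfold kron_step in Hx. apply in_flat_map in Hx. destruct Hx as [[a n] [Hin Hx]].
      apply in_map_iff in Hx. destruct Hx as [l [E _]]. injection E as <- <-. simpl.
      destruct (I3 (a, n) Hin) as (Q1 & Q2 & Q3). simpl in *. split; [|split].
      * rewrite Cmod_mult, Q1, Cmod_pow, Cmod_conj, Hth, pow1. ring.
      * assert (X := Nat.pow_nonzero p l). nia.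
      * intros q Hq Hnq. apply divides_prime_mul_pow; auto.
Qed.

Lemma kron_list_ge1 th r ps : (forall p, In p ps -> is_prime p = true) ->
  forall x, In x (kron_list th r ps) -> (1 <= snd x)%nat.
Proof.
  induction ps as [|p ps IH]; intros HP.
  - intros x [<-|[]]. simpl; lia.
  - intros [b k] Hx. simpl in Hx. unfold kron_step in Hx. apply in_flat_map in Hx.
    destruct Hx as [[a n] [Hin Hx]]. apply in_map_iff in Hx. destruct Hx as [l [E _]].
    injection E as <- <-. simpl. specialize (IH (fun p i => HP p (or_intror i)) _ Hin). simpl in IH.
    assert (P2 := is_prime_ge2 p (HP p (or_introl eq_refl))).
    assert (X := Nat.pow_nonzero p l). nia.
Qed.

Lemma phase_sum_kron_list th r ps t : (forall p, In p ps -> is_prime p = true) ->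
  phase_sum (kron_list th r ps) t = fold_right (fun p acc => kron_factor th r p t * acc)%C (RtoC 1) ps.
Proof.
  induction ps as [|p ps IH]; intros HP.
  - simpl. unfold phase. rewrite npow_1. ring.
  - simpl. rewrite <- IH by (intros; apply HP; now right).
    assert (P2 := is_prime_ge2 p (HP p (or_introl eq_refl))).
    assert (Hge := kron_list_ge1 th r ps (fun p i => HP p (or_intror i))).
    set (S := kron_list th r ps) in *. clearbody S. clear IH HP. unfold kron_step.
    induction S as [|[a n] S IHS]; simpl.
    + ring.
    + rewrite phase_sum_app, IHS by (intros; apply Hge; now right).
      rewrite Cmult_plus_distr_l. f_equal. unfold kron_factor.
      assert (N1 : (1 <= n)%nat) by (apply (Hge (a, n)); now left).
      assert (K : forall m st, phase_sum (map (fun l => ((a * Cconj (th p) ^ l)%C, (n * p ^ l)%nat)) (seq st m)) t =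
        (a * phase n t * csum (fun l => (Cconj (th p) * phase p t) ^ (st + l))%C m)%C).
      { induction m; intros st; [simpl; ring|].
        rewrite <- (Nat.add_1_r m). rewrite seq_app, map_app, phase_sum_app, IHm.
        rewrite csum_split. simpl.
        rewrite phase_mult by (auto; assert (X := Nat.pow_nonzero p (st + m)); lia).
        rewrite phase_pow by lia.
        rewrite Nat.add_0_r, Cpow_mult_l. ring. }
      rewrite K. cbn [Nat.add]. ring.
Qed.

Lemma list_bound {A} (f : A -> R) (L : list A) : exists B, forall x, In x L -> f x <= B.
Proof.
  induction L as [|a L [B HB]].
  - exists 0. intros x [].
  - exists (Rmax (f a) B). intros x [<-|Hx]; [apply Rmax_l|].
    eapply Rle_trans; [apply HB, Hx | apply Rmax_r].
Qed.

Lemma fold_mult_remove (f : nat -> C) p ps : NoDup ps -> In p ps ->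
  fold_right (fun q acc => f q * acc)%C (RtoC 1) ps =
  (f p * fold_right (fun q acc => f q * acc)%C (RtoC 1) (remove Nat.eq_dec p ps))%C.
Proof.
  induction ps as [|q ps IH]; intros HN Hin; [destruct Hin|].
  inversion HN as [|? ? Hnin HN']; subst. simpl.
  destruct (Nat.eq_dec p q) as [<-|ne].
  - now rewrite notin_remove.
  - destruct Hin as [E|Hin]; [congruence|]. rewrite IH by auto. simpl. ring.
Qed.

Lemma NoDup_remove_id p (ps : list nat) : NoDup ps -> NoDup (remove Nat.eq_dec p ps).
Proof.
  induction 1; simpl; [constructor|].
  destruct (Nat.eq_dec p x); auto. constructor; auto.
  intros Hx. apply in_remove in Hx. tauto.
Qed.

Lemma length_remove p (ps : list nat) : NoDup ps -> In p ps ->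
  S (length (remove Nat.eq_dec p ps)) = length ps.
Proof.
  induction ps as [|q ps IH]; intros HN Hin; [destruct Hin|].
  inversion HN as [|? ? Hnin HN']; subst. simpl.
  destruct (Nat.eq_dec p q) as [<-|ne].
  - now rewrite notin_remove.
  - destruct Hin as [E|Hin]; [congruence|]. simpl. rewrite IH; auto.
Qed.

Lemma kron_factor_bound th r p t eps : Cmod (th p) = 1 -> 0 < eps ->
  eps <= Cmod (phase p t - th p)%C -> Cmod (kron_factor th r p t) ^ 2 <= 4 / (eps * eps).
Proof.
  intros Hth He H. set (w := (Cconj (th p) * phase p t)%C).
  assert (Hw : Cmod w = 1) by (unfold w; rewrite Cmod_mult, Cmod_conj, Hth, Cmod_phase; ring).
  assert (Hc : (Cconj (th p) * th p)%C = 1).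
  { rewrite Cmult_comm, <- Cmod2_conj, Hth. f_equal. ring. }
  assert (H1 : eps <= Cmod (w - 1)%C).
  { unfold w. rewrite <- Hc. replace (Cconj (th p) * phase p t - Cconj (th p) * th p)%C with
      (Cconj (th p) * (phase p t - th p))%C by ring.
    rewrite Cmod_mult, Cmod_conj, Hth. lra. }
  assert (N1 : (w - 1)%C <> RtoC 0) by (apply Cmod_pos_neq; lra).
  assert (E : forall n, csum (fun k => w ^ k)%C n = ((w ^ n - 1) / (w - 1))%C).
  { induction n; [simpl; field; auto|]. simpl csum. rewrite IHn. simpl Cpow. field; auto. }
  assert (B : Cmod (kron_factor th r p t) <= 2 / eps).
  { unfold kron_factor. fold w. rewrite E, Cmod_div by auto.
    apply Rmult_le_compat; [apply Cmod_ge_0 | apply Rlt_le, Rinv_0_lt_compat; lra | |].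
    - eapply Rle_trans; [apply Cmod_minus_le|]. rewrite Cmod_pow, Hw, pow1, Cmod_1. lra.
    - apply Rinv_le_contravar; lra. }
  replace (4 / (eps * eps)) with ((2 / eps) ^ 2) by (field; lra).
  apply pow_incr. split; [apply Cmod_ge_0 | exact B].
Qed.

Lemma phase_sum_R_le (f : nat -> R) (L : list nat) x : In x L -> (forall y, 0 <= f y) ->
  f x <= fold_right (fun y acc => f y + acc) 0 L.
Proof.
  intros Hx Hf. induction L as [|y L IH]; [destruct Hx|]. simpl.
  assert (P : 0 <= fold_right (fun y acc => f y + acc) 0 L).
  { clear - Hf. induction L; simpl; [lra|]. specialize (Hf a). lra. }
  destruct Hx as [<-|Hx]; [lra|]. specialize (IH Hx). specialize (Hf y). lra.
Qed.

(* If the phases never came close, every Fejer-type factor would be bounded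
   at each sample point, contradicting the mean square [r ^ length ps] of the product. *)
Lemma kronecker (ps : list nat) (th : nat -> C) (eps T : R) :
  NoDup ps -> (forall p, In p ps -> is_prime p = true) -> (forall p, Cmod (th p) = 1) -> 0 < eps ->
  exists t, T <= t /\ forall p, In p ps -> Cmod (phase p t - th p)%C < eps.
Proof.
  intros HN HP Hth He. apply NNPP. intros Hno.
  assert (Hbad : forall t, T <= t -> exists p, In p ps /\ eps <= Cmod (phase p t - th p)%C).
  { intros t Ht. apply NNPP. intros Hn. apply Hno. exists t. split; auto.
    intros p Hp. apply Rnot_le_lt. intros Hle. apply Hn. exists p. auto. }
  clear Hno.
  (* With l primes, the mean square r^l would be at most l (4 / eps^2) r^(l - 1); any r above l (4 /
     eps^2) contradicts this. *)
  destruct (INR_unbounded (4 * INR (length ps) / (eps * eps))) as [r Hr].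
  set (K := fun qs => kron_list th r qs).
  destruct (list_bound (fun x : C * nat => lnN (snd x))
    (K ps ++ flat_map (fun p => K (remove Nat.eq_dec p ps)) ps)) as [B HB].
  set (h := / (Rabs B + 1)).
  assert (PB : 0 < Rabs B + 1) by (assert (X := Rabs_pos B); lra).
  assert (Hh : 0 < h) by now apply Rinv_0_lt_compat.
  assert (Hsmall : forall x, lnN x <= B -> h * lnN x < 1).
  { intros x Hx. unfold h. apply Rmult_lt_reg_l with (Rabs B + 1); auto.
    rewrite <- Rmult_assoc, Rinv_r, Rmult_1_l by lra. assert (X := Rle_abs B). lra. }
  assert (M : forall qs, NoDup qs -> (forall p, In p qs -> is_prime p = true) ->
    (forall x, In x (K qs) -> lnN (snd x) <= B) ->
    rmean (fun k => Cmod (phase_sum (K qs) (T + INR k * h)) ^ 2) (INR r ^ length qs)).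
  { intros qs HNq HPq HBq. destruct (kron_list_spec th r qs Hth HNq HPq) as (S1 & S2 & S3).
    rewrite <- pow_INR, <- S2. apply mean_square; auto.
    intros x Hx. destruct (S3 x Hx) as (Q1 & Q2 & _). repeat split; auto. }
  assert (M1 := M ps HN HP (fun x Hx => HB x (in_or_app _ _ _ (or_introl Hx)))).
  set (c := 4 / (eps * eps)).
  assert (Pc : 0 < c) by (apply Rdiv_lt_0_compat; nra).
  assert (M2 : rmean (fun k => fold_right (fun p acc =>
      c * Cmod (phase_sum (K (remove Nat.eq_dec p ps)) (T + INR k * h)) ^ 2 + acc) 0 ps)
      (INR (length ps) * (c * INR r ^ (pred (length ps))))).
  { assert (Hsub : forall qs, incl qs ps -> rmean (fun k => fold_right (fun p acc =>
      c * Cmod (phase_sum (K (remove Nat.eq_dec p ps)) (T + INR k * h)) ^ 2 + acc) 0 qs)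
      (INR (length qs) * (c * INR r ^ (pred (length ps))))).
    { induction qs as [|q qs IH]; intros Hi.
      - simpl. rewrite Rmult_0_l. apply rmean_const.
      - simpl length. rewrite S_INR.
        replace ((INR (length qs) + 1) * (c * INR r ^ Init.Nat.pred (length ps))) with
          (c * INR r ^ pred (length ps) + INR (length qs) * (c * INR r ^ pred (length ps))) by ring.
        assert (Hq : In q ps) by (apply Hi; now left).
        apply rmean_plus; [|apply IH; intros y Hy; apply Hi; now right].
        apply rmean_scal. rewrite <- (length_remove q ps HN Hq). simpl pred.
        apply M.
        + now apply NoDup_remove_id.
        + intros p Hp. apply in_remove in Hp. now apply HP.
        + intros x Hx. apply HB. apply in_or_app. right. apply in_flat_map. exists q. auto. }
    apply Hsub. intros y; auto. }
  (* At each sample some prime misses its target, so its factor is bounded and the product over the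
     remaining primes is left. Summing over all primes removes the dependence on which one
     missed. *)
  assert (L : INR r ^ length ps <= INR (length ps) * (c * INR r ^ pred (length ps))).
  { apply rmean_le with (2 := M1) (3 := M2). intros k.
    destruct (Hbad (T + INR k * h)) as [p [Hp Hpe]].
    { assert (X := pos_INR k). nra. }
    eapply Rle_trans; [|apply (phase_sum_R_le (fun p => c * Cmod (phase_sum (K (remove Nat.eq_dec p ps)) (T + INR k * h)) ^ 2) ps p Hp)].
    - unfold K. rewrite !phase_sum_kron_list; auto.
      2:{ intros q Hq. apply in_remove in Hq. now apply HP. }
      rewrite (fold_mult_remove _ p ps HN Hp), Cmod_mult, Rpow_mult_distr.
      apply Rmult_le_compat_r; [apply pow2_ge_0|]. apply kron_factor_bound; auto.
    - intros q. apply Rmult_le_pos; [lra | apply pow2_ge_0]. }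
  destruct (Hbad T) as [p [Hp _]]; [lra|].
  assert (Hlen : (length ps = S (pred (length ps)))%nat) by (destruct ps; [destruct Hp | reflexivity]).
  rewrite Hlen in L at 1. simpl pow in L.
  assert (Pr : 0 < INR r).
  { eapply Rle_lt_trans; [|exact Hr]. unfold Rdiv. apply Rmult_le_pos.
    - assert (X := pos_INR (length ps)). lra.
    - apply Rlt_le, Rinv_0_lt_compat. nra. }
  assert (PP := pow_lt _ (pred (length ps)) Pr).
  assert (X : 4 * INR (length ps) / (eps * eps) = INR (length ps) * c) by (unfold c; field; lra).
  rewrite X in Hr. nra.
Qed.

(** * Sums over primes *)

Lemma lnN_unbounded x : exists n, (3 <= n)%nat /\ forall k, (n <= k)%nat -> x <= lnN k.
Proof.
  destruct (INR_unbounded (exp x)) as [n Hn].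
  exists (n + 3)%nat. split; [lia|]. intros k Hk.
  unfold lnN. rewrite <- (ln_exp x). apply ln_le; [apply exp_pos|].
  apply Rlt_le, Rlt_le_trans with (1 := Hn). apply le_INR. lia.
Qed.

Lemma exp_mlnN n : (1 <= n)%nat -> exp (- lnN n) = / INR n.
Proof. intros H. rewrite exp_Ropp. unfold lnN. rewrite exp_ln; auto. apply lt_0_INR; lia. Qed.

Definition weight (k : nat) (sg : R) (n : nat) : R := lnN n ^ k * exp (- sg * lnN n).

Lemma weight_pos k sg n : 0 <= weight k sg n.
Proof. apply Rmult_le_pos; [apply pow_le, lnN_ge0 | apply Rlt_le, exp_pos]. Qed.

(** Any exponent strictly between 1/2 and 1 would serve: it must absorb the powers of ln n, yet sum
    over squares, where 3/4 becomes 3/2. *)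
Lemma weight_bound k : exists B, 0 < B /\ forall n, weight k 1 n <= B * exp (- (3/4) * lnN n).
Proof.
  destruct (subpoly_dcoef ones k subpoly_ones) as [_ H].
  destruct (H (/4)) as [B [PB HB]]; [lra|]. exists (B + 1). split; [lra|].
  intros n. unfold weight. destruct n as [|n].
  - rewrite lnN_0, !Rmult_0_r, exp_0.
    assert (0 ^ k <= 1) by (destruct k; simpl; lra). lra.
  - specialize (HB (S n)). unfold dcoef, ones in HB. simpl Nat.eqb in HB. cbv iota in HB.
    rewrite Rmult_1_r, <- RPow_abs, Rabs_Ropp, Rabs_pos_eq in HB by apply lnN_ge0.
    replace (exp (- (3/4) * lnN (S n))) with (exp (/4 * lnN (S n)) * exp (- (1) * lnN (S n)))
      by (rewrite <- exp_plus; f_equal; field).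
    rewrite <- Rmult_assoc. apply Rmult_le_compat_r; [apply Rlt_le, exp_pos|].
    assert (X := exp_pos (/ 4 * lnN (S n))). lra.
Qed.

Lemma weight_small m eps : 0 < eps -> exists P, forall n k, (P <= n)%nat -> (k <= m)%nat -> weight k 1 n <= eps.
Proof.
  intros He. destruct (weight_bound m) as [B [PB HB]].
  destruct (lnN_unbounded (Rmax 1 (2 * ln (B / eps)))) as [P [_ HP]].
  exists P. intros n k Hn Hk. specialize (HP n Hn).
  assert (L1 := Rmax_l 1 (2 * ln (B / eps))). assert (L2 := Rmax_r 1 (2 * ln (B / eps))).
  apply Rle_trans with (weight m 1 n).
  - apply Rmult_le_compat_r; [apply Rlt_le, exp_pos|]. apply Rle_pow; [lra | auto].
  - eapply Rle_trans; [apply HB|].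
    apply Rle_trans with (B * exp (- ln (B / eps))).
    + apply Rmult_le_compat_l; [lra|]. apply exp_le. lra.
    + rewrite exp_Ropp, exp_ln by (apply Rdiv_lt_0_compat; auto). right. field. lra.
Qed.

(** The function x^k exp(- sg x) decreases once x >= k. The growth of the power is bounded through
    y'/y <= exp(y'/y - 1). *)
Lemma weight_decr k sg n n' : 1 <= sg -> (2 <= n)%nat -> INR k <= lnN n -> (n <= n')%nat ->
  weight k sg n' <= weight k sg n.
Proof.
  intros Hs Hn Hk Hnn'. unfold weight.
  assert (Py := lnN_pos n Hn). assert (Hy := lnN_le n n' Hnn').
  set (y := lnN n) in *. set (y' := lnN n') in *.
  assert (E : y' ^ k <= y ^ k * exp (sg * (y' - y))).
  { replace y' with (y * (y' / y)) at 1 by (field; lra).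
    rewrite Rpow_mult_distr. apply Rmult_le_compat_l; [apply pow_le; lra|].
    apply Rle_trans with (exp (y' / y - 1) ^ k).
    - apply pow_incr. split.
      + apply Rmult_le_pos; [lra | apply Rlt_le, Rinv_0_lt_compat; auto].
      + assert (X := exp_ge_1p (y' / y - 1)). lra.
    - rewrite exp_pow_INR. apply exp_le. apply Rle_trans with (1 * (y' - y)); [|nra].
      replace (INR k * (y' / y - 1)) with ((INR k / y) * (y' - y)) by (field; lra).
      apply Rmult_le_compat_r; [lra|].
      apply Rmult_le_reg_r with y; auto. unfold Rdiv. rewrite Rmult_assoc, Rinv_l by lra. lra. }
  replace (y ^ k * exp (- sg * y)) with (y ^ k * exp (sg * (y' - y)) * exp (- sg * y')).
  - apply Rmult_le_compat_r; [apply Rlt_le, exp_pos | exact E].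
  - rewrite Rmult_assoc, <- exp_plus. f_equal. f_equal. ring.
Qed.

Lemma weight_sg_le k sg sg' n : sg <= sg' -> weight k sg' n <= weight k sg n.
Proof.
  intros H. apply Rmult_le_compat_l; [apply pow_le, lnN_ge0|]. apply exp_le.
  assert (X := lnN_ge0 n). nra.
Qed.

Lemma rsum_swap (u : nat -> nat -> R) N M :
  rsum (fun i => rsum (fun j => u i j) M) N = rsum (fun j => rsum (fun i => u i j) N) M.
Proof.
  induction N; simpl.
  - induction M; simpl; lra.
  - rewrite IHN. now rewrite <- rsum_plus.
Qed.

Lemma rsum_delta_le (g : nat -> R) a N : 0 <= g a ->
  rsum (fun n => if Nat.eqb n a then g n else 0) N <= g a.
Proof.
  intros Hg. assert (K : forall N, (N <= a)%nat -> rsum (fun n => if Nat.eqb n a then g n else 0) N = 0).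
  { induction N0; intros H; [reflexivity|]. simpl. rewrite IHN0 by lia.
    destruct (Nat.eqb_spec N0 a); [lia | ring]. }
  destruct (Nat.le_gt_cases N a) as [H|H]; [rewrite K by auto; auto|].
  replace N with (S a + (N - S a))%nat by lia.
  rewrite rsum_split. cbn [rsum]. rewrite K by lia. rewrite Nat.eqb_refl.
  rewrite (rsum_ext _ (fun _ => 0)).
  - rewrite rsum_zero. lra.
  - intros n _. change (S a + n)%nat with (S (a + n)). destruct (Nat.eqb_spec (S (a + n)) a) as [e|e]; [lia | reflexivity].
Qed.

(** Every proper power is m^2 or m^2 [pdiv m] for some m, so the sum is at most twice the sum over
    squares. *)
Lemma proper_power_summable (g : nat -> R) : (forall n, 0 <= g n) ->
  (forall m n, (1 <= m)%nat -> (m <= n)%nat -> g n <= g m) ->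
  summable (fun m => g (m * m)%nat) -> summable (fun n => if proper_power n then g n else 0).
Proof.
  intros Hg Hd [B HB].
  exists (B + B). intros N.
  (* [Nat.max 1 0] is just 1: for m >= 1 the second term is g(m^2), which dominates g at m^2
     [pdiv m]; at m = 0 both numbers are 0. *)
  apply Rle_trans with (rsum (fun m => g (m * m)%nat + (if Nat.leb 1 m then g (m * m * PeanoNat.Nat.max 1 0)%nat else g 0%nat)) N).
  - set (b := fun m => (m * m * prime.pdiv m)%nat).
    apply Rle_trans with (rsum (fun n => rsum (fun m =>
       (if Nat.eqb n (m * m) then g n else 0) + (if Nat.eqb n (b m) then g n else 0)) N) N).
    + apply rsum_le. intros n Hn.
      assert (T0 : forall m, 0 <= (if Nat.eqb n (m * m) then g n else 0) + (if Nat.eqb n (b m) then g n else 0)).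
      { intros m. specialize (Hg n). destruct (Nat.eqb n (m * m)), (Nat.eqb n (b m)); lra. }
      destruct (proper_power n) eqn:E; [|apply rsum_nonneg; intros; apply T0].
      destruct (proper_power_half n E) as [m [Hm [Hc _]]].
      apply Rle_trans with ((if Nat.eqb n (m * m) then g n else 0) + (if Nat.eqb n (b m) then g n else 0)).
      * specialize (Hg n). destruct Hc as [Hc|Hc].
        -- rewrite <- Hc, Nat.eqb_refl. destruct (Nat.eqb n (b m)); lra.
        -- fold (b m) in Hc. rewrite <- Hc, Nat.eqb_refl. destruct (Nat.eqb n (m * m)); lra.
      * apply (rsum_term (fun m => (if Nat.eqb n (m * m) then g n else 0) + (if Nat.eqb n (b m) then g n else 0)) N m); auto. lia.
    + rewrite rsum_swap. apply rsum_le. intros m _. rewrite rsum_plus.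
      apply Rplus_le_compat.
      * now apply rsum_delta_le.
      * eapply Rle_trans; [now apply rsum_delta_le|].
        unfold b. destruct m as [|m]; [simpl; lra|]. simpl Nat.leb. cbv iota.
        rewrite Nat.max_0_r, Nat.mul_1_r. apply Hd; [lia|]. assert (X := pdiv_pos (S m)). nia.
  - rewrite rsum_plus. apply Rplus_le_compat; [apply HB|].
    eapply Rle_trans; [|apply (HB N)]. apply rsum_le. intros [|m] _; simpl Nat.leb; cbv iota.
    + simpl; lra.
    + rewrite Nat.max_0_r, Nat.mul_1_r. lra.
Qed.

Definition lzcoef_pp (n : nat) : R := if is_prime n then 0 else lzcoef n.

Lemma lzcoef_pp_bound n : 0 <= lzcoef_pp n <= 1.
Proof. unfold lzcoef_pp. assert (X := lzcoef_bound n). destruct (is_prime n); lra. Qed.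

Lemma lzcoef_pp_proper_power n : lzcoef_pp n <= if proper_power n then 1 else 0.
Proof.
  assert (X := lzcoef_pp_bound n). destruct (proper_power n) eqn:E; [lra|].
  unfold lzcoef_pp in *. destruct (is_prime n) eqn:E2; [lra|].
  unfold lzcoef. destruct (Req_dec (mangoldt n) 0) as [->|H]; [unfold Rdiv; lra|].
  destruct (mangoldt_case n H); congruence.
Qed.

Lemma lzcoef_prime n : is_prime n = true -> lzcoef n = 1.
Proof.
  intros H. unfold lzcoef. rewrite (mangoldt_prime n H). fold (lnN n). field.
  apply Rgt_not_eq, lnN_pos, (is_prime_ge2 n H).
Qed.

(** The part of log zeta off the primes converges absolutely even at Re s = 1, so beyond a fixed
    point its phases may be ignored. *)
Lemma lzcoef_pp_summable k : summable (fun n => lzcoef_pp n * weight k 1 n).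
Proof.
  destruct (weight_bound k) as [B [PB HB]].
  apply summable_le with (fun n => B * (if proper_power n then exp (- (3/4) * lnN n) else 0)).
  - intros n. assert (X := lzcoef_pp_proper_power n). assert (X0 := lzcoef_pp_bound n).
    destruct (proper_power n).
    + rewrite <- (Rmult_1_l (B * _)). apply Rmult_le_compat; auto; [lra | apply weight_pos].
    + assert (lzcoef_pp n = 0) as -> by lra. lra.
  - apply summable_scal; [lra|]. apply (proper_power_summable (fun n => exp (- (3/4) * lnN n))).
    + intros; apply Rlt_le, exp_pos.
    + intros m n _ H. apply exp_le. assert (X := lnN_le m n H). lra.
    + apply summable_le with (2 := p_series (3/2) ltac:(lra)). intros [|n].
      * simpl. rewrite lnN_0, !Rmult_0_r. lra.
      * apply exp_le. unfold lnN. rewrite mult_INR, ln_mult by (apply lt_0_INR; lia). lra.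
Qed.

Definition sigma_seq (j : nat) : R := 1 + / (INR j + 2).

Lemma sigma_seq_bound j : 1 < sigma_seq j < 2.
Proof.
  unfold sigma_seq. assert (X := pos_INR j). split.
  - assert (0 < / (INR j + 2)) by (apply Rinv_0_lt_compat; lra). lra.
  - assert (/ (INR j + 2) < / 1) by (apply Rinv_lt_contravar; lra). lra.
Qed.

Lemma sigma_seq_lim : is_lim_seq sigma_seq 1.
Proof.
  replace (Finite 1) with (Finite (1 + 0)) by (f_equal; ring).
  apply is_lim_seq_plus'; [apply is_lim_seq_const|].
  apply is_lim_seq_ext with (fun j => / INR (j + 2)).
  - intros j. rewrite plus_INR. reflexivity.
  - apply (is_lim_seq_incr_n (fun n => / INR n) 2).
    apply is_lim_seq_eps. intros eps He.
    destruct (archimed_cor1 eps He) as [N [HN PN]]. exists N. intros n Hn.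
    rewrite Rminus_0_r, Rabs_pos_eq by (apply Rlt_le, Rinv_0_lt_compat, lt_0_INR; lia).
    eapply Rle_lt_trans; [|exact HN]. apply Rinv_le_contravar; [apply lt_0_INR; lia | now apply le_INR].
Qed.

Lemma exp_sigma_seq_lim n : is_lim_seq (fun j => exp (- sigma_seq j * lnN n)) (exp (- (1) * lnN n)).
Proof.
  apply is_lim_seq_continuous with (f := fun x => exp (- x * lnN n)) (2 := sigma_seq_lim).
  apply derivable_continuous_pt. reg.
Qed.

Lemma rsum_lim (u : nat -> nat -> R) (v : nat -> R) N : (forall n, is_lim_seq (fun j => u j n) (v n)) ->
  is_lim_seq (fun j => rsum (u j) N) (rsum v N).
Proof.
  intros H. induction N; simpl; [apply is_lim_seq_const|]. now apply is_lim_seq_plus'.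
Qed.

Lemma harmonic_unbounded N : (1 <= N)%nat -> lnN N <= rsum (fun n => ones n * exp (- (1) * lnN n)) N.
Proof.
  induction N as [|N IH]; [lia|]. intros _. destruct N as [|N].
  - rewrite lnN_1. simpl. unfold ones. simpl. lra.
  - specialize (IH ltac:(lia)). simpl rsum in *. change (ones (S N)) with 1.
    replace (- (1) * lnN (S N)) with (- lnN (S N)) by ring.
    rewrite exp_mlnN, Rmult_1_l by lia.
    assert (P : 0 < INR (S N)) by (apply lt_0_INR; lia).
    assert (E : lnN (S (S N)) - lnN (S N) <= / INR (S N)).
    { unfold lnN. rewrite <- ln_div by (apply lt_0_INR; lia).
      assert (Q : INR (S (S N)) / INR (S N) = 1 + / INR (S N)) by (rewrite (S_INR (S N)); field; lra).
      rewrite Q. apply Rle_trans with (ln (exp (/ INR (S N)))); [|rewrite ln_exp; lra].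
      apply ln_le; [assert (0 < / INR (S N)) by (apply Rinv_0_lt_compat; auto); lra | apply exp_ge_1p]. }
    lra.
Qed.

(* Divergence of the sum of [1/p]: otherwise [logzeta_d 0], hence [zeta = exp (logzeta_d 0)], stays bounded near [1]. *)
Lemma prime_sum_unbounded : forall B, exists N, B < rsum (fun n => if is_prime n then weight 0 1 n else 0) N.
Proof.
  intros B. apply NNPP. intros Hno.
  assert (HB : forall N, rsum (fun n => if is_prime n then weight 0 1 n else 0) N <= B).
  { intros N. apply Rnot_lt_le. intros H. apply Hno. eauto. }
  destruct (lzcoef_pp_summable 0) as [B' HB'].
  (* The bound does not depend on j; letting [sigma_seq j] tend to 1 at fixed N turns it into a
     bound for the harmonic series. *)
  assert (HZ : forall j N, rsum (fun n => ones n * exp (- sigma_seq j * lnN n)) N <= exp (B + B')).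
  { intros j N. assert (Hs := sigma_seq_bound j). set (s := RtoC (sigma_seq j)).
    assert (Hr : 1 < Re s) by (unfold s; simpl; lra).
    assert (G0 : Cmod (logzeta_d 0 s) <= B + B').
    { apply Cser_le with (fun n => (if is_prime n then weight 0 1 n else 0) + lzcoef_pp n * weight 0 1 n).
      - intros n. rewrite Cmod_dirichlet_term. unfold dcoef. simpl pow. rewrite Rmult_1_l.
        assert (X := lzcoef_bound n). rewrite Rabs_pos_eq by lra.
        assert (E : exp (- Re s * lnN n) <= weight 0 1 n).
        { unfold weight, s. simpl. rewrite Rmult_1_l. apply exp_le. assert (Y := lnN_ge0 n). nra. }
        apply Rle_trans with (lzcoef n * weight 0 1 n); [apply Rmult_le_compat_l; lra|].
        unfold lzcoef_pp. destruct (is_prime n) eqn:Ep; [rewrite lzcoef_prime; auto; lra | lra].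
      - intros M. rewrite rsum_plus. apply Rplus_le_compat; auto. }
    assert (Z0 : Cmod (zeta_d 0 s) <= exp (B + B')).
    { rewrite zeta_d_exp, Cmod_Cexp by auto. apply exp_le. eapply Rle_trans; [|exact G0].
      eapply Rle_trans; [apply Rle_abs | apply re_le_Cmod]. }
    assert (L := clim_Re _ _ (dirichlet_cv (dcoef ones 0) s (subpoly_dcoef ones 0 subpoly_ones) Hr)).
    assert (E : forall M, Re (csum (dirichlet_term (dcoef ones 0) s) M) = rsum (fun n => ones n * exp (- sigma_seq j * lnN n)) M).
    { induction M; [reflexivity|]. simpl csum. rewrite Re_plus, IHM. simpl rsum. f_equal.
      unfold dirichlet_term, dcoef, npow. simpl pow. rewrite Rmult_1_l.
      replace (- s * RtoC (lnN M))%C with (RtoC (- sigma_seq j * lnN M)) by (unfold s; rewrite RtoC_mult, RtoC_opp; reflexivity).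
      rewrite Cexp_R, <- RtoC_mult. reflexivity. }
    apply is_lim_seq_ext with (1 := E) in L.
    assert (I := is_lim_seq_incr_compare _ _ L).
    assert (P : forall n : nat, rsum (fun n => ones n * exp (- sigma_seq j * lnN n)) n <= rsum (fun n => ones n * exp (- sigma_seq j * lnN n)) (S n)).
    { intros n. simpl. assert (0 <= ones n) by (unfold ones; destruct (Nat.eqb n 0); lra).
      assert (X := exp_pos (- sigma_seq j * lnN n)). nra. }
    specialize (I P N). eapply Rle_trans; [exact I|]. eapply Rle_trans; [|exact Z0].
    eapply Rle_trans; [apply Rle_abs | apply re_le_Cmod]. }
  assert (HN : forall N, rsum (fun n => ones n * exp (- (1) * lnN n)) N <= exp (B + B')).
  { intros N. apply (is_lim_seq_le (fun j => rsum (fun n => ones n * exp (- sigma_seq j * lnN n)) N) (fun _ => exp (B + B'))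
      (rsum (fun n => ones n * exp (- (1) * lnN n)) N) (exp (B + B'))).
    - intros j. apply HZ.
    - apply (rsum_lim (fun j n => ones n * exp (- sigma_seq j * lnN n))). intros n.
      apply is_lim_seq_mult'; [apply is_lim_seq_const | apply exp_sigma_seq_lim].
    - apply is_lim_seq_const. }
  destruct (lnN_unbounded (exp (B + B') + 1)) as [n [Hn Hl]].
  specialize (Hl n (le_n _)). assert (X := harmonic_unbounded n ltac:(lia)). specialize (HN n). lra.
Qed.

(** * Alternating sums over primes *)

(** The sign flips after each prime, so consecutive primes carry opposite signs. *)
Fixpoint alt_sign (n : nat) : R :=
  match n with O => 1 | S n => if is_prime n then - alt_sign n else alt_sign n end.

Lemma alt_sign_pm n : alt_sign n = 1 \/ alt_sign n = -1.
Proof. induction n; simpl; [auto|]. destruct (is_prime n); destruct IHn as [-> | ->]; auto; right + left; ring. Qed.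

(** Leibniz's estimate for an alternating decreasing series, with the primes as the only indices
    that contribute. *)
Lemma alt_sum_bound (f : nat -> R) a b : (forall n, (a <= n)%nat -> 0 <= f (S n) <= f n) -> 0 <= f a ->
  (a <= b)%nat ->
  Rabs (rsum (fun n => if is_prime n then alt_sign n * f n else 0) b -
        rsum (fun n => if is_prime n then alt_sign n * f n else 0) a) <= f a.
Proof.
  intros Hf Ha Hab. set (u := fun n => if is_prime n then alt_sign n * f n else 0).
  (* After an even number of primes the signed sum lies between 0 and f(a) - f(b); after an odd
     number, between f(b) and f(a). *)
  assert (K : forall d, let b := (a + d)%nat in 0 <= f b <= f a /\
    ((alt_sign b = alt_sign a /\ 0 <= alt_sign a * (rsum u b - rsum u a) <= f a - f b) \/
     (alt_sign b = - alt_sign a /\ f b <= alt_sign a * (rsum u b - rsum u a) <= f a))).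
  { induction d; intros b0; subst b0.
    - rewrite Nat.add_0_r. split; [lra|]. left. split; auto. lra.
    - destruct IHd as [I0 I1]. rewrite Nat.add_succ_r.
      assert (F := Hf (a + d)%nat ltac:(lia)). split; [lra|].
      change (rsum u (S (a + d))) with (rsum u (a + d) + u (a + d)%nat).
      change (alt_sign (S (a + d))) with (if is_prime (a + d) then - alt_sign (a + d) else alt_sign (a + d)).
      assert (Q : alt_sign a * alt_sign a = 1) by (destruct (alt_sign_pm a) as [-> | ->]; ring).
      replace (alt_sign a * (rsum u (a + d) + u (a + d)%nat - rsum u a)) with
        (alt_sign a * (rsum u (a + d) - rsum u a) + alt_sign a * u (a + d)%nat) by ring.
      assert (U : u (a + d)%nat = if is_prime (a + d) then alt_sign (a + d) * f (a + d)%nat else 0) by reflexivity.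
      rewrite U.
      destruct (is_prime (a + d)); destruct I1 as [[E1 E2]|[E1 E2]]; rewrite E1.
      + right. split; auto. replace (alt_sign a * (alt_sign a * f (a + d)%nat)) with (f (a + d)%nat) by (rewrite <- Rmult_assoc, Q; ring). lra.
      + left. split; [ring|]. replace (alt_sign a * (- alt_sign a * f (a + d)%nat)) with (- f (a + d)%nat)
          by (rewrite <- Rmult_assoc, <- Ropp_mult_distr_r, Q; ring). lra.
      + left. split; auto. lra.
      + right. split; auto. lra. }
  destruct (K (b - a)%nat) as [K0 K1]. replace (a + (b - a))%nat with b in * by lia.
  assert (X : Rabs (alt_sign a * (rsum u b - rsum u a)) <= f a).
  { apply Rabs_le. destruct K1 as [[_ K1]|[_ K1]]; lra. }
  rewrite Rabs_mult in X. replace (Rabs (alt_sign a)) with 1 in X; [lra|].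
  destruct (alt_sign_pm a) as [-> | ->]; unfold Rabs; destruct Rcase_abs; lra.
Qed.

(** * Density of the logarithmic derivatives *)

Lemma eventually_forall_le (A : nat -> nat -> Prop) m :
  (forall k, exists P, forall P', (P <= P')%nat -> A k P') ->
  exists P, forall k P', (k <= m)%nat -> (P <= P')%nat -> A k P'.
Proof.
  intros H. induction m as [|m [P HP]].
  - destruct (H 0%nat) as [P HP]. exists P. intros k P' Hk. replace k with 0%nat by lia. auto.
  - destruct (H (S m)) as [P2 HP2]. exists (P + P2)%nat. intros k P' Hk HP'.
    destruct (Nat.eq_dec k (S m)) as [->|]; [apply HP2; lia | apply HP; lia].
Qed.

(** The steps have size at most [dl] and the sums are unbounded. The first sum to exceed the target
    therefore lands within [dl] of it. *)
Lemma crossing (g : nat -> R) L dl x : (forall n, (L <= n)%nat -> 0 <= g n <= dl) ->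
  (forall B, exists N, B < rsum g N) -> 0 <= x -> 0 <= dl ->
  exists M, (L <= M)%nat /\ Rabs (rsum g M - rsum g L - x) <= dl.
Proof.
  intros Hg Hu Hx Hdl. apply NNPP. intros Hno.
  assert (K : forall d, rsum g (L + d) - rsum g L <= x).
  { induction d.
    - rewrite Nat.add_0_r. lra.
    - apply Rnot_lt_le. intros Hlt. apply Hno. exists (L + d)%nat. split; [lia|].
      rewrite Nat.add_succ_r in Hlt. simpl in Hlt. assert (X := Hg (L + d)%nat ltac:(lia)).
      apply Rabs_le. lra. }
  destruct (Hu (Rabs (rsum g L) + x + rsum (fun n => Rabs (g n)) L)) as [N HN].
  assert (P0 : forall n, rsum g n <= rsum (fun n => Rabs (g n)) n).
  { intros n. apply rsum_le. intros; apply Rle_abs. }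
  assert (A := Rle_abs (rsum g L)). assert (A0 := Rabs_pos (rsum g L)).
  assert (Q0 : 0 <= rsum (fun n => Rabs (g n)) L) by (apply rsum_nonneg; intros; apply Rabs_pos).
  destruct (Nat.le_gt_cases L N) as [H|H].
  - specialize (K (N - L)%nat). replace (L + (N - L))%nat with N in K by lia. lra.
  - assert (X := P0 N). assert (Y := rsum_mono (fun n => Rabs (g n)) N L (fun n => Rabs_pos _) ltac:(lia)). lra.
Qed.

Definition signed_weight (k : nat) (sg : R) (n : nat) : R := (- lnN n) ^ k * exp (- sg * lnN n).

Lemma signed_weight_weight k sg n : signed_weight k sg n = (-1) ^ k * weight k sg n.
Proof.
  unfold signed_weight, weight. replace (- lnN n) with ((-1) * lnN n) at 1 by ring.
  rewrite Rpow_mult_distr. ring.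
Qed.

Lemma Rabs_signed_weight k sg n : Rabs (signed_weight k sg n) = weight k sg n.
Proof.
  rewrite signed_weight_weight, Rabs_mult, pow_1_abs, (Rabs_pos_eq (weight k sg n)) by apply weight_pos. ring.
Qed.

(* The Dirichlet polynomial of [logzeta_d k] with [p ^ (- i t)] idealised to [1] for [p < P] and to [th p]
   for primes [p >= P]; proper prime powers [>= P] are dropped. *)
Definition model_coef (P : nat) (th : nat -> C) (n : nat) : C :=
  if Nat.ltb n P then RtoC (lzcoef n) else if is_prime n then th n else 0.
Definition model_sum (P : nat) (th : nat -> C) (k : nat) (sg : R) (N : nat) : C :=
  csum (fun n => model_coef P th n * RtoC (signed_weight k sg n))%C N.

Lemma model_sum_diff P th k sg N M (h : nat -> R) (c : C) : (N <= M)%nat ->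
  (forall n, (N <= n)%nat -> (model_coef P th n * RtoC (signed_weight k sg n))%C = (c * RtoC (h n))%C) ->
  model_sum P th k sg M = (model_sum P th k sg N + c * RtoC (rsum h M - rsum h N))%C.
Proof.
  intros HNM H. unfold model_sum. replace M with (N + (M - N))%nat by lia.
  rewrite csum_split, rsum_split. f_equal.
  replace (rsum h N + rsum (fun k0 => h (N + k0)%nat) (M - N) - rsum h N) with
    (rsum (fun k0 => h (N + k0)%nat) (M - N)) by ring.
  rewrite RtoC_rsum, <- csum_scal. apply csum_ext. intros i _. apply H. lia.
Qed.

Lemma model_sum_ext P th th' k sg N : (forall n, (n < N)%nat -> th n = th' n) ->
  model_sum P th k sg N = model_sum P th' k sg N.
Proof. intros H. apply csum_ext. intros n Hn. unfold model_coef. now rewrite H. Qed.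

Lemma Cplus_minus_l (x y : C) : (x + y - x)%C = y.
Proof. ring. Qed.

Lemma model_sum_alt P th k sg Q L : (2 <= P)%nat -> 1 <= sg -> (P <= Q)%nat -> (Q <= L)%nat ->
  INR k <= lnN Q -> (forall n, (Q <= n)%nat -> th n = RtoC (alt_sign n)) ->
  Cmod (model_sum P th k sg L - model_sum P th k sg Q)%C <= weight k sg Q.
Proof.
  intros HP Hs HQ HL Hk Hth.
  rewrite (model_sum_diff P th k sg Q L (fun n => if is_prime n then alt_sign n * weight k sg n else 0) (RtoC ((-1) ^ k))); auto.
  - rewrite Cplus_minus_l.
    rewrite Cmod_mult, !Cmod_R, pow_1_abs, Rmult_1_l.
    apply alt_sum_bound; auto.
    + intros n Hn. split; [apply weight_pos|]. apply weight_decr; auto; [lia|].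
      eapply Rle_trans; [exact Hk|]. now apply lnN_le.
    + apply weight_pos.
  - intros n Hn. unfold model_coef. destruct (Nat.ltb_spec n P); [lia|].
    rewrite signed_weight_weight, Hth by auto. destruct (is_prime n); rewrite ?RtoC_mult; ring.
Qed.

Lemma model_sum_cont P th k N : clim (fun j => model_sum P th k (sigma_seq j) N) (model_sum P th k 1 N).
Proof.
  unfold model_sum. induction N; simpl; [apply clim_const|]. apply clim_plus; [exact IHN|].
  apply clim_scal, clim_RtoC. unfold signed_weight.
  apply is_lim_seq_mult'; [apply is_lim_seq_const | apply exp_sigma_seq_lim].
Qed.

(** At step j the phases below Q are kept, alternating signs lead out to a remote L, and the primes
    in [L, M) share one phase pointing along the residual of order j. For each lower order the
    alternating stretch costs at most [eta] and the block at most [eta], which explains the bound 2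
    eta j. *)
Lemma stage (m P : nat) (ga : nat -> C) (eta : R) : 0 < eta -> (3 <= P)%nat ->
  (forall n, (P <= n)%nat -> INR m <= lnN n) ->
  (forall n k, (P <= n)%nat -> (k <= m)%nat -> weight k 1 n <= eta) ->
  forall j, (j <= S m)%nat -> exists Q th, (P <= Q)%nat /\ (forall n, Cmod (th n) = 1) /\
    forall k, (k < j)%nat -> Cmod (ga k - model_sum P th k 1 Q)%C <= 2 * eta * INR j.
Proof.
  intros He HP Hm Hf. induction j as [|j IH]; intros Hj.
  - exists P, (fun _ => RtoC 1). split; [lia|]. split; [intros; apply Cmod_1|]. intros; lia.
  - destruct IH as (Q & th & HQ & Hth & HIH); [lia|].
    set (r0 := (ga j - model_sum P th j 1 Q)%C).
    (* Bounds the mass of order j that the block will carry: the residual changes by at most [eta]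
       on the way to L, and the crossing overshoots by at most [eta]. *)
    set (X := Cmod r0 + 2 * eta).
    assert (P0 := Cmod_ge_0 r0).
    destruct (lnN_unbounded (Rmax 1 (X / eta))) as [L0 [_ HL0]].
    set (L := (L0 + Q)%nat).
    assert (HL : forall n, (L <= n)%nat -> 1 <= lnN n /\ X / eta <= lnN n).
    { intros n Hn. assert (Y := HL0 n ltac:(unfold L in Hn; lia)).
      assert (Y1 := Rmax_l 1 (X / eta)). assert (Y2 := Rmax_r 1 (X / eta)). lra. }
    set (th1 := fun n => if Nat.ltb n Q then th n else RtoC (alt_sign n)).
    assert (Hth1 : forall n, Cmod (th1 n) = 1).
    { intros n. unfold th1. destruct (Nat.ltb n Q); auto.
      rewrite Cmod_R. destruct (alt_sign_pm n) as [-> | ->]; unfold Rabs; destruct Rcase_abs; lra. }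
    assert (S1 : forall k, (k <= j)%nat -> Cmod (model_sum P th1 k 1 L - model_sum P th k 1 Q)%C <= eta).
    { intros k Hk. rewrite (model_sum_ext P th th1 k 1 Q).
      - eapply Rle_trans; [|apply (Hf Q k); lia]. apply model_sum_alt; [lia | lra | lia | unfold L; lia | |].
        + apply Rle_trans with (INR m); [apply le_INR; lia | apply Hm; lia].
        + intros n Hn. unfold th1. destruct (Nat.ltb_spec n Q); [lia | auto].
      - intros n Hn. unfold th1. destruct (Nat.ltb_spec n Q); [auto | lia]. }
    set (r1 := (ga j - model_sum P th1 j 1 L)%C).
    assert (Hr1 : Cmod r1 <= Cmod r0 + eta).
    { replace r1 with (r0 - (model_sum P th1 j 1 L - model_sum P th j 1 Q))%C by (unfold r0, r1; ring).
      eapply Rle_trans; [apply Cmod_minus_le|]. specialize (S1 j (le_n _)). lra. }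
    assert (Hu : exists u, Cmod u = 1 /\ r1 = (u * RtoC (Cmod r1))%C).
    { destruct (Req_dec (Cmod r1) 0) as [E|E].
      - exists (RtoC 1). split; [apply Cmod_1|]. rewrite E. rewrite (Cmod_eq_0 r1 E). ring.
      - exists (r1 / RtoC (Cmod r1))%C. assert (N : RtoC (Cmod r1) <> RtoC 0) by now apply RtoC_neq0.
        split; [|field; auto]. rewrite Cmod_div, Cmod_R, Rabs_pos_eq by (auto; apply Cmod_ge_0).
        field; auto. }
    destruct Hu as [u [Hu1 Hu2]].
    set (g := fun k n => if is_prime n then weight k 1 n else 0).
    assert (Hg0 : forall k n, 0 <= g k n) by (intros k n; unfold g; destruct (is_prime n); [apply weight_pos | lra]).
    destruct (crossing (g j) L eta (Cmod r1)) as [M [HM Hx]].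
    { intros n Hn. split; auto. unfold g. destruct (is_prime n); [|lra]. apply Hf; unfold L in Hn; lia. }
    (* Beyond L the logarithms are at least 1, so divergence at order 0 forces divergence at order
       j. *)
    { intros B. destruct (prime_sum_unbounded (B + rsum (g 0%nat) L)) as [N HN].
      exists (L + N)%nat. fold (g 0%nat) in HN.
      assert (E : rsum (g 0%nat) N <= rsum (g 0%nat) (L + N)) by (apply rsum_mono; auto; lia).
      rewrite rsum_split in E |- *.
      assert (E2 : rsum (fun k => g 0%nat (L + k)%nat) N <= rsum (fun k => g j (L + k)%nat) N).
      { apply rsum_le. intros i _. unfold g. destruct (is_prime (L + i)); [|lra].
        apply Rmult_le_compat_r; [apply Rlt_le, exp_pos|]. simpl pow. apply pow_R1_Rle.
        apply HL; lia. }
      assert (E3 : 0 <= rsum (g j) L) by (apply rsum_nonneg; auto).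
      change (rsum (fun n : nat => if is_prime n then weight 0 1 n else 0) N) with (rsum (g 0%nat) N) in HN. lra. }
    { apply Cmod_ge_0. } { lra. }
    (* The sign (-1)^j cancels that of [signed_weight], so that the block of order j points along
       u. *)
    set (th2 := fun n => if Nat.ltb n L then th1 n else (RtoC ((-1) ^ j) * u)%C).
    exists M, th2. split; [unfold L in HM; lia|]. split.
    { intros n. unfold th2. destruct (Nat.ltb n L); auto.
      rewrite Cmod_mult, Cmod_R, pow_1_abs, Hu1. ring. }
    assert (S2 : forall k, model_sum P th2 k 1 M = (model_sum P th1 k 1 L +
      (RtoC ((-1) ^ j) * u * RtoC ((-1) ^ k)) * RtoC (rsum (g k) M - rsum (g k) L))%C).
    { intros k. rewrite (model_sum_ext P th1 th2 k 1 L).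
      - apply model_sum_diff; auto. intros n Hn. unfold model_coef, th2, g.
        destruct (Nat.ltb_spec n P); [unfold L in Hn; lia|].
        destruct (Nat.ltb_spec n L); [lia|].
        rewrite signed_weight_weight. destruct (is_prime n); rewrite ?RtoC_mult; ring.
      - intros n Hn. unfold th2. destruct (Nat.ltb_spec n L); [auto | lia]. }
    intros k Hk. rewrite S_INR.
    destruct (Nat.eq_dec k j) as [->|Hne].
    + rewrite S2.
      assert (Q1 : (RtoC ((-1) ^ j) * u * RtoC ((-1) ^ j))%C = u).
      { transitivity (RtoC ((-1) ^ j * (-1) ^ j) * u)%C; [rewrite RtoC_mult; ring|].
        rewrite <- Rpow_mult_distr. replace (-1 * -1) with 1 by ring. rewrite pow1. ring. }
      rewrite Q1.
      replace (ga j - (model_sum P th1 j 1 L + u * RtoC (rsum (g j) M - rsum (g j) L)))%C with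
        (u * RtoC (Cmod r1 - (rsum (g j) M - rsum (g j) L)))%C.
      * rewrite Cmod_mult, Hu1, Cmod_R, Rmult_1_l.
        rewrite <- Rabs_Ropp. replace (- (Cmod r1 - (rsum (g j) M - rsum (g j) L))) with
          (rsum (g j) M - rsum (g j) L - Cmod r1) by ring.
        eapply Rle_trans; [exact Hx|]. assert (Z := pos_INR j). nra.
      * transitivity (r1 - u * RtoC (rsum (g j) M - rsum (g j) L))%C; [|unfold r1; ring].
        rewrite Hu2 at 2. rewrite RtoC_minus. ring.
    + assert (Hkj : (k < j)%nat) by lia. specialize (HIH k Hkj). specialize (S1 k ltac:(lia)).
      rewrite S2.
      replace (ga k - (model_sum P th1 k 1 L + RtoC ((-1) ^ j) * u * RtoC ((-1) ^ k) * RtoC (rsum (g k) M - rsum (g k) L)))%C with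
        ((ga k - model_sum P th k 1 Q) - (model_sum P th1 k 1 L - model_sum P th k 1 Q) -
          RtoC ((-1) ^ j) * u * RtoC ((-1) ^ k) * RtoC (rsum (g k) M - rsum (g k) L))%C by ring.
      (* Order k < j has at least one factor ln p less, and ln p >= X / eta on the block, while the
         block of order j has mass at most X. *)
      assert (FK : 0 <= rsum (g k) M - rsum (g k) L <= eta).
      { replace M with (L + (M - L))%nat in Hx |- * by lia. rewrite rsum_split in Hx |- *.
        set (Sj := rsum (fun i => g j (L + i)%nat) (M - L)) in *.
        replace (rsum (g j) L + Sj - rsum (g j) L - Cmod r1) with (Sj - Cmod r1) in Hx by ring.
        apply Rabs_le_between in Hx.
        replace (rsum (g k) L + rsum (fun i => g k (L + i)%nat) (M - L) - rsum (g k) L) with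
          (rsum (fun i => g k (L + i)%nat) (M - L)) by ring.
        split; [apply rsum_nonneg; auto|].
        assert (PX : 0 < X) by (unfold X; lra).
        apply Rle_trans with (eta / X * Sj).
        - unfold Sj. rewrite <- rsum_scal. apply rsum_le. intros i _. unfold g.
          destruct (is_prime (L + i)); [|lra]. unfold weight.
          destruct (HL (L + i)%nat ltac:(lia)) as [Y1 Y2]. set (y := lnN (L + i)) in *.
          rewrite <- Rmult_assoc. apply Rmult_le_compat_r; [apply Rlt_le, exp_pos|].
          replace j with (k + S (j - k - 1))%nat by lia. rewrite pow_add.
          assert (Y3 : 0 < y ^ k) by (apply pow_lt; lra).
          assert (Y4 : X / eta <= y ^ S (j - k - 1)).
          { simpl pow. assert (Y5 := pow_R1_Rle y (j - k - 1) Y1). nra. }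
          replace (eta / X * (y ^ k * y ^ S (j - k - 1))) with (y ^ k * (eta / X * y ^ S (j - k - 1))) by ring.
          rewrite <- (Rmult_1_r (y ^ k)) at 1. apply Rmult_le_compat_l; [lra|].
          apply Rle_trans with (eta / X * (X / eta)); [right; field; lra|].
          apply Rmult_le_compat_l; auto. apply Rlt_le, Rdiv_lt_0_compat; auto.
        - apply Rle_trans with (eta / X * X); [|right; field; lra].
          apply Rmult_le_compat_l; [apply Rlt_le, Rdiv_lt_0_compat; auto|]. unfold X. lra. }
      eapply Rle_trans; [apply Cmod_minus_le|].
      assert (Y := Cmod_minus_le (ga k - model_sum P th k 1 Q)%C (model_sum P th1 k 1 L - model_sum P th k 1 Q)%C).
      rewrite !Cmod_mult, !Cmod_R, !pow_1_abs, Hu1, (Rabs_pos_eq (rsum (g k) M - _)) by lra.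
      lra.
Qed.

Lemma Cpow_minus_1 w r : Cmod w = 1 -> Cmod (w ^ r - 1)%C <= INR r * Cmod (w - 1)%C.
Proof.
  intros Hw. induction r.
  - simpl. replace (1 - 1)%C with (RtoC 0) by ring. rewrite Cmod_0. lra.
  - rewrite S_INR, Cpow_S. replace (w * w ^ r - 1)%C with (w * (w ^ r - 1) + (w - 1))%C by ring.
    eapply Rle_trans; [apply Cmod_triangle|]. rewrite Cmod_mult, Hw. lra.
Qed.

Lemma lzcoef_prime_power n : lzcoef n <> 0 -> prime_power n = true.
Proof.
  intros H. unfold lzcoef, mangoldt in H. destruct (prime_power n); auto. exfalso. apply H. unfold Rdiv. ring.
Qed.

(** The choices must be nested. P makes higher prime powers beyond it negligible; [stage] then gives
    Q and the phases; sigma is taken so close to 1 that the sums up to Q barely move; N truncates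
    the series at this sigma; only then does Kronecker's theorem supply t for the finitely many
    primes below N. *)
Lemma log_zeta_dense (m : nat) (ga : nat -> C) (eps T : R) : 0 < eps ->
  exists s, 1 < Re s < 2 /\ T <= Im s /\ forall k, (k <= m)%nat -> Cmod (logzeta_d k s - ga k)%C < eps.
Proof.
  (* The truncation costs [eta], the replacement of phases 2 [eta], the alternating tail [eta], the
     move from sigma to 1 [eta], and [stage] costs 2 [eta] (m + 1); this leaves one [eta] to
     spare. *)
  intros He. set (eta := eps / (2 * INR (S m) + 6)).
  assert (Pm := pos_INR (S m)).
  assert (Peta : 0 < eta) by (apply Rdiv_lt_0_compat; lra).
  assert (Heta : eta * (2 * INR (S m) + 6) = eps) by (unfold eta; field; lra).
  destruct (eventually_forall_le (fun k P => forall M, rsum (fun i => lzcoef_pp (P + i) * weight k 1 (P + i)) M <= eta) m)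
    as [P1 HP1].
  { intros k. destruct (summable_tail (fun n => lzcoef_pp n * weight k 1 n)) with (eps := eta) as [P HP]; auto.
    - intros n. apply Rmult_le_pos; [apply lzcoef_pp_bound | apply weight_pos].
    - apply lzcoef_pp_summable.
    - exists P. intros P' HP' M. now apply HP. }
  destruct (weight_small m eta Peta) as [P2 HP2].
  destruct (lnN_unbounded (INR m)) as [P3 [HP3a HP3]].
  set (P := (P1 + P2 + P3)%nat).
  destruct (stage m P ga eta Peta) with (j := S m) as (Q & th & HQ & Hth & Hst); auto.
  { unfold P; lia. } { intros n Hn. apply HP3. unfold P in Hn; lia. }
  { intros n k Hn Hk. apply HP2; auto. unfold P in Hn; lia. }
  (* Below P the target phase is 1, so that the powers of these primes are aligned too; beyond Q the
     signs alternate. *)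
  set (thf := fun n => if Nat.ltb n P then RtoC 1 else if Nat.ltb n Q then th n else RtoC (alt_sign n)).
  assert (Hthf : forall n, Cmod (thf n) = 1).
  { intros n. unfold thf. destruct (Nat.ltb n P); [apply Cmod_1|]. destruct (Nat.ltb n Q); auto.
    rewrite Cmod_R. destruct (alt_sign_pm n) as [-> | ->]; unfold Rabs; destruct Rcase_abs; lra. }
  assert (Hmsf : forall k sg, model_sum P th k sg Q = model_sum P thf k sg Q).
  { intros k sg. apply csum_ext. intros n Hn. f_equal. unfold model_coef, thf.
    destruct (Nat.ltb_spec n P); auto. destruct (Nat.ltb_spec n Q); [auto | lia]. }
  destruct (eventually_forall_le (fun k j => Cmod (model_sum P thf k (sigma_seq j) Q - model_sum P thf k 1 Q)%C < eta) m) as [j Hj].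
  { intros k. assert (L : clim (fun j => model_sum P thf k (sigma_seq j) Q) (model_sum P thf k 1 Q)).
    { apply model_sum_cont. }
    rewrite clim_eps in L. destruct (L eta Peta) as [N HN]. exists N. auto. }
  specialize (fun k Hk => Hj k j Hk (le_n _)).
  set (sg := sigma_seq j) in *. assert (Hsg : 1 < sg < 2) by apply sigma_seq_bound.
  destruct (eventually_forall_le (fun k N => forall M,
    rsum (fun i => Rabs (dcoef lzcoef k (N + i)) * exp (- sg * lnN (N + i))) M <= eta) m) as [N0 HN0].
  { intros k. destruct (summable_tail (fun n => Rabs (dcoef lzcoef k n) * exp (- sg * lnN n))) with (eps := eta) as [N HN]; auto.
    - intros n. apply Rmult_le_pos; [apply Rabs_pos | apply Rlt_le, exp_pos].
    - apply subpoly_summable; [apply subpoly_dcoef, subpoly_lzcoef | lra].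
    - exists N. intros N' HN' M. now apply HN. }
  set (N := (N0 + Q)%nat).
  destruct (list_bound (fun k => rsum (weight k 1) N) (seq 0 (S m))) as [B HB].
  (* A power p^r < P multiplies the deviation by r < P, and B bounds the total weight of all n < N
     in each order. *)
  set (dl := eta / ((INR P + 1) * (Rabs B + 1))).
  assert (PP := pos_INR P). assert (PB := Rabs_pos B).
  assert (Pdl : 0 < dl) by (apply Rdiv_lt_0_compat; nra).
  destruct (kronecker (filter is_prime (seq 0 N)) thf dl T) as [t [HT Ht]]; auto.
  { apply NoDup_filter, seq_NoDup. }
  { intros p Hp. now apply filter_In in Hp. }
  assert (Hph : forall p, (p < N)%nat -> is_prime p = true -> Cmod (phase p t - thf p)%C < dl).
  { intros p Hp Hpp. apply Ht, filter_In. split; auto. apply in_seq. lia. }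
  exists (RtoC sg + Ci * RtoC t)%C.
  assert (HRe : Re (RtoC sg + Ci * RtoC t)%C = sg) by (unfold Ci, Re; simpl; ring).
  assert (HIm : Im (RtoC sg + Ci * RtoC t)%C = t) by (unfold Ci, Im; simpl; ring).
  rewrite HRe, HIm. split; [auto|]. split; [auto|].
  set (s := (RtoC sg + Ci * RtoC t)%C) in *.
  intros k Hk.
  assert (D1 : forall n, dirichlet_term (dcoef lzcoef k) s n = (RtoC (lzcoef n) * phase n t * RtoC (signed_weight k sg n))%C).
  { intros n. unfold dirichlet_term, dcoef, npow, s, signed_weight.
    replace (- (RtoC sg + Ci * RtoC t) * RtoC (lnN n))%C with
      (RtoC (- sg * lnN n) + - Ci * RtoC (t * lnN n))%C by (rewrite !RtoC_mult, RtoC_opp; ring).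
    rewrite Cexp_plus, Cexp_R, <- phase_eq, !RtoC_mult. ring. }
  assert (T1 : Cmod (logzeta_d k s - csum (dirichlet_term (dcoef lzcoef k) s) N)%C <= eta).
  { apply Cser_tail with (b := fun n => Rabs (dcoef lzcoef k n) * exp (- sg * lnN n)).
    - intros n. apply Cmod_dirichlet_term_le. lra.
    - apply subpoly_summable; [apply subpoly_dcoef, subpoly_lzcoef | lra].
    - intros M. apply (HN0 k N Hk). unfold N; lia. }
  assert (T2 : Cmod (csum (dirichlet_term (dcoef lzcoef k) s) N - model_sum P thf k sg N)%C <= 2 * eta).
  { unfold model_sum. rewrite <- csum_minus. eapply Rle_trans; [apply Cmod_csum|].
    (* The first term pays for prime powers below P and for primes from P on; the second pays for
       the higher prime powers from P on, which the model omits. *)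
    apply Rle_trans with (rsum (fun n => ((INR P + 1) * dl) * weight k 1 n +
      (if Nat.ltb n P then 0 else lzcoef_pp n * weight k 1 n)) N).
    - apply rsum_le. intros n Hn. rewrite D1.
      replace (RtoC (lzcoef n) * phase n t * RtoC (signed_weight k sg n) - model_coef P thf n * RtoC (signed_weight k sg n))%C with
        ((RtoC (lzcoef n) * phase n t - model_coef P thf n) * RtoC (signed_weight k sg n))%C by ring.
      rewrite Cmod_mult, Cmod_R, Rabs_signed_weight.
      assert (F1 := weight_pos k 1 n). assert (F2 := weight_pos k sg n).
      assert (F3 := weight_sg_le k 1 sg n ltac:(lra)).
      assert (Gb := lzcoef_bound n).
      unfold model_coef. destruct (Nat.ltb_spec n P) as [HnP|HnP].
      + rewrite Rplus_0_r.
        replace (RtoC (lzcoef n) * phase n t - RtoC (lzcoef n))%C with (RtoC (lzcoef n) * (phase n t - 1))%C by ring.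
        rewrite Cmod_mult, Cmod_RtoC_pos by lra.
        destruct (Req_dec (lzcoef n) 0) as [->|Hgc]; [rewrite !Rmult_0_l; apply Rmult_le_pos; auto; nra|].
        destruct (prime_power_pow n (lzcoef_prime_power n Hgc)) as (p & r & Hp & Hr & E & Hpn).
        assert (Hphn : Cmod (phase n t - 1)%C <= (INR P + 1) * dl).
        { rewrite E, phase_pow by (apply is_prime_ge2 in Hp; lia).
          eapply Rle_trans; [apply Cpow_minus_1, Cmod_phase|].
          assert (Hpp := Hph p ltac:(lia) Hp). unfold thf in Hpp.
          destruct (Nat.ltb_spec p P); [|lia].
          apply Rmult_le_compat; [apply pos_INR | apply Cmod_ge_0 | | lra].
          assert (Hrn : (r < n)%nat) by (rewrite E; apply Nat.pow_gt_lin_r; apply is_prime_ge2 in Hp; lia).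
          assert (INR r <= INR P) by (apply le_INR; lia). lra. }
        assert (C0 := Cmod_ge_0 (phase n t - 1)%C).
        apply Rmult_le_compat; auto; [nra|].
        apply Rle_trans with (1 * Cmod (phase n t - 1)%C); [apply Rmult_le_compat_r; lra | lra].
      + unfold lzcoef_pp. destruct (is_prime n) eqn:Ep.
        * rewrite lzcoef_prime by auto. replace (1 * phase n t - thf n)%C with (phase n t - thf n)%C by ring.
          assert (Hpp := Hph n Hn Ep).
          assert (C0 := Cmod_ge_0 (phase n t - thf n)%C).
          rewrite Rmult_0_l, Rplus_0_r. apply Rmult_le_compat; auto. nra.
        * replace (RtoC (lzcoef n) * phase n t - 0)%C with (RtoC (lzcoef n) * phase n t)%C by ring.
          rewrite Cmod_mult, Cmod_phase, Cmod_RtoC_pos, Rmult_1_r by lra.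
          assert (0 <= (INR P + 1) * dl * weight k 1 n) by (apply Rmult_le_pos; [nra | auto]).
          assert (lzcoef n * weight k sg n <= lzcoef n * weight k 1 n) by (apply Rmult_le_compat_l; lra). lra.
    - rewrite rsum_plus, rsum_scal.
      assert (E1 : (INR P + 1) * dl * rsum (weight k 1) N <= eta).
      { apply Rle_trans with ((INR P + 1) * dl * (Rabs B + 1)).
        - apply Rmult_le_compat_l; [nra|]. assert (X := HB k ltac:(apply in_seq; lia)).
          assert (Y := Rle_abs B). simpl in X. lra.
        - right. unfold dl. field. split; lra. }
      assert (E2 : rsum (fun n => if Nat.ltb n P then 0 else lzcoef_pp n * weight k 1 n) N <= eta).
      { replace N with (P + (N - P))%nat by (unfold N; lia). rewrite rsum_split.
        rewrite (rsum_ext _ (fun _ => 0) P).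
        2:{ intros n Hn. destruct (Nat.ltb_spec n P); [auto | lia]. }
        rewrite rsum_zero, Rplus_0_l.
        rewrite (rsum_ext _ (fun i => lzcoef_pp (P + i) * weight k 1 (P + i)%nat)).
        2:{ intros n Hn. destruct (Nat.ltb_spec (P + n) P); [lia | auto]. }
        apply (HP1 k P Hk). unfold P; lia. }
      lra. }
  assert (T3 : Cmod (model_sum P thf k sg N - model_sum P thf k sg Q)%C <= eta).
  { eapply Rle_trans; [apply model_sum_alt; auto|].
    - unfold P; lia.
    - lra.
    - unfold N; lia.
    - apply Rle_trans with (INR m); [now apply le_INR | apply HP3; unfold P in HQ; lia].
    - intros n Hn. unfold thf. destruct (Nat.ltb_spec n P); [lia|]. destruct (Nat.ltb_spec n Q); [lia | auto].
    - eapply Rle_trans; [apply (weight_sg_le k 1 sg); lra|]. apply HP2; auto. unfold P in HQ; lia. }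
  assert (T4 := Hj k Hk).
  assert (T5 := Hst k ltac:(lia)). rewrite Hmsf in T5.
  replace (logzeta_d k s - ga k)%C with ((logzeta_d k s - csum (dirichlet_term (dcoef lzcoef k) s) N) +
    ((csum (dirichlet_term (dcoef lzcoef k) s) N - model_sum P thf k sg N) + ((model_sum P thf k sg N - model_sum P thf k sg Q) +
     ((model_sum P thf k sg Q - model_sum P thf k 1 Q) - (ga k - model_sum P thf k 1 Q)))))%C by ring.
  eapply Rle_lt_trans; [apply Cmod_triangle|].
  eapply Rle_lt_trans; [apply Rplus_le_compat_l, Cmod_triangle|].
  eapply Rle_lt_trans; [apply Rplus_le_compat_l, Rplus_le_compat_l, Cmod_triangle|].
  eapply Rle_lt_trans; [apply Rplus_le_compat_l, Rplus_le_compat_l, Rplus_le_compat_l, Cmod_minus_le|].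
  lra.
Qed.

(** * Density of the values of zeta and its derivatives *)

(** Bounded real parts keep psi close to ln Im s, and Im s_i >= i ensures that every such sequence
    climbs to infinity. *)
Definition strip_seq (s : nat -> C) : Prop :=
  forall i, 1 < Re (s i) < 2 /\ INR i <= Im (s i).

Definition binom (n k : nat) : R := Binomial.C n k.

(** Leibniz's rule for zeta' = (log zeta)' zeta. The step differentiates the previous identity,
    valid near s, and uses uniqueness of derivatives and Pascal's rule. *)
Lemma zeta_d_leibniz k s : 1 < Re s ->
  zeta_d (S k) s = csum (fun i => RtoC (binom k i) * (logzeta_d (S i) s * zeta_d (k - i) s))%C (S k).
Proof.
  revert s. induction k as [|k IH]; intros s Hs.
  - simpl. unfold binom. replace (Binomial.C 0 0) with 1 by (unfold Binomial.C; simpl; field).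
    rewrite zeta_d_ode by auto. ring.
  - apply cder_unique with (zeta_d (S k)) s; [now apply cder_zeta_d|].
    apply cder_ext_loc with (fun w => csum (fun i => RtoC (binom k i) * (logzeta_d (S i) w * zeta_d (k - i) w))%C (S k)).
    { exists (Re s - 1). split; [lra|]. intros h Hh. symmetry. apply IH.
      assert (X := re_le_Cmod h). assert (Y := Rle_abs (- Re h)). rewrite Rabs_Ropp in Y.
      autorewrite with cri. lra. }
    eapply cder_eq; [|apply (cder_csum (fun i w => RtoC (binom k i) * (logzeta_d (S i) w * zeta_d (k - i) w))%C
      (fun i w => RtoC (binom k i) * (logzeta_d (S (S i)) w * zeta_d (k - i) w + logzeta_d (S i) w * zeta_d (S (k - i)) w))%C)].
    2:{ intros i. apply cder_scal. apply cder_mult; [now apply cder_logzeta_d | now apply cder_zeta_d]. }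
    set (a := fun i => (logzeta_d (S i) s * zeta_d (S k - i) s)%C).
    assert (E1 : csum (fun i => RtoC (binom k i) * (logzeta_d (S (S i)) s * zeta_d (k - i) s + logzeta_d (S i) s * zeta_d (S (k - i)) s))%C (S k) =
      (csum (fun i => RtoC (binom k i) * a (S i))%C (S k) + csum (fun i => RtoC (binom k i) * a i)%C (S k))%C).
    { rewrite <- csum_plus. apply csum_ext. intros i Hi. unfold a.
      replace (S k - S i)%nat with (k - i)%nat by lia.
      replace (S k - i)%nat with (S (k - i)) by lia. ring. }
    rewrite E1.
    assert (H0 : forall (f : nat -> C) n, csum f (S n) = (f 0%nat + csum (fun i => f (S i)) n)%C).
    { intros f n. change (S n) with (1 + n)%nat. rewrite csum_split. simpl. ring. }
    assert (Bnn : forall n, binom n n = 1).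
    { intros n. unfold binom, Binomial.C. rewrite Nat.sub_diag. simpl. field.
      apply INR_fact_neq_0. }
    assert (Bn0 : forall n, binom n 0 = 1).
    { intros n. unfold binom, Binomial.C. rewrite Nat.sub_0_r. simpl. field.
      apply INR_fact_neq_0. }
    rewrite (H0 (fun i => RtoC (binom (S k) i) * _)%C).
    rewrite (H0 (fun i => RtoC (binom k i) * a i)%C).
    change (csum (fun i => RtoC (binom k i) * a (S i))%C (S k)) with
      (csum (fun i => RtoC (binom k i) * a (S i))%C k + RtoC (binom k k) * a (S k))%C.
    change (csum (fun i => RtoC (binom (S k) (S i)) * (logzeta_d (S (S i)) s * zeta_d (S k - S i) s))%C (S k)) with
      (csum (fun i => RtoC (binom (S k) (S i)) * a (S i))%C k + RtoC (binom (S k) (S k)) * a (S k))%C.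
    rewrite !Bnn, !Bn0.
    assert (E2 : csum (fun i => RtoC (binom (S k) (S i)) * a (S i))%C k =
      (csum (fun i => RtoC (binom k i) * a (S i))%C k + csum (fun i => RtoC (binom k (S i)) * a (S i))%C k)%C).
    { rewrite <- csum_plus. apply csum_ext. intros i Hi. unfold binom. rewrite <- pascal by lia.
      rewrite RtoC_plus. ring. }
    rewrite E2. change (logzeta_d 1 s * zeta_d (S k - 0) s)%C with (a 0%nat). ring.
Qed.

Lemma Cexp_surj (b : C) : b <> RtoC 0 -> exists g, Cexp g = b.
Proof.
  intros Hb. assert (P := Cmod_pos b Hb).
  set (x := Re b / Cmod b). set (y := Im b / Cmod b).
  assert (Hxy : x * x + y * y = 1).
  { unfold x, y. assert (X := Cmod2_alt b). field_simplify; [|lra].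
    rewrite <- X. field. lra. }
  assert (Hx : -1 <= x <= 1) by (split; nra).
  assert (Hc : exists phi, cos phi = x /\ sin phi = y).
  { destruct (Rle_dec 0 y) as [Hy|Hy].
    - exists (acos x). split; [apply cos_acos; lra|].
      rewrite sin_acos by lra. replace (1 - x²) with (y * y) by (unfold Rsqr; lra). now apply sqrt_square.
    - exists (- acos x). rewrite cos_neg, sin_neg. split; [apply cos_acos; lra|].
      rewrite sin_acos by lra. replace (1 - x²) with ((- y) * (- y)) by (unfold Rsqr; lra).
      rewrite sqrt_square; lra. }
  destruct Hc as [phi [H1 H2]]. exists (ln (Cmod b), phi).
  unfold Cexp. apply C_eq_ReIm; unfold Re at 1, Im at 1; simpl.
  - change (Re (ln (Cmod b), phi)) with (ln (Cmod b)). change (Im (ln (Cmod b), phi)) with phi.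
    rewrite exp_ln, H1 by auto. unfold x. field. lra.
  - change (Re (ln (Cmod b), phi)) with (ln (Cmod b)). change (Im (ln (Cmod b), phi)) with phi.
    rewrite exp_ln, H2 by auto. unfold y. field. lra.
Qed.

(* Inverts the triangular map [(log zeta)^(i) -> zeta^(k)] given by [zeta_d_leibniz]. *)
Fixpoint leibniz_inverse (g0 : C) (b : nat -> C) (k : nat) : nat -> C :=
  match k with
  | O => fun _ => g0
  | S k => fun i => if Nat.eqb i (S k) then
      ((b (S k) - csum (fun i => RtoC (binom k i) * (leibniz_inverse g0 b k (S i) * b (k - i)%nat)) k) / b 0%nat)%C
      else leibniz_inverse g0 b k i
  end.

Lemma leibniz_inverse_stable g0 b k i : (i <= k)%nat -> leibniz_inverse g0 b k i = leibniz_inverse g0 b i i.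
Proof.
  induction k; intros H.
  - now replace i with 0%nat by lia.
  - destruct (Nat.eq_dec i (S k)) as [->|Hne]; auto.
    simpl. destruct (Nat.eqb_spec i (S k)); [lia|]. apply IHk; lia.
Qed.

(** Prescribing zeta and its derivatives amounts to prescribing log zeta and its derivatives, since
    [b 0] has a logarithm and may be divided by. Convergence is then carried back by strong
    induction on the order. *)
Lemma zeta_dense (m : nat) (b : nat -> C) : b 0%nat <> RtoC 0 ->
  exists s, strip_seq s /\ forall k, (k <= m)%nat -> clim (fun i => zeta_d k (s i)) (b k).
Proof.
  intros Hb. destruct (Cexp_surj (b 0%nat) Hb) as [g0 Hg0].
  set (ga := fun i => leibniz_inverse g0 b i i).
  assert (H : forall i, exists s, 1 < Re s < 2 /\ INR i <= Im s /\
    forall k, (k <= m)%nat -> Cmod (logzeta_d k s - ga k)%C < / (INR i + 1)).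
  { intros i. apply log_zeta_dense. apply Rinv_0_lt_compat. assert (X := pos_INR i). lra. }
  apply choice in H. destruct H as [s Hs]. exists s.
  split; [intros i; specialize (Hs i); tauto|].
  assert (Hr : forall i, 1 < Re (s i)) by (intros i; specialize (Hs i); lra).
  assert (L : forall k, (k <= m)%nat -> clim (fun i => logzeta_d k (s i)) (ga k)).
  { intros k Hk. apply clim_squeeze with (fun i => / (INR i + 1)).
    - exists 0%nat. intros i _. apply Rlt_le. now apply Hs.
    - apply is_lim_seq_ext with (fun i => / INR (S i)); [intros; now rewrite S_INR|].
      apply is_lim_seq_inv_INR. }
  intros k. induction k as [k IH] using (well_founded_induction Nat.lt_wf_0). intros Hk.
  destruct k as [|k].
  - rewrite <- Hg0. apply clim_ext with (fun i => Cexp (logzeta_d 0 (s i))).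
    + intros i. now rewrite zeta_d_exp.
    + apply (cder_cont Cexp _ _ _ (cder_Cexp _)). apply (L 0%nat Hk).
  - apply clim_ext with (fun j => csum (fun i => RtoC (binom k i) * (logzeta_d (S i) (s j) * zeta_d (k - i) (s j)))%C (S k)).
    { intros j. now rewrite zeta_d_leibniz. }
    assert (E : b (S k) = csum (fun i => RtoC (binom k i) * (ga (S i) * b (k - i)%nat))%C (S k)).
    { cbn [csum]. rewrite Nat.sub_diag. unfold binom at 2.
      replace (Binomial.C k k) with 1.
      2:{ unfold Binomial.C. rewrite Nat.sub_diag. simpl. field. apply INR_fact_neq_0. }
      unfold ga at 2. cbn [leibniz_inverse]. rewrite Nat.eqb_refl.
      rewrite (csum_ext (fun i => RtoC (binom k i) * (ga (S i) * b (k - i)%nat))%C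
        (fun i => RtoC (binom k i) * (leibniz_inverse g0 b k (S i) * b (k - i)%nat))%C).
      2:{ intros i Hi. unfold ga. rewrite (leibniz_inverse_stable g0 b k (S i)) by lia. reflexivity. }
      field. auto. }
    rewrite E.
    assert (K : forall n, (n <= S k)%nat -> clim (fun j => csum (fun i => RtoC (binom k i) * (logzeta_d (S i) (s j) * zeta_d (k - i) (s j)))%C n)
      (csum (fun i => RtoC (binom k i) * (ga (S i) * b (k - i)%nat))%C n)).
    { induction n; intros Hn; simpl; [apply clim_const|].
      apply clim_plus; [apply IHn; lia|]. apply clim_scal, clim_mult; [apply L; lia | apply IH; lia]. }
    apply K. lia.
Qed.

(** * Hasse's series *)

Lemma summable_ratio b N th : (forall n, 0 <= b n) -> 0 <= th < 1 ->
  (forall n, (N <= n)%nat -> b (S n) <= th * b n) -> summable b.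
Proof.
  intros Hb Hth H. exists (rsum b N + b N / (1 - th)).
  assert (K : forall d, rsum b (N + d) <= rsum b N + (b N - b (N + d)%nat) / (1 - th)).
  { induction d.
    - rewrite Nat.add_0_r. unfold Rdiv. rewrite Rminus_diag, Rmult_0_l. lra.
    - rewrite Nat.add_succ_r. simpl rsum. specialize (H (N + d)%nat ltac:(lia)).
      assert (E : b (N + d)%nat <= (b (N + d)%nat - b (S (N + d))) / (1 - th)).
      { apply Rmult_le_reg_r with (1 - th); [lra|]. unfold Rdiv.
        rewrite Rmult_assoc, Rinv_l by lra. lra. }
      unfold Rdiv in *. rewrite Rmult_minus_distr_r in *. lra. }
  intros M. apply Rle_trans with (rsum b (N + M)); [apply rsum_mono; auto; lia|].
  eapply Rle_trans; [apply K|]. apply Rplus_le_compat_l. apply Rmult_le_compat_r.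
  - apply Rlt_le, Rinv_0_lt_compat. lra.
  - specialize (Hb (N + M)%nat). lra.
Qed.

(* [rising_binom al j = al (al + 1) ... (al + j - 1) / j!], the coefficients of [(1 - z) ^ (- al)]. *)
Fixpoint rising_binom (al : C) (j : nat) : C :=
  match j with O => RtoC 1 | S j => (rising_binom al j * (al + RtoC (INR j)) / RtoC (INR (S j)))%C end.

Lemma INR_S_pos n : 0 < INR (S n).
Proof. apply lt_0_INR. lia. Qed.

Lemma INR_S_neq n : RtoC (INR (S n)) <> RtoC 0.
Proof. apply RtoC_neq0. assert (X := INR_S_pos n). lra. Qed.

Lemma rising_binom_rec al j : rising_binom al (S j) = (rising_binom al j * (al + RtoC (INR j)) / RtoC (INR (S j)))%C.
Proof. reflexivity. Qed.

Lemma rising_binom_S al j : (RtoC (INR (S j)) * rising_binom al (S j))%C = (rising_binom al j * (al + RtoC (INR j)))%C.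
Proof. rewrite rising_binom_rec. field. apply INR_S_neq. Qed.

(** The absorption identity: a factor j is traded for raising the parameter by 1. It turns the
    exponent s - 1 of Hasse's series into the s of zeta. *)
Lemma rising_binom_shift al j : (RtoC (INR (S j)) * rising_binom al (S j))%C = (al * rising_binom (al + 1) j)%C.
Proof.
  induction j.
  - simpl. field.
  - rewrite rising_binom_S.
    assert (N := INR_S_neq j).
    assert (E : rising_binom al (S j) = (al * rising_binom (al + 1) j / RtoC (INR (S j)))%C) by (rewrite <- IHj; field; auto).
    rewrite E. rewrite !rising_binom_rec. rewrite S_INR, RtoC_plus in *. field. auto.
Qed.

(** The extra factor (j + 1)^2 leaves room for differentiating the binomial series twice. *)
Lemma rising_binom_summable al rho : 0 < rho < 1 ->
  summable (fun j => Cmod (rising_binom al j) * (INR (S j) * INR (S j)) * rho ^ j).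
Proof.
  intros Hr.
  set (A := Cmod al).
  (* With x = 1/(n + 1), F(x) bounds the ratio of consecutive terms and tends to rho < 1. *)
  set (F := fun x => rho * ((1 + A * x) * ((1 + x) * (1 + x)))).
  assert (L : is_lim_seq (fun n => F (/ INR (S n))) (F 0)).
  { apply is_lim_seq_continuous; [|apply is_lim_seq_inv_INR]. unfold F.
    apply derivable_continuous_pt. reg. }
  replace (F 0) with rho in L by (unfold F; ring).
  rewrite is_lim_seq_eps in L. destruct (L ((1 - rho) / 2)) as [N HN]; [lra|].
  apply summable_ratio with N ((1 + rho) / 2); [| lra |].
  - intros n. apply Rmult_le_pos; [|apply pow_le; lra].
    apply Rmult_le_pos; [apply Cmod_ge_0|]. assert (X := INR_S_pos n). nra.
  - intros n Hn. specialize (HN n Hn). apply Rabs_def2 in HN.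
    assert (P := INR_S_pos n). assert (P0 := pos_INR n).
    set (x := / INR (S n)) in *.
    assert (Px : 0 < x) by (unfold x; now apply Rinv_0_lt_compat).
    assert (B1 : Cmod (rising_binom al (S n)) <= Cmod (rising_binom al n) * (1 + A * x)).
    { rewrite !rising_binom_rec. rewrite Cmod_div, Cmod_mult, Cmod_RtoC_pos by (apply INR_S_neq || lra).
      unfold Rdiv. rewrite Rmult_assoc. apply Rmult_le_compat_l; [apply Cmod_ge_0|].
      apply Rle_trans with ((A + INR n) * / INR (S n)).
      - apply Rmult_le_compat_r; [now apply Rlt_le|].
        eapply Rle_trans; [apply Cmod_triangle|]. rewrite Cmod_RtoC_pos by auto. unfold A. lra.
      - fold x. rewrite Rmult_plus_distr_r.
        assert (INR n * x <= 1).
        { unfold x. apply Rmult_le_reg_r with (INR (S n)); auto.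
          rewrite Rmult_assoc, Rinv_l by lra. rewrite S_INR. lra. }
        lra. }
    assert (B2 : INR (S (S n)) = INR (S n) * (1 + x)) by (rewrite (S_INR (S n)); unfold x; field; lra).
    rewrite B2. simpl pow.
    assert (PA : 0 <= A) by apply Cmod_ge_0.
    assert (P1 : 0 <= INR (S n) * (1 + x) * (INR (S n) * (1 + x)) * (rho * rho ^ n)).
    { apply Rmult_le_pos; [nra|]. apply Rmult_le_pos; [lra | apply pow_le; lra]. }
    apply Rle_trans with (Cmod (rising_binom al n) * (1 + A * x) * (INR (S n) * (1 + x) * (INR (S n) * (1 + x))) * (rho * rho ^ n)).
    { rewrite !(Rmult_assoc _ _ (rho * rho ^ n)). rewrite <- !(Rmult_assoc _ _ (rho * rho ^ n)).
      rewrite (Rmult_assoc (Cmod (rising_binom al (S n)))), (Rmult_assoc (Cmod (rising_binom al n) * (1 + A * x))).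
      now apply Rmult_le_compat_r. }
    replace (Cmod (rising_binom al n) * (1 + A * x) * (INR (S n) * (1 + x) * (INR (S n) * (1 + x))) * (rho * rho ^ n))
      with (F x * (Cmod (rising_binom al n) * (INR (S n) * INR (S n)) * rho ^ n)) by (unfold F; ring).
    apply Rmult_le_compat_r; [|lra].
    apply Rmult_le_pos; [|apply pow_le; lra]. apply Rmult_le_pos; [apply Cmod_ge_0 | nra].
Qed.

Lemma rising_binom_summable0 al rho : 0 <= rho < 1 -> summable (fun j => Cmod (rising_binom al j) * rho ^ j).
Proof.
  intros Hr. apply summable_le with (2 := rising_binom_summable al ((1 + rho) / 2) ltac:(lra)).
  intros j. rewrite Rmult_assoc. apply Rmult_le_compat_l; [apply Cmod_ge_0|].
  assert (X : 1 <= INR (S j)) by (apply INR_ge1; lia).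
  assert (Y : 0 <= rho ^ j) by (apply pow_le; lra).
  assert (W : rho ^ j <= ((1 + rho) / 2) ^ j) by (apply pow_incr; lra).
  assert (X2 : 1 <= INR (S j) * INR (S j)) by nra.
  apply Rle_trans with (1 * ((1 + rho) / 2) ^ j); [lra|]. apply Rmult_le_compat_r; lra.
Qed.

Definition binom_series (al z : C) : C := Cser (fun j => rising_binom al j * z ^ j)%C.

Lemma binom_series_cv al z : Cmod z < 1 -> clim (csum (fun j => rising_binom al j * z ^ j)%C) (binom_series al z).
Proof.
  intros Hz. apply Cser_cv with (fun j => Cmod (rising_binom al j) * Cmod z ^ j).
  - intros j. rewrite Cmod_mult, Cmod_pow. lra.
  - apply rising_binom_summable0. split; [apply Cmod_ge_0 | auto].
Qed.

Lemma cder_zpow z k : cder (fun w => w ^ k)%C z (RtoC (INR k) * z ^ (pred k))%C.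
Proof.
  apply cder_eq with (RtoC (INR k) * z ^ (pred k) * 1)%C; [ring|].
  apply (cder_pow (fun w => w)), cder_id.
Qed.

Lemma cder_binom_series al z : Cmod z < 1 ->
  cder (binom_series al) z (Cser (fun j => rising_binom al j * (RtoC (INR j) * z ^ pred j))%C) /\
  clim (csum (fun j => rising_binom al j * (RtoC (INR j) * z ^ pred j))%C)
    (Cser (fun j => rising_binom al j * (RtoC (INR j) * z ^ pred j))%C).
Proof.
  intros Hz. assert (Hz0 := Cmod_ge_0 z).
  set (r := (1 - Cmod z) / 2). set (rho := (1 + Cmod z) / 2).
  assert (Hrho : 0 < rho < 1) by (unfold rho; lra).
  assert (Hb : forall w, Cmod (w - z)%C < r -> Cmod w <= rho).
  { intros w Hw. assert (X := Cmod_rev w z). unfold rho, r in *. lra. }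
  destruct (rising_binom_summable al rho Hrho) as [M HM].
  (* Two differentiations lower the exponent by at most 2, even with truncation at 0, so a division
     by rho^2 covers every case. *)
  assert (Hpp : forall x j, 0 <= x <= rho -> x ^ pred j <= rho ^ j / (rho * rho) /\ x ^ pred (pred j) <= rho ^ j / (rho * rho)).
  { intros x j Hx.
    assert (K : forall i, (i <= j)%nat -> (j <= i + 2)%nat -> rho ^ i <= rho ^ j / (rho * rho)).
    { intros i H1 H2. apply Rmult_le_reg_r with (rho * rho); [nra|].
      unfold Rdiv. rewrite Rmult_assoc, Rinv_l, Rmult_1_r by nra.
      replace (rho ^ j) with (rho ^ i * rho ^ (j - i)) by (rewrite <- pow_add; f_equal; lia).
      apply Rmult_le_compat_l; [apply pow_le; lra|].
      assert (X : (j - i = 0 \/ j - i = 1 \/ j - i = 2)%nat) by lia.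
      destruct X as [-> | [-> | ->]]; simpl pow; nra. }
    split; (eapply Rle_trans; [apply pow_incr; split; [|apply Hx]; lra|]); apply K; lia. }
  assert (S1 : forall w, Cmod w <= rho -> forall j, Cmod (rising_binom al j * (RtoC (INR j) * w ^ pred j))%C <=
    / (rho * rho) * (Cmod (rising_binom al j) * (INR (S j) * INR (S j)) * rho ^ j)).
  { intros w Hw j. rewrite !Cmod_mult, Cmod_pow, Cmod_RtoC_pos by apply pos_INR.
    destruct (Hpp (Cmod w) j) as [H1 _]; [split; [apply Cmod_ge_0|auto]|].
    assert (P0 := pos_INR j). assert (P1 := Cmod_ge_0 (rising_binom al j)).
    assert (P2 : 0 <= Cmod w ^ pred j) by (apply pow_le, Cmod_ge_0).
    replace (/ (rho * rho) * (Cmod (rising_binom al j) * (INR (S j) * INR (S j)) * rho ^ j)) with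
      (Cmod (rising_binom al j) * ((INR (S j) * INR (S j)) * (rho ^ j / (rho * rho)))) by (field; lra).
    apply Rmult_le_compat_l; auto. apply Rmult_le_compat; auto. rewrite S_INR. nra. }
  assert (Sm : summable (fun j => / (rho * rho) * (Cmod (rising_binom al j) * (INR (S j) * INR (S j)) * rho ^ j))).
  { apply summable_scal; [|now exists M]. apply Rlt_le, Rinv_0_lt_compat. nra. }
  assert (Hzr : Cmod z <= rho) by (unfold rho; lra).
  assert (CV : clim (csum (fun j => rising_binom al j * (RtoC (INR j) * z ^ pred j))%C)
    (Cser (fun j => rising_binom al j * (RtoC (INR j) * z ^ pred j))%C)).
  { apply Cser_cv with (2 := Sm). apply S1. auto. }
  split; auto.
  apply (cder_lim (fun N w => csum (fun j => rising_binom al j * w ^ j)%C N)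
    (fun N w => csum (fun j => rising_binom al j * (RtoC (INR j) * w ^ pred j))%C N)
    (fun N w => csum (fun j => rising_binom al j * (RtoC (INR j) * (RtoC (INR (pred j)) * w ^ pred (pred j))))%C N))
    with (r := r) (M := / (rho * rho) * M); auto.
  - unfold r; lra.
  - intros N w Hw. split; [|split].
    + apply (cder_csum (fun j w => rising_binom al j * w ^ j)%C (fun j w => rising_binom al j * (RtoC (INR j) * w ^ pred j))%C).
      intros j. apply cder_scal, cder_zpow.
    + apply (cder_csum (fun j w => rising_binom al j * (RtoC (INR j) * w ^ pred j))%C
        (fun j w => rising_binom al j * (RtoC (INR j) * (RtoC (INR (pred j)) * w ^ pred (pred j))))%C).
      intros j. apply cder_scal, cder_scal, cder_zpow.
    + eapply Rle_trans; [apply Cmod_csum|].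
      apply Rle_trans with (/ (rho * rho) * rsum (fun j => Cmod (rising_binom al j) * (INR (S j) * INR (S j)) * rho ^ j) N).
      * rewrite <- rsum_scal. apply rsum_le. intros j _.
        rewrite !Cmod_mult, Cmod_pow, !Cmod_RtoC_pos by apply pos_INR.
        destruct (Hpp (Cmod w) j) as [_ H1]; [split; [apply Cmod_ge_0|auto]|].
        assert (P0 := pos_INR j). assert (P1 := Cmod_ge_0 (rising_binom al j)).
        assert (P2 : 0 <= Cmod w ^ pred (pred j)) by (apply pow_le, Cmod_ge_0).
        assert (P3 : 0 <= INR (pred j) <= INR (S j)) by (split; [apply pos_INR | apply le_INR; lia]).
        assert (P4 : INR j <= INR (S j)) by (apply le_INR; lia).
        replace (/ (rho * rho) * (Cmod (rising_binom al j) * (INR (S j) * INR (S j)) * rho ^ j)) with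
          (Cmod (rising_binom al j) * (INR (S j) * (INR (S j) * (rho ^ j / (rho * rho))))) by (field; lra).
        apply Rmult_le_compat_l; auto. apply Rmult_le_compat; auto; [nra|].
        apply Rmult_le_compat; auto; lra.
      * apply Rmult_le_compat_l; auto. apply Rlt_le, Rinv_0_lt_compat. nra.
  - intros w Hw. apply binom_series_cv. specialize (Hb w Hw). lra.
Qed.

Lemma csum_head (f : nat -> C) n : csum f (S n) = (f 0%nat + csum (fun i => f (S i)) n)%C.
Proof. change (S n) with (1 + n)%nat. rewrite csum_split. simpl. ring. Qed.

(** The equation (1 - z) f' = al f of f = (1 - z)^(- al), read off from the recursion of the
    coefficients. *)
Lemma binom_series_ode al z : Cmod z < 1 ->
  ((1 - z) * Cser (fun j => rising_binom al j * (RtoC (INR j) * z ^ pred j)))%C = (al * binom_series al z)%C.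
Proof.
  intros Hz. destruct (cder_binom_series al z Hz) as [_ CV].
  set (d := fun j => (rising_binom al j * (RtoC (INR j) * z ^ pred j))%C) in *.
  apply clim_unique with (fun N => csum (fun j => d (S j) - z * d j)%C N).
  - apply clim_ext with (fun N => csum d (S N) - z * csum d N)%C.
    + intros N. rewrite csum_minus, csum_scal, csum_head. f_equal.
      unfold d at 1. simpl. ring.
    + replace ((1 - z) * Cser d)%C with (Cser d - z * Cser d)%C by ring.
      apply clim_minus; [now apply clim_incr_1 in CV | now apply clim_scal].
  - apply clim_ext with (fun N => al * csum (fun j => rising_binom al j * z ^ j) N)%C.
    + intros N. rewrite <- csum_scal. apply csum_ext. intros j _. unfold d. simpl pred.
      assert (E : (z * z ^ pred j * RtoC (INR j))%C = (RtoC (INR j) * z ^ j)%C).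
      { destruct j; simpl; [ring | ring]. }
      transitivity ((RtoC (INR (S j)) * rising_binom al (S j)) * z ^ j - rising_binom al j * (z * z ^ pred j * RtoC (INR j)))%C; [|ring].
      rewrite rising_binom_S, E. ring.
    + now apply clim_scal, binom_series_cv.
Qed.

Lemma exp_lt_1 x : 0 < x -> exp (- x) < 1.
Proof. intros H. rewrite <- exp_0. apply exp_increasing. lra. Qed.

(* The derivative of [w => binom_series al (1 - exp (-w)) * exp (- al w)] vanishes. *)
Lemma binom_series_exp al (w : R) : 0 <= w -> binom_series al (RtoC (1 - exp (- w))) = Cexp (al * RtoC w)%C.
Proof.
  intros Hw.
  set (f := fun v : C => (binom_series al (1 - Cexp (- v)) * Cexp (- al * v))%C).
  assert (Hreal : forall x, 0 <= x -> Cmod (1 - Cexp (- RtoC x))%C < 1).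
  { intros x Hx. rewrite <- RtoC_opp, Cexp_R, <- RtoC_minus, Cmod_R.
    assert (P := exp_pos (- x)). assert (P2 : exp (- x) <= 1) by (rewrite <- exp_0; apply exp_le; lra).
    rewrite Rabs_pos_eq; lra. }
  assert (E : f (0 + RtoC w)%C = f 0).
  { assert (X := cder_mvt f (fun _ => RtoC 0) 0 (RtoC w) 0).
    assert (Y : Cmod (f (0 + RtoC w)%C - f 0)%C <= 0 * Cmod (RtoC w)).
    { apply X. intros x Hx. rewrite Cmod_0. split; [|lra].
      replace (0 + RtoC x * RtoC w)%C with (RtoC (x * w)) by (rewrite RtoC_mult; ring).
      set (v := RtoC (x * w)).
      assert (Hv : Cmod (1 - Cexp (- v))%C < 1) by (apply Hreal; nra).
      destruct (cder_binom_series al _ Hv) as [D1 _].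
      set (d := Cser (fun j => rising_binom al j * (RtoC (INR j) * (1 - Cexp (- v)) ^ pred j))%C) in *.
      assert (D0 : cder (fun v => 1 - Cexp (- v))%C v (Cexp (- v))).
      { apply cder_eq with (0 - (- (1)) * Cexp (- v))%C; [ring|].
        apply cder_minus; [apply cder_const|].
        apply (cder_comp (fun v => - v)%C Cexp); [|apply cder_Cexp].
        apply (cder_opp (fun v => v)), cder_id. }
      assert (D2 : cder (fun v => Cexp (- al * v))%C v (- al * Cexp (- al * v))%C).
      { apply (cder_comp (fun v => - al * v)%C Cexp); [|apply cder_Cexp].
        apply cder_eq with (- al * 1)%C; [ring|]. apply cder_scal, cder_id. }
      eapply cder_eq; [|apply (cder_mult _ _ _ _ _ (cder_comp _ _ _ _ _ D0 D1) D2)].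
      assert (O := binom_series_ode al _ Hv). fold d in O.
      replace (Cexp (- v) * d * Cexp (- al * v) + binom_series al (1 - Cexp (- v)) * (- al * Cexp (- al * v)))%C
        with (((1 - (1 - Cexp (- v))) * d - al * binom_series al (1 - Cexp (- v))) * Cexp (- al * v))%C by ring.
      rewrite O. ring. }
    rewrite Rmult_0_l in Y. assert (W := Cmod_ge_0 (f (0 + RtoC w)%C - f 0)%C).
    assert (E0 : (f (0 + RtoC w)%C - f 0)%C = 0) by (apply Cmod_eq_0; lra).
    replace (f (0 + RtoC w)%C) with (f (0 + RtoC w)%C - f 0 + f 0)%C by ring. rewrite E0. ring. }
  replace (0 + RtoC w)%C with (RtoC w) in E by ring.
  assert (F0 : f 0 = 1).
  { unfold f. replace (- 0)%C with (RtoC 0) by ring. replace (- al * 0)%C with (RtoC 0) by ring.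
    rewrite Cexp_0. replace (1 - 1)%C with (RtoC 0) by ring. rewrite Cmult_1_r.
    unfold binom_series. apply Cser_eq. apply clim_incr_1.
    apply clim_ext with (fun _ => RtoC 1); [|apply clim_const].
    intros n. rewrite csum_head. rewrite (csum_ext _ (fun _ => RtoC 0)); [rewrite csum_0; simpl; ring|].
    intros i _. simpl. ring. }
  rewrite F0 in E. unfold f in E.
  replace (1 - Cexp (- RtoC w))%C with (RtoC (1 - exp (- w))) in E
    by (rewrite <- RtoC_opp, Cexp_R, RtoC_minus; reflexivity).
  replace (- al * RtoC w)%C with (- (al * RtoC w))%C in E by ring.
  rewrite Cexp_opp in E. assert (NZ := Cexp_neq0 (al * RtoC w)%C).
  replace (binom_series al (RtoC (1 - exp (- w)))) with
    (binom_series al (RtoC (1 - exp (- w))) * / Cexp (al * RtoC w) * Cexp (al * RtoC w))%C by (field; auto).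
  rewrite E. ring.
Qed.

Lemma binom_series_val al y : 0 <= y < 1 -> binom_series al (RtoC y) = Cexp (- al * RtoC (ln (1 - y)))%C.
Proof.
  intros Hy.
  assert (L : ln (1 - y) <= 0) by (rewrite <- ln_1; apply ln_le; lra).
  replace y with (1 - exp (- (- ln (1 - y)))) at 1.
  - rewrite binom_series_exp by lra. f_equal. rewrite RtoC_opp. ring.
  - rewrite Ropp_involutive, exp_ln by lra. ring.
Qed.

(** With a = Re al and tau = Im al, |al + j| exceeds a + j by a factor at most exp(tau^2 / (a +
    j)^2), and the product of these factors converges. Complex parameters are thus reduced to
    positive ones. *)
Lemma rising_binom_dominated (al : C) : 0 < Re al ->
  exists K, 0 < K /\ forall j, Cmod (rising_binom al j) <= K * Cmod (rising_binom (RtoC (Re al)) j).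
Proof.
  intros Ha. set (a := Re al) in *. set (tau := Im al).
  destruct (p_series 2 ltac:(lra)) as [B HB].
  set (E := fun j => rsum (fun i => tau * tau * / ((a + INR i) * (a + INR i))) j).
  assert (K : forall j, Cmod (rising_binom al j) <= exp (E j) * Cmod (rising_binom (RtoC a) j)).
  { induction j.
    - simpl. unfold E; simpl. rewrite exp_0. lra.
    - rewrite !rising_binom_rec. assert (P := INR_S_pos j). assert (P0 := pos_INR j).
      rewrite !Cmod_div by apply INR_S_neq. rewrite !Cmod_mult, !(Cmod_RtoC_pos (INR (S j))) by lra.
      unfold E; simpl rsum. fold (E j). rewrite exp_plus.
      rewrite <- RtoC_plus, (Cmod_RtoC_pos (a + INR j)) by lra.
      assert (Q : Cmod (al + RtoC (INR j))%C <= exp (tau * tau * / ((a + INR j) * (a + INR j))) * (a + INR j)).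
      { apply Rsqr_incr_0_var.
        2:{ apply Rmult_le_pos; [apply Rlt_le, exp_pos | lra]. }
        assert (S := Cmod2_alt (al + RtoC (INR j))%C). autorewrite with cri in S. fold a in S. fold tau in S.
        set (d := (a + INR j) * (a + INR j)). assert (Pd : 0 < d) by (unfold d; nra).
        assert (X := exp_ge_1p (tau * tau * / d)).
        assert (Y : 0 <= tau * tau * / d) by (apply Rmult_le_pos; [nra | apply Rlt_le, Rinv_0_lt_compat; auto]).
        set (e := exp (tau * tau * / d)) in *.
        unfold Rsqr. replace (Cmod (al + RtoC (INR j))%C * Cmod (al + RtoC (INR j))%C) with
          (d * (1 + tau * tau * / d)).
        - replace (e * (a + INR j) * (e * (a + INR j))) with (d * (e * e)) by (unfold d; ring).
          apply Rmult_le_compat_l; nra.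
        - transitivity (Cmod (al + RtoC (INR j))%C ^ 2); [|ring]. rewrite S.
          replace ((a + INR j) ^ 2) with d by (unfold d; ring). field. lra. }
      unfold Rdiv.
      replace (exp (E j) * exp (tau * tau * / ((a + INR j) * (a + INR j))) * (Cmod (rising_binom a j) * (a + INR j) * / INR (S j)))
        with ((exp (E j) * Cmod (rising_binom a j)) * (exp (tau * tau * / ((a + INR j) * (a + INR j))) * (a + INR j)) * / INR (S j)) by ring.
      apply Rmult_le_compat_r; [apply Rlt_le, Rinv_0_lt_compat; auto|].
      apply Rmult_le_compat; auto; apply Cmod_ge_0. }
  exists (exp (tau * tau * (/ (a * a) + B))). split; [apply exp_pos|]. intros j.
  eapply Rle_trans; [apply K|]. apply Rmult_le_compat_r; [apply Cmod_ge_0|]. apply exp_le.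
  unfold E. rewrite (rsum_scal (tau * tau)). apply Rmult_le_compat_l; [nra|].
  apply Rle_trans with (rsum (fun i => (if Nat.eqb i 0 then / (a * a) else 0) + exp (- (2) * lnN i)) j).
  - apply rsum_le. intros i _. destruct i as [|i].
    + replace (a + INR 0) with a by (simpl; ring). cbn [Nat.eqb].
      assert (X := exp_pos (- (2) * lnN 0)). lra.
    + simpl Nat.eqb. cbv iota. rewrite Rplus_0_l.
      replace (- (2) * lnN (S i)) with (- lnN (S i) + - lnN (S i)) by ring.
      rewrite exp_plus, exp_Ropp. unfold lnN. assert (P := INR_S_pos i). rewrite exp_ln by auto.
      rewrite <- Rinv_mult. apply Rinv_le_contravar; nra.
  - rewrite rsum_plus. apply Rplus_le_compat; [|apply HB].
    assert (P : 0 < / (a * a)) by (apply Rinv_0_lt_compat; nra).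
    destruct j; [simpl; lra|].
    apply Rle_trans with (rsum (fun i => if Nat.eqb i 0 then / (a * a) else 0) 1 + 0); [|simpl; lra].
    change (S j) with (1 + j)%nat. rewrite rsum_split. apply Rplus_le_compat_l.
    rewrite (rsum_ext _ (fun _ => 0)); [right; clear; induction j; simpl; lra|]. intros; reflexivity.
Qed.

Lemma rising_binom_real_sum a y N : 0 < a -> 0 <= y < 1 ->
  rsum (fun j => Cmod (rising_binom (RtoC a) j) * y ^ j) N <= exp (- a * ln (1 - y)).
Proof.
  intros Ha Hy.
  assert (R : forall j, rising_binom (RtoC a) j = RtoC (Cmod (rising_binom (RtoC a) j))).
  { assert (Q : forall j, exists x, 0 <= x /\ rising_binom (RtoC a) j = RtoC x).
    { induction j as [|j [x [Hx E]]]; [exists 1; split; [lra | reflexivity]|].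
      exists (x * (a + INR j) / INR (S j)). assert (P := INR_S_pos j). assert (P0 := pos_INR j). split.
      - apply Rmult_le_pos; [nra | apply Rlt_le, Rinv_0_lt_compat; auto].
      - rewrite !rising_binom_rec. rewrite E, <- RtoC_plus, <- RtoC_mult. unfold Cdiv. rewrite <- RtoC_inv by lra.
        rewrite <- RtoC_mult. reflexivity. }
    intros j. destruct (Q j) as [x [Hx E]]. rewrite E. f_equal. now rewrite Cmod_RtoC_pos. }
  assert (L := clim_Re _ _ (binom_series_cv (RtoC a) (RtoC y) ltac:(rewrite Cmod_RtoC_pos; lra))).
  rewrite binom_series_val in L by auto.
  replace (- RtoC a * RtoC (ln (1 - y)))%C with (RtoC (- a * ln (1 - y))) in L
    by (rewrite RtoC_mult, RtoC_opp; reflexivity).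
  rewrite Cexp_R, Re_RtoC in L.
  assert (E : forall M, Re (csum (fun j => rising_binom (RtoC a) j * RtoC y ^ j)%C M) = rsum (fun j => Cmod (rising_binom (RtoC a) j) * y ^ j) M).
  { induction M; [reflexivity|]. simpl csum. rewrite Re_plus, IHM. simpl rsum. f_equal.
    rewrite R at 1. rewrite <- RtoC_pow, <- RtoC_mult. reflexivity. }
  apply is_lim_seq_ext with (1 := E) in L.
  apply (is_lim_seq_incr_compare _ _ L). intros n. simpl.
  assert (0 <= Cmod (rising_binom a n) * y ^ n) by (apply Rmult_le_pos; [apply Cmod_ge_0 | apply pow_le; lra]). lra.
Qed.

(* The partial sums of [- ln (1 - y) / y = sum y ^ n / (n + 1)] with [y = 1 - exp (- 2 v)]. *)
Lemma log_series_error v N : 0 < v -> (1 <= N)%nat ->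
  Rabs (rsum (fun n => (1 - exp (- (2 * v))) ^ n / INR (S n)) N - 2 * v / (1 - exp (- (2 * v)))) <=
  exp v / sqrt (INR N).
Proof.
  intros Hv HN.
  assert (PN : 0 < INR N) by (apply lt_0_INR; lia).
  assert (PsN : 0 < sqrt (INR N)) by now apply sqrt_lt_R0.
  (* The remainder of the logarithmic series in y = 1 - exp(-2x); its derivative collapses to 2
     y^N. *)
  set (phi := fun x => 2 * x - rsum (fun n => (1 - exp (- (2 * x))) ^ (S n) / INR (S n)) N).
  assert (Dphi : forall x, derivable_pt_lim phi x (2 * (1 - exp (- (2 * x))) ^ N)).
  { intros x.
    assert (K : forall M, derivable_pt_lim (fun x => rsum (fun n => (1 - exp (- (2 * x))) ^ (S n) / INR (S n)) M) x
      (2 * (1 - (1 - exp (- (2 * x))) ^ M))).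
    { induction M.
      - simpl. replace (2 * (1 - 1)) with 0 by ring. apply derivable_pt_lim_const.
      - simpl rsum. replace (2 * (1 - (1 - exp (- (2 * x))) ^ S M)) with
          (2 * (1 - (1 - exp (- (2 * x))) ^ M) + 2 * exp (- (2 * x)) * (1 - exp (- (2 * x))) ^ M) by (simpl pow; ring).
        apply (derivable_pt_lim_plus _ (fun x => (1 - exp (- (2 * x))) ^ S M / INR (S M))); auto.
        apply is_derive_Reals. assert (P := INR_S_pos M).
        auto_derive; auto.
        change (match M with 0%nat => 1 | S _ => INR M + 1 end) with (INR (S M)).
        unfold Rminus. revert P. generalize (INR (S M)). intros w P. field. lra. }
    unfold phi. replace (2 * (1 - exp (- (2 * x))) ^ N) with (2 - 2 * (1 - (1 - exp (- (2 * x))) ^ N)) by ring.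
    apply (derivable_pt_lim_minus (fun x => 2 * x)); auto.
    apply is_derive_Reals. auto_derive; auto. ring. }
  (* The majorant 2 sinh x / sqrt N, chosen because its derivative exceeds 2 y^N and dividing it by
     y gives exactly exp x / sqrt N. *)
  set (psi := fun x => (exp x - exp (- x)) / sqrt (INR N)).
  assert (Dpsi : forall x, derivable_pt_lim psi x ((exp x + exp (- x)) / sqrt (INR N))).
  { intros x. apply is_derive_Reals. unfold psi. auto_derive; auto. unfold Rdiv. ring. }
  assert (Hy : forall x, 0 <= x -> 0 <= 1 - exp (- (2 * x)) < 1).
  { intros x Hx. assert (P := exp_pos (- (2 * x))).
    assert (exp (- (2 * x)) <= 1) by (rewrite <- exp_0; apply exp_le; lra). lra. }
  assert (B0 : 0 <= phi v).
  { destruct (MVT_cor2 phi (fun x => 2 * (1 - exp (- (2 * x))) ^ N) 0 v Hv) as [c [E Hc]]; [intros; apply Dphi|].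
    assert (Z0 : phi 0 = 0).
    { unfold phi. replace (- (2 * 0)) with 0 by ring. rewrite exp_0.
      rewrite (rsum_ext _ (fun _ => 0)).
      - assert (R0 : forall n, rsum (fun _ => 0) n = 0) by (induction n; simpl; lra). rewrite R0. ring.
      - intros n _. replace (1 - 1) with 0 by ring. simpl pow. rewrite Rmult_0_l. unfold Rdiv. ring. }
    rewrite Z0 in E. assert (P := pow_le _ N (proj1 (Hy c ltac:(lra)))). nra. }
  assert (B1 : phi v <= psi v).
  { destruct (MVT_cor2 (fun x => psi x - phi x) (fun x => (exp x + exp (- x)) / sqrt (INR N) - 2 * (1 - exp (- (2 * x))) ^ N) 0 v Hv)
      as [c [E Hc]]; [intros c _; now apply (derivable_pt_lim_minus psi phi)|].
    assert (Z0 : phi 0 = 0).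
    { unfold phi. replace (- (2 * 0)) with 0 by ring. rewrite exp_0.
      rewrite (rsum_ext _ (fun _ => 0)).
      - assert (R0 : forall n, rsum (fun _ => 0) n = 0) by (induction n; simpl; lra). rewrite R0. ring.
      - intros n _. replace (1 - 1) with 0 by ring. simpl pow. rewrite Rmult_0_l. unfold Rdiv. ring. }
    assert (Z1 : psi 0 = 0) by (unfold psi; rewrite Ropp_0; unfold Rdiv; ring).
    rewrite Z0, Z1 in E.
    assert (Q : 2 * (1 - exp (- (2 * c))) ^ N <= (exp c + exp (- c)) / sqrt (INR N)).
    { apply Rle_trans with (exp c / sqrt (INR N)).
      2:{ apply Rmult_le_compat_r; [apply Rlt_le, Rinv_0_lt_compat; auto|]. assert (P := exp_pos (- c)). lra. }
      (* The power y^N is at most exp(-x), and 2 sqrt x <= 1 + x <= exp x; solving for exp(-x)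
         produces the factor 1 / sqrt N. *)
      set (x := INR N * exp (- (2 * c))).
      assert (U1 : (1 - exp (- (2 * c))) ^ N <= exp (- x)).
      { apply Rle_trans with (exp (- exp (- (2 * c))) ^ N).
        - apply pow_incr. split; [apply Hy; lra|]. assert (W := exp_ge_1p (- exp (- (2 * c)))). lra.
        - rewrite exp_pow_INR. right. f_equal. unfold x. ring. }
      apply Rle_trans with (2 * exp (- x)); [lra|].
      apply Rmult_le_reg_r with (sqrt (INR N)); auto. unfold Rdiv. rewrite (Rmult_assoc (exp c)), Rinv_l, Rmult_1_r by lra.
      assert (Ex : sqrt (INR N) = exp c * (sqrt (INR N) * exp (- c))).
      { rewrite (Rmult_comm (sqrt _)), <- Rmult_assoc, <- exp_plus. replace (c + - c) with 0 by ring. rewrite exp_0. ring. }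
      rewrite Ex. set (u := sqrt (INR N) * exp (- c)).
      assert (Hu : u * u = x).
      { unfold u, x. replace (- (2 * c)) with (- c + - c) by ring. rewrite exp_plus.
        replace (sqrt (INR N) * exp (- c) * (sqrt (INR N) * exp (- c))) with
          ((sqrt (INR N) * sqrt (INR N)) * (exp (- c) * exp (- c))) by ring.
        rewrite sqrt_sqrt by lra. ring. }
      assert (V : 2 * u <= exp x).
      { assert (W := exp_ge_1p x). assert (W2 := Rle_0_sqr (u - 1)). unfold Rsqr in W2.
        rewrite <- Hu in W at 1. lra. }
      rewrite exp_Ropp. assert (Px := exp_pos x). assert (Pc := exp_pos c).
      apply Rmult_le_reg_r with (exp x); auto.
      replace (2 * / exp x * (exp c * u) * exp x) with (exp c * (2 * u)) by (field; lra).
      apply Rmult_le_compat_l; lra. }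
    nra. }
  assert (Py : 0 < 1 - exp (- (2 * v))) by (assert (W := exp_lt_1 (2 * v) ltac:(lra)); lra).
  set (y := 1 - exp (- (2 * v))) in *.
  assert (E : rsum (fun n => y ^ n / INR (S n)) N - 2 * v / y = - (phi v / y)).
  { unfold phi. fold y. rewrite (rsum_ext (fun n => y ^ S n / INR (S n)) (fun n => y * (y ^ n / INR (S n)))).
    - rewrite rsum_scal. field. lra.
    - intros n _. simpl pow. unfold Rdiv. ring. }
  rewrite E, Rabs_Ropp, Rabs_pos_eq.
  2:{ apply Rmult_le_pos; [auto | apply Rlt_le, Rinv_0_lt_compat; auto]. }
  apply Rmult_le_reg_r with y; auto. unfold Rdiv at 1. rewrite Rmult_assoc, Rinv_l, Rmult_1_r by lra.
  eapply Rle_trans; [exact B1|]. right. unfold psi, y. unfold Rdiv.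
  replace (exp v * / sqrt (INR N) * (1 - exp (- (2 * v)))) with ((exp v - exp v * exp (- (2 * v))) * / sqrt (INR N)) by ring.
  rewrite <- exp_plus. replace (v + - (2 * v)) with (- v) by ring. reflexivity.
Qed.

(** * Hasse's series with discretised powers *)

Lemma Csum_eq f n : Csum f n = csum f (S n).
Proof. induction n; simpl in *; [ring | now rewrite IHn]. Qed.

Lemma clim_csum (u : nat -> nat -> C) (v : nat -> C) N : (forall n, clim (fun r => u r n) (v n)) ->
  clim (fun r => csum (u r) N) (csum v N).
Proof. intros H. induction N; simpl; [apply clim_const | now apply clim_plus]. Qed.

Lemma one_minus_exp_ge u : 0 < u -> u / (1 + u) <= 1 - exp (- u) <= u.
Proof.
  intros Hu. assert (X := exp_ge_1p u). assert (Y := exp_ge_1p (- u)). split; [|lra].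
  rewrite exp_Ropp. assert (/ exp u <= / (1 + u)) by (apply Rinv_le_contravar; lra).
  replace (u / (1 + u)) with (1 - / (1 + u)) by (field; lra). lra.
Qed.

Lemma exp_quotient_lim x : is_lim_seq (fun r => (1 - exp (- (x * / INR (S r)))) / (/ INR (S r))) x.
Proof.
  assert (D : derivable_pt_lim (fun u => 1 - exp (- (x * u))) 0 x).
  { apply is_derive_Reals. auto_derive; auto. rewrite Rmult_0_r, Ropp_0, exp_0. ring. }
  apply is_lim_seq_eps. intros eps He. destruct (D eps He) as [dl Hd].
  assert (L := is_lim_seq_inv_INR). rewrite is_lim_seq_eps in L.
  destruct (L dl (cond_pos dl)) as [N HN]. exists N. intros n Hn. specialize (HN n Hn).
  rewrite Rminus_0_r in HN. assert (P := INR_S_pos n).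
  assert (P2 : / INR (S n) <> 0) by (apply Rinv_neq_0_compat; lra).
  specialize (Hd _ P2 HN). rewrite Rplus_0_l, Rmult_0_r, Ropp_0, exp_0, Rminus_diag, Rminus_0_r in Hd.
  exact Hd.
Qed.

(** A stand-in for x^(- al) as h tends to 0. In its binomial expansion x occurs only through exp(- x
    h)^j, on which alternating binomial sums act exactly. *)
Definition discrete_pow (al : C) (h x : R) : C := Cexp (- al * RtoC (ln ((1 - exp (- (x * h))) / h)))%C.

Lemma discrete_pow_lim al x : 0 < x -> clim (fun r => discrete_pow al (/ INR (S r)) x) (Cexp (- al * RtoC (ln x)))%C.
Proof.
  intros Hx. unfold discrete_pow. apply (cder_cont Cexp _ _ _ (cder_Cexp _)). apply clim_scal, clim_RtoC.
  apply is_lim_seq_continuous with (f := ln); [|apply exp_quotient_lim].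
  apply derivable_continuous_pt. exists (/ x). now apply derivable_pt_lim_ln.
Qed.

Definition hpow (al : C) (h : R) : C := Cexp (al * RtoC (ln h))%C.

Lemma exp_in_01 x : 0 < x -> 0 < exp (- x) < 1.
Proof. intros H. split; [apply exp_pos | now apply exp_lt_1]. Qed.

Lemma discrete_pow_binom_series al h x : 0 < h -> 0 < x -> discrete_pow al h x = (hpow al h * binom_series al (RtoC (exp (- (x * h)))))%C.
Proof.
  intros Hh Hx. assert (P := exp_in_01 (x * h) ltac:(nra)).
  rewrite binom_series_val by lra. unfold discrete_pow, hpow. rewrite <- Cexp_plus. f_equal.
  rewrite ln_div, RtoC_minus by lra. ring.
Qed.

(** Finite combinations of binomial series with the same parameter are treated through their weights
    alone, so two of them can be compared weight by weight. *)
Definition has_binom_sum (al : C) (W : nat -> C) (t : C) : Prop := clim (csum (fun j => rising_binom al j * W j)%C) t.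

Lemma has_binom_sum_scal al c W t : has_binom_sum al W t -> has_binom_sum al (fun j => c * W j)%C (c * t)%C.
Proof.
  intros H. apply clim_ext with (fun M => c * csum (fun j => rising_binom al j * W j) M)%C.
  - intros M. rewrite <- csum_scal. apply csum_ext. intros; ring.
  - now apply clim_scal.
Qed.

Lemma has_binom_sum_plus al W W' t t' : has_binom_sum al W t -> has_binom_sum al W' t' ->
  has_binom_sum al (fun j => W j + W' j)%C (t + t')%C.
Proof.
  intros H H'. apply clim_ext with (fun M => csum (fun j => rising_binom al j * W j) M + csum (fun j => rising_binom al j * W' j) M)%C.
  - intros M. rewrite <- csum_plus. apply csum_ext. intros; ring.
  - now apply clim_plus.
Qed.

Lemma has_binom_sum_csum al (W : nat -> nat -> C) (t : nat -> C) N : (forall n, (n < N)%nat -> has_binom_sum al (W n) (t n)) ->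
  has_binom_sum al (fun j => csum (fun n => W n j) N) (csum t N).
Proof.
  intros H. induction N.
  - apply clim_ext with (fun _ => RtoC 0); [|apply clim_const]. intros M.
    rewrite (csum_ext _ (fun _ => RtoC 0)); [now rewrite csum_0|]. intros; simpl; ring.
  - simpl. apply has_binom_sum_plus; auto.
Qed.

Lemma has_binom_sum_ext al W W' t : (forall j, W j = W' j) -> has_binom_sum al W t -> has_binom_sum al W' t.
Proof. intros H. apply clim_ext. intros M. apply csum_ext. intros; now rewrite H. Qed.

Lemma binomial_alt y n :
  csum (fun k => RtoC ((-1) ^ k * Binomial.C n k) * RtoC (y ^ k))%C (S n) = RtoC ((1 - y) ^ n).
Proof.
  assert (E : forall m f, csum (fun k => RtoC (f k)) (S m) = RtoC (sum_f_R0 f m)).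
  { induction m; intros f; [simpl; ring|]. rewrite tech5, RtoC_plus, <- IHm. reflexivity. }
  rewrite (csum_ext _ (fun k => RtoC (Binomial.C n k * (- y) ^ k * 1 ^ (n - k)))).
  - rewrite E, <- binomial. f_equal. f_equal. ring.
  - intros k _. rewrite <- RtoC_mult. f_equal. rewrite pow1.
    replace (- y) with ((-1) * y) by ring. rewrite Rpow_mult_distr. ring.
Qed.

Definition hasse_sum (al : C) (h : R) (N : nat) : C :=
  csum (fun n => RtoC (/ INR (S n)) *
    csum (fun k => RtoC ((-1) ^ k * Binomial.C n k) * discrete_pow al h (INR (S k))) (S n))%C N.

Lemma hasse_sum_lim s N : clim (fun r => hasse_sum (s - 1) (/ INR (S r)) N) (csum (hasse_term s) N).
Proof.
  unfold hasse_sum. apply (clim_csum (fun r n => RtoC (/ INR (S n)) *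
    csum (fun k => RtoC ((-1) ^ k * Binomial.C n k) * discrete_pow (s - 1) (/ INR (S r)) (INR (S k))) (S n))%C).
  intros n. unfold hasse_term. rewrite Csum_eq. apply clim_scal.
  apply (clim_csum (fun r k => RtoC ((-1) ^ k * Binomial.C n k) * discrete_pow (s - 1) (/ INR (S r)) (INR (S k)))%C).
  intros k. apply clim_scal. unfold Rcpow.
  replace ((1 - s) * RtoC (ln (INR (S k))))%C with (- (s - 1) * RtoC (ln (INR (S k))))%C by ring.
  apply discrete_pow_lim, INR_S_pos.
Qed.

(** The alternating sum over k turns exp(- j h) into (1 - exp(- j h))^n; the sum over n < N is then
    a truncated logarithm. *)
Lemma hasse_sum_has_binom_sum al h N : 0 < h -> exists t, hasse_sum al h N = (hpow al h * t)%C /\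
  has_binom_sum al (fun j => RtoC (exp (- (INR j * h)) * rsum (fun n => (1 - exp (- (INR j * h))) ^ n / INR (S n)) N)) t.
Proof.
  intros Hh.
  exists (csum (fun n => RtoC (/ INR (S n)) * csum (fun k => RtoC ((-1) ^ k * Binomial.C n k) *
    binom_series al (RtoC (exp (- (INR (S k) * h))))) (S n))%C N). split.
  - unfold hasse_sum. rewrite <- csum_scal. apply csum_ext. intros n _.
    transitivity (RtoC (/ INR (S n)) * (hpow al h * csum (fun k => RtoC ((-1) ^ k * Binomial.C n k) *
    binom_series al (RtoC (exp (- (INR (S k) * h))))) (S n)))%C; [|ring].
    f_equal. rewrite <- csum_scal. apply csum_ext. intros k _. rewrite discrete_pow_binom_series by (auto; apply INR_S_pos). ring.
  - apply has_binom_sum_ext with (fun j => csum (fun n => RtoC (/ INR (S n)) * csum (fun k =>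
      RtoC ((-1) ^ k * Binomial.C n k) * RtoC (exp (- (INR (S k) * h))) ^ j) (S n))%C N).
    + intros j. rewrite RtoC_mult, RtoC_rsum, <- csum_scal. apply csum_ext. intros n _.
      set (y := exp (- (INR j * h))).
      rewrite (csum_ext _ (fun k => RtoC y * (RtoC ((-1) ^ k * Binomial.C n k) * RtoC (y ^ k)))%C).
      * rewrite csum_scal, binomial_alt. unfold Rdiv. rewrite RtoC_mult. ring.
      * intros k _. assert (E : (RtoC (exp (- (INR (S k) * h))) ^ j)%C = RtoC (y * y ^ k)).
        { rewrite <- RtoC_pow. f_equal. unfold y. rewrite !exp_pow_INR, <- exp_plus. f_equal.
          rewrite S_INR. ring. }
        rewrite E, !RtoC_mult. ring.
    + apply has_binom_sum_csum. intros n _. apply has_binom_sum_scal. apply has_binom_sum_csum. intros k _. apply has_binom_sum_scal.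
      apply binom_series_cv. assert (P := exp_in_01 (INR (S k) * h)). assert (P2 := INR_S_pos k).
      rewrite Cmod_RtoC_pos by (apply Rlt_le, exp_pos). apply P. nra.
Qed.

(** The limit for large N of the weights of [hasse_sum], by - ln(1 - y) / y = sum of y^n / (n + 1)
    with y = 1 - exp(- j h). At j = 0 the value 1 is this limit, the quotient being 0/0. *)
Definition log_weight (h : R) (j : nat) : R :=
  match j with O => 1 | S _ => exp (- (INR j * h)) * (INR j * h / (1 - exp (- (INR j * h)))) end.

(** The factor j is absorbed by [rising_binom_shift], and q^j / (1 - q^j) with q = exp(- h) is a
    geometric series over m. Exchanging the sums over j and m by dominated convergence gives the
    Riemann sum [v]; the leading 1 is the term j = 0. *)
Lemma log_weight_has_binom_sum al h : 0 < h -> exists v,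
  has_binom_sum al (fun j => RtoC (log_weight h j)) (1 + al * RtoC h * v)%C /\
  clim (csum (fun m => RtoC (exp (- (INR (S m) * h))) * binom_series (al + 1) (RtoC (exp (- (INR (S m) * h)))))%C) v.
Proof.
  intros Hh.
  set (q := exp (- h)). assert (Hq : 0 < q < 1) by now apply exp_in_01.
  assert (Eq : forall j, exp (- (INR j * h)) = q ^ j).
  { intros j. unfold q. rewrite exp_pow_INR. f_equal. ring. }
  assert (Hqj : forall j, 0 < q ^ S j <= q).
  { intros j. assert (X := pow_lt q j ltac:(lra)). simpl. split; [nra|].
    assert (Y : q ^ j <= 1 ^ j) by (apply pow_incr; lra). rewrite pow1 in Y. nra. }
  set (vj := fun j => (rising_binom (al + 1) j * RtoC (q ^ S j / (1 - q ^ S j)))%C).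
  set (b := fun j => / (1 - q) * (Cmod (rising_binom (al + 1) j) * q ^ j)).
  assert (Sb : summable b).
  { apply summable_scal; [apply Rlt_le, Rinv_0_lt_compat; lra|]. apply rising_binom_summable0. lra. }
  assert (Geo : forall j M, rsum (fun m => q ^ S m * (q ^ S m) ^ j) M = q ^ S j * ((1 - (q ^ S j) ^ M) / (1 - q ^ S j))).
  { intros j M. assert (X := Hqj j). induction M; [simpl; field; simpl in X; lra|].
    change (rsum ?f (S M)) with (rsum f M + f M). rewrite IHM.
    assert (E : q ^ S M * (q ^ S M) ^ j = q ^ S j * (q ^ S j) ^ M).
    { rewrite <- !pow_mult, <- !pow_add. f_equal. lia. }
    rewrite E. set (y := q ^ S j) in *. change (y ^ S M) with (y * y ^ M). field. lra. }
  set (uu := fun M j => (rising_binom (al + 1) j * RtoC (rsum (fun m => (q ^ S m * (q ^ S m) ^ j)%R) M))%C).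
  assert (Hqq : forall j, q ^ S j / (1 - q ^ S j) <= q ^ j / (1 - q)).
  { intros j. assert (X := Hqj j). assert (Y := pow_lt q j ltac:(lra)).
    apply Rmult_le_compat; [lra | apply Rlt_le, Rinv_0_lt_compat; lra | simpl; nra | apply Rinv_le_contravar; lra]. }
  assert (Huu : forall M j, Cmod (uu M j) <= b j).
  { intros M j. unfold uu, b. rewrite Cmod_mult, Cmod_R, Geo. assert (X := Hqj j).
    assert (Y1 := pow_lt (q ^ S j) M ltac:(lra)).
    assert (Y2 : (q ^ S j) ^ M <= 1 ^ M) by (apply pow_incr; lra). rewrite pow1 in Y2.
    assert (I : 0 < / (1 - q ^ S j)) by (apply Rinv_0_lt_compat; lra).
    rewrite Rabs_pos_eq.
    2:{ apply Rmult_le_pos; [lra|]. unfold Rdiv. apply Rmult_le_pos; lra. }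
    replace (/ (1 - q) * (Cmod (rising_binom (al + 1) j) * q ^ j)) with (Cmod (rising_binom (al + 1) j) * (q ^ j / (1 - q))) by (unfold Rdiv; ring).
    apply Rmult_le_compat_l; [apply Cmod_ge_0|]. eapply Rle_trans; [|apply Hqq].
    unfold Rdiv. apply Rmult_le_compat_l; [lra|]. rewrite <- (Rmult_1_l (/ (1 - q ^ S j))) at 2.
    apply Rmult_le_compat_r; lra. }
  assert (Hv : clim (fun M => Cser (uu M)) (Cser vj)).
  { apply Cser_dominated with b; auto. intros j. unfold uu, vj. apply clim_scal, clim_RtoC.
    assert (X := Hqj j).
    apply is_lim_seq_ext with (fun M => q ^ S j * ((1 - (q ^ S j) ^ M) / (1 - q ^ S j))); [intros; now rewrite Geo|].
    replace (q ^ S j / (1 - q ^ S j)) with (q ^ S j * ((1 - 0) * / (1 - q ^ S j))) by (field; lra).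
    apply is_lim_seq_mult'; [apply is_lim_seq_const|]. apply is_lim_seq_mult'; [|apply is_lim_seq_const].
    apply is_lim_seq_minus'; [apply is_lim_seq_const|]. apply is_lim_seq_geom. rewrite Rabs_pos_eq; lra. }
  assert (Hvj : forall j, Cmod (vj j) <= b j).
  { intros j. unfold vj, b. rewrite Cmod_mult, Cmod_R. assert (X := Hqj j).
    rewrite Rabs_pos_eq by (apply Rmult_le_pos; [lra | apply Rlt_le, Rinv_0_lt_compat; lra]).
    replace (/ (1 - q) * (Cmod (rising_binom (al + 1) j) * q ^ j)) with (Cmod (rising_binom (al + 1) j) * (q ^ j / (1 - q))) by (unfold Rdiv; ring).
    apply Rmult_le_compat_l; [apply Cmod_ge_0 | apply Hqq]. }
  exists (Cser vj). split.
  - apply clim_incr_1.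
    apply clim_ext with (fun M => 1 + al * RtoC h * csum vj M)%C.
    + intros M. rewrite csum_head. f_equal; [simpl; ring|]. rewrite <- csum_scal. apply csum_ext. intros j _.
      unfold log_weight, vj. rewrite Eq. assert (X := Hqj j).
      transitivity (RtoC h * (RtoC (INR (S j)) * rising_binom al (S j)) * RtoC (q ^ S j / (1 - q ^ S j)))%C.
      * rewrite rising_binom_shift. ring.
      * replace (q ^ S j * (INR (S j) * h / (1 - q ^ S j))) with (h * (INR (S j) * (q ^ S j / (1 - q ^ S j)))) by (field; lra).
        rewrite !RtoC_mult. ring.
    + apply clim_plus; [apply clim_const|]. apply clim_scal. now apply Cser_cv with b.
  - apply clim_ext with (2 := Hv). intros M. apply Cser_eq.
    assert (HC := has_binom_sum_csum (al + 1) (fun m j => RtoC (exp (- (INR (S m) * h))) * RtoC (exp (- (INR (S m) * h))) ^ j)%C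
      (fun m => RtoC (exp (- (INR (S m) * h))) * binom_series (al + 1) (RtoC (exp (- (INR (S m) * h)))))%C M).
    eapply clim_ext; [|apply HC].
    + intros J. apply csum_ext. intros j _. unfold uu. f_equal. rewrite RtoC_rsum. apply csum_ext. intros m _.
      rewrite Eq, <- RtoC_pow, <- RtoC_mult. reflexivity.
    + intros m _. apply has_binom_sum_scal. apply binom_series_cv. rewrite Eq, Cmod_RtoC_pos; assert (X := Hqj m); lra.
Qed.

(** Since 1 - exp(- h/2) >= (h/2) / (1 + h/2) >= h/3 for h <= 1, the quotient of h by 1 - exp(- h/2)
    is at most 3. This is what makes the error of Hasse's sum uniform in h. *)
Lemma sqrt_exp_quot h a : 0 < h <= 1 -> 0 < a ->
  exp (a * ln h) * exp (- a * ln (1 - exp (- (h / 2)))) <= exp (a * ln 3).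
Proof.
  intros Hh Ha. rewrite <- exp_plus. apply exp_le.
  assert (P := one_minus_exp_ge (h / 2) ltac:(lra)). set (x := 1 - exp (- (h / 2))) in *.
  assert (Q : h / 3 <= x).
  { eapply Rle_trans; [|apply P]. unfold Rdiv.
    assert (I : / (3/2) <= / (1 + h * / 2)) by (apply Rinv_le_contravar; lra).
    replace (/ (3/2)) with (2/3) in I by field. nra. }
  assert (L : ln (h / 3) <= ln x) by (apply ln_le; lra).
  rewrite ln_div in L by lra. nra.
Qed.

(** The error exp(j h / 2) / sqrt N of the logarithm meets the weight exp(- j h), and the sum over j
    is (1 - exp(- h/2))^(- Re al). Its growth is cancelled by the factor h^(Re al), so the bound is
    free of h. *)
Lemma hasse_error al h N K : 0 < h <= 1 -> 0 < Re al -> (1 <= N)%nat -> 0 < K ->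
  (forall j, Cmod (rising_binom al j) <= K * Cmod (rising_binom (RtoC (Re al)) j)) ->
  exists v, clim (csum (fun m => RtoC (exp (- (INR (S m) * h))) * discrete_pow (al + 1) h (INR (S m)))%C) v /\
  Cmod (hasse_sum al h N - (hpow al h + al * v))%C <= K * exp (Re al * ln 3) / sqrt (INR N).
Proof.
  intros Hh Ha HN HK Hbc. set (a := Re al) in *.
  destruct (hasse_sum_has_binom_sum al h N ltac:(lra)) as [t [Et Ht]].
  destruct (log_weight_has_binom_sum al h ltac:(lra)) as [v [Hv1 Hv2]].
  assert (Ehp : hpow (al + 1) h = (hpow al h * RtoC h)%C).
  { unfold hpow. replace ((al + 1) * RtoC (ln h))%C with (al * RtoC (ln h) + RtoC (ln h))%C by ring.
    rewrite Cexp_plus, Cexp_R, exp_ln by lra. reflexivity. }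
  exists (hpow al h * RtoC h * v)%C. split.
  - apply clim_ext with (fun M => hpow al h * RtoC h * csum (fun m => RtoC (exp (- (INR (S m) * h))) * binom_series (al + 1) (RtoC (exp (- (INR (S m) * h))))) M)%C.
    + intros M. rewrite <- csum_scal. apply csum_ext. intros m _.
      rewrite discrete_pow_binom_series by (apply INR_S_pos || lra). rewrite Ehp. ring.
    + now apply clim_scal.
  - rewrite Et. replace (hpow al h * t - (hpow al h + al * (hpow al h * RtoC h * v)))%C with
      (hpow al h * (t - (1 + al * RtoC h * v)))%C by ring.
    rewrite Cmod_mult. unfold hpow at 1. rewrite Cmod_Cexp.
    replace (Re (al * RtoC (ln h))%C) with (a * ln h) by (autorewrite with cri; unfold a; ring).
    assert (PsN : 0 < sqrt (INR N)) by (apply sqrt_lt_R0, lt_0_INR; lia).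
    assert (B : Cmod (t - (1 + al * RtoC h * v))%C <= K * exp (- a * ln (1 - exp (- (h / 2)))) / sqrt (INR N)).
    { apply clim_le with (1 := clim_minus _ _ _ _ Ht Hv1). exists 0%nat. intros M _.
      rewrite <- csum_minus. eapply Rle_trans; [apply Cmod_csum|].
      set (y := exp (- (h / 2))). assert (Hy : 0 < y < 1) by (apply exp_in_01; lra).
      apply Rle_trans with (rsum (fun j => (K / sqrt (INR N)) * (Cmod (rising_binom (RtoC a) j) * y ^ j)) M).
      - apply rsum_le. intros j _. match goal with |- Cmod (?x * ?y - ?x * ?w)%C <= _ => replace (x * y - x * w)%C with (x * (y - w))%C by ring end.
        rewrite Cmod_mult.
        rewrite <- RtoC_minus, Cmod_R.
        replace (K / sqrt (INR N) * (Cmod (rising_binom (RtoC a) j) * y ^ j)) with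
          ((K * Cmod (rising_binom (RtoC a) j)) * (y ^ j / sqrt (INR N))) by (field; lra).
        apply Rmult_le_compat; [apply Cmod_ge_0 | apply Rabs_pos | apply Hbc |].
        destruct j as [|j].
        + change (INR 0) with 0. rewrite Rmult_0_l, Ropp_0, exp_0, Rmult_1_l.
          assert (E : rsum (fun n => (1 - 1) ^ n / INR (S n)) N = 1).
          { destruct N as [|N]; [lia|]. clear. induction N.
            - simpl. field.
            - change (rsum ?f (S (S N))) with (rsum f (S N) + f (S N)). rewrite IHN. cbv beta.
              rewrite Rminus_diag. simpl pow. rewrite Rmult_0_l. unfold Rdiv. ring. }
          rewrite E. simpl log_weight. rewrite Rminus_diag, Rabs_R0. simpl.
          apply Rlt_le, Rdiv_lt_0_compat; lra.
        + assert (Pj := INR_S_pos j). unfold log_weight. rewrite <- Rmult_minus_distr_l, Rabs_mult.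
          rewrite (Rabs_pos_eq (exp _)) by apply Rlt_le, exp_pos.
          assert (LE := log_series_error (INR (S j) * h / 2) N ltac:(nra) HN).
          replace (2 * (INR (S j) * h / 2)) with (INR (S j) * h) in LE by field.
          eapply Rle_trans; [apply Rmult_le_compat_l; [apply Rlt_le, exp_pos | exact LE]|].
          unfold Rdiv at 1. rewrite <- Rmult_assoc, <- exp_plus.
          right. unfold y. rewrite exp_pow_INR. unfold Rdiv. f_equal. f_equal. field.
      - rewrite rsum_scal.
        replace (K * exp (- a * ln (1 - y)) / sqrt (INR N)) with (K / sqrt (INR N) * exp (- a * ln (1 - y))) by (field; lra).
        apply Rmult_le_compat_l; [apply Rlt_le, Rdiv_lt_0_compat; auto|].
        apply rising_binom_real_sum; auto. lra. }
    eapply Rle_trans; [apply Rmult_le_compat_l; [apply Rlt_le, exp_pos | exact B]|].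
    assert (S := sqrt_exp_quot h a Hh Ha).
    replace (exp (a * ln h) * (K * exp (- a * ln (1 - exp (- (h / 2)))) / sqrt (INR N))) with
      (K * (exp (a * ln h) * exp (- a * ln (1 - exp (- (h / 2))))) / sqrt (INR N)) by (field; lra).
    unfold Rdiv. apply Rmult_le_compat_r; [apply Rlt_le, Rinv_0_lt_compat; auto|].
    apply Rmult_le_compat_l; lra.
Qed.

Lemma zeta_d_shift s : 1 < Re s -> clim (csum (fun m => npow (S m) s)) (zeta_d 0 s).
Proof.
  intros Hs. assert (X := dirichlet_cv (dcoef ones 0) s (subpoly_dcoef ones 0 subpoly_ones) Hs).
  apply clim_incr_1 in X. apply clim_ext with (2 := X). intros M. rewrite csum_head.
  unfold dirichlet_term at 1, dcoef at 1, ones at 1. simpl Nat.eqb. cbv iota.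
  rewrite Rmult_0_r, Cmult_0_l, Cplus_0_l. apply csum_ext. intros m _. unfold dirichlet_term, dcoef, ones. simpl.
  replace (1 * 1) with 1 by ring. ring.
Qed.

Lemma hpow_lim al : 0 < Re al -> clim (fun r => hpow al (/ INR (S r))) 0.
Proof.
  intros Ha. apply clim_squeeze with (fun r => exp (- (Re al * lnN (S r)))).
  - exists 0%nat. intros r _. rewrite Cmod_minus_0. unfold hpow. rewrite Cmod_Cexp.
    rewrite ln_Rinv by apply INR_S_pos. autorewrite with cri. right. f_equal. unfold lnN. ring.
  - apply is_lim_seq_eps. intros eps He.
    destruct (INR_unbounded (exp (- ln eps / Re al))) as [n Hn].
    exists n. intros k Hk. rewrite Rminus_0_r, Rabs_pos_eq by apply Rlt_le, exp_pos.
    rewrite <- (exp_ln eps) by auto. apply exp_increasing.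
    assert (L : - ln eps / Re al < lnN (S k)).
    { unfold lnN. rewrite <- (ln_exp (- ln eps / Re al)). apply ln_increasing; [apply exp_pos|].
      eapply Rlt_le_trans; [exact Hn|]. apply le_INR. lia. }
    apply Rmult_lt_compat_l with (r := Re al) in L; auto.
    replace (Re al * (- ln eps / Re al)) with (- ln eps) in L by (field; lra). lra.
Qed.

(* Uniform in [h], [(h / (1 - exp (- m h))) ^ (a + 1) * exp (- m h)] is dominated by [m ^ - (a + 1)]. *)
Lemma discrete_pow_dominated (be : C) h m : 1 < Re be -> 0 < h -> (1 <= m)%nat ->
  Cmod (RtoC (exp (- (INR m * h))) * discrete_pow be h (INR m))%C <=
  exp (1 + Re be * ln (Re be)) * exp (- Re be * lnN m).
Proof.
  intros Hb Hh Hm. set (b := Re be) in *.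
  assert (Pm : 1 <= INR m) by now apply INR_ge1.
  rewrite Cmod_mult, Cmod_RtoC_pos by apply Rlt_le, exp_pos.
  unfold discrete_pow. rewrite Cmod_Cexp. rewrite <- !exp_plus. apply exp_le.
  replace (Re (- be * RtoC (ln ((1 - exp (- (INR m * h))) / h)))%C) with
    (- b * ln ((1 - exp (- (INR m * h))) / h)) by (autorewrite with cri; unfold b; ring).
  set (x := INR m * h). assert (Px : 0 < x) by (unfold x; nra).
  assert (Q := proj1 (one_minus_exp_ge x Px)).
  assert (L1 : ln (INR m / (1 + x)) <= ln ((1 - exp (- x)) / h)).
  { apply ln_le; [apply Rdiv_lt_0_compat; lra|].
    apply Rmult_le_reg_r with h; auto. unfold Rdiv at 2. rewrite Rmult_assoc, Rinv_l, Rmult_1_r by lra.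
    eapply Rle_trans; [|exact Q]. right. unfold x. field. unfold x in Px. lra. }
  rewrite ln_div in L1 by lra. fold (lnN m) in L1.
  assert (L2 : ln (1 + x) <= (1 + x) / b - 1 + ln b).
  { assert (E : ln (1 + x) = ln ((1 + x) / b) + ln b) by (rewrite ln_div; lra).
    assert (W := exp_ge_1p (ln ((1 + x) / b))). rewrite exp_ln in W by (apply Rdiv_lt_0_compat; lra). lra. }
  assert (L3 : b * ln (1 + x) <= (1 + x) - b + b * ln b).
  { replace ((1 + x) - b + b * ln b) with (b * ((1 + x) / b - 1 + ln b)) by (field; lra).
    apply Rmult_le_compat_l; lra. }
  nra.
Qed.

(** With h = 1/(r + 1), h^(s - 1) tends to 0 and the Riemann sum tends to zeta by dominated
    convergence. *)
Lemma hasse_series s : 1 < Re s -> clim (csum (hasse_term s)) ((s - 1) * zeta_d 0 s)%C.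
Proof.
  intros Hs. set (al := (s - 1)%C).
  assert (Ha : 0 < Re al) by (unfold al; autorewrite with cri; lra).
  destruct (rising_binom_dominated al Ha) as [K [HK Hbc]].
  assert (Hb1 : Re (al + 1)%C = Re s) by (unfold al; autorewrite with cri; ring).
  assert (Hh : forall r, 0 < / INR (S r) <= 1).
  { intros r. assert (P := INR_S_pos r). split; [now apply Rinv_0_lt_compat|].
    rewrite <- Rinv_1. apply Rinv_le_contravar; [lra|]. apply INR_ge1. lia. }
  set (tm := fun r m => (RtoC (exp (- (INR (S m) * / INR (S r)))) * discrete_pow (al + 1) (/ INR (S r)) (INR (S m)))%C).
  set (b := fun m => exp (1 + Re s * ln (Re s)) * exp (- Re s * lnN (S m))).
  assert (Hdom : forall r m, Cmod (tm r m) <= b m).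
  { intros r m. unfold tm, b. rewrite <- Hb1. apply discrete_pow_dominated; [lra | apply Hh | lia]. }
  assert (Sb : summable b).
  { apply summable_scal; [apply Rlt_le, exp_pos|].
    destruct (p_series (Re s) Hs) as [B HB]. exists B. intros N.
    eapply Rle_trans; [|apply (HB (S N))]. change (S N) with (1 + N)%nat. rewrite rsum_split. simpl.
    assert (X := exp_pos (- Re s * lnN 0)). lra. }
  assert (LT : clim (fun r => Cser (tm r)) (zeta_d 0 s)).
  { rewrite <- (Cser_eq _ _ (zeta_d_shift s Hs)). apply Cser_dominated with b; auto. intros m. unfold tm.
    replace (npow (S m) s) with (1 * Cexp (- (al + 1) * RtoC (ln (INR (S m)))))%C.
    2:{ unfold npow, al, lnN. rewrite Cmult_1_l. f_equal. ring. }
    apply clim_mult; [|apply discrete_pow_lim, INR_S_pos]. apply clim_RtoC.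
    replace 1 with (exp (- (INR (S m) * 0))) by (rewrite Rmult_0_r, Ropp_0, exp_0; auto).
    apply is_lim_seq_continuous with (f := fun x => exp (- (INR (S m) * x))).
    - apply derivable_continuous_pt. reg.
    - apply is_lim_seq_inv_INR. }
  (* Uniformity in h lets r go to infinity at fixed N; only afterwards does N grow. *)
  assert (Main : forall N, (1 <= N)%nat ->
    Cmod (csum (hasse_term s) N - al * zeta_d 0 s)%C <= K * exp (Re al * ln 3) / sqrt (INR N)).
  { intros N HN.
    apply clim_le with (fun r => hasse_sum al (/ INR (S r)) N - (hpow al (/ INR (S r)) + al * Cser (tm r)))%C.
    - replace (al * zeta_d 0 s)%C with (0 + al * zeta_d 0 s)%C by ring.
      apply clim_minus; [apply hasse_sum_lim|]. apply clim_plus; [now apply hpow_lim | now apply clim_scal].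
    - exists 0%nat. intros r _.
      destruct (hasse_error al (/ INR (S r)) N K (Hh r) Ha HN HK Hbc) as [v [Hv1 Hv2]].
      change (clim (csum (tm r)) v) in Hv1. rewrite (Cser_eq _ _ Hv1). exact Hv2. }
  apply clim_squeeze with (fun N => K * exp (Re al * ln 3) * / sqrt (INR N)).
  - exists 1%nat. intros N HN. apply Main, HN.
  - replace (Finite 0) with (Finite (K * exp (Re al * ln 3) * 0)) by (f_equal; ring).
    apply is_lim_seq_mult'; [apply is_lim_seq_const|].
    apply is_lim_seq_eps. intros eps He.
    destruct (INR_unbounded (/ (eps * eps))) as [n Hn]. exists n. intros k Hk.
    assert (Pe : 0 < / (eps * eps)) by (apply Rinv_0_lt_compat; nra).
    assert (Lk : / (eps * eps) < INR k) by (eapply Rlt_le_trans; [exact Hn | now apply le_INR]).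
    assert (Ps : 0 < sqrt (INR k)) by (apply sqrt_lt_R0; lra).
    rewrite Rminus_0_r, Rabs_pos_eq by (apply Rlt_le, Rinv_0_lt_compat; auto).
    rewrite <- (Rinv_inv eps). apply Rinv_lt_contravar.
    + apply Rmult_lt_0_compat; auto. now apply Rinv_0_lt_compat.
    + rewrite <- (sqrt_square (/ eps)) by (apply Rlt_le, Rinv_0_lt_compat; auto).
      apply sqrt_lt_1; [apply Rle_0_sqr | lra |]. rewrite <- Rinv_mult. exact Lk.
Qed.

Lemma zeta_hasse_eq s : 1 < Re s -> zeta s = zeta_d 0 s.
Proof.
  intros Hs. unfold zeta.
  assert (N1 : (s - 1)%C <> RtoC 0).
  { apply Cmod_pos_neq. eapply Rlt_le_trans; [|apply re_le_Cmod]. autorewrite with cri.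
    rewrite Rabs_pos_eq; lra. }
  assert (E : Cseries (hasse_term s) = ((s - 1) * zeta_d 0 s)%C).
  { assert (X : @is_series C_AbsRing C_NormedModule (hasse_term s) ((s - 1) * zeta_d 0 s)%C).
    { assert (H := hasse_series s Hs). apply clim_incr_1 in H.
      apply clim_filterlim in H. unfold is_series.
      eapply filterlim_ext; [|exact H]. intros n.
      induction n; [rewrite sum_O; simpl; ring|]. rewrite sum_Sn, <- IHn. reflexivity. }
    unfold Cseries.
    assert (Y := epsilon_spec (inhabits (RtoC 0)) (fun l => @is_series C_AbsRing C_NormedModule (hasse_term s) l) (ex_intro _ _ X)).
    cbv beta in Y. exact (filterlim_locally_unique _ _ _ Y X). }
  rewrite E. field. exact N1.
Qed.

(** * Iterated derivatives of zeta on Re s > 1 *)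

Lemma halfplane_ball (z h : C) (c : R) : c < Re z -> Cmod h < Re z - c -> c < Re (z + h)%C.
Proof.
  intros Hz Hh. assert (X := re_le_Cmod h). assert (Y := Rle_abs (- Re h)). rewrite Rabs_Ropp in Y.
  autorewrite with cri. lra.
Qed.

(** Each identification must hold on an open half-plane, so that the chosen derivative of order k
    may be differentiated again. *)
Lemma Cderive_n_eq (f : C -> C) (g : nat -> C -> C) c : (forall z, c < Re z -> f z = g 0%nat z) ->
  (forall k z, c < Re z -> cder (g k) z (g (S k) z)) ->
  forall k z, c < Re z -> Cderive_n k f z = g k z.
Proof.
  intros H0 H. induction k as [|k IH]; intros z Hz; [now apply H0|].
  simpl. apply Cderive_eq. apply cder_ext_loc with (2 := H k z Hz).
  exists (Re z - c). split; [lra|]. intros h Hh. symmetry. apply IH. now apply halfplane_ball.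
Qed.

Lemma zeta_derive_n k s : 1 < Re s -> Cderive_n k zeta s = zeta_d k s.
Proof.
  apply (Cderive_n_eq zeta zeta_d 1); [exact zeta_hasse_eq|]. intros; now apply cder_zeta_d.
Qed.

(** * The Gamma function *)

Definition gauss_prod (N : nat) (z : C) : C :=
  Cdiv (Cmult (RtoC (INR (fact N))) (Rcpow (INR N) z)) (rising z N).

(** The logarithmic derivative of [gauss_prod N], converging to digamma. *)
Definition gauss_psi (N : nat) (z : C) : C :=
  (RtoC (lnN N) - csum (fun k => / (z + RtoC (INR k))) (S N))%C.

Definition polygamma_sum (j N : nat) (z : C) : C := csum (fun k => (/ (z + RtoC (INR k))) ^ (S j))%C N.

Lemma Cinv_0 : (/ RtoC 0)%C = RtoC 0.
Proof. apply C_eq_ReIm; unfold Re, Im, Cinv; simpl; unfold Rdiv; ring. Qed.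

Lemma Cinv_mult (x y : C) : (/ (x * y))%C = (/ x * / y)%C.
Proof.
  destruct (classic (x = RtoC 0)) as [->|Hx].
  { now rewrite Cmult_0_l, Cinv_0, Cmult_0_l. }
  destruct (classic (y = RtoC 0)) as [->|Hy].
  { now rewrite Cmult_0_r, Cinv_0, Cmult_0_r. }
  field. auto.
Qed.

Lemma Re_shift z k : Re (z + RtoC (INR k))%C = Re z + INR k.
Proof. reflexivity. Qed.

Lemma Cmod_ge_Re z : Re z <= Cmod z.
Proof. eapply Rle_trans; [apply Rle_abs | apply re_le_Cmod]. Qed.

Lemma Cmod_ge_Im z : Im z <= Cmod z.
Proof. eapply Rle_trans; [apply Rle_abs | apply im_le_Cmod]. Qed.

Lemma shift_neq0 z k : 1 < Re z -> (z + RtoC (INR k))%C <> RtoC 0.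
Proof.
  intros H. apply Cmod_pos_neq. assert (X := Cmod_ge_Re (z + RtoC (INR k))%C).
  rewrite Re_shift in X. assert (P := pos_INR k). lra.
Qed.

Lemma inv_shift_bound z k : 1 < Re z -> Cmod (/ (z + RtoC (INR k)))%C <= / INR (S k).
Proof.
  intros H. rewrite Cmod_inv by now apply shift_neq0. apply Rinv_le_contravar; [apply INR_S_pos|].
  eapply Rle_trans; [|apply Cmod_ge_Re]. rewrite Re_shift, S_INR. lra.
Qed.

Lemma rising_neq0 z N : 1 < Re z -> rising z N <> RtoC 0.
Proof.
  intros H. induction N.
  - simpl. replace z with (z + RtoC (INR 0))%C by (simpl; ring). now apply shift_neq0.
  - change (rising z (S N)) with (rising z N * (z + RtoC (INR (S N))))%C.
    apply Cmult_neq_0; auto. now apply shift_neq0.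
Qed.

Lemma sum_inv_sq_summable : summable (fun n => / (INR (S n) * INR (S n))).
Proof.
  destruct (p_series 2 ltac:(lra)) as [B HB]. exists B. intros N.
  eapply Rle_trans; [|apply (HB (S N))]. change (S N) with (1 + N)%nat. rewrite rsum_split.
  assert (X := exp_pos (- (2) * lnN 0)). simpl rsum at 2.
  apply Rle_trans with (rsum (fun k => exp (- (2) * lnN (1 + k))) N); [|lra].
  apply rsum_le. intros k _. right.
  replace (- (2) * lnN (1 + k)) with (- lnN (S k) + - lnN (S k)) by (simpl; ring).
  rewrite exp_plus, exp_Ropp. unfold lnN. rewrite exp_ln by apply INR_S_pos. rewrite Rinv_mult. reflexivity.
Qed.

Lemma cder_inv_shift z k : 1 < Re z ->
  cder (fun w => / (w + RtoC (INR k)))%C z (- (/ (z + RtoC (INR k))) ^ 2)%C.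
Proof.
  intros H.
  eapply cder_eq; [|apply (cder_comp (fun w => w + RtoC (INR k))%C (fun w => / w)%C)].
  3:{ apply cder_inv. now apply shift_neq0. }
  2:{ apply cder_plus; [apply cder_id | apply cder_const]. }
  simpl. field. now apply shift_neq0.
Qed.

Lemma cder_polygamma_sum j N z : 1 < Re z ->
  cder (polygamma_sum j N) z (RtoC (- INR (S j)) * polygamma_sum (S j) N z)%C.
Proof.
  intros H. unfold polygamma_sum. rewrite <- csum_scal.
  apply (cder_csum (fun k w => (/ (w + RtoC (INR k))) ^ S j)%C
    (fun k w => RtoC (- INR (S j)) * (/ (w + RtoC (INR k))) ^ S (S j))%C).
  intros k. eapply cder_eq; [|apply cder_pow, cder_inv_shift; auto].
  rewrite RtoC_opp. simpl pred. rewrite !Cpow_S. simpl. ring.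
Qed.

Lemma cder_gauss_psi N z : 1 < Re z -> cder (gauss_psi N) z (polygamma_sum 1 (S N) z).
Proof.
  intros H. unfold gauss_psi, polygamma_sum.
  apply cder_eq with (0 - csum (fun k => - (/ (z + RtoC (INR k))) ^ 2)%C (S N))%C.
  - rewrite (csum_ext (fun k => - (/ (z + RtoC (INR k))) ^ 2)%C (fun k => (-(1)) * (/ (z + RtoC (INR k))) ^ 2)%C) by (intros; ring).
    rewrite csum_scal. ring.
  - apply cder_minus; [apply cder_const|].
    apply (cder_csum (fun k w => / (w + RtoC (INR k)))%C (fun k w => - (/ (w + RtoC (INR k))) ^ 2)%C).
    intros k. now apply cder_inv_shift.
Qed.

Lemma cder_rising N z : 1 < Re z ->
  cder (fun w => / rising w N)%C z (- csum (fun k => / (z + RtoC (INR k))) (S N) * / rising z N)%C.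
Proof.
  intros H. induction N.
  - simpl. apply cder_ext with (fun w => / (w + RtoC (INR 0)))%C; [intros; f_equal; simpl; ring|].
    eapply cder_eq; [|now apply cder_inv_shift]. simpl.
    replace (z + 0)%C with z by ring.
    ring.
  - apply cder_ext with (fun w => / rising w N * / (w + RtoC (INR (S N))))%C.
    + intros w. change (rising w (S N)) with (rising w N * (w + RtoC (INR (S N))))%C.
      now rewrite Cinv_mult.
    + eapply cder_eq; [|apply (cder_mult _ _ _ _ _ IHN (cder_inv_shift z (S N) H))].
      change (rising z (S N)) with (rising z N * (z + RtoC (INR (S N))))%C.
      change (csum (fun k => / (z + RtoC (INR k)))%C (S (S N))) with
        (csum (fun k => / (z + RtoC (INR k))) (S N) + / (z + RtoC (INR (S N))))%C.
      rewrite Cinv_mult. generalize (csum (fun k => / (z + RtoC (INR k)))%C (S N)). intros c. simpl. ring.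
Qed.

Lemma cder_gauss_prod N z : 1 < Re z -> cder (gauss_prod N) z (gauss_psi N z * gauss_prod N z)%C.
Proof.
  intros H. unfold gauss_prod.
  apply cder_ext with (fun w => RtoC (INR (fact N)) * (Rcpow (INR N) w * / rising w N))%C.
  { intros w. unfold Cdiv. ring. }
  assert (D1 : cder (Rcpow (INR N)) z (RtoC (lnN N) * Rcpow (INR N) z)%C).
  { unfold Rcpow. apply (cder_comp (fun w => w * RtoC (lnN N))%C Cexp); [|apply cder_Cexp].
    apply cder_eq with (1 * RtoC (lnN N) + z * 0)%C; [ring|].
    apply (cder_mult (fun w => w) (fun _ => RtoC (lnN N))); [apply cder_id | apply cder_const]. }
  eapply cder_eq; [|apply cder_scal, (cder_mult _ _ _ _ _ D1 (cder_rising N z H))].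
  unfold gauss_psi, Cdiv. ring.
Qed.

(** * Convergence of Gauss's product *)

Lemma Cexp_taylor w : Cmod (Cexp w - 1 - w)%C <= exp (Cmod w + 1) * (Cmod w * Cmod w).
Proof.
  assert (T := cder_taylor Cexp Cexp Cexp 0 (Cmod w + 1) (exp (Cmod w + 1)) w).
  replace (0 + w)%C with w in T by ring. rewrite Cexp_0 in T.
  replace (w * 1)%C with w in T by ring.
  rewrite <- Rmult_assoc. apply T; [|lra].
  intros v Hv. split; [apply cder_Cexp|]. split; [apply cder_Cexp|].
  rewrite Cmod_Cexp. apply exp_le. eapply Rle_trans; [apply Cmod_ge_Re|].
  replace (v - 0)%C with v in Hv by ring. lra.
Qed.

Lemma ln_ratio_bounds n : let x := / INR (S (S n)) in let L := lnN (S (S n)) - lnN (S n) in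
  x <= L /\ L - x <= 2 * (x * x).
Proof.
  intros x L. assert (P1 := INR_S_pos n). assert (P2 := INR_S_pos (S n)).
  assert (E : INR (S (S n)) = INR (S n) + 1) by apply S_INR.
  assert (P3 : 1 <= INR (S n)) by (apply INR_ge1; lia).
  split.
  - assert (EL : - L = ln (INR (S n) / INR (S (S n)))) by (unfold L, lnN; rewrite ln_div by lra; ring).
    assert (W := exp_ge_1p (- L)). rewrite EL, exp_ln in W by (apply Rdiv_lt_0_compat; lra).
    rewrite <- EL in W. replace (INR (S n) / INR (S (S n))) with (1 - x) in W by (unfold x; rewrite E; field; lra). lra.
  - assert (EL : L = ln (INR (S (S n)) / INR (S n))) by (unfold L, lnN; rewrite ln_div by lra; ring).
    assert (W := exp_ge_1p L). rewrite EL, exp_ln in W by (apply Rdiv_lt_0_compat; lra).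
    rewrite <- EL in W. apply Rle_trans with (/ INR (S n) - x).
    + replace (INR (S (S n)) / INR (S n)) with (1 + / INR (S n)) in W by (rewrite E; field; lra). lra.
    + unfold x. rewrite E. set (m := INR (S n)) in *.
      replace (/ m - / (m + 1)) with (/ (m * (m + 1))) by (field; lra).
      replace (2 * (/ (m + 1) * / (m + 1))) with (/ ((m + 1) * (m + 1) / 2)) by (field; lra).
      apply Rinv_le_contravar; nra.
Qed.

(** The ratio of consecutive products is exp(z L) / (1 + z x) with L = x + O(x^2), hence 1 + O(x^2)
    uniformly for |z| <= R. As Re z > 1, both exp(z L) and 1 + z x have modulus at least 1, so the
    inverse ratio is controlled as well. *)
Lemma gauss_ratio R : 0 <= R -> exists K, 0 < K /\ forall z n, 1 < Re z -> Cmod z <= R ->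
  let x := / INR (S (S n)) in
  exists d d', gauss_prod (S (S n)) z = (gauss_prod (S n) z * (1 + d))%C /\ (/ gauss_prod (S (S n)) z)%C = (/ gauss_prod (S n) z * (1 + d'))%C /\
   Cmod d <= K * (x * x) /\ Cmod d' <= K * (x * x).
Proof.
  intros HR.
  exists (exp (R * 2 + 1) * (4 * (R * R)) + 2 * R + 1). split.
  { assert (X := exp_pos (R * 2 + 1)). nra. }
  intros z n Hz Hb x.
  destruct (ln_ratio_bounds n) as [L1 L2]. fold x in L1, L2.
  set (L := lnN (S (S n)) - lnN (S n)) in *.
  assert (P1 := INR_S_pos n). assert (P2 := INR_S_pos (S n)).
  assert (Px : 0 < x) by (unfold x; now apply Rinv_0_lt_compat).
  assert (Hx2 : x <= / 2).
  { unfold x. apply Rinv_le_contravar; [lra|]. rewrite (S_INR (S n)). assert (X := INR_ge1 (S n) ltac:(lia)). lra. }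
  assert (HL : 0 < L <= 2 * x) by nra.
  set (e := Cexp (z * RtoC L)). set (zx := (z * RtoC x)%C).
  assert (De : Cmod (e - 1 - zx)%C <= (exp (R * 2 + 1) * (4 * (R * R)) + 2 * R + 1) * (x * x)).
  { replace (e - 1 - zx)%C with ((e - 1 - z * RtoC L) + z * RtoC (L - x))%C
      by (unfold zx; rewrite RtoC_minus; ring).
    eapply Rle_trans; [apply Cmod_triangle|].
    assert (T := Cexp_taylor (z * RtoC L)). fold e in T.
    rewrite !Cmod_mult, !Cmod_RtoC_pos in * by lra.
    assert (Zb := Cmod_ge_0 z).
    assert (M1 : Cmod z * L <= R * (2 * x)) by (apply Rmult_le_compat; lra).
    assert (M0 : 0 <= Cmod z * L) by (apply Rmult_le_pos; lra).
    assert (M2 : exp (Cmod z * L + 1) <= exp (R * 2 + 1)) by (apply exp_le; nra).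
    assert (M3 : Cmod z * L * (Cmod z * L) <= R * (2 * x) * (R * (2 * x))) by (apply Rmult_le_compat; lra).
    assert (M4 : exp (Cmod z * L + 1) * (Cmod z * L * (Cmod z * L)) <= exp (R * 2 + 1) * (R * (2 * x) * (R * (2 * x)))).
    { apply Rmult_le_compat; auto; [apply Rlt_le, exp_pos | nra]. }
    assert (M5 : Cmod z * (L - x) <= R * (2 * (x * x))) by (apply Rmult_le_compat; lra).
    nra. }
  assert (Nz1 : (1 + zx)%C <> RtoC 0 /\ 1 <= Cmod (1 + zx)%C).
  { assert (X := Cmod_ge_Re (1 + zx)%C). unfold zx in X. autorewrite with cri in X.
    assert (1 <= Cmod (1 + zx)%C) by (unfold zx; nra). split; auto. apply Cmod_pos_neq. lra. }
  assert (He1 : 1 <= Cmod e).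
  { unfold e. rewrite Cmod_Cexp. autorewrite with cri. rewrite <- exp_0. apply exp_le. nra. }
  assert (He : e <> RtoC 0) by apply Cexp_neq0.
  assert (Eg : gauss_prod (S (S n)) z = (gauss_prod (S n) z * (e / (1 + zx)))%C).
  { unfold gauss_prod. change (rising z (S (S n))) with (rising z (S n) * (z + RtoC (INR (S (S n)))))%C.
    replace (z + RtoC (INR (S (S n))))%C with (RtoC (INR (S (S n))) * (1 + zx))%C.
    2:{ unfold zx, x. rewrite RtoC_inv by lra. field. apply RtoC_neq0. lra. }
    replace (RtoC (INR (fact (S (S n))))) with (RtoC (INR (S (S n))) * RtoC (INR (fact (S n))))%C
      by (rewrite <- RtoC_mult, <- mult_INR; reflexivity).
    replace (Rcpow (INR (S (S n))) z) with (Rcpow (INR (S n)) z * e)%C.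
    2:{ unfold Rcpow, e. rewrite <- Cexp_plus. f_equal. unfold L, lnN. rewrite RtoC_minus. ring. }
    assert (R0 := rising_neq0 z (S n) Hz). field. split; [|split]; auto; try apply Nz1. apply RtoC_neq0. lra. }
  assert (Ng : gauss_prod (S n) z <> RtoC 0).
  { unfold gauss_prod, Cdiv. repeat apply Cmult_neq_0.
    - apply RtoC_neq0, INR_fact_neq_0.
    - apply Cexp_neq0.
    - apply Cinv_neq_0 || idtac. apply Cmod_pos_neq. rewrite Cmod_inv by now apply rising_neq0.
      apply Rinv_0_lt_compat, Cmod_pos, rising_neq0, Hz. }
  destruct Nz1 as [Nz1 Nz2].
  exists ((e - 1 - zx) / (1 + zx))%C, (- (e - 1 - zx) / e)%C. split; [|split; [|split]].
  - rewrite Eg. f_equal. field. auto.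
  - rewrite Eg. field. repeat split; auto.
  - rewrite Cmod_div by auto. apply Rle_trans with (Cmod (e - 1 - zx)%C / 1); [|lra].
    apply Rmult_le_compat_l; [apply Cmod_ge_0|]. apply Rinv_le_contravar; lra.
  - rewrite Cmod_div, Cmod_opp by auto. apply Rle_trans with (Cmod (e - 1 - zx)%C / 1); [|lra].
    apply Rmult_le_compat_l; [apply Cmod_ge_0|]. apply Rinv_le_contravar; lra.
Qed.

Lemma product_bound (u : nat -> C) (d : nat -> R) : (forall n, 0 <= d n) ->
  (forall n, exists e, u (S n) = (u n * (1 + e))%C /\ Cmod e <= d n) ->
  forall N, Cmod (u N) <= Cmod (u 0%nat) * exp (rsum d N).
Proof.
  intros Hd H. induction N.
  - simpl. rewrite exp_0. lra.
  - destruct (H N) as [e [E He]]. rewrite E, Cmod_mult. simpl rsum. rewrite exp_plus, <- Rmult_assoc.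
    apply Rmult_le_compat; auto using Cmod_ge_0.
    eapply Rle_trans; [apply Cmod_triangle|]. rewrite Cmod_1.
    assert (X := exp_ge_1p (d N)). lra.
Qed.

(** The factors 1 + O(1/n^2) give bounded products and summable differences. The same bound for the
    inverse products excludes the limit 0, whence Gamma has no zero here. *)
Lemma gauss_bounds R : 0 <= R -> exists B, 0 < B /\ (forall z N, 1 < Re z -> Cmod z <= R -> Cmod (gauss_prod (S N) z) <= B) /\
  (forall z, 1 < Re z -> Cmod z <= R -> exists l, clim (fun N => gauss_prod N z) l /\ l <> RtoC 0).
Proof.
  intros HR. destruct (gauss_ratio R HR) as [K [HK H]].
  destruct sum_inv_sq_summable as [S2 HS2].
  set (d := fun n => K * (/ INR (S (S n)) * / INR (S (S n)))).
  assert (Hd : forall n, 0 <= d n).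
  { intros n. assert (X := Rinv_0_lt_compat _ (INR_S_pos (S n))). unfold d. nra. }
  assert (HdS : forall N, rsum d N <= K * S2).
  { intros N. unfold d. rewrite rsum_scal. apply Rmult_le_compat_l; [lra|].
    eapply Rle_trans; [|apply (HS2 (S N))]. change (S N) with (1 + N)%nat. rewrite rsum_split.
    assert (X : 0 < / (INR 1 * INR 1)) by (apply Rinv_0_lt_compat; simpl; lra). simpl rsum at 2.
    apply Rle_trans with (rsum (fun k => / (INR (S (1 + k)) * INR (S (1 + k)))) N); [|simpl in *; lra].
    apply rsum_le. intros k _. rewrite <- Rinv_mult. simpl. lra. }
  assert (G1 : forall z, 1 < Re z -> gauss_prod 1 z = (/ (z * (z + 1)))%C).
  { intros z Hz. unfold gauss_prod. simpl rising. unfold Rcpow. simpl INR. rewrite ln_1, Cmult_0_r, Cexp_0.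
    unfold Cdiv. ring. }
  assert (B1 : forall z N, 1 < Re z -> Cmod z <= R -> Cmod (gauss_prod (S N) z) <= exp (K * S2)).
  { intros z N Hz Hb.
    eapply Rle_trans; [apply (product_bound (fun N => gauss_prod (S N) z) d Hd)|].
    - intros n. destruct (H z n Hz Hb) as (e & e' & E & _ & He & _). exists e. auto.
    - rewrite <- (Rmult_1_l (exp (K * S2))). apply Rmult_le_compat; auto using Cmod_ge_0.
      + apply Rlt_le, exp_pos.
      + rewrite G1 by auto.
        assert (N0 := shift_neq0 z 0 Hz). assert (N1 := shift_neq0 z 1 Hz).
        simpl in N0, N1. replace (z + 0)%C with z in N0 by ring.
        rewrite Cinv_mult, Cmod_mult.
        assert (I0 := inv_shift_bound z 0 Hz). assert (I1 := inv_shift_bound z 1 Hz).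
        simpl in I0, I1. replace (z + 0)%C with z in I0 by ring. rewrite Rinv_1 in I0.
        assert (Y0 := Cmod_ge_0 (/ z)%C). assert (Y1 := Cmod_ge_0 (/ (z + 1))%C). nra.
      + apply exp_le, HdS. }
  exists (exp (K * S2)). split; [apply exp_pos|]. split; [exact B1|].
  intros z Hz Hb.
  assert (Hdiff : forall n, Cmod (gauss_prod (S (S n)) z - gauss_prod (S n) z)%C <= exp (K * S2) * d n).
  { intros n. destruct (H z n Hz Hb) as (e & e' & E & _ & He & _). rewrite E.
    replace (gauss_prod (S n) z * (1 + e) - gauss_prod (S n) z)%C with (gauss_prod (S n) z * e)%C by ring.
    rewrite Cmod_mult. apply Rmult_le_compat; auto using Cmod_ge_0. }
  assert (CV : clim (csum (fun n => gauss_prod (S (S n)) z - gauss_prod (S n) z)%C) (Cser (fun n => gauss_prod (S (S n)) z - gauss_prod (S n) z)%C)).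
  { apply Cser_cv with (1 := Hdiff). apply summable_scal; [apply Rlt_le, exp_pos|]. now exists (K * S2). }
  assert (Tel : forall N, csum (fun n => gauss_prod (S (S n)) z - gauss_prod (S n) z)%C N = (gauss_prod (S N) z - gauss_prod 1 z)%C).
  { induction N; simpl csum; [ring|]. rewrite IHN. ring. }
  set (l := (Cser (fun n => gauss_prod (S (S n)) z - gauss_prod (S n) z) + gauss_prod 1 z)%C).
  assert (Hl : clim (fun N => gauss_prod (S N) z) l).
  { apply clim_ext with (fun N => csum (fun n => gauss_prod (S (S n)) z - gauss_prod (S n) z) N + gauss_prod 1 z)%C.
    - intros N. rewrite Tel. ring.
    - apply clim_plus; auto. apply clim_const. }
  exists l. split; [now apply clim_incr_1|].
  assert (Inv : forall N, Cmod (/ gauss_prod (S N) z)%C <= Cmod (/ gauss_prod 1 z)%C * exp (K * S2)).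
  { intros N. eapply Rle_trans; [apply (product_bound (fun N => / gauss_prod (S N) z)%C d Hd)|].
    - intros n. destruct (H z n Hz Hb) as (e' & e & _ & E & _ & He). exists e. auto.
    - apply Rmult_le_compat_l; [apply Cmod_ge_0|]. apply exp_le, HdS. }
  intros E0. apply clim_Cmod in Hl. rewrite E0, Cmod_0 in Hl.
  set (W := Cmod (/ gauss_prod 1 z)%C * exp (K * S2)) in *.
  assert (NG : forall N, gauss_prod (S N) z <> RtoC 0).
  { intros N. unfold gauss_prod, Cdiv. repeat apply Cmult_neq_0.
    - apply RtoC_neq0, INR_fact_neq_0.
    - apply Cexp_neq0.
    - apply Cmod_pos_neq. rewrite Cmod_inv by now apply rising_neq0.
      apply Rinv_0_lt_compat, Cmod_pos, rising_neq0, Hz. }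
  assert (WP : 0 < W).
  { apply Rlt_le_trans with (2 := Inv 0%nat). rewrite Cmod_inv by apply NG.
    apply Rinv_0_lt_compat, Cmod_pos, NG. }
  rewrite is_lim_seq_eps in Hl. destruct (Hl (/ W)) as [N HN]; [now apply Rinv_0_lt_compat|].
  specialize (HN N (le_n _)). rewrite Rminus_0_r, Rabs_pos_eq in HN by apply Cmod_ge_0.
  specialize (Inv N). rewrite Cmod_inv in Inv by apply NG.
  assert (P := Cmod_pos _ (NG N)).
  apply Rinv_le_contravar in Inv; [|now apply Rinv_0_lt_compat]. rewrite Rinv_inv in Inv. lra.
Qed.

Lemma gauss_prod_cv z : 1 < Re z -> clim (fun N => gauss_prod N z) (Gamma z).
Proof.
  intros Hz. destruct (gauss_bounds (Cmod z) (Cmod_ge_0 z)) as (B & _ & _ & H).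
  destruct (H z Hz (Rle_refl _)) as [l [Hl _]].
  change (clim (fun N => gauss_prod N z) (Clim (fun N => gauss_prod N z))). now rewrite (Clim_eq _ _ Hl).
Qed.

Lemma Gamma_neq0 z : 1 < Re z -> Gamma z <> RtoC 0.
Proof.
  intros Hz. destruct (gauss_bounds (Cmod z) (Cmod_ge_0 z)) as (B & _ & _ & H).
  destruct (H z Hz (Rle_refl _)) as [l [Hl Nl]].
  now rewrite (clim_unique _ _ _ (gauss_prod_cv z Hz) Hl).
Qed.

Lemma gauss_psi_step z n : 1 < Re z -> Cmod (gauss_psi (S (S n)) z - gauss_psi (S n) z)%C <=
  (2 + Cmod z) * / (INR (S (S n)) * INR (S (S n))).
Proof.
  intros Hz. unfold gauss_psi. destruct (ln_ratio_bounds n) as [L1 L2].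
  change (csum ?f (S (S (S n)))) with (csum f (S (S n)) + f (S (S n)))%C. cbv beta.
  set (m := INR (S (S n))) in *. assert (Pm : 0 < m) by apply INR_S_pos.
  assert (N1 := shift_neq0 z (S (S n)) Hz). fold m in N1.
  replace (RtoC (lnN (S (S n))) - (csum (fun k => / (z + RtoC (INR k))) (S (S n)) + / (z + RtoC m)) -
    (RtoC (lnN (S n)) - csum (fun k => / (z + RtoC (INR k))) (S (S n))))%C with
    (RtoC (lnN (S (S n)) - lnN (S n) - / m) + z * (RtoC (/ m) * / (z + RtoC m)))%C.
  2:{ rewrite !RtoC_minus, RtoC_inv by lra. field. split; auto. apply RtoC_neq0. lra. }
  eapply Rle_trans; [apply Cmod_triangle|]. rewrite !Cmod_mult, !Cmod_R.
  assert (Pi : 0 < / m) by now apply Rinv_0_lt_compat.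
  rewrite Rabs_pos_eq, (Rabs_pos_eq (/ m)) by lra.
  assert (I := inv_shift_bound z (S (S n)) Hz). fold m in I.
  assert (I2 : / INR (S (S (S n))) <= / m) by (apply Rinv_le_contravar; [auto | apply le_INR; lia]).
  assert (Z0 := Cmod_ge_0 z). assert (Z1 := Cmod_ge_0 (/ (z + RtoC m))%C).
  rewrite Rinv_mult, Rmult_plus_distr_r. apply Rplus_le_compat; [lra|].
  apply Rmult_le_compat_l; auto. apply Rmult_le_compat_l; lra.
Qed.

Definition psi (z : C) : C := Clim (fun N => gauss_psi N z).

Lemma gauss_psi_bound z N : 1 < Re z -> Cmod (gauss_psi (S N) z)%C <=
  2 + (2 + Cmod z) * rsum (fun n => / (INR (S n) * INR (S n))) (S N).
Proof.
  intros Hz. assert (Z0 := Cmod_ge_0 z).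
  assert (B1 : Cmod (gauss_psi 1 z) <= 2).
  { unfold gauss_psi. rewrite lnN_1. simpl csum.
    assert (I0 := inv_shift_bound z 0 Hz). assert (I1 := inv_shift_bound z 1 Hz).
    simpl in I0, I1. rewrite Rinv_1 in I0.
    replace (0 - (0 + / (z + RtoC 0) + / (z + RtoC 1)))%C with (- (/ (z + 0) + / (z + 1)))%C by ring.
    rewrite Cmod_opp. eapply Rle_trans; [apply Cmod_triangle|].
    assert (/ (1 + 1) <= 1) by lra. lra. }
  induction N.
  - eapply Rle_trans; [exact B1|]. simpl.
    assert (0 < / (1 * 1)) by (apply Rinv_0_lt_compat; lra). nra.
  - assert (X := gauss_psi_step z N Hz).
    assert (T := Cmod_triangle (gauss_psi (S (S N)) z - gauss_psi (S N) z)%C (gauss_psi (S N) z)).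
    replace (gauss_psi (S (S N)) z - gauss_psi (S N) z + gauss_psi (S N) z)%C with (gauss_psi (S (S N)) z) in T by ring.
    change (rsum ?f (S (S N))) with (rsum f (S N) + f (S N)). cbv beta. nra.
Qed.

Lemma gauss_psi_cv z : 1 < Re z -> clim (fun N => gauss_psi N z) (psi z).
Proof.
  intros Hz. assert (Z0 := Cmod_ge_0 z).
  assert (CV : clim (csum (fun n => gauss_psi (S (S n)) z - gauss_psi (S n) z)%C) (Cser (fun n => gauss_psi (S (S n)) z - gauss_psi (S n) z)%C)).
  { apply Cser_cv with (1 := fun n => gauss_psi_step z n Hz). apply summable_scal; [lra|].
    destruct sum_inv_sq_summable as [B HB]. exists B. intros N.
    eapply Rle_trans; [|apply (HB (S N))]. change (S N) with (1 + N)%nat. rewrite rsum_split.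
    assert (X : 0 < / (INR 1 * INR 1)) by (apply Rinv_0_lt_compat; simpl; lra). simpl rsum at 2.
    apply Rle_trans with (rsum (fun k => / (INR (S (1 + k)) * INR (S (1 + k)))) N); [|simpl in *; lra].
    apply rsum_le. intros k _. simpl. lra. }
  assert (Tel : forall N, csum (fun n => gauss_psi (S (S n)) z - gauss_psi (S n) z)%C N = (gauss_psi (S N) z - gauss_psi 1 z)%C).
  { induction N; simpl csum; [ring|]. rewrite IHN. ring. }
  assert (L : clim (fun N => gauss_psi N z) (Cser (fun n => gauss_psi (S (S n)) z - gauss_psi (S n) z) + gauss_psi 1 z)%C).
  { apply clim_incr_1. apply clim_ext with (fun N => csum (fun n => gauss_psi (S (S n)) z - gauss_psi (S n) z) N + gauss_psi 1 z)%C.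
    - intros N. rewrite Tel. ring.
    - apply clim_plus; auto. apply clim_const. }
  unfold psi. now rewrite (Clim_eq _ _ L).
Qed.

(* Up to the factor [(-1) ^ (j + 1) * j!] the [j]-th derivative of [psi], for [j >= 1]. *)
Definition polygamma (j : nat) (z : C) : C := Cser (fun k => (/ (z + RtoC (INR k))) ^ (S j))%C.

Lemma polygamma_term_bound j z k : (1 <= j)%nat -> 1 < Re z ->
  Cmod ((/ (z + RtoC (INR k))) ^ S j)%C <= / (INR (S k) * INR (S k)).
Proof.
  intros Hj Hz. rewrite Cmod_pow.
  assert (I := inv_shift_bound z k Hz). assert (I0 := Cmod_ge_0 (/ (z + RtoC (INR k)))%C).
  assert (P : 1 <= INR (S k)) by (apply INR_ge1; lia).
  assert (I1 : 0 < / INR (S k) <= 1).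
  { split; [apply Rinv_0_lt_compat; lra|]. rewrite <- Rinv_1. apply Rinv_le_contravar; lra. }
  apply Rle_trans with ((/ INR (S k)) ^ S j); [apply pow_incr; lra|].
  destruct j as [|j]; [lia|]. rewrite Rinv_mult. revert I1. generalize (/ INR (S k)). intros x I1.
  simpl pow.
  assert (X : x ^ j <= 1 ^ j) by (apply pow_incr; lra). rewrite pow1 in X.
  apply Rmult_le_compat_l; [lra|].
  apply Rle_trans with (x * 1); [apply Rmult_le_compat_l; lra | lra].
Qed.

Lemma polygamma_sum_cv j z : (1 <= j)%nat -> 1 < Re z -> clim (fun N => polygamma_sum j N z) (polygamma j z).
Proof.
  intros Hj Hz. apply Cser_cv with (1 := fun k => polygamma_term_bound j z k Hj Hz).
  apply sum_inv_sq_summable.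
Qed.

Lemma polygamma_sum_bound : exists B, 0 < B /\ forall j N z, (1 <= j)%nat -> 1 < Re z -> Cmod (polygamma_sum j N z) <= B.
Proof.
  destruct sum_inv_sq_summable as [B HB]. exists (B + 1). split.
  - specialize (HB 0%nat). simpl in HB. lra.
  - intros j N z Hj Hz. eapply Rle_trans; [apply Cmod_csum|].
    apply Rle_trans with (rsum (fun n => / (INR (S n) * INR (S n))) N).
    + apply rsum_le. intros. now apply polygamma_term_bound.
    + specialize (HB N). lra.
Qed.

Lemma ball_facts z w : 1 < Re z -> Cmod (w - z)%C < Rmin (Re z - 1) 1 -> 1 < Re w /\ Cmod w <= Cmod z + 1.
Proof.
  intros Hz Hw. assert (M1 := Rmin_l (Re z - 1) 1). assert (M2 := Rmin_r (Re z - 1) 1).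
  replace w with (z + (w - z))%C by ring. split.
  - apply halfplane_ball; lra.
  - eapply Rle_trans; [apply Cmod_triangle|]. lra.
Qed.

Lemma cder_polygamma j z : (1 <= j)%nat -> 1 < Re z ->
  cder (polygamma j) z (RtoC (- INR (S j)) * polygamma (S j) z)%C.
Proof.
  intros Hj Hz. destruct polygamma_sum_bound as [B [HB0 HB]].
  apply (cder_lim (fun N w => polygamma_sum j N w) (fun N w => RtoC (- INR (S j)) * polygamma_sum (S j) N w)%C
    (fun N w => RtoC (- INR (S j)) * (RtoC (- INR (S (S j))) * polygamma_sum (S (S j)) N w))%C)
    with (r := Rmin (Re z - 1) 1) (M := INR (S j) * (INR (S (S j)) * B)).
  - apply Rmin_pos; lra.
  - intros N w Hw. destruct (ball_facts z w Hz Hw) as [Hw1 _]. split; [|split].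
    + now apply cder_polygamma_sum.
    + apply cder_scal. now apply cder_polygamma_sum.
    + assert (P1 := INR_S_pos j). assert (P2 := INR_S_pos (S j)).
      rewrite !Cmod_mult, !Cmod_R, !Rabs_Ropp, !Rabs_pos_eq by lra.
      repeat (apply Rmult_le_compat_l; [lra|]). apply HB; auto; lia.
  - intros w Hw. destruct (ball_facts z w Hz Hw) as [Hw1 _]. now apply polygamma_sum_cv.
  - apply clim_scal. apply polygamma_sum_cv; auto; lia.
Qed.

Lemma cder_psi z : 1 < Re z -> cder psi z (polygamma 1 z).
Proof.
  intros Hz. destruct polygamma_sum_bound as [B [HB0 HB]].
  apply (cder_lim (fun N w => gauss_psi N w) (fun N w => polygamma_sum 1 (S N) w)
    (fun N w => RtoC (- INR 2) * polygamma_sum 2 (S N) w)%C)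
    with (r := Rmin (Re z - 1) 1) (M := 2 * B).
  - apply Rmin_pos; lra.
  - intros N w Hw. destruct (ball_facts z w Hz Hw) as [Hw1 _]. split; [|split].
    + now apply cder_gauss_psi.
    + now apply cder_polygamma_sum.
    + rewrite Cmod_mult, Cmod_R. simpl INR. rewrite Rabs_Ropp, Rabs_pos_eq by lra.
      apply Rmult_le_compat_l; [lra|]. apply HB; auto.
  - intros w Hw. destruct (ball_facts z w Hz Hw) as [Hw1 _]. now apply gauss_psi_cv.
  - assert (X := polygamma_sum_cv 1 z (le_n _) Hz). now apply clim_incr_1 in X.
Qed.

(** The second derivative of a Gauss product is the product times psi_N' + psi_N^2; all three are
    bounded near z uniformly in N, as [cder_lim] demands. *)
Lemma cder_Gamma z : 1 < Re z -> cder Gamma z (psi z * Gamma z)%C.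
Proof.
  intros Hz. destruct polygamma_sum_bound as [B [HB0 HB]].
  assert (HR : 0 <= Cmod z + 1) by (assert (X := Cmod_ge_0 z); lra).
  destruct (gauss_bounds (Cmod z + 1) HR) as (B2 & HB2 & HG & _).
  destruct sum_inv_sq_summable as [S2 HS2].
  assert (S2P : 0 <= S2) by (specialize (HS2 0%nat); simpl in HS2; lra).
  set (B3 := 2 + (2 + (Cmod z + 1)) * S2).
  apply (cder_lim (fun N w => gauss_prod (S N) w) (fun N w => gauss_psi (S N) w * gauss_prod (S N) w)%C
    (fun N w => polygamma_sum 1 (S (S N)) w * gauss_prod (S N) w + gauss_psi (S N) w * (gauss_psi (S N) w * gauss_prod (S N) w))%C)
    with (r := Rmin (Re z - 1) 1) (M := B * B2 + B3 * (B3 * B2)).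
  - apply Rmin_pos; lra.
  - intros N w Hw. destruct (ball_facts z w Hz Hw) as [Hw1 Hw2]. split; [|split].
    + now apply cder_gauss_prod.
    + apply cder_mult; [now apply cder_gauss_psi | now apply cder_gauss_prod].
    + assert (Bp : Cmod (gauss_psi (S N) w) <= B3).
      { eapply Rle_trans; [now apply gauss_psi_bound|]. unfold B3. apply Rplus_le_compat_l.
        apply Rmult_le_compat; auto; try lra; [assert (X := Cmod_ge_0 w); lra|].
        apply rsum_nonneg. intros n _. apply Rlt_le, Rinv_0_lt_compat.
        assert (X := INR_S_pos n). nra. }
      eapply Rle_trans; [apply Cmod_triangle|]. rewrite !Cmod_mult.
      assert (X1 := HB 1%nat (S (S N)) w (le_n _) Hw1). assert (X2 := HG w N Hw1 Hw2).
      assert (C1 := Cmod_ge_0 (gauss_psi (S N) w)). assert (C2 := Cmod_ge_0 (gauss_prod (S N) w)).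
      assert (C3 := Cmod_ge_0 (polygamma_sum 1 (S (S N)) w)).
      apply Rplus_le_compat; [apply Rmult_le_compat; auto|].
      apply Rmult_le_compat; auto; [nra|]. apply Rmult_le_compat; auto.
  - intros w Hw. destruct (ball_facts z w Hz Hw) as [Hw1 _].
    assert (X := gauss_prod_cv w Hw1). now apply clim_incr_1 in X.
  - assert (X := gauss_prod_cv z Hz). apply clim_incr_1 in X.
    assert (Y := gauss_psi_cv z Hz). apply clim_incr_1 in Y. now apply clim_mult.
Qed.

(** * Decay of Gamma along vertical lines *)

Lemma rising_shift z N : (rising (z + 1) N * z)%C = (rising z N * (z + RtoC (INR (S N))))%C.
Proof.
  induction N.
  - simpl. ring.
  - change (rising (z + 1) (S N)) with (rising (z + 1) N * (z + 1 + RtoC (INR (S N))))%C.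
    change (rising z (S N)) with (rising z N * (z + RtoC (INR (S N))))%C.
    transitivity (rising (z + 1) N * z * (z + 1 + RtoC (INR (S N))))%C; [ring|].
    rewrite IHN, (S_INR (S N)), RtoC_plus. ring.
Qed.

Lemma Gamma_succ z : 1 < Re z -> Gamma (z + 1)%C = (z * Gamma z)%C.
Proof.
  intros Hz.
  assert (Hz1 : 1 < Re (z + 1)%C) by (autorewrite with cri; lra).
  assert (Nz := shift_neq0 z 0 Hz). simpl in Nz. replace (z + 0)%C with z in Nz by ring.
  assert (L1 := gauss_prod_cv (z + 1)%C Hz1). apply clim_incr_1 in L1.
  apply clim_unique with (1 := L1).
  assert (L2 := gauss_prod_cv z Hz). apply clim_incr_1 in L2.
  apply clim_ext with (fun N => z * gauss_prod (S N) z * / (1 + (z + 1) * RtoC (/ INR (S N))))%C.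
  - intros N. unfold gauss_prod.
    assert (R0 := rising_neq0 z (S N) Hz). assert (R1 := rising_neq0 (z + 1)%C (S N) Hz1).
    assert (Nk := shift_neq0 z (S (S N)) Hz). assert (Sh := rising_shift z (S N)).
    assert (NN := INR_S_neq N).
    assert (E : rising z (S N) = (rising (z + 1) (S N) * z / (z + RtoC (INR (S (S N)))))%C).
    { rewrite Sh. field. auto. }
    rewrite E. replace (Rcpow (INR (S N)) (z + 1)) with (Rcpow (INR (S N)) z * RtoC (INR (S N)))%C.
    2:{ unfold Rcpow. replace ((z + 1) * RtoC (ln (INR (S N))))%C with (z * RtoC (ln (INR (S N))) + RtoC (ln (INR (S N))))%C by ring.
        rewrite Cexp_plus, Cexp_R, exp_ln; auto. apply INR_S_pos. }
    rewrite RtoC_inv by (assert (X := INR_S_pos N); lra).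
    rewrite (S_INR (S N)), RtoC_plus in Nk |- *.
    field. repeat split; auto.
    intros X. apply Nk. rewrite <- X. ring.
  - replace (z * Gamma z)%C with (z * Gamma z * / (1 + (z + 1) * RtoC 0))%C.
    + apply clim_mult; [now apply clim_scal|]. apply clim_inv.
      * replace (1 + (z + 1) * RtoC 0)%C with (RtoC 1) by ring. apply RtoC_neq0; lra.
      * apply clim_plus; [apply clim_const|]. apply clim_scal, clim_RtoC, is_lim_seq_inv_INR.
    + replace (1 + (z + 1) * RtoC 0)%C with (RtoC 1) by ring. field.
Qed.

(** Because |z + k| >= Re z + k, the bound at real points extends to whole vertical lines. *)
Lemma gauss_prod_real_le z N : 1 < Re z -> Cmod (gauss_prod N z) <= Cmod (gauss_prod N (RtoC (Re z))).
Proof.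
  intros Hz. set (x := Re z) in *. unfold gauss_prod.
  assert (R0 := rising_neq0 z N Hz). assert (R1 := rising_neq0 (RtoC x) N Hz).
  rewrite !Cmod_div, !Cmod_mult by auto.
  assert (E : Cmod (Rcpow (INR N) z) = Cmod (Rcpow (INR N) (RtoC x))).
  { unfold Rcpow. rewrite !Cmod_Cexp. autorewrite with cri. fold x. f_equal. ring. }
  rewrite E. apply Rmult_le_compat_l; [apply Rmult_le_pos; apply Cmod_ge_0|].
  apply Rinv_le_contravar; [now apply Cmod_pos|]. clear R0 R1 E.
  induction N.
  - simpl. rewrite Cmod_RtoC_pos by lra. apply Cmod_ge_Re.
  - change (rising ?w (S N)) with (rising w N * (w + RtoC (INR (S N))))%C. rewrite !Cmod_mult. apply Rmult_le_compat; auto using Cmod_ge_0.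
    rewrite <- RtoC_plus, Cmod_RtoC_pos by (assert (P := pos_INR (S N)); lra).
    eapply Rle_trans; [|apply Cmod_ge_Re]. rewrite Re_shift. apply Rle_refl.
Qed.

Lemma Gamma_bounded R : 1 <= R -> exists B, 0 < B /\ forall z, 1 < Re z <= R -> Cmod (Gamma z) <= B.
Proof.
  intros HR. destruct (gauss_bounds R ltac:(lra)) as (B & HB & HG & _).
  exists B. split; auto. intros z Hz. assert (L := gauss_prod_cv z ltac:(lra)). apply clim_incr_1 in L.
  apply clim_le with (1 := L). exists 0%nat. intros N _.
  eapply Rle_trans; [apply gauss_prod_real_le; lra|]. apply HG; [apply Hz|]. rewrite Cmod_RtoC_pos; lra.
Qed.

(** Each use of Gamma(z) = Gamma(z + 1) / z gains a factor 1 / Im z and shifts z by 1; the strip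
    widens accordingly, so [R] is quantified inside the induction. *)
Lemma Gamma_decay K : forall R, 1 <= R -> exists B, 0 < B /\ forall z, 1 < Re z <= R -> 1 <= Im z ->
  Cmod (Gamma z) <= B / Im z ^ K.
Proof.
  induction K as [|K IH]; intros R HR.
  - destruct (Gamma_bounded R HR) as [B [HB H]]. exists B. split; auto. intros z Hz _. simpl.
    specialize (H z Hz). lra.
  - destruct (IH (R + 1) ltac:(lra)) as [B [HB H]]. exists B. split; auto. intros z Hz Ht.
    specialize (H (z + 1)%C). autorewrite with cri in H.
    specialize (H ltac:(lra) ltac:(lra)). rewrite Rplus_0_r in H.
    rewrite Gamma_succ, Cmod_mult in H by lra.
    assert (Zt := Cmod_ge_Im z). assert (G0 := Cmod_ge_0 (Gamma z)).
    assert (Pt := pow_lt (Im z) K ltac:(lra)).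
    apply Rmult_le_reg_l with (Im z); [lra|].
    apply Rle_trans with (Cmod z * Cmod (Gamma z)); [apply Rmult_le_compat_r; auto|].
    eapply Rle_trans; [exact H|]. right. simpl. field. split; lra.
Qed.

(** * Asymptotics of the digamma function in a vertical strip *)

Lemma inv_shift_Im z k : 0 < Im z -> Cmod (/ (z + RtoC (INR k)))%C <= / Im z.
Proof.
  intros H. assert (X := Cmod_ge_Im (z + RtoC (INR k))%C).
  autorewrite with cri in X. rewrite Rplus_0_r in X.
  rewrite Cmod_inv by (apply Cmod_pos_neq; lra). apply Rinv_le_contravar; lra.
Qed.

(** From (k + 1)^2 + t^2 >= (t + k)(t + k + 1) / 2 with t = Im z, the terms are dominated by a
    telescoping sum. *)
Lemma sum_inv_sq_strip z N : 1 < Re z -> 0 < Im z ->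
  rsum (fun k => Cmod (/ (z + RtoC (INR k)))%C ^ 2) N <= 2 / Im z.
Proof.
  intros Hz Ht. set (t := Im z) in *.
  assert (K : forall N, rsum (fun k => Cmod (/ (z + RtoC (INR k)))%C ^ 2) N <= 2 * (/ t - / (t + INR N))).
  { induction N0.
    - simpl. rewrite Rplus_0_r. lra.
    - change (rsum ?f (S N0)) with (rsum f N0 + f N0). cbv beta. assert (P := pos_INR N0). rewrite S_INR.
      assert (B : Cmod (/ (z + RtoC (INR N0)))%C ^ 2 <= 2 * (/ (t + INR N0) - / (t + (INR N0 + 1)))).
      { rewrite Cmod_inv by now apply shift_neq0. rewrite pow_inv, Cmod2_alt.
        autorewrite with cri. fold t. rewrite Rplus_0_r.
        replace (2 * (/ (t + INR N0) - / (t + (INR N0 + 1)))) with (/ ((t + INR N0) * (t + (INR N0 + 1)) / 2)) by (field; lra).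
        set (p := INR N0) in *.
        assert (Q : (p + 1) ^ 2 <= (Re z + p) ^ 2) by (apply pow_incr; lra).
        apply Rinv_le_contravar; [nra|]. assert (S := Rle_0_sqr (t - p - 1)). unfold Rsqr in S. nra. }
      lra. }
  eapply Rle_trans; [apply K|]. assert (P := pos_INR N).
  assert (0 < / (t + INR N)) by (apply Rinv_0_lt_compat; lra). lra.
Qed.

(** Of the j + 2 factors in each term two are summed over k; each of the others is at most 1 / Im
    z. *)
Lemma polygamma_strip_bound j z : 1 < Re z -> 0 < Im z -> Cmod (polygamma (S j) z) <= 2 / Im z ^ S j.
Proof.
  intros Hz Ht.
  apply Cser_le with (fun k => (/ Im z) ^ j * Cmod (/ (z + RtoC (INR k)))%C ^ 2).
  - intros k. rewrite Cmod_pow. replace (S (S j)) with (j + 2)%nat by lia. rewrite pow_add.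
    apply Rmult_le_compat_r; [apply pow2_ge_0|]. apply pow_incr.
    split; [apply Cmod_ge_0 | now apply inv_shift_Im].
  - intros N. rewrite rsum_scal. assert (X := sum_inv_sq_strip z N Hz Ht).
    assert (Y : 0 < (/ Im z) ^ j) by (apply pow_lt, Rinv_0_lt_compat; auto).
    apply Rle_trans with ((/ Im z) ^ j * (2 / Im z)); [apply Rmult_le_compat_l; [lra | exact X]|].
    rewrite pow_inv. right. change (Im z ^ S j) with (Im z * Im z ^ j). field.
    split; [apply pow_nonzero; lra | lra] || (split; [lra | apply pow_nonzero; lra]).
Qed.

(** 1/z telescopes into the terms 1/(z + k) - 1/(z + k + 1), which differ from 1/(z + k)^2 by 1/((z
    + k)^2 (z + k + 1)). *)
Lemma polygamma1_inv z : 1 < Re z -> 0 < Im z -> Cmod (polygamma 1 z - / z)%C <= 2 / (Im z * Im z).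
Proof.
  intros Hz Ht.
  assert (N0 := shift_neq0 z 0 Hz). simpl in N0. replace (z + 0)%C with z in N0 by ring.
  assert (L : clim (fun N => polygamma_sum 1 N z - (/ z - / (z + RtoC (INR N))))%C (polygamma 1 z - (/ z - 0))%C).
  { apply clim_minus; [now apply polygamma_sum_cv|]. apply clim_minus; [apply clim_const|].
    apply clim_squeeze with (fun N => / INR (S N)); [|apply is_lim_seq_inv_INR].
    exists 0%nat. intros N _. rewrite Cmod_minus_0. now apply inv_shift_bound. }
  replace (polygamma 1 z - / z)%C with (polygamma 1 z - (/ z - 0))%C by ring.
  apply clim_le with (1 := L). exists 0%nat. intros N _.
  assert (E : (polygamma_sum 1 N z - (/ z - / (z + RtoC (INR N))))%C =
    csum (fun k => (/ (z + RtoC (INR k))) ^ 2 * / (z + RtoC (INR (S k))))%C N).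
  { unfold polygamma_sum. induction N.
    - simpl. replace (z + 0)%C with z by ring. ring.
    - change (csum ?f (S N)) with (csum f N + f N)%C. rewrite <- IHN. cbv beta. simpl Cpow.
      assert (A := shift_neq0 z N Hz). assert (B := shift_neq0 z (S N) Hz).
      rewrite S_INR, RtoC_plus in *. field. repeat split; auto. }
  rewrite E. eapply Rle_trans; [apply Cmod_csum|].
  apply Rle_trans with (rsum (fun k => / Im z * Cmod (/ (z + RtoC (INR k)))%C ^ 2) N).
  - apply rsum_le. intros k _. rewrite Cmod_mult, Cmod_pow, Rmult_comm.
    apply Rmult_le_compat_r; [apply pow2_ge_0|]. now apply inv_shift_Im.
  - rewrite rsum_scal. assert (X := sum_inv_sq_strip z N Hz Ht).
    apply Rle_trans with (/ Im z * (2 / Im z)); [|right; field; lra].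
    apply Rmult_le_compat_l; auto. apply Rlt_le, Rinv_0_lt_compat; auto.
Qed.

(** Needed to keep eps from being too small. The threshold 10 makes the error 2/t^2 small beside
    1/|z| >= 1/(t + 2). *)
Lemma polygamma1_lower z : 1 < Re z < 2 -> 10 <= Im z -> / (2 * Im z) <= Cmod (polygamma 1 z).
Proof.
  intros Hz Ht. set (t := Im z) in *.
  assert (A := polygamma1_inv z ltac:(lra) ltac:(fold t; lra)). fold t in A.
  assert (B : / (t + 2) <= Cmod (/ z)%C).
  { rewrite Cmod_inv by (apply Cmod_pos_neq; assert (X := Cmod_ge_Im z); fold t in X; lra).
    apply Rinv_le_contravar.
    - assert (X := Cmod_ge_Im z); fold t in X; lra.
    - eapply Rle_trans; [apply Cmod_le_ReIm|]. rewrite !Rabs_pos_eq; fold t; lra. }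
  assert (T := Cmod_rev (/ z)%C (/ z - polygamma 1 z)%C).
  replace (/ z - (/ z - polygamma 1 z))%C with (polygamma 1 z) in T by ring.
  rewrite (Cmod_minus_sym (/ z)%C (polygamma 1 z)) in T.
  assert (C : / (2 * t) <= / (t + 2) - 2 / (t * t)); [|lra].
  apply Rmult_le_reg_r with (2 * t * t * (t + 2)); [nra|].
  replace (/ (2 * t) * (2 * t * t * (t + 2))) with (t * (t + 2)) by (field; lra).
  replace ((/ (t + 2) - 2 / (t * t)) * (2 * t * t * (t + 2))) with (2 * t * t - 4 * (t + 2)) by (field; lra).
  nra.
Qed.

(** Gauss's approximation is stopped at T, the integer part of Im z: the T + 1 fractions are at most
    1 / Im z each and contribute at most 2, and the steps beyond T sum to at most (5 + T) / T <=
    6. *)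
Lemma psi_log z : 1 < Re z < 2 -> 1 <= Im z -> exists T, (1 <= T)%nat /\ INR T <= Im z < INR T + 1 /\
  Cmod (psi z - RtoC (lnN T))%C <= 8.
Proof.
  intros Hz Ht. destruct (nfloor_ex (Im z) ltac:(lra)) as [T HT].
  assert (HT1 : (1 <= T)%nat).
  { destruct T; [simpl in HT; lra | lia]. }
  exists T. split; auto. split; auto.
  assert (PT : 1 <= INR T) by now apply INR_ge1.
  assert (Zb : Cmod z <= 3 + INR T).
  { eapply Rle_trans; [apply Cmod_le_ReIm|]. rewrite !Rabs_pos_eq; lra. }
  destruct T as [|T']; [lia|]. set (T := S T') in *.
  assert (B1 : Cmod (gauss_psi T z - RtoC (lnN T))%C <= 2).
  { unfold gauss_psi. replace (RtoC (lnN T) - csum (fun k => / (z + RtoC (INR k))) (S T) - RtoC (lnN T))%C with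
      (- csum (fun k => / (z + RtoC (INR k))) (S T))%C by ring.
    rewrite Cmod_opp. eapply Rle_trans; [apply Cmod_csum|].
    apply Rle_trans with (rsum (fun _ => / Im z * 1) (S T)).
    - apply rsum_le. intros k _. rewrite Rmult_1_r. apply inv_shift_Im. lra.
    - rewrite rsum_scal.
      assert (E : rsum (fun _ => 1) (S T) = INR (S T)).
      { generalize (S T). induction n; [reflexivity|]. rewrite S_INR. simpl rsum. lra. }
      rewrite E, S_INR. apply Rmult_le_reg_l with (Im z); [lra|].
      rewrite <- Rmult_assoc, Rinv_r by lra. lra. }
  assert (B2 : forall d, Cmod (gauss_psi (T + d) z - gauss_psi T z)%C <= (2 + Cmod z) * (/ INR T - / INR (T + d))).
  { induction d.
    - rewrite Nat.add_0_r. replace (gauss_psi T z - gauss_psi T z)%C with (RtoC 0) by ring. rewrite Cmod_0. lra.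
    - rewrite Nat.add_succ_r. assert (X := gauss_psi_step z (T' + d) ltac:(lra)).
      change (S (T' + d)) with (T + d)%nat in X.
      eapply Rle_trans; [apply (Cmod_tri3 _ (gauss_psi (T + d) z))|].
      assert (Q : / (INR (S (T + d)) * INR (S (T + d))) <= / INR (T + d) - / INR (S (T + d))).
      { rewrite S_INR. assert (P : 1 <= INR (T + d)) by (apply INR_ge1; lia).
        replace (/ INR (T + d) - / (INR (T + d) + 1)) with (/ (INR (T + d) * (INR (T + d) + 1))) by (field; lra).
        apply Rinv_le_contravar; nra. }
      assert (Z0 := Cmod_ge_0 z).
      assert (W : (2 + Cmod z) * / (INR (S (T + d)) * INR (S (T + d))) <= (2 + Cmod z) * (/ INR (T + d) - / INR (S (T + d))))
        by (apply Rmult_le_compat_l; lra).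
      lra. }
  assert (L : clim (fun d => gauss_psi (d + T) z - gauss_psi T z)%C (psi z - gauss_psi T z)%C).
  { apply clim_minus; [|apply clim_const]. apply (clim_incr_n (fun N => gauss_psi N z)). apply gauss_psi_cv. lra. }
  assert (B3 : Cmod (psi z - gauss_psi T z)%C <= 6).
  { apply clim_le with (1 := L). exists 0%nat. intros d _. rewrite Nat.add_comm. eapply Rle_trans; [apply B2|].
    assert (P : 0 < / INR (T + d)) by (apply Rinv_0_lt_compat, lt_0_INR; lia).
    assert (Z0 := Cmod_ge_0 z).
    apply Rle_trans with ((5 + INR T) * / INR T).
    - apply Rmult_le_compat; try lra. assert (/ INR (T + d) <= / INR T).
      { apply Rinv_le_contravar; [lra | apply le_INR; lia]. } lra.
    - apply Rmult_le_reg_r with (INR T); [lra|]. rewrite Rmult_assoc, Rinv_l by lra. lra. }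
  eapply Rle_trans; [apply (Cmod_tri3 _ (gauss_psi T z))|]. lra.
Qed.

Lemma psi_upper z : 1 < Re z < 2 -> 1 <= Im z -> Cmod (psi z) <= ln (Im z) + 8.
Proof.
  intros Hz Ht. destruct (psi_log z Hz Ht) as (T & HT & HT2 & H).
  assert (L0 := lnN_ge0 T). assert (X := Cmod_rev (psi z) (RtoC (lnN T))).
  rewrite (Cmod_RtoC_pos (lnN T)) in X by auto.
  assert (lnN T <= ln (Im z)).
  { apply ln_le; [apply lt_0_INR; lia | lra]. }
  lra.
Qed.

Lemma psi_lower s i : strip_seq s -> (1 <= i)%nat -> lnN i - 8 <= Cmod (psi (s i)).
Proof.
  intros Hs Hi. destruct (Hs i) as [H1 H2]. assert (P : 1 <= INR i) by now apply INR_ge1.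
  destruct (psi_log (s i) H1 ltac:(lra)) as (T & HT & HT2 & H).
  assert (L : lnN i <= lnN T).
  { apply lnN_le. assert (X : INR i < INR (S T)) by (rewrite S_INR; lra). apply INR_lt in X. lia. }
  assert (X := Cmod_rev (RtoC (lnN T)) (psi (s i))). rewrite Cmod_minus_sym in X.
  rewrite (Cmod_RtoC_pos (lnN T)) in X by apply lnN_ge0. lra.
Qed.

Lemma psi_large s M : strip_seq s -> exists N, (1 <= N)%nat /\ forall i, (N <= i)%nat -> M <= Cmod (psi (s i)).
Proof.
  intros Hs. destruct (lnN_unbounded (M + 8)) as [N [HN HL]]. exists N. split; [lia|].
  intros i Hi. specialize (HL i Hi). assert (X := psi_lower s i Hs ltac:(lia)). lra.
Qed.

Lemma psi_inv_lim s : strip_seq s -> clim (fun i => / psi (s i))%C 0.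
Proof.
  intros Hs. apply clim_eps. intros eps He.
  destruct (psi_large s (/ eps + 1) Hs) as [N [_ HN]]. exists N. intros i Hi. specialize (HN i Hi).
  assert (P : 0 < / eps) by now apply Rinv_0_lt_compat.
  rewrite Cmod_minus_0, Cmod_inv by (apply Cmod_pos_neq; lra).
  rewrite <- (Rinv_inv eps). apply Rinv_lt_contravar; [|lra].
  apply Rmult_lt_0_compat; lra.
Qed.

(** A common yardstick for powers of the logarithm, at least 1 and monotone in the exponent, so that
    estimates may be multiplied freely. *)
Definition psi_growth (A : nat) (z : C) : R := (1 + Cmod (psi z)) ^ A.

Lemma psi_growth_ge1 A z : 1 <= psi_growth A z.
Proof. apply pow_R1_Rle. assert (X := Cmod_ge_0 (psi z)). lra. Qed.

Lemma psi_growth_mult A B z : psi_growth A z * psi_growth B z = psi_growth (A + B) z.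
Proof. unfold psi_growth. now rewrite pow_add. Qed.

Lemma psi_growth_mono A B z : (A <= B)%nat -> psi_growth A z <= psi_growth B z.
Proof. intros H. apply Rle_pow; auto. assert (X := Cmod_ge_0 (psi z)). lra. Qed.

Lemma psi_growth_lim s A : strip_seq s -> is_lim_seq (fun i => psi_growth A (s i) / Im (s i)) 0.
Proof.
  intros Hs. set (A' := INR (S A)). assert (PA : 1 <= A') by (apply INR_ge1; lia).
  (* With 1 + |psi| <= 9 + y and y = ln Im s, writing 9 + y = 2 A' u and u <= exp u leaves at most
     exp((9 + y)/2), the square root of Im s up to a constant. A' = A + 1 avoids division by 0. *)
  set (C0 := (2 * A') ^ A * exp (9 / 2)).
  assert (PC : 0 < C0) by (apply Rmult_lt_0_compat; [apply pow_lt; lra | apply exp_pos]).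
  apply is_lim_seq_le_le_loc with (u := fun _ => 0) (w := fun i => C0 * exp (- (/ 2) * lnN i)).
  - exists 1%nat. intros i Hi. destruct (Hs i) as [H1 H2]. assert (P : 1 <= INR i) by now apply INR_ge1.
    set (t := Im (s i)) in *. assert (U := psi_upper (s i) H1 ltac:(fold t; lra)). fold t in U.
    split.
    { apply Rmult_le_pos; [assert (X := psi_growth_ge1 A (s i)); lra | apply Rlt_le, Rinv_0_lt_compat; lra]. }
    assert (Ly : 0 <= ln t) by (rewrite <- ln_1; apply ln_le; lra).
    set (y := ln t) in *. set (u := (9 + y) / (2 * A')).
    assert (B : psi_growth A (s i) <= C0 * exp (/ 2 * y)).
    { apply Rle_trans with ((9 + y) ^ A).
      - apply pow_incr. assert (X := Cmod_ge_0 (psi (s i))). lra.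
      - replace (9 + y) with (2 * A' * u) by (unfold u; field; lra). rewrite Rpow_mult_distr.
        unfold C0. rewrite Rmult_assoc. apply Rmult_le_compat_l; [apply pow_le; lra|].
        assert (Pu : 0 <= u) by (apply Rmult_le_pos; [lra | apply Rlt_le, Rinv_0_lt_compat; lra]).
        apply Rle_trans with (exp u ^ A).
        + apply pow_incr. split; auto. assert (X := exp_ge_1p u). lra.
        + rewrite exp_pow_INR, <- exp_plus. apply exp_le.
          assert (INR A <= A') by (apply le_INR; lia).
          apply Rle_trans with (A' * u); [apply Rmult_le_compat_r; auto|]. right. unfold u. field. lra. }
    apply Rle_trans with (C0 * exp (/ 2 * y) / t).
    { apply Rmult_le_compat_r; [apply Rlt_le, Rinv_0_lt_compat; lra | exact B]. }
    replace (/ t) with (exp (- y)) by (unfold y; rewrite exp_Ropp, exp_ln; lra).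
    unfold Rdiv. replace (/ t) with (exp (- y)) by (unfold y; rewrite exp_Ropp, exp_ln; lra).
    rewrite Rmult_assoc, <- exp_plus. apply Rmult_le_compat_l; [lra|]. apply exp_le.
    assert (lnN i <= y) by (apply ln_le; lra). lra.
  - apply is_lim_seq_const.
  - replace (Finite 0) with (Finite (C0 * 0)) by (f_equal; ring).
    apply is_lim_seq_mult'; [apply is_lim_seq_const|].
    apply is_lim_seq_eps. intros eps He.
    destruct (lnN_unbounded (1 - 2 * ln eps)) as [n [Hn HL]]. exists n. intros i Hi. specialize (HL i Hi).
    rewrite Rminus_0_r, Rabs_pos_eq by apply Rlt_le, exp_pos.
    rewrite <- (exp_ln eps) by auto. apply exp_increasing. lra.
Qed.

Lemma clim_psi_growth s u l C0 A : strip_seq s ->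
  (exists N, forall i, (N <= i)%nat -> Cmod (u i - l)%C <= C0 * (psi_growth A (s i) / Im (s i))) -> clim u l.
Proof.
  intros Hs H. apply clim_squeeze with (1 := H).
  replace (Finite 0) with (Finite (C0 * 0)) by (f_equal; ring).
  apply is_lim_seq_mult'; [apply is_lim_seq_const | now apply psi_growth_lim].
Qed.

(** * Logarithmic derivatives of Gamma *)

(* [weighted w] contains the polynomials in [psi, psi', psi'', ...] all of whose monomials have weight
   at least [w], where [psi ^ (j)] has weight [j]. *)
Inductive weighted : nat -> (C -> C) -> Prop :=
| weighted_const c : weighted 0 (fun _ => c)
| weighted_psi : weighted 0 psi
| weighted_polygamma j : weighted (S j) (polygamma (S j))
| weighted_plus w f g : weighted w f -> weighted w g -> weighted w (fun z => f z + g z)%C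
| weighted_mult w w' f g : weighted w f -> weighted w' g -> weighted (w + w') (fun z => f z * g z)%C
| weighted_weaken w w' f : (w' <= w)%nat -> weighted w f -> weighted w' f.

Lemma weighted_scal w c f : weighted w f -> weighted w (fun z => c * f z)%C.
Proof. intros H. apply (weighted_mult 0 w (fun _ => c) f); auto. apply weighted_const. Qed.

Lemma weighted_pow k : weighted 0 (fun z => psi z ^ k)%C.
Proof.
  induction k; simpl; [apply weighted_const|].
  apply (weighted_mult 0 0 psi (fun z => psi z ^ k)%C); auto. apply weighted_psi.
Qed.

Lemma weighted_derive w f : weighted w f -> exists f', weighted (S w) f' /\ forall z, 1 < Re z -> cder f z (f' z).
Proof.
  induction 1 as [c | | j | w f g Hf (f' & Hf1 & Hf2) Hg (g' & Hg1 & Hg2)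
    | w w' f g Hf (f' & Hf1 & Hf2) Hg (g' & Hg1 & Hg2) | w w' f Hw Hf (f' & Hf1 & Hf2)].
  - exists (fun z => 0 * polygamma 1 z)%C. split; [apply weighted_scal, weighted_polygamma|].
    intros z _. apply cder_eq with (RtoC 0); [ring | apply cder_const].
  - exists (polygamma 1). split; [apply weighted_polygamma|]. intros; now apply cder_psi.
  - exists (fun z => RtoC (- INR (S (S j))) * polygamma (S (S j)) z)%C. split; [apply weighted_scal, weighted_polygamma|].
    intros; apply cder_polygamma; auto; lia.
  - exists (fun z => f' z + g' z)%C. split; [now apply weighted_plus|]. intros; apply cder_plus; auto.
  - exists (fun z => f' z * g z + f z * g' z)%C. split.
    + apply weighted_plus.
      * apply (weighted_mult (S w) w' f' g); auto.
      * rewrite <- Nat.add_succ_r. now apply weighted_mult.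
    + intros; apply cder_mult; auto.
  - exists f'. split; auto. apply (weighted_weaken (S w) (S w')); auto; lia.
Qed.

Lemma weighted_bound w f : weighted w f -> exists C0 A, 0 <= C0 /\ forall z, 1 < Re z < 2 -> 1 <= Im z ->
  Cmod (f z) <= C0 * psi_growth A z / Im z ^ w.
Proof.
  induction 1 as [c | | j | w f g Hf (C1 & A1 & P1 & H1) Hg (C2 & A2 & P2 & H2)
    | w w' f g Hf (C1 & A1 & P1 & H1) Hg (C2 & A2 & P2 & H2) | w w' f Hw Hf (C1 & A1 & P1 & H1)].
  - exists (Cmod c), 0%nat. split; [apply Cmod_ge_0|]. intros z _ _. unfold psi_growth. simpl. lra.
  - exists 1, 1%nat. split; [lra|]. intros z _ _. unfold psi_growth. simpl. lra.
  - exists 2, 0%nat. split; [lra|]. intros z Hz Ht. unfold psi_growth. simpl pow at 1. rewrite Rmult_1_r.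
    apply polygamma_strip_bound; lra.
  - exists (C1 + C2), (A1 + A2)%nat. split; [lra|]. intros z Hz Ht.
    specialize (H1 z Hz Ht). specialize (H2 z Hz Ht). eapply Rle_trans; [apply Cmod_triangle|].
    assert (M1 := psi_growth_mono A1 (A1 + A2) z ltac:(lia)). assert (M2 := psi_growth_mono A2 (A1 + A2) z ltac:(lia)).
    assert (Pt : 0 < / Im z ^ w) by (apply Rinv_0_lt_compat, pow_lt; lra).
    unfold Rdiv in *. rewrite Rmult_plus_distr_r, Rmult_plus_distr_r.
    assert (Q1 : C1 * psi_growth A1 z * / Im z ^ w <= C1 * psi_growth (A1 + A2) z * / Im z ^ w)
      by (apply Rmult_le_compat_r; [lra | apply Rmult_le_compat_l; auto]).
    assert (Q2 : C2 * psi_growth A2 z * / Im z ^ w <= C2 * psi_growth (A1 + A2) z * / Im z ^ w)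
      by (apply Rmult_le_compat_r; [lra | apply Rmult_le_compat_l; auto]).
    lra.
  - exists (C1 * C2), (A1 + A2)%nat. split; [now apply Rmult_le_pos|]. intros z Hz Ht.
    specialize (H1 z Hz Ht). specialize (H2 z Hz Ht). rewrite Cmod_mult, pow_add, <- psi_growth_mult.
    replace (C1 * C2 * (psi_growth A1 z * psi_growth A2 z) / (Im z ^ w * Im z ^ w')) with
      ((C1 * psi_growth A1 z / Im z ^ w) * (C2 * psi_growth A2 z / Im z ^ w')).
    + apply Rmult_le_compat; auto using Cmod_ge_0.
    + field. split; apply pow_nonzero; lra.
  - exists C1, A1. split; auto. intros z Hz Ht. eapply Rle_trans; [apply (H1 z Hz Ht)|].
    apply Rmult_le_compat_l.
    + apply Rmult_le_pos; auto. assert (X := psi_growth_ge1 A1 z). lra.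
    + apply Rinv_le_contravar; [apply pow_lt; lra | now apply Rle_pow].
Qed.

(** The number j(j - 1)/2, coefficient of psi^(j - 2) psi' in Gamma^(j) / Gamma. *)
Fixpoint triangular (j : nat) : R := match j with O => 0 | S j => triangular j + INR j end.

Lemma triangular_ge1 j : (2 <= j)%nat -> 1 <= triangular j.
Proof.
  intros H. assert (K : forall j, 0 <= triangular j).
  { induction j0; simpl; [lra|]. assert (X := pos_INR j0). lra. }
  destruct j as [|j]; [lia|]. simpl. assert (X := K j). assert (Y := INR_ge1 j ltac:(lia)). lra.
Qed.

(** Only the terms of weight 0 and 1 are kept explicit: the first correction decides the size of
    eps, and everything of weight 2 is smaller by a factor 1 / Im z up to logarithms. *)
Lemma Gamma_derive_n j : exists E, weighted 2 E /\ forall z, 1 < Re z ->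
  Cderive_n j Gamma z = ((psi z ^ j + RtoC (triangular j) * (psi z ^ (j - 2) * polygamma 1 z) + E z) * Gamma z)%C.
Proof.
  induction j as [|j (E & HE & IH)].
  - exists (fun z => 0 * polygamma 2 z)%C. split; [apply weighted_scal, weighted_polygamma|].
    intros z _. simpl. ring.
  - destruct (weighted_derive 2 E HE) as (E' & HE1 & HE2).
    destruct (weighted_derive 0 _ (weighted_pow (j - 2))) as (p' & Hp1 & Hp2).
    exists (fun z => RtoC (triangular j) * (p' z * polygamma 1 z + psi z ^ (j - 2) * (RtoC (- INR 2) * polygamma 2 z)) + E' z + psi z * E z)%C.
    split.
    + apply weighted_plus; [apply weighted_plus|].
      * apply weighted_scal, weighted_plus.
        -- apply (weighted_mult 1 1 p' (polygamma 1)); auto. apply weighted_polygamma.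
        -- apply (weighted_mult 0 2 (fun z => psi z ^ (j - 2))%C (fun z => RtoC (- INR 2) * polygamma 2 z)%C);
             [apply weighted_pow | apply weighted_scal, weighted_polygamma].
      * apply (weighted_weaken 3 2); auto.
      * apply (weighted_mult 0 2 psi E); auto. apply weighted_psi.
    + intros z Hz. simpl Cderive_n. apply Cderive_eq.
      apply cder_ext_loc with (fun z => (psi z ^ j + RtoC (triangular j) * (psi z ^ (j - 2) * polygamma 1 z) + E z) * Gamma z)%C.
      { exists (Re z - 1). split; [lra|]. intros h Hh. symmetry. apply IH. now apply halfplane_ball. }
      eapply cder_eq; [|apply cder_mult; [apply cder_plus; [apply cder_plus|]|now apply cder_Gamma]].
      2:{ apply cder_pow. now apply cder_psi. }
      2:{ apply cder_scal, cder_mult; [now apply Hp2 | apply (cder_polygamma 1); auto]. }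
      2:{ now apply HE2. }
      replace (S j - 2)%nat with (pred j) by lia.
      (* For j = 0 and 1 the truncated exponent j - 2 is wrong, but the coefficient is 0. *)
      assert (T1 : (RtoC (triangular j) * (psi z * psi z ^ (j - 2)))%C = (RtoC (triangular j) * psi z ^ pred j)%C).
      { destruct j as [|[|j]]; [simpl; ring | simpl; replace (0 + 0) with 0 by ring; ring |].
        replace (S (S j) - 2)%nat with j by lia. reflexivity. }
      change (triangular (S j)) with (triangular j + INR j). rewrite RtoC_plus, Cpow_S.
      replace ((psi z ^ j + RtoC (triangular j) * (psi z ^ (j - 2) * polygamma 1 z) + E z) * (psi z * Gamma z))%C with
        ((psi z * psi z ^ j + (RtoC (triangular j) * (psi z * psi z ^ (j - 2))) * polygamma 1 z + psi z * E z) * Gamma z)%C by ring.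
      rewrite T1. simpl. ring.
Qed.

Definition Gamma_ratio (j : nat) (z : C) : C := (Cderive_n j Gamma z / Gamma z)%C.

Lemma Gamma_ratio_expansion j : exists E, weighted 2 E /\ forall z, 1 < Re z ->
  Gamma_ratio j z = (psi z ^ j + RtoC (triangular j) * (psi z ^ (j - 2) * polygamma 1 z) + E z)%C.
Proof.
  destruct (Gamma_derive_n j) as (E & HE & H). exists E. split; auto. intros z Hz.
  unfold Gamma_ratio. rewrite H by auto. field. now apply Gamma_neq0.
Qed.

Definition Gamma_ratio_err (j : nat) (z : C) : C := (Gamma_ratio j z / psi z ^ j - 1)%C.

(** Every term of eps carries a polygamma factor, so eps is at most 1 / Im s times powers of psi,
    and Im s outgrows those. *)
Lemma Gamma_ratio_err_small s j A : strip_seq s -> clim (fun i => Gamma_ratio_err j (s i) * psi (s i) ^ A)%C 0.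
Proof.
  intros Hs. destruct (Gamma_ratio_expansion j) as (E & HE & H).
  destruct (weighted_bound 2 E HE) as (C1 & A1 & P1 & H1).
  assert (Pt : 0 <= triangular j).
  { clear. induction j; simpl; [lra|]. assert (X := pos_INR j). lra. }
  apply (clim_psi_growth s) with (C0 := 2 * triangular j + C1) (A := ((j - 2) + A1 + A)%nat); auto.
  destruct (psi_large s 1 Hs) as (N & HN1 & HN).
  exists N. intros i Hi. specialize (HN i Hi). destruct (Hs i) as [Hr Ht].
  assert (P : 1 <= INR i) by (apply INR_ge1; lia).
  set (z := s i) in *. set (t := Im z) in *.
  assert (Np : psi z <> RtoC 0) by (apply Cmod_pos_neq; lra).
  assert (Nj : (psi z ^ j)%C <> RtoC 0) by now apply Cpow_nz.
  rewrite Cmod_minus_0. unfold Gamma_ratio_err. rewrite H by lra.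
  replace ((psi z ^ j + RtoC (triangular j) * (psi z ^ (j - 2) * polygamma 1 z) + E z) / psi z ^ j - 1)%C with
    ((RtoC (triangular j) * (psi z ^ (j - 2) * polygamma 1 z) + E z) / psi z ^ j)%C by (field; auto).
  rewrite Cmod_mult, Cmod_div, !Cmod_pow by auto.
  set (p := Cmod (psi z)) in *.
  assert (B1 : Cmod (RtoC (triangular j) * (psi z ^ (j - 2) * polygamma 1 z) + E z)%C <= (2 * triangular j + C1) * (psi_growth ((j - 2) + A1) z / t)).
  { eapply Rle_trans; [apply Cmod_triangle|]. rewrite !Cmod_mult, Cmod_RtoC_pos, Cmod_pow by auto. fold p.
    assert (Q1 := polygamma_strip_bound 0 z ltac:(lra) ltac:(fold t; lra)). simpl pow in Q1. rewrite Rmult_1_r in Q1. fold t in Q1.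
    assert (Q2 := H1 z Hr ltac:(fold t; lra)). fold t in Q2.
    assert (Pi : 0 < / t) by (apply Rinv_0_lt_compat; lra).
    assert (Q3 : p ^ (j - 2) <= psi_growth (j - 2 + A1) z).
    { apply Rle_trans with (psi_growth (j - 2) z); [apply pow_incr; fold p; lra | apply psi_growth_mono; lia]. }
    assert (Q4 := psi_growth_mono A1 (j - 2 + A1) z ltac:(lia)).
    assert (Q5 : C1 * psi_growth A1 z / t ^ 2 <= C1 * (psi_growth (j - 2 + A1) z / t)).
    { unfold Rdiv. rewrite Rmult_assoc. apply Rmult_le_compat_l; auto.
      apply Rmult_le_compat; [assert (X := psi_growth_ge1 A1 z); lra | | auto |].
      - apply Rlt_le, Rinv_0_lt_compat. nra.
      - apply Rinv_le_contravar; nra. }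
    assert (Q6 : triangular j * (p ^ (j - 2) * Cmod (polygamma 1 z)) <= 2 * triangular j * (psi_growth (j - 2 + A1) z / t)).
    { replace (2 * triangular j * (psi_growth (j - 2 + A1) z / t)) with (triangular j * (psi_growth (j - 2 + A1) z * (2 / t))) by (unfold Rdiv; ring).
      apply Rmult_le_compat_l; auto. apply Rmult_le_compat; auto using Cmod_ge_0. apply pow_le; lra. }
    lra. }
  apply Rle_trans with ((2 * triangular j + C1) * (psi_growth ((j - 2) + A1) z / t) * psi_growth A z).
  - apply Rmult_le_compat.
    + apply Rmult_le_pos; [apply Cmod_ge_0 | apply Rlt_le, Rinv_0_lt_compat, pow_lt; lra].
    + apply pow_le; lra.
    + eapply Rle_trans; [|exact B1]. rewrite <- (Rmult_1_r (Cmod _)) at 2.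
      apply Rmult_le_compat_l; [apply Cmod_ge_0|]. rewrite <- Rinv_1.
      apply Rinv_le_contravar; [lra | now apply pow_R1_Rle].
    + apply pow_incr. fold p. lra.
  - right. rewrite <- (psi_growth_mult (j - 2 + A1) A z). unfold Rdiv. ring.
Qed.

Lemma Gamma_ratio_quotient_lim s j : strip_seq s -> clim (fun i => Gamma_ratio j (s i) / psi (s i) ^ j)%C 1.
Proof.
  intros Hs. assert (H := Gamma_ratio_err_small s j 0 Hs).
  apply clim_ext with (fun i => Gamma_ratio_err j (s i) * psi (s i) ^ 0 + 1)%C.
  - intros i. unfold Gamma_ratio_err. simpl. ring.
  - assert (X := clim_plus _ _ _ _ H (clim_const 1)). replace (0 + 1)%C with (RtoC 1) in X by ring. exact X.
Qed.

(** eps psi^2 / psi' tends to n(n - 1)/2 >= 1, so eventually exceeds 1/2 in modulus; with |psi'| >=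
    1/(2 Im s) this gives the constant 4. *)
Lemma Gamma_ratio_err_inv s n : strip_seq s -> (2 <= n)%nat -> exists N, forall i, (N <= i)%nat ->
  Gamma_ratio_err n (s i) <> RtoC 0 /\ Cmod (/ Gamma_ratio_err n (s i))%C <= 4 * Im (s i) * psi_growth 2 (s i).
Proof.
  intros Hs Hn. destruct (Gamma_ratio_expansion n) as (E & HE & H).
  destruct (weighted_bound 2 E HE) as (C1 & A1 & P1 & H1).
  assert (Hc := triangular_ge1 n Hn).
  destruct (psi_large s 1 Hs) as (N1 & HN1 & HN).
  assert (L : clim (fun i => Gamma_ratio_err n (s i) * psi (s i) ^ 2 / polygamma 1 (s i))%C (RtoC (triangular n))).
  { apply (clim_psi_growth s) with (C0 := 2 * C1) (A := A1); auto.
    exists (N1 + 10)%nat. intros i Hi. specialize (HN i ltac:(lia)). destruct (Hs i) as [Hr Ht].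
    assert (P : 10 <= INR i) by (replace 10 with (INR 10) by (simpl; ring); apply le_INR; lia).
    set (z := s i) in *. set (t := Im z) in *.
    assert (Np : psi z <> RtoC 0) by (apply Cmod_pos_neq; lra).
    assert (Pl := polygamma1_lower z Hr ltac:(fold t; lra)). fold t in Pl.
    assert (P2t : 0 < / (2 * t)) by (apply Rinv_0_lt_compat; lra).
    assert (Nq : polygamma 1 z <> RtoC 0) by (apply Cmod_pos_neq; lra).
    assert (En : (psi z ^ n)%C = (psi z ^ 2 * psi z ^ (n - 2))%C).
    { rewrite <- Cpow_add_r. f_equal. lia. }
    assert (N2 : (psi z ^ (n - 2))%C <> RtoC 0) by now apply Cpow_nz.
    assert (Nn : (psi z ^ n)%C <> RtoC 0) by now apply Cpow_nz.
    replace (Gamma_ratio_err n z * psi z ^ 2 / polygamma 1 z - RtoC (triangular n))%C with (E z / (psi z ^ (n - 2) * polygamma 1 z))%C.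
    2:{ unfold Gamma_ratio_err. rewrite H by lra. rewrite En. field. repeat split; auto. }
    rewrite Cmod_div, Cmod_mult, Cmod_pow by (apply Cmult_neq_0; auto).
    assert (Q := H1 z Hr ltac:(fold t; lra)). fold t in Q.
    apply Rle_trans with (C1 * psi_growth A1 z / t ^ 2 * (2 * t)); [|right; field; lra].
    apply Rmult_le_compat; auto using Cmod_ge_0.
    - apply Rlt_le, Rinv_0_lt_compat. apply Rmult_lt_0_compat; [apply pow_lt; lra | lra].
    - rewrite <- (Rinv_inv (2 * t)). apply Rinv_le_contravar; auto.
      assert (X := pow_R1_Rle (Cmod (psi z)) (n - 2) HN).
      assert (Y := Cmod_ge_0 (polygamma 1 z)). nra. }
  apply clim_Cmod in L. rewrite Cmod_RtoC_pos in L by lra.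
  rewrite is_lim_seq_eps in L. destruct (L (/ 2)) as [N HN2]; [lra|].
  exists (N + N1 + 10)%nat. intros i Hi. specialize (HN i ltac:(lia)). specialize (HN2 i ltac:(lia)).
  destruct (Hs i) as [Hr Ht].
  assert (P : 10 <= INR i) by (replace 10 with (INR 10) by (simpl; ring); apply le_INR; lia).
  set (z := s i) in *. set (t := Im z) in *.
  assert (Np : psi z <> RtoC 0) by (apply Cmod_pos_neq; lra).
  assert (Pl := polygamma1_lower z Hr ltac:(fold t; lra)). fold t in Pl.
  assert (P2t : 0 < / (2 * t)) by (apply Rinv_0_lt_compat; lra).
  assert (Nq : polygamma 1 z <> RtoC 0) by (apply Cmod_pos_neq; lra).
  rewrite Cmod_div, Cmod_mult, Cmod_pow in HN2 by auto. apply Rabs_def2 in HN2.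
  set (e := Cmod (Gamma_ratio_err n z)) in *. set (p := Cmod (psi z)) in *. set (q := Cmod (polygamma 1 z)) in *.
  assert (Hq : 0 < q) by lra.
  assert (B : q / 2 <= e * p ^ 2).
  { replace (e * p ^ 2) with (e * p ^ 2 / q * q) by (field; lra). nra. }
  assert (Pp : 0 < p ^ 2) by (apply pow_lt; lra).
  assert (Le : / (4 * t * p ^ 2) <= e).
  { apply Rmult_le_reg_r with (p ^ 2); auto. eapply Rle_trans; [|exact B].
    replace (/ (4 * t * p ^ 2) * p ^ 2) with (/ (2 * t) / 2) by (field; lra). lra. }
  assert (Pe : 0 < / (4 * t * p ^ 2)) by (apply Rinv_0_lt_compat; nra).
  assert (Ne : Gamma_ratio_err n z <> RtoC 0) by (apply Cmod_pos_neq; fold e; lra).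
  split; auto. rewrite Cmod_inv by auto. fold e.
  apply Rle_trans with (4 * t * p ^ 2).
  - rewrite <- (Rinv_inv (4 * t * p ^ 2)). apply Rinv_le_contravar; auto.
  - apply Rmult_le_compat_l; [lra|]. unfold psi_growth. fold p. apply pow_incr. lra.
Qed.

(** The decay of order k + 1 beats the factor (Im s)^k coming from the inverse powers of eps and
    leaves one 1 / Im s against powers of psi. *)
Lemma Gamma_small s n A k : strip_seq s -> (2 <= n)%nat ->
  clim (fun i => Gamma (s i) * psi (s i) ^ A * (/ Gamma_ratio_err n (s i)) ^ k)%C 0.
Proof.
  intros Hs Hn. destruct (Gamma_ratio_err_inv s n Hs Hn) as [N HN].
  destruct (Gamma_decay (S k) 2 ltac:(lra)) as (B & HB & HG).
  apply (clim_psi_growth s) with (C0 := B * 4 ^ k) (A := (A + 2 * k)%nat); auto.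
  exists (N + 1)%nat. intros i Hi. destruct (HN i ltac:(lia)) as [Ne He]. destruct (Hs i) as [Hr Ht].
  assert (P : 1 <= INR i) by (apply INR_ge1; lia).
  set (z := s i) in *. set (t := Im z) in *.
  assert (G1 := HG z ltac:(lra) ltac:(fold t; lra)). fold t in G1.
  rewrite Cmod_minus_0, !Cmod_mult, !Cmod_pow.
  assert (Q1 : Cmod (psi z) ^ A <= psi_growth A z) by (apply pow_incr; assert (X := Cmod_ge_0 (psi z)); lra).
  assert (Q2 : Cmod (/ Gamma_ratio_err n z)%C ^ k <= (4 * t * psi_growth 2 z) ^ k) by (apply pow_incr; split; [apply Cmod_ge_0 | auto]).
  apply Rle_trans with (B / t ^ S k * psi_growth A z * (4 * t * psi_growth 2 z) ^ k).
  - apply Rmult_le_compat; auto.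
    + apply Rmult_le_pos; [apply Cmod_ge_0 | apply pow_le, Cmod_ge_0].
    + apply pow_le, Cmod_ge_0.
    + apply Rmult_le_compat; auto; [apply Cmod_ge_0 | apply pow_le, Cmod_ge_0].
  - right. rewrite <- (psi_growth_mult A (2 * k) z). rewrite !Rpow_mult_distr.
    replace (psi_growth 2 z ^ k) with (psi_growth (2 * k) z) by (unfold psi_growth; now rewrite pow_mult).
    change (t ^ S k) with (t * t ^ k). field. split; [lra | apply pow_nonzero; lra].
Qed.

(** * Peeling off dominant terms *)

Definition list_csum {I : Type} (f : I -> C) (l : list I) : C := fold_right Cplus (RtoC 0) (map f l).

Lemma list_csum_ext {I} (f g : I -> C) l : (forall i, In i l -> f i = g i) -> list_csum f l = list_csum g l.
Proof. intros H. unfold list_csum. f_equal. now apply map_ext_in. Qed.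

Lemma list_csum_0 {I} (l : list I) : list_csum (fun _ => RtoC 0) l = 0.
Proof. induction l; unfold list_csum in *; simpl; [auto | rewrite IHl; ring]. Qed.

Lemma list_csum_cons {I} (f : I -> C) i l : list_csum f (i :: l) = (f i + list_csum f l)%C.
Proof. reflexivity. Qed.

Lemma list_csum_plus {I} (f g : I -> C) l : list_csum (fun i => f i + g i)%C l = (list_csum f l + list_csum g l)%C.
Proof. induction l; [unfold list_csum; simpl; ring|]. rewrite !list_csum_cons, IHl. ring. Qed.

Lemma list_csum_scal {I} c (f : I -> C) l : list_csum (fun i => c * f i)%C l = (c * list_csum f l)%C.
Proof. induction l; [unfold list_csum; simpl; ring|]. rewrite !list_csum_cons, IHl. ring. Qed.

Lemma list_csum_swap {I J} (f : I -> J -> C) l l' :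
  list_csum (fun i => list_csum (f i) l') l = list_csum (fun j => list_csum (fun i => f i j) l) l'.
Proof.
  induction l.
  - symmetry. apply list_csum_0.
  - rewrite list_csum_cons, IHl, <- list_csum_plus. reflexivity.
Qed.

Lemma list_csum_delta {I} (i0 : I) (x : C) (f : I -> C) l : NoDup l -> In i0 l -> f i0 = x ->
  (forall i, In i l -> i <> i0 -> f i = 0) -> list_csum f l = x.
Proof.
  intros HN Hin Hx H. induction l as [|j l IH]; [destruct Hin|].
  inversion HN as [|? ? Hnin HN']; subst. rewrite list_csum_cons.
  destruct Hin as [->|Hin].
  - rewrite (list_csum_ext f (fun _ => RtoC 0) l), list_csum_0; [ring|].
    intros i Hi. apply H; [now right|]. intros ->. auto.
  - rewrite IH; auto.
    + rewrite (H j); [ring | now left |]. intros ->. auto.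
    + intros i Hi. apply H. now right.
Qed.

Lemma list_csum_seq (f : nat -> C) N : list_csum f (seq 0 N) = csum f N.
Proof.
  induction N; [reflexivity|]. rewrite seq_S. unfold list_csum in *. rewrite map_app, fold_right_app.
  simpl. rewrite <- IHN. generalize (map f (seq 0 N)). induction l; simpl; [ring | rewrite IHl; ring].
Qed.

Lemma clim_list_csum {I} (u : nat -> I -> C) (l : I -> C) (L : list I) :
  (forall i, In i L -> clim (fun n => u n i) (l i)) -> clim (fun n => list_csum (u n) L) (list_csum l L).
Proof.
  induction L; intros H; [apply (clim_const (RtoC 0))|].
  apply (clim_plus (fun n => u n a) (fun n => list_csum (u n) L)); [apply H; now left|].
  apply IHL. intros; apply H; now right.
Qed.

(** * Continuous coefficient functions *)

Lemma continuous_Cm_lim m (f : (nat -> C) -> C) (v : nat -> nat -> C) (b : nat -> C) :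
  continuous_Cm m f -> (forall k, (k <= m)%nat -> clim (fun i => v i k) (b k)) ->
  clim (fun i => f (v i)) (f b).
Proof.
  intros Hf Hv. apply clim_eps. intros eps He. destruct (Hf b eps He) as [dl [Hd H]].
  destruct (eventually_forall_le (fun k i => (k <= m)%nat -> Cmod (v i k - b k)%C < dl) m) as [N HN].
  - intros k. destruct (Nat.le_gt_cases k m) as [Hk|Hk].
    + specialize (Hv k Hk). rewrite clim_eps in Hv. destruct (Hv dl Hd) as [N HN]. exists N. auto.
    + exists 0%nat. intros. lia.
  - exists N. intros i Hi. apply H. intros k Hk. now apply HN.
Qed.

(** Zeta does not vanish for Re s > 1, and density is stated for a nonzero first coordinate; a small
    change of that coordinate preserves nonvanishing. *)
Lemma continuous_Cm_nonzero m (f : (nat -> C) -> C) u : continuous_Cm m f -> f u <> RtoC 0 ->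
  exists b, b 0%nat <> RtoC 0 /\ f b <> RtoC 0.
Proof.
  intros Hf Hu. destruct (classic (u 0%nat = RtoC 0)) as [E|E]; [|exists u; auto].
  destruct (Hf u (Cmod (f u)) (Cmod_pos _ Hu)) as [dl [Hd H]].
  exists (fun i => match i with O => RtoC (dl / 2) | S _ => u i end). split.
  - apply RtoC_neq0. lra.
  - intros E2. specialize (H (fun i => match i with O => RtoC (dl / 2) | S _ => u i end)).
    rewrite E2 in H. rewrite Cmod_minus_sym, Cmod_minus_0 in H.
    assert (X : Cmod (f u) < Cmod (f u)); [|lra]. apply H. intros [|i] Hi.
    + rewrite E, Cmod_minus_0, Cmod_RtoC_pos; lra.
    + replace (u (S i) - u (S i))%C with (RtoC 0) by ring. rewrite Cmod_0. exact Hd.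
Qed.

Lemma continuous_Cm_scal m (c : C) f : continuous_Cm m f -> continuous_Cm m (fun u => c * f u)%C.
Proof.
  intros Hf u eps He. assert (Pc := Cmod_ge_0 c).
  destruct (Hf u (eps / (Cmod c + 1))) as [dl [Hd H]]; [apply Rdiv_lt_0_compat; lra|].
  exists dl. split; auto. intros v Hv. specialize (H v Hv).
  replace (c * f v - c * f u)%C with (c * (f v - f u))%C by ring. rewrite Cmod_mult.
  apply Rle_lt_trans with (Cmod c * (eps / (Cmod c + 1))).
  - apply Rmult_le_compat_l; lra.
  - apply Rmult_lt_reg_r with (Cmod c + 1); [lra|].
    replace (Cmod c * (eps / (Cmod c + 1)) * (Cmod c + 1)) with (Cmod c * eps) by (field; lra). nra.
Qed.

Lemma continuous_Cm_list_csum m {I} (f : I -> (nat -> C) -> C) l :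
  (forall i, In i l -> continuous_Cm m (f i)) -> continuous_Cm m (fun u => list_csum (fun i => f i u) l).
Proof.
  induction l as [|i l IH]; intros H u eps He.
  - exists 1. split; [lra|]. intros v _. unfold list_csum. simpl.
    replace (0 - 0)%C with (RtoC 0) by ring. now rewrite Cmod_0.
  - destruct (H i (or_introl eq_refl) u (eps / 2)) as [d1 [P1 H1]]; [lra|].
    destruct (IH (fun j Hj => H j (or_intror Hj)) u (eps / 2)) as [d2 [P2 H2]]; [lra|].
    exists (Rmin d1 d2). split; [now apply Rmin_pos|]. intros v Hv. rewrite !list_csum_cons.
    assert (M1 := Rmin_l d1 d2). assert (M2 := Rmin_r d1 d2).
    specialize (H1 v). specialize (H2 v).
    replace (f i v + list_csum (fun i => f i v) l - (f i u + list_csum (fun i => f i u) l))%C with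
      ((f i v - f i u) + (list_csum (fun i => f i v) l - list_csum (fun i => f i u) l))%C by ring.
    eapply Rle_lt_trans; [apply Cmod_triangle|].
    assert (A1 : Cmod (f i v - f i u)%C < eps / 2) by (apply H1; intros; eapply Rlt_le_trans; [now apply Hv | lra]).
    assert (A2 : Cmod (list_csum (fun i => f i v) l - list_csum (fun i => f i u) l)%C < eps / 2)
      by (apply H2; intros; eapply Rlt_le_trans; [now apply Hv | lra]).
    lra.
Qed.

Lemma min_rank {I} (rank : I -> nat) (Q : I -> Prop) i : Q i ->
  exists i0, Q i0 /\ forall j, Q j -> (rank i0 <= rank j)%nat.
Proof.
  remember (rank i) as r eqn:E. revert i E. induction r as [r IH] using (well_founded_induction Nat.lt_wf_0).
  intros i E Hi. destruct (classic (exists j, Q j /\ (rank j < r)%nat)) as [[j [Hj Hr]]|Hn].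
  - apply (IH (rank j) Hr j eq_refl Hj).
  - exists i. split; auto. intros j Hj. apply Nat.nlt_ge. intros Hlt. apply Hn. exists j. split; auto. lia.
Qed.

Definition zeta_vec (z : C) : nat -> C := fun i => Cderive_n i zeta z.

(* Along a sequence on which the zeta vector converges to a point where the coefficient of least rank
   is nonzero, that term would dominate all the others. *)
Lemma peel (m : nat) {I : Type} (idx : list I) (c : I -> (nat -> C) -> C) (R : I -> C -> C) (rank : I -> nat) :
  NoDup idx ->
  (forall i, In i idx -> continuous_Cm m (c i)) ->
  (forall i j, In i idx -> In j idx -> rank i = rank j -> i = j) ->
  (forall i s, In i idx -> (exists u, c i u <> RtoC 0) -> strip_seq s ->
     exists N, forall n, (N <= n)%nat -> R i (s n) <> RtoC 0) ->
  (forall i j s, In i idx -> In j idx -> (exists u, c i u <> RtoC 0) -> (exists u, c j u <> RtoC 0) ->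
     (rank i < rank j)%nat -> strip_seq s -> clim (fun n => R j (s n) / R i (s n))%C 0) ->
  (forall s, strip_seq s -> exists N, forall n, (N <= n)%nat ->
     list_csum (fun i => c i (zeta_vec (s n)) * R i (s n))%C idx = 0) ->
  forall i u, In i idx -> c i u = RtoC 0.
Proof.
  intros HN Hc Hinj Hnz Hdom Hsum i u Hi. apply NNPP. intros Hne.
  destruct (min_rank rank (fun i => In i idx /\ exists u, c i u <> RtoC 0) i) as [i0 [[Hi0 [u0 Hu0]] Hmin]].
  { split; eauto. }
  destruct (continuous_Cm_nonzero m (c i0) u0 (Hc i0 Hi0) Hu0) as [b [Hb0 Hb]].
  destruct (zeta_dense m b Hb0) as [s [Hs Hlim]].
  assert (HL : forall j, In j idx -> clim (fun n => c j (zeta_vec (s n))) (c j b)).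
  { intros j Hj. apply (continuous_Cm_lim m); auto. intros k Hk.
    apply clim_ext with (2 := Hlim k Hk). intros n. unfold zeta_vec. symmetry. apply zeta_derive_n. apply Hs. }
  destruct (Hnz i0 s Hi0 (ex_intro _ u0 Hu0) Hs) as [N1 HN1].
  destruct (Hsum s Hs) as [N2 HN2].
  (* After division by the leading term every other summand tends to 0: by domination if its
     coefficient is somewhere nonzero, and trivially otherwise. *)
  assert (L1 : clim (fun n => list_csum (fun j => c j (zeta_vec (s n)) * (R j (s n) / R i0 (s n)))%C idx)
    (list_csum (fun j => if excluded_middle_informative (j = i0) then c i0 b else 0) idx)).
  { apply (clim_list_csum (fun n j => c j (zeta_vec (s n)) * (R j (s n) / R i0 (s n)))%C). intros j Hj.
    destruct (excluded_middle_informative (j = i0)) as [->|Hji].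
    - replace (c i0 b) with (c i0 b * 1)%C by ring. apply clim_mult; [auto|].
      apply clim_ext_loc with (fun _ => RtoC 1); [|apply clim_const].
      exists N1. intros n Hn. field. now apply HN1.
    - destruct (classic (exists u, c j u <> RtoC 0)) as [Hj2|Hj2].
      + replace (RtoC 0) with (c j b * 0)%C by ring. apply clim_mult; auto. apply Hdom; eauto.
        assert (X := Hmin j (conj Hj Hj2)).
        assert (Y : rank i0 <> rank j) by (intros E; apply Hji; symmetry; now apply Hinj). lia.
      + apply clim_ext with (fun _ => RtoC 0); [|apply clim_const]. intros n.
        replace (c j (zeta_vec (s n))) with (RtoC 0); [ring|].
        apply NNPP. intros Hx. apply Hj2. exists (zeta_vec (s n)). auto. }
  assert (E : list_csum (fun j => if excluded_middle_informative (j = i0) then c i0 b else 0) idx = c i0 b).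
  { apply list_csum_delta with i0; auto.
    - destruct (excluded_middle_informative (i0 = i0)); [auto | congruence].
    - intros j _ Hji. destruct (excluded_middle_informative (j = i0)); [congruence | auto]. }
  rewrite E in L1. apply Hb. apply clim_unique with (1 := L1).
  apply clim_ext_loc with (fun _ => RtoC 0); [|apply clim_const].
  exists (N1 + N2)%nat. intros n Hn.
  rewrite (list_csum_ext _ (fun j => / R i0 (s n) * (c j (zeta_vec (s n)) * R j (s n)))%C) by (intros; unfold Cdiv; ring).
  rewrite list_csum_scal, HN2 by lia. ring.
Qed.

(** * Dominance among the monomials *)

Definition core (n p e k : nat) (z : C) : C := (Gamma z ^ p * psi z ^ e * Gamma_ratio_err n z ^ k)%C.

Lemma clim_pow u l d : clim u l -> clim (fun n => u n ^ d)%C (l ^ d)%C.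
Proof. intros H. induction d; simpl; [apply clim_const | now apply clim_mult]. Qed.

Lemma eventually_nonzero s n : strip_seq s -> (2 <= n)%nat -> exists N, forall i, (N <= i)%nat ->
  1 < Re (s i) /\ Gamma (s i) <> RtoC 0 /\ psi (s i) <> RtoC 0 /\ Gamma_ratio_err n (s i) <> RtoC 0.
Proof.
  intros Hs Hn. destruct (Gamma_ratio_err_inv s n Hs Hn) as [N1 H1]. destruct (psi_large s 1 Hs) as (N2 & _ & H2).
  exists (N1 + N2)%nat. intros i Hi. destruct (Hs i) as [Hr _]. split; [lra|].
  split; [apply Gamma_neq0; lra|]. split.
  - apply Cmod_pos_neq. specialize (H2 i ltac:(lia)). lra.
  - apply H1; lia.
Qed.

Lemma core_neq0 s n p e k : strip_seq s -> (2 <= n)%nat -> exists N, forall i, (N <= i)%nat ->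
  core n p e k (s i) <> RtoC 0.
Proof.
  intros Hs Hn. destruct (eventually_nonzero s n Hs Hn) as [N H]. exists N. intros i Hi.
  destruct (H i Hi) as (_ & H1 & H2 & H3). unfold core. repeat apply Cmult_neq_0; now apply Cpow_nz.
Qed.

Lemma Cpow_inv_l (x : C) k : x <> RtoC 0 -> ((/ x) ^ k * x ^ k)%C = 1.
Proof.
  intros Hx. induction k; simpl; [ring|].
  transitivity ((/ x * x) * ((/ x) ^ k * x ^ k))%C; [ring|]. rewrite IHk. field. auto.
Qed.

(** One spare Gamma absorbs all powers of psi and inverse powers of eps; at equal p one spare eps
    absorbs all powers of psi; at equal p and k a power of 1/psi is left. *)
Lemma core_dominance s n p e k p' e' k' : strip_seq s -> (2 <= n)%nat ->
  (p < p' \/ (p = p' /\ (k < k' \/ (k = k' /\ e' < e))))%nat ->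
  clim (fun i => core n p' e' k' (s i) / core n p e k (s i))%C 0.
Proof.
  intros Hs Hn Hord. destruct (eventually_nonzero s n Hs Hn) as [N H].
  assert (Leps : clim (fun i => Gamma_ratio_err n (s i)) 0).
  { apply clim_ext with (2 := Gamma_ratio_err_small s n 0 Hs). intros i. simpl. ring. }
  assert (Lpsi := psi_inv_lim s Hs).
  assert (LGam : clim (fun i => Gamma (s i)) 0).
  { apply clim_ext with (2 := Gamma_small s 2 0 0 Hs ltac:(lia)). intros i. simpl. ring. }
  destruct Hord as [Hp | [<- [Hk | [<- He]]]].
  - replace (RtoC 0) with (0 ^ (p' - p - 1) * 0 * 0 ^ e * 0 ^ k')%C by ring.
    apply clim_ext_loc with (fun i => Gamma (s i) ^ (p' - p - 1) * (Gamma (s i) * psi (s i) ^ e' * (/ Gamma_ratio_err n (s i)) ^ k) *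
      (/ psi (s i)) ^ e * Gamma_ratio_err n (s i) ^ k')%C.
    + exists N. intros i Hi. destruct (H i Hi) as (_ & H1 & H2 & H3). unfold core.
      replace (Gamma (s i) ^ p')%C with (Gamma (s i) ^ (p' - p - 1) * Gamma (s i) * Gamma (s i) ^ p)%C.
      2:{ transitivity (Gamma (s i) ^ (p' - p - 1) * Gamma (s i) ^ S p)%C; [rewrite Cpow_S; ring|].
          rewrite <- Cpow_add_r. f_equal. lia. }
      assert (Q1 := Cpow_inv_l _ k H3). assert (Q2 := Cpow_inv_l _ e H2).
      assert (W1 : (Gamma_ratio_err n (s i) ^ k)%C <> RtoC 0) by now apply Cpow_nz.
      assert (W2 : (psi (s i) ^ e)%C <> RtoC 0) by now apply Cpow_nz.
      assert (W3 : (Gamma (s i) ^ p)%C <> RtoC 0) by now apply Cpow_nz.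
      replace ((/ Gamma_ratio_err n (s i)) ^ k)%C with (/ (Gamma_ratio_err n (s i) ^ k))%C.
      2:{ transitivity (((/ Gamma_ratio_err n (s i)) ^ k * Gamma_ratio_err n (s i) ^ k) * / (Gamma_ratio_err n (s i) ^ k))%C; [rewrite Q1; ring | field; auto]. }
      replace ((/ psi (s i)) ^ e)%C with (/ (psi (s i) ^ e))%C.
      2:{ transitivity (((/ psi (s i)) ^ e * psi (s i) ^ e) * / (psi (s i) ^ e))%C; [rewrite Q2; ring | field; auto]. }
      field. auto.
    + apply clim_mult; [|now apply clim_pow]. apply clim_mult; [|now apply clim_pow].
      apply clim_mult; [now apply clim_pow | now apply Gamma_small].
  - replace (RtoC 0) with (0 ^ (k' - k - 1) * 0 * 0 ^ e)%C by ring.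
    apply clim_ext_loc with (fun i => Gamma_ratio_err n (s i) ^ (k' - k - 1) * (Gamma_ratio_err n (s i) * psi (s i) ^ e') * (/ psi (s i)) ^ e)%C.
    + exists N. intros i Hi. destruct (H i Hi) as (_ & H1 & H2 & H3). unfold core.
      replace (Gamma_ratio_err n (s i) ^ k')%C with (Gamma_ratio_err n (s i) ^ (k' - k - 1) * Gamma_ratio_err n (s i) * Gamma_ratio_err n (s i) ^ k)%C.
      2:{ transitivity (Gamma_ratio_err n (s i) ^ (k' - k - 1) * Gamma_ratio_err n (s i) ^ S k)%C; [rewrite Cpow_S; ring|].
          rewrite <- Cpow_add_r. f_equal. lia. }
      assert (Q2 := Cpow_inv_l _ e H2).
      assert (W1 : (Gamma_ratio_err n (s i) ^ k)%C <> RtoC 0) by now apply Cpow_nz.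
      assert (W2 : (psi (s i) ^ e)%C <> RtoC 0) by now apply Cpow_nz.
      assert (W3 : (Gamma (s i) ^ p)%C <> RtoC 0) by now apply Cpow_nz.
      replace ((/ psi (s i)) ^ e)%C with (/ (psi (s i) ^ e))%C.
      2:{ transitivity (((/ psi (s i)) ^ e * psi (s i) ^ e) * / (psi (s i) ^ e))%C; [rewrite Q2; ring | field; auto]. }
      field. auto.
    + apply clim_mult; [|now apply clim_pow]. apply clim_mult; [now apply clim_pow | now apply Gamma_ratio_err_small].
  - replace (RtoC 0) with (0 ^ (e - e'))%C.
    2:{ destruct (e - e')%nat eqn:E; [lia|]. simpl. ring. }
    apply clim_ext_loc with (fun i => (/ psi (s i)) ^ (e - e'))%C.
    + exists N. intros i Hi. destruct (H i Hi) as (_ & H1 & H2 & H3). unfold core.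
      replace (psi (s i) ^ e)%C with (psi (s i) ^ e' * psi (s i) ^ (e - e'))%C
        by (rewrite <- Cpow_add_r; f_equal; lia).
      assert (Q2 := Cpow_inv_l _ (e - e') H2).
      assert (W1 : (Gamma_ratio_err n (s i) ^ k)%C <> RtoC 0) by now apply Cpow_nz.
      assert (W2 : (psi (s i) ^ e')%C <> RtoC 0) by now apply Cpow_nz.
      assert (W3 : (Gamma (s i) ^ p)%C <> RtoC 0) by now apply Cpow_nz.
      assert (W4 : (psi (s i) ^ (e - e'))%C <> RtoC 0) by now apply Cpow_nz.
      transitivity (((/ psi (s i)) ^ (e - e') * psi (s i) ^ (e - e')) * / (psi (s i) ^ (e - e')))%C; [field; auto|].
      rewrite Q2. field. auto.
    + now apply clim_pow.
Qed.

(** * Factorisation of the monomials in the derivatives of Gamma *)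

Definition list_cprod {I : Type} (f : I -> C) (l : list I) : C := fold_right Cmult (RtoC 1) (map f l).

Lemma list_cprod_ext {I} (f g : I -> C) l : (forall i, In i l -> f i = g i) -> list_cprod f l = list_cprod g l.
Proof. intros H. unfold list_cprod. f_equal. now apply map_ext_in. Qed.

Lemma list_cprod_mult {I} (f g : I -> C) l : list_cprod (fun i => f i * g i)%C l = (list_cprod f l * list_cprod g l)%C.
Proof. induction l; unfold list_cprod in *; simpl; [ring | rewrite IHl; ring]. Qed.

Lemma list_cprod_app {I} (f : I -> C) l l' : list_cprod f (l ++ l') = (list_cprod f l * list_cprod f l')%C.
Proof. induction l; unfold list_cprod in *; simpl; [ring | rewrite IHl; ring]. Qed.

Lemma list_cprod_pow {I} x (a : I -> nat) l : list_cprod (fun i => x ^ a i)%C l = (x ^ fold_right Nat.add 0%nat (map a l))%C.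
Proof. induction l; unfold list_cprod in *; simpl; [auto | rewrite IHl, Cpow_add_r; auto]. Qed.

Lemma clim_list_cprod_1 {I} (u : nat -> I -> C) (L : list I) :
  (forall i, In i L -> clim (fun n => u n i) 1) -> clim (fun n => list_cprod (u n) L) 1.
Proof.
  induction L; intros H; [apply (clim_const (RtoC 1))|].
  replace (RtoC 1) with (1 * 1)%C by ring.
  apply (clim_mult (fun n => u n a) (fun n => list_cprod (u n) L)); [apply H; now left|].
  apply IHL. intros; apply H; now right.
Qed.

Lemma map_nth_seq_id (l : list nat) : map (fun j => nth j l 0%nat) (seq 0 (length l)) = l.
Proof.
  induction l; simpl; auto. f_equal. rewrite <- seq_shift, map_map. exact IHl.
Qed.

Lemma monomial_split n lam z : length lam = S n -> Gamma z <> RtoC 0 ->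
  monomial n lam (fun j => Cderive_n j Gamma z) =
  (Gamma z ^ lam_abs lam * list_cprod (fun j => Gamma_ratio j z ^ nth j lam 0%nat) (seq 0 (S n)))%C.
Proof.
  intros Hl HG. unfold monomial. fold (list_cprod (fun j => Cderive_n j Gamma z ^ nth j lam 0%nat)%C (seq 0 (S n))).
  rewrite (list_cprod_ext _ (fun j => Gamma z ^ nth j lam 0%nat * Gamma_ratio j z ^ nth j lam 0%nat)%C).
  - rewrite list_cprod_mult, list_cprod_pow. f_equal. f_equal. unfold lam_abs.
    rewrite <- Hl, map_nth_seq_id. reflexivity.
  - intros j _. rewrite <- Cpow_mult_l. f_equal. unfold Gamma_ratio. field. auto.
Qed.

Lemma Gamma_ratio_0 z : Gamma z <> RtoC 0 -> Gamma_ratio 0 z = 1.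
Proof. intros H. unfold Gamma_ratio. simpl. field. auto. Qed.

Lemma Gamma_ratio_1 z : 1 < Re z -> Gamma_ratio 1 z = psi z.
Proof.
  intros H. unfold Gamma_ratio. simpl. rewrite (Cderive_eq _ _ _ (cder_Gamma z H)). field. now apply Gamma_neq0.
Qed.

(** Entry 0 is recovered from the total |lambda|. *)
Lemma list_ext_nth (l l' : list nat) : length l = length l' ->
  (forall j, (1 <= j < length l)%nat -> nth j l 0%nat = nth j l' 0%nat) -> lam_abs l = lam_abs l' -> l = l'.
Proof.
  intros Hl Hn Hs. destruct l as [|a l], l' as [|a' l']; try discriminate; auto.
  assert (E : l = l').
  { apply nth_ext with 0%nat 0%nat; [injection Hl; auto|]. intros j Hj. apply (Hn (S j)). simpl. lia. }
  subst l'. f_equal. unfold lam_abs in Hs. simpl in Hs. lia.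
Qed.

(** * The case [n = 1] *)

(** Here Gamma'/Gamma = psi exactly, so eps would be 0, and the monomials Gamma^|lambda|
    psi^(lambda_1) are already separated. The argument 2 of [core] is a formality, since eps occurs
    with exponent 0. *)
Lemma theorem_one (m : nat) (Lam : list (list nat)) (F : list nat -> (nat -> C) -> C) :
  in_family m 1 Lam F ->
  (forall z : C, 1 < Re z -> calF 1 Lam F (zeta_vec z) (fun j => Cderive_n j Gamma z) = RtoC 0) ->
  forall lam, In lam Lam -> forall u : nat -> C, F lam u = RtoC 0.
Proof.
  intros (HN & Hlen & HF & _ & _) Hz lam Hin u.
  destruct (list_bound (fun l : list nat => INR (nth 1 l 0%nat)) Lam) as [B0 HB0].
  destruct (INR_unbounded B0) as [Q HQ].
  assert (HQ1 : forall l, In l Lam -> (nth 1 l 0 < Q)%nat).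
  { intros l Hl. apply INR_lt. specialize (HB0 l Hl). simpl in HB0. lra. }
  (* A two-digit number in base Q: |lambda| increasing, then lambda_1 decreasing. *)
  set (rank := fun l : list nat => (lam_abs l * Q + (Q - 1 - nth 1 l 0))%nat).
  apply (peel m Lam F (fun l => core 2 (lam_abs l) (nth 1 l 0%nat) 0) rank); auto.
  - intros l Hl. now apply HF.
  - intros l l' Hl Hl' E. specialize (HQ1 l Hl) as H1. specialize (HQ1 l' Hl') as H2.
    unfold rank in E. assert (X := Nat.div_mod_unique Q (lam_abs l) (lam_abs l') (Q - 1 - nth 1 l 0)%nat (Q - 1 - nth 1 l' 0)%nat ltac:(lia) ltac:(lia) ltac:(lia)).
    apply list_ext_nth; [rewrite !Hlen; auto | | apply X].
    rewrite Hlen by auto. intros j Hj. replace j with 1%nat by lia. lia.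
  - intros l s Hl _ Hs. now apply core_neq0.
  - intros l l' s Hl Hl' _ _ Hr Hs. specialize (HQ1 l Hl) as H1. specialize (HQ1 l' Hl') as H2.
    apply core_dominance; auto. unfold rank in Hr.
    destruct (Nat.lt_trichotomy (lam_abs l) (lam_abs l')) as [H|[H|H]]; [auto | | nia].
    right. split; auto. right. split; auto. rewrite H in Hr. lia.
  - intros s Hs. exists 0%nat. intros i _. destruct (Hs i) as [Hr _].
    rewrite <- (Hz (s i)) by lra. unfold calF. apply list_csum_ext. intros l Hl.
    f_equal. assert (HG := Gamma_neq0 (s i) ltac:(lra)).
    rewrite monomial_split by auto. unfold core, list_cprod. simpl. rewrite Gamma_ratio_0, Gamma_ratio_1 by (auto; lra).
    rewrite Cpow_1_l. ring.
Qed.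

(** * The case [n >= 2] *)

(** Pascal's recursion yields 0 for k > a, which the triangular elimination relies on; the quotient
    of factorials with truncated subtraction would not vanish there. *)
Fixpoint binom_nat (a k : nat) : nat :=
  match a, k with
  | _, O => 1
  | O, S _ => 0
  | S a, S k => binom_nat a k + binom_nat a (S k)
  end.

Lemma binom_nat_gt a k : (a < k)%nat -> binom_nat a k = 0%nat.
Proof. revert k. induction a; intros [|k] H; try lia; simpl; auto. rewrite !IHa; lia. Qed.

Lemma binom_nat_diag a : binom_nat a a = 1%nat.
Proof. induction a; simpl; auto. rewrite IHa, binom_nat_gt; lia. Qed.

Lemma binom_nat_binomial a x K : (a < K)%nat -> ((1 + x) ^ a)%C = csum (fun k => RtoC (INR (binom_nat a k)) * x ^ k)%C K.
Proof.
  revert K. induction a; intros K HK.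
  - destruct K as [|K]; [lia|]. rewrite csum_head. rewrite (csum_ext _ (fun _ => RtoC 0)), csum_0.
    + simpl. ring.
    + intros i _. simpl. ring.
  - destruct K as [|K]; [lia|]. rewrite csum_head, Cpow_S.
    rewrite (csum_ext _ (fun k => x * (RtoC (INR (binom_nat a k)) * x ^ k) + RtoC (INR (binom_nat a (S k))) * x ^ S k)%C).
    + rewrite csum_plus, csum_scal, <- IHa by lia.
      assert (E : ((1 + x) ^ a)%C = csum (fun k => RtoC (INR (binom_nat a k)) * x ^ k)%C (S K)) by (apply IHa; lia).
      rewrite csum_head in E.
      assert (B0 : binom_nat a 0 = 1%nat) by now destruct a.
      rewrite B0 in E. change (binom_nat (S a) 0) with 1%nat.
      transitivity ((1 + x) ^ a + x * (1 + x) ^ a)%C; [ring|]. rewrite E at 1. simpl. ring.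
    + intros i _. change (binom_nat (S a) (S i)) with (binom_nat a i + binom_nat a (S i))%nat. rewrite plus_INR, RtoC_plus, !Cpow_S. ring.
Qed.

(** The factor Gamma^(n) has been replaced by its leading part and a power of eps. What remains
    depends on [lam] only through |lambda|, |lambda|^star and the middle entries. *)
Definition reduced_term (n : nat) (lam : list nat) (k : nat) (z : C) : C :=
  (Gamma z ^ lam_abs lam * psi z ^ lam_star n lam * Gamma_ratio_err n z ^ k *
   list_cprod (fun j => Gamma_ratio j z ^ nth j lam 0%nat) (seq 2 (n - 2)))%C.

(** The middle derivatives relative to their leading powers of psi; it tends to 1 and does not
    affect the ordering by size. *)
Definition slow_factor (n : nat) (lam : list nat) (z : C) : C :=
  list_cprod (fun j => (Gamma_ratio j z / psi z ^ j) ^ nth j lam 0%nat)%C (seq 2 (n - 2)).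

Lemma reduced_term_core n lam k z : psi z <> RtoC 0 ->
  reduced_term n lam k z = (core n (lam_abs lam) (lam_star n lam + lam_chi n lam) k z * slow_factor n lam z)%C.
Proof.
  intros Hp. unfold reduced_term, core, slow_factor.
  assert (E : list_cprod (fun j => Gamma_ratio j z ^ nth j lam 0%nat)%C (seq 2 (n - 2)) =
    (psi z ^ lam_chi n lam * list_cprod (fun j => (Gamma_ratio j z / psi z ^ j) ^ nth j lam 0%nat)%C (seq 2 (n - 2)))%C).
  { unfold lam_chi. rewrite <- list_cprod_pow, <- list_cprod_mult. apply list_cprod_ext. intros j _.
    rewrite Cpow_mult_r, <- Cpow_mult_l. f_equal. field. now apply Cpow_nz. }
  rewrite E, Cpow_add_r. ring.
Qed.

Lemma slow_factor_lim n lam s : strip_seq s -> clim (fun i => slow_factor n lam (s i)) 1.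
Proof.
  intros Hs. apply (clim_list_cprod_1 (fun i j => (Gamma_ratio j (s i) / psi (s i) ^ j) ^ nth j lam 0%nat)%C).
  intros j _. rewrite <- (Cpow_1_l (nth j lam 0%nat)) at 1. apply clim_pow. now apply Gamma_ratio_quotient_lim.
Qed.

Lemma monomial_expansion n lam z K : (2 <= n)%nat -> length lam = S n -> 1 < Re z -> psi z <> RtoC 0 ->
  (nth n lam 0 < K)%nat ->
  monomial n lam (fun j => Cderive_n j Gamma z) =
  csum (fun k => RtoC (INR (binom_nat (nth n lam 0%nat) k)) * reduced_term n lam k z)%C K.
Proof.
  intros Hn Hl Hz Hp HK. assert (HG := Gamma_neq0 z Hz).
  rewrite monomial_split by auto.
  assert (Es : seq 0 (S n) = ((0%nat :: 1%nat :: nil) ++ seq 2 (n - 2) ++ (n :: nil))%list).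
  { replace (S n) with (2 + ((n - 2) + 1))%nat by lia. rewrite seq_app, seq_app. simpl.
    repeat f_equal. lia. }
  rewrite Es, !list_cprod_app. unfold list_cprod at 1 3. simpl fold_right.
  rewrite Gamma_ratio_0, Gamma_ratio_1, Cpow_1_l by auto.
  assert (En : Gamma_ratio n z = (psi z ^ n * (1 + Gamma_ratio_err n z))%C).
  { unfold Gamma_ratio_err. field. now apply Cpow_nz. }
  rewrite En, Cpow_mult_l, (binom_nat_binomial _ _ K HK).
  rewrite (csum_ext (fun k => RtoC (INR (binom_nat (nth n lam 0%nat) k)) * reduced_term n lam k z)%C
    (fun k => (Gamma z ^ lam_abs lam * psi z ^ lam_star n lam *
    list_cprod (fun j => Gamma_ratio j z ^ nth j lam 0%nat) (seq 2 (n - 2))) * (RtoC (INR (binom_nat (nth n lam 0%nat) k)) * Gamma_ratio_err n z ^ k))%C).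
  - rewrite csum_scal. unfold lam_star. rewrite Cpow_add_r, (Cpow_mult_r (psi z) n). ring.
  - intros k _. unfold reduced_term. ring.
Qed.

(** Terms of equal size are gathered under one integer key, peeling annihilates the gathered
    coefficients, and a triangular elimination in lambda_n then isolates each F_lambda. *)
Lemma theorem_many (m n : nat) (Lam : list (list nat)) (F : list nat -> (nat -> C) -> C) :
  (2 <= n)%nat -> in_family m n Lam F ->
  (forall z : C, 1 < Re z -> calF n Lam F (zeta_vec z) (fun j => Cderive_n j Gamma z) = RtoC 0) ->
  forall lam, In lam Lam -> forall u : nat -> C, F lam u = RtoC 0.
Proof.
  intros Hn (HN & Hlen & HF & Hi & Hii) Hz.
  destruct (list_bound (fun l : list nat => INR (lam_star n l)) Lam) as [B1 HB1].
  destruct (INR_unbounded B1) as [Q HQ].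
  assert (HQ1 : forall l, In l Lam -> (lam_star n l < Q)%nat).
  { intros l Hl. apply INR_lt. specialize (HB1 l Hl). simpl in HB1. lra. }
  destruct (list_bound (fun l : list nat => INR (nth n l 0%nat)) Lam) as [B2 HB2].
  destruct (INR_unbounded B2) as [K HK].
  assert (HK1 : forall l, In l Lam -> (nth n l 0 < K)%nat).
  { intros l Hl. apply INR_lt. specialize (HB2 l Hl). simpl in HB2. lra. }
  destruct (list_bound (fun l : list nat => INR (lam_abs l)) Lam) as [B3 HB3].
  destruct (INR_unbounded B3) as [P HP].
  assert (HP1 : forall l, In l Lam -> (lam_abs l < P)%nat).
  { intros l Hl. apply INR_lt. specialize (HB3 l Hl). simpl in HB3. lra. }
  (* Terms are ordered by increasing [|lam|], then increasing power of [Gamma_ratio_err], then decreasing [|lam|^*]. *)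
  set (key := fun (l : list nat) k => ((lam_abs l * K + k) * Q + (Q - 1 - lam_star n l))%nat).
  assert (Hkey : forall l l' k k', In l Lam -> In l' Lam -> (k < K)%nat -> (k' < K)%nat -> key l k = key l' k' ->
    lam_abs l = lam_abs l' /\ k = k' /\ lam_star n l = lam_star n l').
  { intros l l' k k' Hl Hl' Hk Hk' E. specialize (HQ1 l Hl) as H1. specialize (HQ1 l' Hl') as H2. unfold key in E.
    assert (X := Nat.div_mod_unique Q (lam_abs l * K + k)%nat (lam_abs l' * K + k')%nat (Q - 1 - lam_star n l)%nat (Q - 1 - lam_star n l')%nat ltac:(lia) ltac:(lia) ltac:(lia)).
    destruct X as [X1 X2].
    assert (Y := Nat.div_mod_unique K (lam_abs l) (lam_abs l') k k' Hk Hk' ltac:(lia)). lia. }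
  assert (Hkeylt : forall l k, In l Lam -> (k < K)%nat -> (key l k < P * K * Q)%nat).
  { intros l k Hl Hk. specialize (HQ1 l Hl). specialize (HP1 l Hl). unfold key.
    assert (lam_abs l * K + k < P * K)%nat by nia. nia. }
  (* A key may come from several tuples, so one is chosen. For an integer that is no key the choice
     is arbitrary, and the coefficient [c r] is 0. *)
  set (rep := fun r => epsilon (inhabits (nil, 0%nat)) (fun x : list nat * nat =>
    In (fst x) Lam /\ (snd x < K)%nat /\ key (fst x) (snd x) = r)).
  set (R := fun r z => reduced_term n (fst (rep r)) (snd (rep r)) z).
  set (c := fun r u => list_csum (fun l => list_csum (fun k =>
    (if Nat.eqb r (key l k) then RtoC (INR (binom_nat (nth n l 0%nat) k)) else 0) * F l u)%C (seq 0 K)) Lam).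
  assert (Hrep : forall l k, In l Lam -> (k < K)%nat ->
    In (fst (rep (key l k))) Lam /\ (snd (rep (key l k)) < K)%nat /\ key (fst (rep (key l k))) (snd (rep (key l k))) = key l k).
  { intros l k Hl Hk. unfold rep. apply epsilon_spec. exists (l, k). auto. }
  (* Condition (i) enters here: tuples with equal |lambda| and |lambda|^star have equal middle
     entries, hence the same reduced term. *)
  assert (HR : forall l k z, In l Lam -> (k < K)%nat -> R (key l k) z = reduced_term n l k z).
  { intros l k z Hl Hk. destruct (Hrep l k Hl Hk) as (A1 & A2 & A3).
    destruct (Hkey _ _ _ _ A1 Hl A2 Hk A3) as (E1 & E2 & E3). unfold R, reduced_term. rewrite E1, E2, E3. f_equal.
    apply list_cprod_ext. intros j Hj. apply in_seq in Hj. f_equal. apply Hi; auto; lia. }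
  assert (Hcnz : forall r, (exists u, c r u <> RtoC 0) -> exists l k, In l Lam /\ (k < K)%nat /\ r = key l k).
  { intros r [u Hu]. apply NNPP. intros Hno. apply Hu. unfold c.
    rewrite (list_csum_ext _ (fun _ => RtoC 0)); [apply list_csum_0|]. intros l Hl.
    rewrite (list_csum_ext _ (fun _ => RtoC 0)); [apply list_csum_0|]. intros k Hk. apply in_seq in Hk.
    destruct (Nat.eqb_spec r (key l k)) as [E|E]; [|ring].
    exfalso. apply Hno. exists l, k. repeat split; auto; lia. }
  assert (Hzero : forall r u, In r (seq 0 (P * K * Q)) -> c r u = RtoC 0).
  { apply (peel m (seq 0 (P * K * Q)) c R (fun r => r)).
    - apply seq_NoDup.
    - intros r _. unfold c. apply continuous_Cm_list_csum. intros l Hl.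
      apply continuous_Cm_list_csum. intros k _. apply continuous_Cm_scal. now apply HF.
    - auto.
    - intros r s _ Hr Hs. destruct (Hcnz r Hr) as (l & k & Hl & Hk & ->).
      destruct (core_neq0 s n (lam_abs l) (lam_star n l + lam_chi n l) k Hs Hn) as [N1 H1].
      destruct (eventually_nonzero s n Hs Hn) as [N2 H2].
      assert (L := clim_Cmod _ _ (slow_factor_lim n l s Hs)). rewrite Cmod_1 in L.
      rewrite is_lim_seq_eps in L. destruct (L (/ 2)) as [N3 H3]; [lra|].
      exists (N1 + N2 + N3)%nat. intros i Hi'. rewrite HR by auto.
      rewrite reduced_term_core by (apply H2; lia). apply Cmult_neq_0; [apply H1; lia|].
      apply Cmod_pos_neq. specialize (H3 i ltac:(lia)). apply Rabs_def2 in H3. lra.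
    - intros r r' s _ _ Hr Hr' Hlt Hs.
      destruct (Hcnz r Hr) as (l & k & Hl & Hk & ->). destruct (Hcnz r' Hr') as (l' & k' & Hl' & Hk' & ->).
      destruct (eventually_nonzero s n Hs Hn) as [N2 H2].
      replace (RtoC 0) with (0 * (1 / 1))%C by (field; apply RtoC_neq0; lra).
      apply clim_ext_loc with (fun i => core n (lam_abs l') (lam_star n l' + lam_chi n l') k' (s i) /
        core n (lam_abs l) (lam_star n l + lam_chi n l) k (s i) * (slow_factor n l' (s i) / slow_factor n l (s i)))%C.
      + exists N2. intros i Hi'. rewrite !HR, !reduced_term_core by (auto; apply H2; auto).
        unfold Cdiv. rewrite Cinv_mult. ring.
      + apply clim_mult.
        * apply core_dominance; auto.
          specialize (HQ1 l Hl) as A1. specialize (HQ1 l' Hl') as A2. unfold key in Hlt.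
          destruct (Nat.lt_trichotomy (lam_abs l) (lam_abs l')) as [H|[H|H]]; [auto | |].
          -- right. split; auto. rewrite H in Hlt.
             destruct (Nat.lt_trichotomy k k') as [H'|[H'|H']]; [auto | |].
             (* Condition (ii) enters here: a strictly larger q comes with chi at least as large, so
                the exponent q + chi(q) of psi is strictly larger. *)
             ++ right. split; auto. subst k'. assert (S1 : (lam_star n l' < lam_star n l)%nat) by lia.
                assert (S2 := Hii l' l Hl' Hl (eq_sym H) ltac:(lia)). lia.
             ++ exfalso. assert (lam_abs l' * K + k' + 1 <= lam_abs l' * K + k)%nat by lia. nia.
          -- exfalso. assert (lam_abs l' * K + k' + 1 <= lam_abs l * K + k)%nat by nia. nia.
        * apply clim_mult; [now apply slow_factor_lim|].
          apply clim_inv; [apply RtoC_neq0; lra | now apply slow_factor_lim].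
    - intros s Hs. destruct (eventually_nonzero s n Hs Hn) as [N2 H2]. exists N2. intros i Hi'.
      destruct (H2 i Hi') as (Hr & _ & Hp & _). rewrite <- (Hz (s i) Hr). unfold calF.
      set (z := s i) in *.
      transitivity (list_csum (fun l => F l (zeta_vec z) * monomial n l (fun j => Cderive_n j Gamma z))%C Lam); [|reflexivity].
      unfold c.
      rewrite (list_csum_ext _ (fun r => list_csum (fun l => list_csum (fun k =>
        (if Nat.eqb r (key l k) then RtoC (INR (binom_nat (nth n l 0%nat) k)) else 0) * F l (zeta_vec z) * R r z)%C (seq 0 K)) Lam)).
      2:{ intros r _. rewrite Cmult_comm, <- list_csum_scal. apply list_csum_ext. intros l _.
          rewrite <- list_csum_scal. apply list_csum_ext. intros; ring. }
      rewrite list_csum_swap. apply list_csum_ext. intros l Hl. rewrite list_csum_swap.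
      rewrite (monomial_expansion n l z K); auto.
      rewrite <- csum_scal, <- list_csum_seq. apply list_csum_ext. intros k Hk. apply in_seq in Hk.
      apply list_csum_delta with (key l k).
      + apply seq_NoDup.
      + apply in_seq. assert (X := Hkeylt l k Hl ltac:(lia)). lia.
      + rewrite Nat.eqb_refl, HR by (auto; lia). ring.
      + intros r _ Hne. destruct (Nat.eqb_spec r (key l k)); [contradiction | ring]. }
  (* Descending induction on lambda_n. In the coefficient with k = lambda_n, tuples with a smaller
     last entry have binomial 0 and those with a larger one are already settled. *)
  assert (Hind : forall d lam, In lam Lam -> (K - nth n lam 0 <= d)%nat -> forall u, F lam u = RtoC 0).
  { induction d as [|d IH]; intros lam Hin Hd u.
    - specialize (HK1 lam Hin). lia.
    - set (k := nth n lam 0%nat) in *. assert (Hk : (k < K)%nat) by now apply HK1.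
      rewrite <- (Hzero (key lam k) u).
      2:{ apply in_seq. assert (X := Hkeylt lam k Hin Hk). lia. }
      symmetry. unfold c. apply list_csum_delta with lam; auto.
      + apply list_csum_delta with k.
        * apply seq_NoDup.
        * apply in_seq. lia.
        * rewrite Nat.eqb_refl. unfold k. rewrite binom_nat_diag. simpl. ring.
        * intros k' Hk' Hne. apply in_seq in Hk'. destruct (Nat.eqb_spec (key lam k) (key lam k')) as [E|E]; [|ring].
          exfalso. apply Hne. symmetry. apply (Hkey lam lam k k'); auto; lia.
      + intros mu Hmu Hne. rewrite (list_csum_ext _ (fun _ => RtoC 0)); [apply list_csum_0|].
        intros k' Hk'. apply in_seq in Hk'.
        destruct (Nat.eqb_spec (key lam k) (key mu k')) as [E|E]; [|ring].
        destruct (Hkey lam mu k k' Hin Hmu Hk ltac:(lia) E) as (E1 & <- & E3).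
        (* With equal last entries, q gives lambda_1, condition (i) the middle entries and |lambda|
           the entry 0, so [mu] would be [lam]. *)
        destruct (Nat.lt_trichotomy (nth n mu 0%nat) k) as [H|[H|H]].
        * rewrite binom_nat_gt by auto. simpl. ring.
        * exfalso. apply Hne. apply list_ext_nth; [rewrite !Hlen; auto | | auto].
          rewrite Hlen by auto. intros j Hj.
          destruct (Nat.eq_dec j n) as [->|]; [exact H|].
          destruct (Nat.eq_dec j 1) as [->|]; [|apply Hi; auto; lia].
          unfold lam_star in E3. fold k in E3. rewrite H in E3. lia.
        * rewrite IH; auto; [ring|]. lia. }
  intros lam Hin u. apply (Hind K lam Hin); lia.
Qed.

Theorem theorem1 (m n : nat) (Lam : list (list nat)) (F : list nat -> (nat -> C) -> C) :
  (1 <= n)%nat ->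
  in_family m n Lam F ->
  (forall z : C, ~ zeta_pole z -> ~ Gamma_pole z ->
     calF n Lam F (fun i => Cderive_n i zeta z) (fun j => Cderive_n j Gamma z) = RtoC 0) ->
  forall lam, In lam Lam -> forall u : nat -> C, F lam u = RtoC 0.
Proof.
  intros Hn HF Hz.
  (* All poles lie in Re z <= 1, so the hypothesis covers the whole half-plane Re z > 1. *)
  assert (Hz' : forall z, 1 < Re z -> calF n Lam F (zeta_vec z) (fun j => Cderive_n j Gamma z) = RtoC 0).
  { intros z Hr. apply Hz.
    - unfold zeta_pole. intros ->. simpl in Hr. lra.
    - intros [k ->]. simpl in Hr. assert (X := pos_INR k). lra. }
  destruct (Nat.eq_dec n 1) as [->|Hn1].
  - now apply (theorem_one m).
  - apply (theorem_many m n); auto. lia.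
Qed.
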